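(* For any initial data $\theta^0\in X^0(\mathbb{R}^2)$ with $\|\theta^0\|_{X^0}<1/4$, there exists a unique global solution $\theta\in\mathfrak{X}^0\cap\mathfrak{X}^1$ of the system $(S_2)$ with initial data $\theta^0$ such that $$\|\theta\|_{\mathfrak{X}^0}+\|\theta\|_{\mathfrak{X}^1}\leq4\|\theta^0\|_{X^0}.$$
   Context: Fourier transform on $\mathbb{R}^2$: $\widehat f(\xi)=\int_{\mathbb{R}^2}e^{-ix\cdot\xi}f(x)\,dx$. For $\sigma\in\mathbb{R}$, $X^\sigma(\mathbb{R}^2)=\{f\in\mathcal S'(\mathbb{R}^2):\ \widehat f\in L^1_{loc}(\mathbb{R}^2),\ \int_{\mathbb{R}^2}|\xi|^\sigma|\widehat f(\xi)|\,d\xi<\infty\}$, with norm $\|f\|_{X^\sigma}=\int_{\mathbb{R}^2}|\xi|^\sigma|\widehat f(\xi)|\,d\xi$. $\mathfrak{X}^0=\{f\in C_b(\mathbb{R}^+,X^0(\mathbb{R}^2)):\ \int_{\mathbb{R}^2}\sup_{0\le t<\infty}|\widehat f(t,\xi)|\,d\xi<\infty\}$ with norm $\|f\|_{\mathfrak{X}^0}=\int_{\mathbb{R}^2}\sup_{0\le t<\infty}|\widehat f(t,\xi)|\,d\xi$, and $\mathfrak{X}^1=L^1(\mathbb{R}^+,X^1(\mathbb{R}^2))$ with norm $\|f\|_{\mathfrak{X}^1}=\int_0^\infty\|f(t)\|_{X^1}\,dt$. Here $\widehat f(t,\xi)$ is the Fourier transform in the space variable, $\mathbb{R}^+=[0,\infty)$,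 and $C_b$ denotes bounded continuous functions. $|D|$ is the Fourier multiplier with symbol $|\xi|$, and $e^{-t|D|}$ the one with symbol $e^{-t|\xi|}$. The Riesz transforms are given by $\widehat{R_jf}(\xi)=-\frac{i\xi_j}{|\xi|}\widehat f(\xi)$, and $u_\theta=(-R_2\theta,R_1\theta)$, a divergence-free field. We set $u_f\cdot\nabla g=\mathrm{div}(g\,u_f)$. The system $(S_2)$ is $$\partial_t\theta+|D|\theta+u_\theta\cdot\nabla\theta=0\ \text{ in }(0,\infty)\times\mathbb{R}^2,\qquad u_\theta=(-R_2\theta,R_1\theta),\qquad \theta|_{t=0}=\theta^0.$$ Solutions are understood in the integral form $\theta(t)=e^{-t|D|}\theta^0-\int_0^te^{-(t-\tau)|D|}(u_\theta\cdot\nabla\theta)(\tau)\,d\tau$. *)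

(* Defs.v *)
From HB Require Import structures.
From mathcomp Require Import all_boot all_order all_algebra.
From mathcomp Require Import complex.
From mathcomp Require Import all_classical all_reals all_analysis.
(* all_analysis does not export the measurable structure of \bar R. *)
From mathcomp Require Import measurable_realfun.

Set Implicit Arguments.
Unset Strict Implicit.
Unset Printing Implicit Defensive.

Import Order.TTheory GRing.Theory Num.Theory.
Import numFieldNormedType.Exports.
Import ComplexField.Normc.

Local Open Scope classical_set_scope.
Local Open Scope complex_scope.
Local Open Scope ring_scope.

Local Notation leb := lebesgue_measure.
Local Notation leb2 := (product_measure1 lebesgue_measure lebesgue_measure).

Section ComplexIntegral.
Context d (T : measurableType d) (R : realType).
Variables (mu : {measure set T -> \bar R}) (D : set T).
Implicit Types f : T -> R[i].

Definition cintegrable f : Prop :=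
  mu.-integrable D (fun x => (complex.Re (f x))%:E) /\
  mu.-integrable D (fun x => (complex.Im (f x))%:E).

Definition cintegral f : R[i] :=
  (\int[mu]_(x in D) complex.Re (f x)) +i* (\int[mu]_(x in D) complex.Im (f x)).

End ComplexIntegral.

Section Defs.
Context {R : realType}.
Implicit Types (x y xi : R * R) (j : bool) (t s tau : R).

(* Coordinates are indexed by bool: false is the index 1, true the index 2. *)
Definition coord2 j x : R := if j then x.2 else x.1.
Definition basis_vec j : R * R := if j then (0, 1) else (1, 0).

Definition dotp x y : R := x.1 * y.1 + x.2 * y.2.

(* The library norm on R * R is the max norm. *)
Definition enorm x : R := Num.sqrt (dotp x x).

Definition cexpi t : R[i] := cos t +i* sin t.

Definition fourier (phi : R * R -> R[i]) (xi : R * R) : R[i] :=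
  cintegral leb2 setT (fun x => cexpi (- dotp x xi) * phi x).

Definition inv_fourier (phi : R * R -> R[i]) (x : R * R) : R[i] :=
  ((2 * pi) ^- 2)%:C *
  cintegral leb2 setT (fun xi => cexpi (dotp x xi) * phi xi).

Definition partial j (phi : R * R -> R[i]) (x : R * R) : R[i] :=
  ('D_(basis_vec j) (fun y => complex.Re (phi y)) x) +i*
  ('D_(basis_vec j) (fun y => complex.Im (phi y)) x).

(* A multi-index of derivation is given as a word in the two directions. *)
Definition partials (w : seq bool) (phi : R * R -> R[i]) : R * R -> R[i] :=
  foldr partial phi w.

Definition smooth (phi : R * R -> R[i]) : Prop :=
  forall w x,
    differentiable (fun y => complex.Re (partials w phi y)) x /\
    differentiable (fun y => complex.Im (partials w phi y)) x.

(* |x^alpha (partial^w phi)(x)|, for p = (alpha, w) *)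
Definition weighted_partial (p : (nat * nat) * seq bool)
    (phi : R * R -> R[i]) (x : R * R) : R :=
  `|x.1| ^+ p.1.1 * `|x.2| ^+ p.1.2 * normc (partials p.2 phi x).

Definition schwartz (phi : R * R -> R[i]) : Prop :=
  smooth phi /\
  forall p, exists M, forall x, weighted_partial p phi x <= M.

Definition schwartz_seminorm p (phi : R * R -> R[i]) : R :=
  sup (range (weighted_partial p phi)).

(* A distribution is a functional on all functions of which only the values on
   Schwartz functions are meaningful: two functionals that agree there are the
   same distribution. *)
Definition functional := (R * R -> R[i]) -> R[i].

Implicit Types T U : functional.

Definition eq_distr T U : Prop := forall phi, schwartz phi -> T phi = U phi.

Definition tempered T : Prop :=
  (forall (a : R[i]) (phi psi : R * R -> R[i]), schwartz phi -> schwartz psi ->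
     T (fun x => a * phi x + psi x) = a * T phi + T psi) /\
  exists (ps : seq ((nat * nat) * seq bool)) (C : R),
    forall phi, schwartz phi ->
      normc (T phi) <= C * \sum_(p <- ps) schwartz_seminorm p phi.

Definition locally_integrable2 (f : R * R -> R[i]) : Prop :=
  [/\ measurable_fun setT (fun x => complex.Re (f x)),
      measurable_fun setT (fun x => complex.Im (f x)) &
      forall K : set (R * R), compact K ->
        (\int[leb2]_(x in K) (normc (f x))%:E < +oo)%E].

(* T is the regular distribution with density f. *)
Definition is_density T (f : R * R -> R[i]) : Prop :=
  locally_integrable2 f /\
  forall phi, schwartz phi ->
    cintegrable leb2 setT (fun x => f x * phi x) /\
    T phi = cintegral leb2 setT (fun x => f x * phi x).

(* The density, unique up to a null set; 0 if T is not regular. *)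
Definition density T : R * R -> R[i] := xget (fun=> 0) [set f | is_density T f].

Definition distr_fourier T : functional := fun phi => T (fourier phi).

Definition fhat T : R * R -> R[i] := density (distr_fourier T).

(* Meaningful only if the Fourier transform of T has a density, in particular
   for T in the space Xspace sigma below. *)
Definition Xnorm (sigma : R) T : \bar R :=
  (\int[leb2]_xi ((enorm xi `^ sigma) * normc (fhat T xi))%:E)%E.

Definition Xspace (sigma : R) T : Prop :=
  [/\ tempered T, exists f, is_density (distr_fourier T) f &
      (Xnorm sigma T < +oo)%E].

(* The multiplier with symbol m, characterized by fhat (mult m T) = m * fhat T
   almost everywhere: it is the inverse Fourier transform, defined by duality,
   of the regular distribution m * fhat T. *)
Definition mult (m : R * R -> R[i]) T : functional := fun phi =>
  cintegral leb2 setT (fun xi => m xi * fhat T xi * inv_fourier phi xi).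

Definition semigroup t T : functional :=
  mult (fun xi => (expR (- (t * enorm xi)))%:C) T.

Definition riesz j T : functional :=
  mult (fun xi => 0 -i* (coord2 j xi / enorm xi)) T.

Definition distr_partial j T : functional := fun phi => - T (partial j phi).

(* Product of two regular distributions: the pointwise product of functions *)
Definition distr_mul T U : functional := fun phi =>
  cintegral leb2 setT (fun x => density T x * density U x * phi x).

Definition velocity j T : functional :=
  if j then riesz false T else fun phi => - riesz true T phi.

(* u_T . grad U = div (U u_T) *)
Definition advection T U : functional := fun phi =>
  distr_partial false (distr_mul U (velocity false T)) phi +
  distr_partial true (distr_mul U (velocity true T)) phi.

Definition times : set R := `[0, +oo[.

Implicit Types f theta : R -> functional.

(* The Fourier transform of f t is defined only almost everywhere for each t,
   so the supremum over the uncountable set of times is the supremum in the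
   lattice of measurable functions modulo equality almost everywhere. *)
Definition is_time_sup f (S : R * R -> \bar R) : Prop :=
  let bound (S' : R * R -> \bar R) := measurable_fun setT S' /\
    forall t, 0 <= t ->
      {ae leb2, forall xi, ((normc (fhat (f t) xi))%:E <= S' xi)%E} in
  bound S /\
  forall S', bound S' -> {ae leb2, forall xi, (S xi <= S' xi)%E}.

Definition time_sup f : R * R -> \bar R :=
  xget (fun=> +oo%E) [set S | is_time_sup f S].

Definition frakX0_norm f : \bar R := (\int[leb2]_xi time_sup f xi)%E.

Definition frakX0 f : Prop :=
  [/\ forall t, 0 <= t -> Xspace 0 (f t),
      exists M : R, forall t, 0 <= t -> (Xnorm 0 (f t) <= M%:E)%E,
      forall t, 0 <= t ->
        (fun s => Xnorm 0 (f s \- f t)) @ within times (nbhs t) --> 0%E &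
      (frakX0_norm f < +oo)%E].

Definition simple_X (sigma : R) f : Prop :=
  exists (n : nat) (A : 'I_n -> set R) (T : 'I_n -> functional),
    (forall k, measurable (A k) /\ Xspace sigma (T k)) /\
    forall t phi, f t phi = \sum_(k < n) (\1_(A k) t)%:C * T k phi.

Definition strongly_measurable_X (sigma : R) f : Prop :=
  exists s : nat -> R -> functional,
    (forall n, simple_X sigma (s n)) /\
    {ae leb, forall t, 0 <= t ->
       (fun n => Xnorm sigma (s n t \- f t)) @ \oo --> 0%E}.

Definition frakX1_norm f : \bar R := (\int[leb]_(t in times) Xnorm 1 (f t))%E.

(* A function in the Bochner space L^1([0, +oo[, Xspace 1) *)
Definition frakX1 f : Prop :=
  [/\ {ae leb, forall t, 0 <= t -> Xspace 1 (f t)},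
      strongly_measurable_X 1 f &
      (frakX1_norm f < +oo)%E].

Definition duhamel theta t (phi : R * R -> R[i]) tau : R[i] :=
  semigroup (t - tau) (advection (theta tau) (theta tau)) phi.

(* The time integral is that of a distribution-valued function: it is taken
   after pairing with each test function. *)
Definition is_solution (theta0 : functional) theta : Prop :=
  forall t, 0 <= t -> forall phi, schwartz phi ->
    cintegrable leb `[0, t] (duhamel theta t phi) /\
    theta t phi = semigroup t theta0 phi
                  - cintegral leb `[0, t] (duhamel theta t phi).

End Defs.

Arguments functional R : clear implicits.

(* Main.v *)
From HB Require Import structures.
From mathcomp Require Import all_boot all_order all_algebra.
From mathcomp Require Import complex.
From mathcomp Require Import all_classical all_reals all_analysis.
From mathcomp Require Import measurable_realfun ring lra.
Require Import Defs.

(* On the Fourier side the equation reads g(t) = e^{-t|xi|} g0 - B(g, g)(t),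
   where B is the time integral of a bilinear convolution whose kernel
   [ker xi b], with b the frequency of the transporting factor, is bounded by
   both |xi| / (2 pi)^2 and |xi - b| / (2 pi)^2.  The second bound spends the
   X^1 norm of one factor, and the integral over t of |xi| e^{-t|xi|} is at most
   1, so that B maps majorants to majorants: if F(xi) bounds both
   sup_t |g(t, xi)| and the integral of |xi| |g(t, xi)| dt, then (F * F) / (2 pi)^2
   bounds the same quantities for B(g, g).  The Picard iteration is thereby
   dominated, uniformly in time, by a scalar quadratic iteration for the L^1
   norm of the majorants, which stays below 2 ||theta0||.

   Uniqueness only uses the X^0 norm: the first bound on the kernel gives
   int_0^T N <= (2 pi)^-2 int_0^T (||theta'|| + ||theta||) N for the X^0 distance
   N(t) of two solutions, hence N = 0 on every [0, T] on which N <= 1; N is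
   continuous and vanishes at 0.

   Between the two sides one needs Fourier inversion on Schwartz functions and
   the fact that a function that is orthogonal to all Schwartz functions vanishes
   almost everywhere; the test functions for the latter are
   exp(- n (p(x1)^(2 n) + q(x2)^(2 n))), with p and q affine, which converge to
   indicators of rectangles. *)

(** The equation is critical: the divergence costs one derivative, and the smoothing of e^{-t|D|},
    integrated in time, gives back exactly one, with no power of t to spare. Smallness therefore has
    to come from the data. As the supremum in time stands inside the integral over xi, the estimates
    are made at each frequency and integrated in xi only at the end. The second kernel bound is the
    first one combined with cross(xi, b) = cross(xi - b, b), which expresses that the velocity is
    divergence free.

    With a the norm of the data, p -> a + (2 pi)^-2 p^2 preserves [0, 2a] once 4 (2 pi)^-2 a <= 1;
    one majorant bounds both norms, whence 4 = 2 + 2. In the uniqueness argument, N <= 1 and 2a <=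
    1/2 give ||theta'|| + ||theta|| <= 3/2 + 1/2, and 2 (2 pi)^-2 <= 1/2 absorbs the integral of N.

    The Fourier transform of a distribution is chosen separately at each time, up to a null set. The
    iteration produces a jointly measurable symbol and one null set for all times; for an arbitrary
    solution, a jointly measurable version is built from continuity in time before Fubini
    applies. *)

Set Implicit Arguments.
Unset Strict Implicit.
Unset Printing Implicit Defensive.

Import Order.TTheory GRing.Theory Num.Theory.
Import numFieldNormedType.Exports.
Import ComplexField.Normc.

Local Open Scope classical_set_scope.
Local Open Scope complex_scope.
Local Open Scope ring_scope.

(** * Integrals of complex-valued functions *)

Section ProductMeasure.
Context d1 d2 (T1 : measurableType d1) (T2 : measurableType d2) (R : realType).
Variables (m1 : {sigma_finite_measure set T1 -> \bar R})
          (m2 : {sigma_finite_measure set T2 -> \bar R}).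

(* The library infers a sigma-finite structure on [product_measure1] only for
   sub-probabilities; this alias carries the general instance. *)
Definition pmeas : set (T1 * T2) -> \bar R := product_measure1 m1 m2.

HB.instance Definition _ := Measure.copy pmeas (product_measure1 m1 m2).

Lemma pmeas_sigma_finite : sigma_finite setT pmeas.
Proof.
have /sigma_finiteP[F [TF ndF Foo]] := sigma_finiteT m1.
have /sigma_finiteP[G [TG ndG Goo]] := sigma_finiteT m2.
exists (fun n => F n `*` G n).
  rewrite -setXTT TF TG predeqE => -[x y]; split.
    move=> [/= [n _ Fnx] [k _ Gky]]; exists (maxn n k) => //; split.
    - by move: x Fnx; exact/subsetPset/ndF/leq_maxl.
    - by move: y Gky; exact/subsetPset/ndG/leq_maxr.
  by move=> [n _ []/= ? ?]; split; exists n.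
move=> k; have [? ?] := Foo k; have [? ?] := Goo k.
split; first exact: measurableX.
by rewrite /pmeas product_measure1E// lte_mul_pinfty// ge0_fin_numE.
Qed.

HB.instance Definition _ := Measure_isSigmaFinite.Build _ _ _ pmeas
  pmeas_sigma_finite.

End ProductMeasure.

(** * Modulus, real part and imaginary part *)

Section Normc.
Context (R : realType).
Implicit Types z w : R[i].
Local Notation cRe := (@complex.Re R).
Local Notation cIm := (@complex.Im R).

Lemma normc_ge0 z : 0 <= normc z.
Proof. by case: z => a b; exact: sqrtr_ge0. Qed.

Lemma normcD z w : normc (z + w) <= normc z + normc w.
Proof. exact: le_normcD. Qed.

Lemma normcNE z : normc (- z) = normc z.
Proof. exact: normcN. Qed.

Lemma normcB z w : normc (z - w) <= normc z + normc w.
Proof. by rewrite -(normcNE w) normcD. Qed.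

Lemma normc_distC z w : normc (z - w) = normc (w - z).
Proof. by rewrite -normcNE opprB. Qed.

Lemma normc_le_abs z : normc z <= `|cRe z| + `|cIm z|.
Proof.
case: z => a b /=.
rewrite -[leRHS]ger0_norm ?addr_ge0// -sqrtr_sqr ler_sqrt ?sqr_ge0//.
rewrite sqrrD !real_normK ?num_real// addrAC lerDl mulrn_wge0//.
Qed.

Lemma abs_Re_le z : `|cRe z| <= normc z.
Proof.
case: z => a b /=; rewrite -sqrtr_sqr ler_sqrt ?addr_ge0 ?sqr_ge0//.
by rewrite lerDl sqr_ge0.
Qed.

Lemma abs_Im_le z : `|cIm z| <= normc z.
Proof.
case: z => a b /=; rewrite -sqrtr_sqr ler_sqrt ?addr_ge0 ?sqr_ge0//.
by rewrite lerDr sqr_ge0.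
Qed.

Lemma normc_sqr z : normc z ^+ 2 = cRe z ^+ 2 + cIm z ^+ 2.
Proof. by case: z => a b /=; rewrite sqr_sqrtr// addr_ge0// sqr_ge0. Qed.

Lemma normc_cexpi t : normc (cexpi t : R[i]) = 1.
Proof. by rewrite /cexpi /= cos2Dsin2 sqrtr1. Qed.

Lemma normc_real (x : R) : normc x%:C = `|x|.
Proof. by rewrite /= expr0n /= addr0 sqrtr_sqr. Qed.

Lemma normc_eq0 z : (normc z = 0) <-> (z = 0).
Proof. by split=> [/eq0_normc//|->]; rewrite normc0. Qed.

Lemma cReD z w : cRe (z + w) = cRe z + cRe w. Proof. by case: z; case: w. Qed.
Lemma cImD z w : cIm (z + w) = cIm z + cIm w. Proof. by case: z; case: w. Qed.
Lemma cReN z : cRe (- z) = - cRe z. Proof. by case: z. Qed.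
Lemma cImN z : cIm (- z) = - cIm z. Proof. by case: z. Qed.
Lemma cReM z w : cRe (z * w) = cRe z * cRe w - cIm z * cIm w.
Proof. by case: z; case: w. Qed.
Lemma cImM z w : cIm (z * w) = cRe z * cIm w + cIm z * cRe w.
Proof. by case: z; case: w. Qed.

Lemma complexE z : z = cRe z +i* cIm z. Proof. by case: z. Qed.

Lemma cexpiD (s t : R) : cexpi (s + t) = cexpi s * cexpi t :> R[i].
Proof.
by rewrite /cexpi cosD sinD; apply/eqP; rewrite eq_complex /= eqxx /= addrC.
Qed.

Lemma cexpi0 : cexpi 0 = 1 :> R[i].
Proof. by rewrite /cexpi cos0 sin0. Qed.

End Normc.

Arguments normc [R] x : simpl never.

(** * Measurable complex-valued functions *)

Section ComplexMeasurable.
Context d (T : measurableType d) (R : realType).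
Implicit Types f g : T -> R[i].
Local Notation cRe := (@complex.Re R).
Local Notation cIm := (@complex.Im R).

Definition cmeas f : Prop := measurable_fun setT (fun x => cRe (f x)) /\
  measurable_fun setT (fun x => cIm (f x)).

Lemma measurable_sqrt (h : T -> R) : measurable_fun setT h ->
  measurable_fun setT (fun x => Num.sqrt (h x)).
Proof.
move=> mh; apply: (measurableT_comp _ mh).
by apply: continuous_measurable_fun; exact: sqrt_continuous.
Qed.

Lemma cmeas_normc f : cmeas f -> measurable_fun setT (fun x => normc (f x)).
Proof.
move=> [m1 m2].
rewrite (_ : (fun _ => _) = fun x => Num.sqrt (cRe (f x) ^+ 2 + cIm (f x) ^+ 2)).
  by apply: measurable_sqrt; apply: measurable_funD; exact: measurable_funX.
by apply/funext => x; case: (f x).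
Qed.

Lemma cmeas_enormc f : cmeas f -> measurable_fun setT (fun x => (normc (f x))%:E).
Proof. by move=> /cmeas_normc; exact: measurableT_comp. Qed.

Lemma cmeas_cst c : cmeas (fun=> c). Proof. by split. Qed.

Lemma cmeasD f g : cmeas f -> cmeas g -> cmeas (fun x => f x + g x).
Proof.
move=> [? ?] [? ?]; split.
  by under eq_fun do rewrite cReD; exact: measurable_funD.
by under eq_fun do rewrite cImD; exact: measurable_funD.
Qed.

Lemma cmeasN f : cmeas f -> cmeas (fun x => - f x).
Proof.
move=> [? ?]; split.
  by under eq_fun do rewrite cReN; exact: measurable_funN.
by under eq_fun do rewrite cImN; exact: measurable_funN.
Qed.

Lemma cmeasB f g : cmeas f -> cmeas g -> cmeas (fun x => f x - g x).
Proof. by move=> mf mg; apply: cmeasD => //; exact: cmeasN. Qed.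

Lemma cmeasM f g : cmeas f -> cmeas g -> cmeas (fun x => f x * g x).
Proof.
move=> [? ?] [? ?]; split.
  under eq_fun do rewrite cReM.
  by apply: measurable_funB; exact: measurable_funM.
under eq_fun do rewrite cImM.
by apply: measurable_funD; exact: measurable_funM.
Qed.

Lemma cmeas_complex (a b : T -> R) : measurable_fun setT a ->
  measurable_fun setT b -> cmeas (fun x => a x +i* b x).
Proof. by split. Qed.

Lemma cmeas_real (a : T -> R) : measurable_fun setT a -> cmeas (fun x => (a x)%:C).
Proof. by move=> ma; split. Qed.

Lemma cmeas_cexpi (a : T -> R) : measurable_fun setT a ->
  cmeas (fun x => cexpi (a x)).
Proof.
move=> ma; apply: cmeas_complex; apply: (measurableT_comp _ ma).
  by apply: continuous_measurable_fun; exact: continuous_cos.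
by apply: continuous_measurable_fun; exact: continuous_sin.
Qed.

Lemma cmeas_sum (I : Type) (r : seq I) (F : I -> T -> R[i]) :
  (forall i, cmeas (F i)) -> cmeas (fun x => \sum_(i <- r) F i x).
Proof.
move=> mF; elim: r => [|i r ih].
  by under eq_fun do rewrite big_nil; exact: cmeas_cst.
by under eq_fun do rewrite big_cons; exact: cmeasD.
Qed.

Lemma cmeas_if (b : T -> bool) f g : measurable_fun setT b ->
  cmeas f -> cmeas g -> cmeas (fun x => if b x then f x else g x).
Proof.
move=> mb [? ?] [? ?]; split.
  rewrite (_ : (fun _ => _) = fun x => if b x then cRe (f x) else cRe (g x)).
    by apply: measurable_fun_ifT.
  by apply/funext => x; case: (b x).
rewrite (_ : (fun _ => _) = fun x => if b x then cIm (f x) else cIm (g x)).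
  by apply: measurable_fun_ifT.
by apply/funext => x; case: (b x).
Qed.

End ComplexMeasurable.

Lemma cmeas_comp d1 d2 (T1 : measurableType d1) (T2 : measurableType d2)
    (R : realType) (f : T2 -> R[i]) (g : T1 -> T2) :
  cmeas f -> measurable_fun setT g -> cmeas (fun x => f (g x)).
Proof. by move=> [? ?] mg; split; [exact: (measurableT_comp (f := fun y => complex.Re (f y)))|exact: (measurableT_comp (f := fun y => complex.Im (f y)))]. Qed.

(** * The complex Lebesgue integral: linearity, modulus bound, dominated convergence *)

Section ComplexIntegralTheory.
Context d (T : measurableType d) (R : realType).
Variable mu : {measure set T -> \bar R}.
Implicit Types f g : T -> R[i].
Local Notation cRe := (@complex.Re R).
Local Notation cIm := (@complex.Im R).

Lemma le_int (u v : T -> \bar R) : (forall x, 0 <= u x)%E ->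
  measurable_fun setT u -> measurable_fun setT v -> (forall x, u x <= v x)%E ->
  (\int[mu]_x u x <= \int[mu]_x v x)%E.
Proof. by move=> u0 mu_ mv uv; exact: ge0_le_integral. Qed.

Lemma integrable_scale (k : R) (h : T -> R) : mu.-integrable setT (EFin \o h) ->
  mu.-integrable setT (EFin \o (fun x => k * h x)).
Proof.
move=> hi; apply: (eq_integrable _ (fun x => k%:E * (EFin \o h) x)%E) => //.
exact: integrableZl.
Qed.

Definition cint f : R[i] := cintegral mu setT f.
Definition cabs f : \bar R := (\int[mu]_x (normc (f x))%:E)%E.

Lemma cabs_ge0 f : (0 <= cabs f)%E.
Proof. by apply: integral_ge0 => x _; rewrite lee_fin normc_ge0. Qed.

Lemma cintegrableP f :
  cintegrable mu setT f <-> cmeas f /\ (cabs f < +oo)%E.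
Proof.
split=> [[/integrableP[m1 i1] /integrableP[m2 i2]]|[[m1 m2] fi]].
  have m1' : measurable_fun setT (fun x => cRe (f x)) by apply/measurable_EFinP.
  have m2' : measurable_fun setT (fun x => cIm (f x)) by apply/measurable_EFinP.
  split => //; apply: (@le_lt_trans _ _
      (\int[mu]_x (`|(cRe (f x))%:E| + `|(cIm (f x))%:E|))%E).
    apply: ge0_le_integral => //.
    - by move=> x _; rewrite lee_fin normc_ge0.
    - exact: cmeas_enormc.
    - by apply: emeasurable_funD; exact: measurableT_comp.
    - by move=> x _; rewrite lee_fin normc_le_abs.
  rewrite ge0_integralD//; [exact: lte_add_pinfty| |];
    exact: measurableT_comp.
split; apply/integrableP; split; try exact/measurable_EFinP.
  apply: le_lt_trans fi; apply: ge0_le_integral => //.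
  - by apply: measurableT_comp => //; exact/measurable_EFinP.
  - exact: cmeas_enormc.
  - by move=> x _; rewrite lee_fin abs_Re_le.
apply: le_lt_trans fi; apply: ge0_le_integral => //.
- by apply: measurableT_comp => //; exact/measurable_EFinP.
- exact: cmeas_enormc.
- by move=> x _; rewrite lee_fin abs_Im_le.
Qed.

Lemma cintegrable_meas f : cintegrable mu setT f -> cmeas f.
Proof. by move/cintegrableP => []. Qed.

Lemma cintegrable_le f (g : T -> R) : cmeas f -> measurable_fun setT g ->
  (forall x, normc (f x) <= g x) -> (\int[mu]_x (g x)%:E < +oo)%E ->
  cintegrable mu setT f.
Proof.
move=> mf mg fg gi; apply/cintegrableP; split => //.
apply: le_lt_trans gi; apply: ge0_le_integral => //.
- by move=> x _; rewrite lee_fin normc_ge0.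
- exact: cmeas_enormc.
- exact/measurable_EFinP.
- by move=> x _; rewrite lee_fin.
Qed.

Lemma cintegrableD f g : cintegrable mu setT f -> cintegrable mu setT g ->
  cintegrable mu setT (fun x => f x + g x).
Proof.
move=> [a b] [a' b']; split.
  under eq_fun do rewrite cReD.
  by under eq_fun do rewrite EFinD; exact: integrableD.
under eq_fun do rewrite cImD.
by under eq_fun do rewrite EFinD; exact: integrableD.
Qed.

Lemma cintegrableZ c f : cintegrable mu setT f ->
  cintegrable mu setT (fun x => c * f x).
Proof.
move=> [a b]; split.
  under eq_fun do rewrite cReM EFinB !EFinM.
  by apply: integrableB => //; exact: integrableZl.
under eq_fun do rewrite cImM EFinD !EFinM.
by apply: integrableD => //; exact: integrableZl.
Qed.

Lemma cintegrableN f : cintegrable mu setT f ->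
  cintegrable mu setT (fun x => - f x).
Proof. by under eq_fun do rewrite -mulN1r; exact: cintegrableZ. Qed.

Lemma cintegrableB f g : cintegrable mu setT f -> cintegrable mu setT g ->
  cintegrable mu setT (fun x => f x - g x).
Proof. by move=> mf mg; apply: cintegrableD => //; exact: cintegrableN. Qed.

Lemma cintegrable0 : cintegrable mu setT (fun=> 0).
Proof. by split; exact: integrable0. Qed.

Lemma cintD f g : cintegrable mu setT f -> cintegrable mu setT g ->
  cint (fun x => f x + g x) = cint f + cint g.
Proof.
move=> [a b] [a' b']; rewrite /cint /cintegral.
under eq_Rintegral do rewrite cReD.
under [in X in _ +i* X]eq_Rintegral do rewrite cImD.
by rewrite !RintegralD.
Qed.

Lemma cintZ c f : cintegrable mu setT f ->
  cint (fun x => c * f x) = c * cint f.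
Proof.
move=> [a b]; rewrite /cint /cintegral.
under eq_Rintegral do rewrite cReM.
under [in X in _ +i* X]eq_Rintegral do rewrite cImM.
rewrite RintegralB ?RintegralD ?RintegralZl//; first by case: c.
all: exact: integrable_scale.
Qed.

Lemma cintN f : cintegrable mu setT f -> cint (fun x => - f x) = - cint f.
Proof.
move=> fi; rewrite -[RHS]mulN1r -cintZ//; congr cint.
by apply/funext => x; rewrite mulN1r.
Qed.

Lemma cintB f g : cintegrable mu setT f -> cintegrable mu setT g ->
  cint (fun x => f x - g x) = cint f - cint g.
Proof. by move=> fi gi; rewrite cintD ?cintN//; exact: cintegrableN. Qed.

Lemma cint0 : cint (fun=> 0) = 0.
Proof.
rewrite /cint /cintegral /Rintegral !integral0_eq//.
Qed.

(** With z the integral of f, |z|^2 is the integral of Re(conj(z) f), which is at most |z| times the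
    integral of |f|. This reduces the bound to the monotonicity of a real integral. *)
Lemma normc_cint_fin f : cintegrable mu setT f ->
  ((normc (cint f))%:E <= cabs f)%E.
Proof.
move=> fi; have /cintegrableP[mf foo] := fi.
have [->|z0] := eqVneq (normc (cint f)) 0; first exact: cabs_ge0.
have zp : 0 < normc (cint f) by rewrite lt_neqAle eq_sym z0 normc_ge0.
set z := cint f in z0 zp *.
have fin : cabs f \is a fin_num by rewrite ge0_fin_numE ?cabs_ge0.
rewrite -(fineK fin) lee_fin -(ler_pM2l zp) -expr2.
have -> : normc z ^+ 2 = \int[mu]_x (cRe z * cRe (f x) + cIm z * cIm (f x)).
  case: (fi) => a b; rewrite RintegralD ?RintegralZl//.
  - by rewrite normc_sqr !expr2.
  - exact: integrable_scale.
  - exact: integrable_scale.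
have fni : mu.-integrable setT (EFin \o (fun x => normc (f x))).
  apply/integrableP; split; first exact: cmeas_enormc.
  rewrite (le_lt_trans _ foo)//; apply: ge0_le_integral => //.
  - by apply: measurableT_comp => //; exact: cmeas_enormc.
  - exact: cmeas_enormc.
  - by move=> x _; rewrite /= lee_fin ger0_norm// normc_ge0.
have -> : normc z * fine (cabs f) = \int[mu]_x (normc z * normc (f x)).
  by rewrite RintegralZl.
apply: le_Rintegral => //.
- case: fi => a b; apply: (@integrableD _ _ _ mu setT measurableT
      (EFin \o (fun x => cRe z * cRe (f x))) (EFin \o (fun x => cIm z * cIm (f x))));
    exact: integrable_scale.
- exact: integrable_scale.
move=> x _; rewrite -normcM.
have -> : cRe z * cRe (f x) + cIm z * cIm (f x) = cRe (conjc z * f x).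
  by case: z {zp z0}=> a b; case: (f x) => u v /=; rewrite mulNr opprK.
rewrite (le_trans (ler_norm _))// (le_trans (abs_Re_le _))// !normcM.
by rewrite (_ : normc (conjc z) = normc z)//; case: z {zp z0} => a b; rewrite /normc /= sqrrN.
Qed.

Lemma normc_cint f : cmeas f -> ((normc (cint f))%:E <= cabs f)%E.
Proof.
move=> mf; have := leey (cabs f); rewrite le_eqVlt => /predU1P[->|fi].
  exact: leey.
by apply: normc_cint_fin; exact/cintegrableP.
Qed.

Lemma eq_cint f g : (forall x, f x = g x) -> cint f = cint g.
Proof. by move=> fg; congr cint; exact/funext. Qed.

Lemma ae_cint f g : cmeas f -> cmeas g ->
  {ae mu, forall x, f x = g x} -> cint f = cint g.
Proof.
move=> [a b] [a' b'] fg; rewrite /cint /cintegral /Rintegral; congr (fine _ +i* fine _).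
  apply: ae_eq_integral => //; try exact/measurable_EFinP.
  by apply: filterS fg => x /= -> _.
apply: ae_eq_integral => //; try exact/measurable_EFinP.
by apply: filterS fg => x /= -> _.
Qed.

Lemma ae_cabs f g : cmeas f -> cmeas g ->
  {ae mu, forall x, f x = g x} -> cabs f = cabs g.
Proof.
move=> mf mg fg; apply: ge0_ae_eq_integral => //.
- exact: cmeas_enormc.
- exact: cmeas_enormc.
- by move=> x _; rewrite lee_fin normc_ge0.
- by move=> x _; rewrite lee_fin normc_ge0.
- by apply: filterS fg => x /= -> _.
Qed.

Lemma ae_cintegrable f g : cintegrable mu setT f -> cmeas g ->
  {ae mu, forall x, f x = g x} -> cintegrable mu setT g.
Proof.
by move=> /cintegrableP[mf fi] mg fg; apply/cintegrableP; rewrite -(ae_cabs mf).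
Qed.

Lemma cabs_eq0 f : cmeas f -> cabs f = 0%E -> {ae mu, forall x, f x = 0}.
Proof.
move=> mf f0.
have : ae_eq mu setT (fun x => (normc (f x))%:E) (cst 0%E).
  apply/ae_eq_integral_abs => //; first exact: cmeas_enormc.
  rewrite -[RHS]f0; apply: eq_integral => x _.
  by rewrite /= ger0_norm// normc_ge0.
apply: filterS => x /(_ Logic.I) /= [] /normc_eq0 //.
Qed.

Lemma ae_cabs0 f : cmeas f -> {ae mu, forall x, f x = 0} -> cabs f = 0%E.
Proof.
move=> mf f0; rewrite (ae_cabs mf (cmeas_cst _ 0) f0) /cabs normc0.
by rewrite integral0_eq.
Qed.

Lemma cabs_le f g : cmeas f -> cmeas g ->
  (forall x, normc (f x) <= normc (g x)) -> (cabs f <= cabs g)%E.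
Proof.
move=> mf mg fg; apply: ge0_le_integral => //.
- by move=> x _; rewrite lee_fin normc_ge0.
- exact: cmeas_enormc.
- exact: cmeas_enormc.
- by move=> x _; rewrite lee_fin.
Qed.

Lemma cabsD f g : cmeas f -> cmeas g ->
  (cabs (fun x => f x + g x)%R <= cabs f + cabs g)%E.
Proof.
move=> mf mg; rewrite /cabs -ge0_integralD//.
- apply: ge0_le_integral => //.
  + by move=> x _; rewrite lee_fin normc_ge0.
  + by apply: cmeas_enormc; exact: cmeasD.
  + by apply: emeasurable_funD; exact: cmeas_enormc.
  + by move=> x _; rewrite -EFinD lee_fin normcD.
- by move=> x _; rewrite lee_fin normc_ge0.
- exact: cmeas_enormc.
- by move=> x _; rewrite lee_fin normc_ge0.
- exact: cmeas_enormc.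
Qed.

Lemma cabsN f : cabs (fun x => - f x) = cabs f.
Proof. by rewrite /cabs; under eq_integral do rewrite normcNE. Qed.

(** The real theorem is applied to |F_n - f|, dominated by g + g, once the bound by g has passed to
    the limit f. The dominating function is extended-valued, so that majorants which may be infinite
    on a null set can be used as they are. *)
Lemma cint_dct (F : nat -> T -> R[i]) f (g : T -> \bar R) :
  (forall n, cmeas (F n)) -> cmeas f -> measurable_fun setT g ->
  {ae mu, forall x, (fun n => normc (F n x - f x)) @ \oo --> (0 : R)} ->
  {ae mu, forall x, forall n, ((normc (F n x))%:E <= g x)%E} ->
  (\int[mu]_x g x < +oo)%E -> (forall x, 0 <= g x)%E ->
  cintegrable mu setT f /\
  ((fun n => cabs (fun x => F n x - f x)) @ \oo --> 0%E).
Proof.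
move=> mF mf mg cvF Fg gi g0.
have fg : {ae mu, forall x, ((normc (f x))%:E <= g x)%E}.
  near=> x.
  have cvx : (fun n => normc (F n x - f x)) @ \oo --> (0 : R) by near: x.
  have Fgx : forall n, ((normc (F n x))%:E <= g x)%E by near: x.
  have : (fun n => normc (F n x - f x) + normc (F n x)) @ \oo --> 0 -> True by [].
  move=> _; have := leey (g x); rewrite le_eqVlt => /predU1P[->|gx]; first exact: leey.
  have gfin : g x \is a fin_num by rewrite ge0_fin_numE.
  rewrite -(fineK gfin) lee_fin; apply/ler_addgt0Pr => e e0.
  have /cvgrPdist_lt /(_ _ e0) [N _ /(_ N (leqnn N))] := cvx.
  rewrite /= sub0r normrN ger0_norm ?normc_ge0// => h.
  have : normc (F N x) <= fine (g x) by rewrite -lee_fin fineK.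
  have -> : f x = F N x - (F N x - f x) by rewrite opprB addrC subrK.
  by move=> h2; rewrite (le_trans (normcB _ _))// lerD// ltW.
have ig : mu.-integrable setT g.
  apply/integrableP; split => //.
  by under eq_integral do rewrite gee0_abs//.
have fi : cintegrable mu setT f.
  apply/cintegrableP; split => //; apply: le_lt_trans gi.
  apply: ae_ge0_le_integral => //.
  - by move=> x _; rewrite lee_fin normc_ge0.
  - exact: cmeas_enormc.
  - by apply: filterS fg => x.
split => //.
have [] := @dominated_convergence _ _ _ mu setT measurableT
   (fun n x => (normc (F n x - f x))%:E) (cst 0%E) (fun x => (g x + g x)%E).
- by move=> n; apply: cmeas_enormc; exact: cmeasB.
- exact: measurable_cst.
- apply: filterS cvF => x cvx _ /=.
  by apply: cvg_comp; [exact: cvx|exact: cvg_id].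
- exact: integrableD.
- near=> x => n _; rewrite /= ger0_norm ?normc_ge0//.
  rewrite (@le_trans _ _ ((normc (F n x))%:E + (normc (f x))%:E)%E)//.
    by rewrite -EFinD lee_fin normcB.
  by rewrite leeD//; [move: n; near: x|near: x].
by move=> _ _; rewrite integral_cst// mul0e.
Unshelve. all: by end_near.
Qed.

Lemma cvg_cint (F : nat -> T -> R[i]) f :
  (forall n, cintegrable mu setT (F n)) -> cintegrable mu setT f ->
  (fun n => cabs (fun x => F n x - f x)) @ \oo --> 0%E ->
  (fun n => normc (cint (F n) - cint f)) @ \oo --> (0 : R).
Proof.
move=> Fi fi /fine_cvgP[fin] h.
apply: (squeeze_cvgr _ (cvg_cst 0) h).
near=> n; rewrite normc_ge0 /= -lee_fin fineK; last by near: n.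
rewrite -cintB//.
by apply: normc_cint_fin; exact: cintegrableB.
Unshelve. all: by end_near.
Qed.

End ComplexIntegralTheory.

Arguments cint : simpl never.
Arguments cabs : simpl never.

(** * Tonelli and Fubini theorems for complex integrands *)

Section ComplexFubini.
Context d1 d2 (T1 : measurableType d1) (T2 : measurableType d2) (R : realType).
Variables (m1 : {sigma_finite_measure set T1 -> \bar R})
          (m2 : {sigma_finite_measure set T2 -> \bar R}).
Implicit Types F : T1 * T2 -> R[i].

Lemma tonelli1 (f : T1 * T2 -> \bar R) : measurable_fun setT f ->
  (forall z, 0 <= f z)%E ->
  (\int[pmeas m1 m2]_z f z = \int[m1]_x \int[m2]_y f (x, y))%E.
Proof. by move=> mf f0; exact: (fubini_tonelli1 f mf f0). Qed.

Lemma tonelli2 (f : T1 * T2 -> \bar R) : measurable_fun setT f ->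
  (forall z, 0 <= f z)%E ->
  (\int[pmeas m1 m2]_z f z = \int[m2]_y \int[m1]_x f (x, y))%E.
Proof. by move=> mf f0; exact: (fubini_tonelli2 f mf f0). Qed.

Lemma measurable_tonelli1 (f : T1 * T2 -> \bar R) : measurable_fun setT f ->
  (forall z, 0 <= f z)%E ->
  measurable_fun setT (fun x => \int[m2]_y f (x, y))%E.
Proof. by move=> mf f0; exact: (measurable_fun_fubini_tonelli_F f mf f0). Qed.

Lemma measurable_tonelli2 (f : T1 * T2 -> \bar R) : measurable_fun setT f ->
  (forall z, 0 <= f z)%E ->
  measurable_fun setT (fun y => \int[m1]_x f (x, y))%E.
Proof. by move=> mf f0; exact: (measurable_fun_fubini_tonelli_G f mf f0). Qed.

(** The positive and negative parts are integrated separately by Tonelli, so that sections which are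
    not integrable are covered too; [fine] is measurable. *)
Lemma measurable_pint (f : T1 * T2 -> R) : measurable_fun setT f ->
  measurable_fun setT (fun x => \int[m2]_y f (x, y)).
Proof.
move=> mf; apply: (measurableT_comp (f := fine)) => //.
have -> : (fun x => \int[m2]_y (f (x, y))%:E)%E =
    (fun x => (\int[m2]_y (EFin \o f)^\+ (x, y)
   - \int[m2]_y (EFin \o f)^\- (x, y))%E).
  apply/funext => x; rewrite integralE.
  by congr (_ - _)%E; apply: eq_integral => y _; rewrite ?funeposE ?funenegE.
have mf' : measurable_fun setT (EFin \o f) by exact/measurable_EFinP.
apply: emeasurable_funB; apply: measurable_tonelli1.
- exact: measurable_funepos.
- by move=> z; exact: funepos_ge0.
- exact: measurable_funeneg.
- by move=> z; exact: funeneg_ge0.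
Qed.

Lemma cmeas_pint F : cmeas F -> cmeas (fun x => cint m2 (fun y => F (x, y))).
Proof.
move=> [ma mb]; split; rewrite /cint /cintegral /=.
  exact: (measurable_pint ma).
exact: (measurable_pint mb).
Qed.

Lemma cabs_pmeas1 F : cmeas F ->
  cabs (pmeas m1 m2) F = (\int[m1]_x cabs m2 (fun y => F (x, y)))%E.
Proof.
move=> mF; apply: (tonelli1 (f := fun z => (normc (F z))%:E)).
  exact: cmeas_enormc.
by move=> z; rewrite lee_fin normc_ge0.
Qed.

Lemma cabs_pmeas2 F : cmeas F ->
  cabs (pmeas m1 m2) F = (\int[m2]_y cabs m1 (fun x => F (x, y)))%E.
Proof.
move=> mF; apply: (tonelli2 (f := fun z => (normc (F z))%:E)).
  exact: cmeas_enormc.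
by move=> z; rewrite lee_fin normc_ge0.
Qed.

Lemma measurable_pabs F : cmeas F ->
  measurable_fun setT (fun x => cabs m2 (fun y => F (x, y))).
Proof.
move=> mF; apply: (measurable_tonelli1 (f := fun z => (normc (F z))%:E)); first exact: cmeas_enormc.
by move=> z; rewrite lee_fin normc_ge0.
Qed.

Lemma ae_cintegrable1 F : cintegrable (pmeas m1 m2) setT F ->
  {ae m1, forall x, cintegrable m2 setT (fun y => F (x, y))}.
Proof.
move=> [ia ib]; have := ae_integrable1 ia; have := ae_integrable1 ib.
by apply: filterS2 => x /= a b; split.
Qed.

Lemma cintegrable_pint F : cintegrable (pmeas m1 m2) setT F ->
  cintegrable m1 setT (fun x => cint m2 (fun y => F (x, y))).
Proof.
move=> /cintegrableP[mF Fi]; apply/cintegrableP; split; first exact: cmeas_pint.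
apply: le_lt_trans Fi; rewrite cabs_pmeas1//; apply: le_int.
- by move=> x; rewrite lee_fin normc_ge0.
- by apply: cmeas_enormc; exact: cmeas_pint.
- exact: measurable_pabs.
- move=> x; apply: normc_cint.
  by apply: (cmeas_comp mF); exact: measurable_pair1.
Qed.

(** The inner real integral is the [fine] of an extended one; the two agree on the integrable
    sections, that is, on almost all of them, which is enough for the outer integral. *)
Lemma Rint_pmeas1 (f : T1 * T2 -> R) :
  (pmeas m1 m2).-integrable setT (EFin \o f) ->
  \int[pmeas m1 m2]_z f z = \int[m1]_x \int[m2]_y f (x, y).
Proof.
move=> fi; rewrite /Rintegral; congr fine.
have mf : measurable_fun setT f by apply/measurable_EFinP; exact: measurable_int fi.
have fi' : (m1 \x m2)%E.-integrable setT (EFin \o f) := fi.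
rewrite -[LHS](integral12_prod_meas1 fi); apply: ae_eq_integral => //.
- exact: (measurable_fubini_F fi').
- exact/measurable_EFinP/measurable_pint.
- have := ae_integrable1 fi; apply: filterS => x /= xi _.
  by rewrite fineK//; exact: integrable_fin_num.
Qed.

Lemma Rint_pmeas2 (f : T1 * T2 -> R) :
  (pmeas m1 m2).-integrable setT (EFin \o f) ->
  \int[pmeas m1 m2]_z f z = \int[m2]_y \int[m1]_x f (x, y).
Proof.
move=> fi; rewrite /Rintegral; congr fine.
have mf : measurable_fun setT f by apply/measurable_EFinP; exact: measurable_int fi.
have fi' : (m1 \x m2)%E.-integrable setT (EFin \o f) := fi.
rewrite -[LHS](integral21_prod_meas1 fi); apply: ae_eq_integral => //.
- exact: (measurable_fubini_G fi').
- apply/measurable_EFinP.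
  apply: (measurableT_comp (f := fine)) => //; exact: (measurable_fubini_G fi').
- have := ae_integrable2 fi; apply: filterS => x /= xi _.
  by rewrite fineK//; exact: integrable_fin_num.
Qed.

Lemma cint_pmeas1 F : cintegrable (pmeas m1 m2) setT F ->
  cint (pmeas m1 m2) F = cint m1 (fun x => cint m2 (fun y => F (x, y))).
Proof.
by move=> [ia ib]; rewrite /cint /cintegral Rint_pmeas1// Rint_pmeas1.
Qed.

Lemma cint_pmeas2 F : cintegrable (pmeas m1 m2) setT F ->
  cint (pmeas m1 m2) F = cint m2 (fun y => cint m1 (fun x => F (x, y))).
Proof.
by move=> [ia ib]; rewrite /cint /cintegral Rint_pmeas2// Rint_pmeas2.
Qed.

Lemma cint_swap F : cintegrable (pmeas m1 m2) setT F ->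
  cint m1 (fun x => cint m2 (fun y => F (x, y))) =
  cint m2 (fun y => cint m1 (fun x => F (x, y))).
Proof. by move=> Fi; rewrite -cint_pmeas1// cint_pmeas2. Qed.

End ComplexFubini.

(** * The plane *)

Section MeasurableClosure.
Context d (T : measurableType d) (R : realType).
Implicit Types f g : T -> R.

Lemma mf_exp f : measurable_fun setT f -> measurable_fun setT (fun x => expR (f x)).
Proof. by move=> mf; exact: (measurableT_comp (@measurable_expR R) mf). Qed.

Lemma mf_cos f : measurable_fun setT f -> measurable_fun setT (fun x => cos (f x)).
Proof.
move=> mf; apply: (measurableT_comp _ mf).
by apply: continuous_measurable_fun; exact: continuous_cos.
Qed.

Lemma mf_sin f : measurable_fun setT f -> measurable_fun setT (fun x => sin (f x)).
Proof.
move=> mf; apply: (measurableT_comp _ mf).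
by apply: continuous_measurable_fun; exact: continuous_sin.
Qed.

Lemma mf_norm f : measurable_fun setT f -> measurable_fun setT (fun x => `|f x|).
Proof. by move=> mf; exact: (measurableT_comp (@normr_measurable R setT) mf). Qed.

Lemma mf_inv f : measurable_fun setT f -> measurable_fun setT (fun x => (f x)^-1).
Proof.
move=> mf; apply: (measurableT_comp (f := fun y : R => y^-1) _ mf).
(* The inverse is continuous off 0 only, so the point 0 is split off. *)
rewrite -(setUv [set 0 : R]); apply/measurable_funU => //.
  exact: measurableC.
split.
  exact: measurable_fun_set1.
apply: open_continuous_measurable_fun.
  by apply: closed_openC; apply: accessible_closed_set1; apply: hausdorff_accessible; exact: Rhausdorff.
by move=> x; rewrite inE /= => /eqP x0; exact: inv_continuous.
Qed.

Lemma mf_fst d1 d2 (T1 : measurableType d1) (T2 : measurableType d2)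
  (g : T -> T1 * T2) : measurable_fun setT g -> measurable_fun setT (fun x => (g x).1).
Proof. by move=> mg; exact: (measurableT_comp measurable_fst mg). Qed.

Lemma mf_snd d1 d2 (T1 : measurableType d1) (T2 : measurableType d2)
  (g : T -> T1 * T2) : measurable_fun setT g -> measurable_fun setT (fun x => (g x).2).
Proof. by move=> mg; exact: (measurableT_comp measurable_snd mg). Qed.

Lemma mf_EFin f : measurable_fun setT f -> measurable_fun setT (fun x => (f x)%:E).
Proof. by move=> mf; apply/measurable_EFinP. Qed.

End MeasurableClosure.

Lemma mf_comp d1 d2 d3 (T1 : measurableType d1) (T2 : measurableType d2)
  (T3 : measurableType d3) (f : T2 -> T3) (g : T1 -> T2) :
  measurable_fun setT f -> measurable_fun setT g ->
  measurable_fun setT (fun x => f (g x)).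
Proof. exact: measurableT_comp. Qed.

Lemma mf_coord2 d (T : measurableType d) (R : realType) (j : bool) (g : T -> R * R) :
  measurable_fun setT g -> measurable_fun setT (fun x => coord2 j (g x)).
Proof. by case: j => mg; [exact: mf_snd|exact: mf_fst]. Qed.

(* Subtraction on [R * R], unfolded into coordinates for measurability. *)
Definition sub2 (R : realType) (x y : R * R) : R * R := (x.1 - y.1, x.2 - y.2).

Definition cross (R : realType) (x y : R * R) : R := x.2 * y.1 - x.1 * y.2.

(** Decomposes a measurability goal along its head symbol. An unknown function applied to an
    argument is handled by a hypothesis on that function, which is why such hypotheses are brought
    into the context before a call. Other shapes are closed by a hypothesis or left to the
    caller. *)
Ltac mfun :=
  lazymatch goal with
  | |- cmeas (fun _ => ?c) => exact: cmeas_cst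
  | |- cmeas (fun x => Algebra.add (@?f x) (@?g x)) => apply: cmeasD; mfun
  | |- cmeas (fun x => Algebra.opp (@?f x)) => apply: cmeasN; mfun
  | |- cmeas (fun x => GRing.mul (@?f x) (@?g x)) => apply: cmeasM; mfun
  | |- cmeas (fun x => real_complex_def _ (@?f x)) => apply: cmeas_real; mfun
  | |- cmeas (fun x => cexpi (@?f x)) => apply: cmeas_cexpi; mfun
  | |- cmeas (fun x => Complex (@?f x) (@?g x)) => apply: cmeas_complex; mfun
  | |- cmeas (fun x => ?f (@?g x)) => first [assumption | apply: (@cmeas_comp _ _ _ _ _ f g); [assumption|mfun]]
  | |- cmeas _ => first [assumption | apply: cmeas_if; mfun | idtac]
  | |- measurable_fun _ (fun _ => ?c) => exact: measurable_cst
  | |- measurable_fun _ (fun x => x) => exact: measurable_id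
  | |- measurable_fun _ (fun x => Algebra.add (@?f x) (@?g x)) =>
      first [apply: (measurable_funD (f := f) (g := g)) | apply: (emeasurable_funD (f := f) (g := g))]; mfun
  | |- measurable_fun _ (fun x => Algebra.opp (@?f x)) => apply: measurable_funN; mfun
  | |- measurable_fun _ (fun x => GRing.mul (@?f x) (@?g x)) => apply: (measurable_funM (f := f) (g := g)); mfun
  | |- measurable_fun _ (fun x => mule (@?f x) (@?g x)) => apply: (emeasurable_funM (f := f) (g := g)); mfun
  | |- measurable_fun _ (fun x => GRing.exp (@?f x) _) => apply: (measurable_funX (f := f)); mfun
  | |- measurable_fun _ (fun x => GRing.inv (@?f x)) => apply: mf_inv; mfun
  | |- measurable_fun _ (fun x => Num.norm (@?f x)) => apply: mf_norm; mfun
  | |- measurable_fun _ (fun x => expR (@?f x)) => apply: mf_exp; mfun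
  | |- measurable_fun _ (fun x => cos (@?f x)) => apply: mf_cos; mfun
  | |- measurable_fun _ (fun x => sin (@?f x)) => apply: mf_sin; mfun
  | |- measurable_fun _ (fun x => normc (@?f x)) => apply: cmeas_normc; mfun
  | |- measurable_fun _ (fun x => EFin (@?f x)) => apply: mf_EFin; mfun
  | |- measurable_fun _ (fun x => (@?f x, @?g x)) => apply: measurable_fun_pair; mfun
  | |- measurable_fun _ (fun x => fst (@?f x)) => apply: mf_fst; mfun
  | |- measurable_fun _ (fun x => snd (@?f x)) => apply: mf_snd; mfun
  | |- measurable_fun _ (fun x => Order.le (@?f x) (@?g x)) => apply: measurable_fun_ler; mfun
  | |- measurable_fun _ (fun x => Order.lt (@?f x) (@?g x)) => apply: measurable_fun_ltr; mfun
  | |- measurable_fun _ (fun x => andb (@?f x) (@?g x)) => apply: measurable_and; mfun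
  | |- measurable_fun _ (fun x => Num.sqrt (@?f x)) => apply: measurable_sqrt; mfun
  | |- measurable_fun _ (fun x => dotp (@?f x) (@?g x)) => rewrite /dotp; mfun
  | |- measurable_fun _ (fun x => sub2 (@?f x) (@?g x)) => rewrite /sub2; mfun
  | |- measurable_fun _ (fun x => cross (@?f x) (@?g x)) => rewrite /cross; mfun
  | |- measurable_fun _ (fun x => coord2 ?j (@?f x)) => apply: mf_coord2; mfun
  | |- measurable_fun _ (fun x => enorm (@?f x)) => rewrite /enorm /dotp; mfun
  | |- measurable_fun _ (fun x => ?f (@?g x)) =>
      first [assumption | apply: (@mf_comp _ _ _ _ _ _ f g); [assumption|mfun]]
  | |- measurable_fun _ _ => first [assumption | apply: measurable_fun_ifT; mfun | idtac]
  end.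

(** An integrable weight of product form, a multiple of which dominates any given Schwartz function.
    Being locked, it stays folded in unification and simplification. *)
HB.lock Definition wgt (R : realType) (x : R * R) : R :=
  (1 + x.1 ^+ 2)^-1 * (1 + x.2 ^+ 2)^-1.

Arguments wgt {R} x.

(** * Lebesgue measure on the line and the plane: changes of variables, Borel sets, norms *)

Section Plane.
Context (R : realType).
Local Notation mR := (measurableTypeR R).

Definition lebR : {sigma_finite_measure set mR -> \bar R} := @lebesgue_measure R.
Definition lebR2 : {sigma_finite_measure set (mR * mR)%type -> \bar R} :=
  pmeas lebR lebR.

(** The push-forward of Lebesgue measure under the shift gives each interval ]u, v] its length,
    hence is Lebesgue measure by uniqueness. Dilations are treated in the same way below, with the
    factor a. *)
Lemma ge0_int_shift (f : R -> \bar R) (b : R) : measurable_fun setT f ->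
  (forall x, 0 <= f x)%E ->
  (\int[lebR]_x f (x + b)%R = \int[lebR]_x f x)%E.
Proof.
move=> mf f0.
have mphi : measurable_fun setT ((fun x => x + b) : mR -> mR) by mfun.
rewrite [RHS](_ : _ = \int[pushforward lebR ((fun x => x + b)%R : mR -> mR)]_x f x)%E.
  by rewrite ge0_integral_pushforward// preimage_setT.
apply: eq_measure_integral => //= A mA _.
apply: lebesgue_measure_unique => // _ [[u v]] _ <-.
rewrite [RHS](_ : _ = @lebesgue_measure R `]u - b, v - b]%classic); last first.
  congr lebesgue_measure; apply/seteqP; split => x /=; rewrite !in_itv /= ltrBlDr lerBrDr//.
rewrite !lebesgue_measure_itv /= !lte_fin ltrD2r.
by case: ifP => // _; rewrite -!EFinB opprB addrA subrK.
Qed.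

Lemma ge0_int_scale (f : R -> \bar R) (a : R) : 0 < a -> measurable_fun setT f ->
  (forall x, 0 <= f x)%E ->
  (a%:E * \int[lebR]_x f (a * x)%R = \int[lebR]_x f x)%E.
Proof.
move=> a0 mf f0.
have mphi : measurable_fun setT ((fun x => a * x) : mR -> mR) by mfun.
pose k := NngNum (ltW a0).
rewrite [RHS](_ : _ = \int[mscale k (pushforward lebR ((fun x => a * x)%R : mR -> mR))]_x f x)%E.
  by rewrite ge0_integral_mscale// ge0_integral_pushforward// preimage_setT.
apply: eq_measure_integral => //= A mA _.
apply: lebesgue_measure_unique => // _ [[u v]] _ <-.
rewrite [RHS](_ : _ = a%:E * @lebesgue_measure R `](u / a)%R, (v / a)%R]%classic)%E; last first.
  congr (_ * lebesgue_measure _)%E; apply/seteqP; split => x /=; rewrite !in_itv /= ltr_pdivrMr// ler_pdivlMr// mulrC//.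
rewrite !lebesgue_measure_itv /= !lte_fin ltr_pM2r ?invr_gt0//.
case: ifP => // _; last by rewrite mule0.
by rewrite -!EFinB -EFinM -mulrBl mulrCA divff ?mulr1// gt_eqF.
Qed.

Lemma ge0_int_opp (f : R -> \bar R) : measurable_fun setT f ->
  (forall x, 0 <= f x)%E ->
  (\int[lebR]_x f (- x)%R = \int[lebR]_x f x)%E.
Proof.
move=> mf f0.
have mphi : measurable_fun setT (-%R : mR -> mR) by exact: oppr_measurable.
rewrite [RHS](_ : _ = \int[pushforward lebR (-%R : mR -> mR)]_x f x)%E.
  by rewrite ge0_integral_pushforward// preimage_setT.
by apply: eq_measure_integral => //= A mA _; exact/esym/lebesgue_measureN.
Qed.

Lemma ge0_int2_shift (f : R * R -> \bar R) (b : R * R) : measurable_fun setT f ->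
  (forall x, 0 <= f x)%E ->
  (\int[lebR2]_x f (x.1 + b.1, x.2 + b.2)%R = \int[lebR2]_x f x)%E.
Proof.
move=> mf f0; have mf' : measurable_fun setT
  (fun x : R * R => f (x.1 + b.1, x.2 + b.2)%R) by mfun.
rewrite [LHS]tonelli1// [RHS]tonelli1//.
transitivity (\int[lebR]_x \int[lebR]_y f (x + b.1, y)%R)%E.
  apply: eq_integral => x _ /=.
  apply: (ge0_int_shift (f := fun y => f (x + b.1, y))) => //; mfun.
apply: (ge0_int_shift (f := fun x => \int[lebR]_y f (x, y)%E)%E) => //.
  exact: measurable_tonelli1.
by move=> x; exact: integral_ge0.
Qed.

Lemma ge0_int2_scale (f : R * R -> \bar R) (a : R) : 0 < a ->
  measurable_fun setT f -> (forall x, 0 <= f x)%E ->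
  ((a ^+ 2)%:E * \int[lebR2]_x f (a * x.1, a * x.2)%R = \int[lebR2]_x f x)%E.
Proof.
move=> a0 mf f0; have mf' : measurable_fun setT
  (fun x : R * R => f (a * x.1, a * x.2)%R) by mfun.
rewrite [in LHS]tonelli1// [RHS]tonelli1//.
transitivity (a%:E * \int[lebR]_x \int[lebR]_y f (a * x, y)%R)%E.
  rewrite expr2 EFinM -muleA -(ge0_integralZl_EFin _ _ _ _ (ltW a0))//.
  - congr (_ * _)%E; apply: eq_integral => x _ /=.
    apply: (ge0_int_scale (f := fun y => f (a * x, y))) => //; mfun.
  - by move=> x _; apply: integral_ge0.
  - exact: (measurable_tonelli1 lebR mf').
apply: (ge0_int_scale (f := fun x => \int[lebR]_y f (x, y)%E)%E) => //.
  exact: measurable_tonelli1.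
by move=> x; exact: integral_ge0.
Qed.

Lemma ge0_int2_opp (f : R * R -> \bar R) :
  measurable_fun setT f -> (forall x, 0 <= f x)%E ->
  (\int[lebR2]_x f (- x.1, - x.2)%R = \int[lebR2]_x f x)%E.
Proof.
move=> mf f0; have mf' : measurable_fun setT
  (fun x : R * R => f (- x.1, - x.2)%R) by mfun.
rewrite [LHS]tonelli1// [RHS]tonelli1//.
transitivity (\int[lebR]_x \int[lebR]_y f (- x, y)%R)%E.
  apply: eq_integral => x _ /=.
  apply: (ge0_int_opp (f := fun y => f (- x, y)%R)) => //; mfun.
apply: (ge0_int_opp (f := fun x => \int[lebR]_y f (x, y)%E)%E) => //.
  exact: measurable_tonelli1.
by move=> x; exact: integral_ge0.
Qed.

(** Passes from nonnegative functions to complex ones through the positive and negative parts of the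
    real and imaginary parts; k plays the part of the Jacobian of phi. *)
Lemma cint_change (phi : R * R -> R * R) (k : R) (f : R * R -> R[i]) : 0 < k ->
  (forall g : R * R -> \bar R, measurable_fun setT g -> (forall x, 0 <= g x)%E ->
    (k%:E * \int[lebR2]_x g (phi x) = \int[lebR2]_x g x)%E) ->
  cmeas f -> k%:C * cint lebR2 (fun x => f (phi x)) = cint lebR2 f.
Proof.
set mu := lebR2.
move=> k0 phiE.
have aux (h : R * R -> R) : measurable_fun setT h ->
    k * \int[mu]_x h (phi x) = \int[mu]_x h x.
  move=> mh; rewrite /Rintegral.
  have mh' : measurable_fun setT (EFin \o h) by exact/measurable_EFinP.
  pose A := (\int[mu]_x (EFin \o h)^\+ (phi x))%E.
  pose B := (\int[mu]_x (EFin \o h)^\- (phi x))%E.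
  have A0 : (0 <= A)%E by apply: integral_ge0 => x _; exact: funepos_ge0.
  have B0 : (0 <= B)%E by apply: integral_ge0 => x _; exact: funeneg_ge0.
  have -> : (\int[mu]_x (h (phi x))%:E = A - B)%E.
    rewrite integralE /A /B; congr (_ - _)%E; apply: eq_integral => x _.
      by rewrite !funeposE.
    by rewrite !funenegE.
  have -> : (\int[mu]_x (h x)%:E = k%:E * A - k%:E * B)%E.
    rewrite integralE /A /B (phiE (EFin \o h)^\+%E) ?(phiE (EFin \o h)^\-%E)//.
    - exact: measurable_funeneg.
    - exact: measurable_funepos.
  (* When one of the two parts has an infinite integral, both sides are 0, the value of [fine] at
     the infinities. *)
  case: A A0 B B0 => [a||] // _ [b||] // _.
  - by rewrite /= mulrBr.
  - by rewrite gt0_muley ?lte_fin//= mulr0.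
  - by rewrite gt0_muley ?lte_fin//= mulr0.
  - by rewrite gt0_muley ?lte_fin//= mulr0.
move=> [ma mb]; apply/eqP; rewrite eq_complex /= !mul0r subr0 addr0.
rewrite (aux (fun x => complex.Re (f x)))//.
by rewrite (aux (fun x => complex.Im (f x)))// !eqxx.
Qed.

Lemma cint2_shift (f : R * R -> R[i]) (b : R * R) : cmeas f ->
  cint lebR2 (fun x => f (x.1 + b.1, x.2 + b.2)) = cint lebR2 f.
Proof.
move=> mf; rewrite -[LHS]mul1r -[1]/(1%:C).
apply: (@cint_change (fun x : R * R => (x.1 + b.1, x.2 + b.2)) 1) => // g mg g0.
by rewrite mul1e; exact: ge0_int2_shift.
Qed.

Lemma cint2_scale (f : R * R -> R[i]) (a : R) : 0 < a -> cmeas f ->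
  (a ^+ 2)%:C * cint lebR2 (fun x => f (a * x.1, a * x.2)) = cint lebR2 f.
Proof.
move=> a0 mf.
apply: (@cint_change (fun x : R * R => (a * x.1, a * x.2)) (a ^+ 2)) => //.
  by rewrite exprn_gt0.
by move=> g mg g0; exact: ge0_int2_scale.
Qed.

(** Measurability refers to the product sigma-algebra, openness to the product topology. An open set
    is the union of the countably many open squares with rational centre and half-side 1 / (n + 1)
    that it contains. *)
Lemma open_measurable2 (U : set (R * R)) : open U -> measurable U.
Proof.
move=> oU.
pose r (n : nat) : R := n.+1%:R^-1.
pose B (p : rat * rat * nat) : set (R * R) :=
  ball (ratr p.1.1 : R) (r p.2) `*` ball (ratr p.1.2 : R) (r p.2).
pose F p : set (R * R) := if `[< B p `<=` U >] then B p else set0.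
rewrite (_ : U = \bigcup_p F p).
  apply: countable_bigcupT_measurable; first exact: countableP.
  move=> p; rewrite /F; case: ifP => // _.
  by apply: measurableX; exact: measurable_ball.
apply/seteqP; split => [[x y] Uxy|[x y] [p _]]; last first.
  by rewrite /F; case: ifPn => // /asboolP BU /BU.
have /nbhs_ballP [e /= e0 eU] : nbhs (x, y) U by exact: open_nbhs_nbhs.
have [n ne] : exists n, r n < e / 2.
  have e20 : 0 < e / 2 by rewrite divr_gt0.
  exists (Num.truncn (e / 2)^-1); rewrite /r invf_plt ?posrE//.
  exact: truncnS_gt.
have rn0 : 0 < r n by rewrite invr_gt0.
have [q1 q1x] : exists q : rat, ball x (r n) (ratr q).
  have : (x - r n < x + r n) by rewrite ltrD2l gt0_cp.
  move=> /rat_in_itvoo [q]; rewrite in_itv /= => /andP[q1 q2]; exists q.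
  by rewrite /ball /= ltr_distlC q1 q2.
have [q2 q2y] : exists q : rat, ball y (r n) (ratr q).
  have : (y - r n < y + r n) by rewrite ltrD2l gt0_cp.
  move=> /rat_in_itvoo [q]; rewrite in_itv /= => /andP[q1' q2]; exists q.
  by rewrite /ball /= ltr_distlC q1' q2.
exists (q1, q2, n) => //; rewrite /F; case: ifPn => [_|/asboolPn].
  by split => /=; exact: ball_sym.
case=> -[u v] [/= ux vy]; apply: eU; split => /=.
  apply: (@le_ball _ _ _ (r n + r n)); last exact: ball_triangle q1x ux.
  by rewrite (splitr e) ltW// ltrD.
apply: (@le_ball _ _ _ (r n + r n)); last exact: ball_triangle q2y vy.
by rewrite (splitr e) ltW// ltrD.
Qed.

Lemma continuous_measurable2 (f : R * R -> R) : continuous f ->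
  measurable_fun setT f.
Proof.
move=> cf; apply: (measurability (@RGenOpens.G R)); first exact: RGenOpens.measurableE.
move=> _ [_ [a [b ->] <-]]; rewrite setTI; apply: open_measurable2.
by apply: open_comp => // x _; exact: cf.
Qed.

Lemma compact_measurable2 (K : set (R * R)) : compact K -> measurable K.
Proof.
have hR2 : hausdorff_space (R * R)%type by exact: norm_hausdorff.
move=> /(compact_closed hR2) cK.
by rewrite -(setCK K); apply: measurableC; apply: open_measurable2; exact: closed_openC.
Qed.


Lemma int_oneDsqr : (\int[lebR]_x ((1 + x ^+ 2)^-1)%:E = pi%:E)%E.
Proof.
have := @ge0_symfun_integralT R (fun x => (oneDsqr x)^-1).
rewrite -set_itvcy integral0y_oneDsqr => ->.
- by rewrite -EFinM mulrC mulfVK// pnatr_eq0.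
- by move=> x; rewrite invr_ge0.
- exact: continuous_oneDsqrV.
- by move=> x; rewrite /= /oneDsqr sqrrN.
Qed.

Lemma wgtE (x : R * R) : wgt x = (1 + x.1 ^+ 2)^-1 * (1 + x.2 ^+ 2)^-1.
Proof. by rewrite wgt.unlock. Qed.

Lemma measurable_wgt : measurable_fun setT (@wgt R).
Proof. by rewrite (funext wgtE); mfun. Qed.

Lemma wgt_ge0 (x : R * R) : 0 <= wgt x.
Proof. by rewrite wgtE mulr_ge0// invr_ge0 addr_ge0// sqr_ge0. Qed.

Lemma int_wgt : (\int[lebR2]_x (wgt (x : R * R))%:E = (pi ^+ 2)%:E)%E.
Proof.
rewrite tonelli1.
- transitivity (\int[lebR]_x (pi%:E * ((1 + (x : R) ^+ 2)^-1)%:E))%E.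
    apply: eq_integral => x _; rewrite -int_oneDsqr muleC; under eq_integral do rewrite wgtE EFinM; rewrite -ge0_integralZl_EFin//.
    + by move=> y _; rewrite lee_fin invr_ge0 addr_ge0// sqr_ge0.
    + by mfun.
    + by rewrite invr_ge0 addr_ge0// sqr_ge0.
  rewrite ge0_integralZl_EFin ?pi_ge0//.
  + by rewrite int_oneDsqr -EFinM expr2.
  + by move=> x _; rewrite lee_fin invr_ge0 addr_ge0// sqr_ge0.
  + by mfun.
- by apply: mf_EFin; exact: measurable_wgt.
- by move=> z; rewrite lee_fin wgt_ge0.
Qed.

Lemma wgt_gt0 (x : R * R) : 0 < wgt x.
Proof. by rewrite wgtE mulr_gt0// invr_gt0 ltr_pwDl// sqr_ge0. Qed.

(** Makes the weight usable for difference quotients with steps at most 1. *)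
Lemma wgt_shift (x : R * R) (j : bool) (s : R) : 0 <= s <= 1 -> wgt (x + s *: basis_vec j) <= 3 * wgt x.
Proof.
move=> /andP[s0 s1].
have key (u : R) : (1 + (u + s) ^+ 2)^-1 <= 3 * (1 + u ^+ 2)^-1.
  have p1 : 0 < 1 + u ^+ 2 by rewrite ltr_pwDl// sqr_ge0.
  have p2 : 0 < 1 + (u + s) ^+ 2 by rewrite ltr_pwDl// sqr_ge0.
  rewrite ler_pdivlMr// mulrC ler_pdivrMr//.
  (* 3 (1 + (u + s)^2) - (1 + u^2) equals (2 u + 3 s)^2 / 2 + 2 - 3 s^2 / 2, and s^2 <= 1. *)
  have := sqr_ge0 (2 * u + 3 * s); nra.
have i0 (u : R) : 0 <= (1 + u ^+ 2)^-1 by rewrite invr_ge0 addr_ge0// sqr_ge0.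
rewrite !wgtE /basis_vec; case: j => /=.
  rewrite /GRing.scale /= mulr0 addr0 mulr1.
  by rewrite mulrCA ler_wpM2l.
rewrite /GRing.scale /= mulr0 addr0 mulr1.
by rewrite mulrA ler_wpM2r.
Qed.

Lemma enorm_ge0 (x : R * R) : 0 <= enorm x.
Proof. exact: sqrtr_ge0. Qed.

Lemma enorm_sqr (x : R * R) : enorm x ^+ 2 = x.1 ^+ 2 + x.2 ^+ 2.
Proof. by rewrite /enorm /dotp -!expr2 sqr_sqrtr// addr_ge0 ?sqr_ge0. Qed.

Lemma abs1_le_enorm (x : R * R) : `|x.1| <= enorm x.
Proof.
by rewrite -sqrtr_sqr ler_sqrt /dotp -?expr2 ?addr_ge0 ?sqr_ge0// lerDl sqr_ge0.
Qed.

Lemma abs2_le_enorm (x : R * R) : `|x.2| <= enorm x.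
Proof.
by rewrite -sqrtr_sqr ler_sqrt /dotp -?expr2 ?addr_ge0 ?sqr_ge0// lerDr sqr_ge0.
Qed.

Lemma enorm_le_abs (x : R * R) : enorm x <= `|x.1| + `|x.2|.
Proof.
rewrite -[leRHS]ger0_norm ?addr_ge0// -sqrtr_sqr ler_sqrt ?sqr_ge0//.
rewrite /dotp sqrrD !real_normK ?num_real// addrAC -!expr2 lerDl mulrn_wge0//.
Qed.

(** Lagrange's identity: the difference of the squares is the square of the scalar product. *)
Lemma cross_le (x y : R * R) : `|cross x y| <= enorm x * enorm y.
Proof.
rewrite -[leRHS]ger0_norm ?mulr_ge0 ?enorm_ge0// -ler_sqr ?nnegrE//.
rewrite !real_normK ?num_real// exprMn !enorm_sqr /cross -subr_ge0.
rewrite (_ : _ - _ = (x.1 * y.1 + x.2 * y.2) ^+ 2) ?sqr_ge0//; ring.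
Qed.

Lemma measurable_enorm : measurable_fun setT (@enorm R).
Proof. by rewrite /enorm /dotp; mfun. Qed.

Lemma ae_lty d (T : measurableType d) (mu : {measure set T -> \bar R})
    (g : T -> \bar R) : measurable_fun setT g -> (forall x, 0 <= g x)%E ->
  (\int[mu]_x g x < +oo)%E -> {ae mu, forall x, (g x < +oo)%E}.
Proof.
move=> mg g0 gi.
have ig : mu.-integrable setT g.
  apply/integrableP; split => //.
  by under eq_integral do rewrite gee0_abs//.
have := integrable_ae measurableT ig.
by apply: filterS => x /(_ Logic.I); rewrite ge0_fin_numE.
Qed.

End Plane.

Arguments lebR {R}.
Arguments lebR2 {R}.

(** * Differential calculus on the plane *)

Lemma squeeze0 (R : realType) (f g : nat -> R) : (forall n, 0 <= f n <= g n) ->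
  g @ \oo --> (0 : R) -> f @ \oo --> (0 : R).
Proof.
by move=> fg; apply: (squeeze_cvgr _ (cvg_cst 0)); apply: nearW.
Qed.

(** A quadratic remainder is what Taylor's formula under an integral sign yields; it gives
    differentiability and identifies the differential at once. *)
Lemma diff_quad_gen (R : realType) (V : normedModType R) (f : V -> R) (x : V)
    (L : {linear V -> R}) (M : R) : continuous L -> 0 <= M ->
  (forall h, `|f (h + x) - f x - L h| <= M * `|h| ^+ 2) ->
  differentiable f x /\ ('d f x = L :> (_ -> _)).
Proof.
move=> cL M0 fM.
have e : f \o shift x = cst (f x) + L +o_ 0 id.
  apply/eqaddoP => e e0; near=> h.
  have -> : `|(f \o shift x - (cst (f x) + L)) h| = `|f (h + x) - f x - L h|.
    by rewrite !fctE /= opprD addrA.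
  rewrite (le_trans (fM h))// expr2 mulrA ler_wpM2r//.
  have : `|h| <= e / (M + 1).
    near: h; apply: nbhs0_le; rewrite divr_gt0// ltr_wpDl//.
  rewrite ler_pdivlMr ?ltr_wpDl// => h1.
  by rewrite (le_trans _ h1)// mulrC ler_wpM2l// lerDl.
have dE := diff_unique cL e.
by split => //; apply/diff_locallyP; rewrite dE.
Unshelve. all: by end_near. Qed.

Section Calculus.
Context (R : realType).
Local Notation cRe := (@complex.Re R).
Local Notation cIm := (@complex.Im R).
Implicit Types (f : R * R -> R) (phi psi : R * R -> R[i]) (x : R * R) (j : bool).

Section Linear2.
Variables a b : R.

Definition lin2 x : R := a * x.1 + b * x.2.

Lemma lin2_is_linear : linear lin2.
Proof. by move=> k u v; rewrite /lin2 /= /GRing.scale /=; ring. Qed.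

HB.instance Definition _ := GRing.isLinear.Build R (R * R)%type R _ lin2 lin2_is_linear.

End Linear2.

Lemma norm1_le x : `|x.1| <= `|x|.
Proof. by rewrite prod_normE le_max lexx. Qed.

Lemma norm2_le x : `|x.2| <= `|x|.
Proof. by rewrite prod_normE le_max lexx orbT. Qed.

Lemma continuous_lin2 a b : continuous (lin2 a b).
Proof.
move=> x; rewrite /lin2; apply: cvgD; apply: cvgM; try exact: cvg_cst.
  exact: cvg_fst.
exact: cvg_snd.
Qed.

Lemma diff_quad f x (a b M : R) :
  (forall h, `|f (h + x) - f x - lin2 a b h| <= M * `|h| ^+ 2) ->
  differentiable f x /\ forall v, 'D_v f x = lin2 a b v.
Proof.
move=> fM.
have M0 : 0 <= M.
  have := fM (1, 1); have -> : `|(1, 1) : R * R| = 1.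
    by rewrite prod_normE /= normr1 maxxx.
  by rewrite expr1n mulr1; apply: le_trans.
have [df dE] := diff_quad_gen (@continuous_lin2 a b) M0 fM.
by split => // v; rewrite deriveE// dE.
Qed.

Definition cdiff phi x : Prop :=
  differentiable (fun y => cRe (phi y)) x /\ differentiable (fun y => cIm (phi y)) x.

Lemma cdiff_quad phi x (G : bool -> R[i]) (M : R) :
  (forall h, normc (phi (h + x) - phi x - (h.1%:C * G false + h.2%:C * G true))
     <= M * `|h| ^+ 2) ->
  cdiff phi x /\ forall j, partial j phi x = G j.
Proof.
move=> phiM.
have [d1 e1] : differentiable (fun y => cRe (phi y)) x /\
    forall v, 'D_v (fun y => cRe (phi y)) x = lin2 (cRe (G false)) (cRe (G true)) v.
  apply: (@diff_quad _ _ _ _ M) => h.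
  rewrite (le_trans _ (phiM h))// (le_trans _ (abs_Re_le _))// /lin2.
  rewrite !(cReD, cReN, cReM) /= !mul0r !subr0.
  by rewrite (mulrC _ h.1) (mulrC _ h.2).
have [d2 e2] : differentiable (fun y => cIm (phi y)) x /\
    forall v, 'D_v (fun y => cIm (phi y)) x = lin2 (cIm (G false)) (cIm (G true)) v.
  apply: (@diff_quad _ _ _ _ M) => h.
  rewrite (le_trans _ (phiM h))// (le_trans _ (abs_Im_le _))// /lin2.
  rewrite !(cImD, cImN, cImM) /= !mul0r !addr0.
  by rewrite (mulrC _ h.1) (mulrC _ h.2).
split => // j; rewrite /partial e1 e2 /lin2 /basis_vec.
by case: j => /=; rewrite ?mulr0 ?mulr1 ?addr0 ?add0r; [case: (G true)|case: (G false)].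
Qed.

Lemma cdiff_der phi x v : cdiff phi x ->
  derivable (fun y => cRe (phi y)) x v /\ derivable (fun y => cIm (phi y)) x v.
Proof. by move=> [d1 d2]; split; exact: diff_derivable. Qed.

Lemma cdiffD phi psi x : cdiff phi x -> cdiff psi x -> cdiff (fun y => phi y + psi y) x.
Proof.
move=> [a b] [a' b']; split.
  by under eq_fun do rewrite cReD; exact: differentiableD.
by under eq_fun do rewrite cImD; exact: differentiableD.
Qed.

Lemma partialD j phi psi x : cdiff phi x -> cdiff psi x ->
  partial j (fun y => phi y + psi y) x = partial j phi x + partial j psi x.
Proof.
move=> /(cdiff_der (basis_vec j)) [a b] /(cdiff_der (basis_vec j)) [a' b'].
rewrite /partial; under [in LHS]eq_fun do rewrite cReD.
under [in X in _ +i* X = _]eq_fun do rewrite cImD.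
by rewrite !deriveD.
Qed.

Lemma derB f g x v : derivable f x v -> derivable g x v ->
  'D_v (fun y => f y - g y) x = 'D_v f x - 'D_v g x.
Proof. exact: deriveB. Qed.

Lemma derD f g x v : derivable f x v -> derivable g x v ->
  'D_v (fun y => f y + g y) x = 'D_v f x + 'D_v g x.
Proof. exact: deriveD. Qed.

Lemma derM f g x v : derivable f x v -> derivable g x v ->
  'D_v (fun y => f y * g y) x = f x * 'D_v g x + g x * 'D_v f x.
Proof. exact: deriveM. Qed.

Lemma derivM f g x v : derivable f x v -> derivable g x v ->
  derivable (fun y => f y * g y) x v.
Proof. exact: derivableM. Qed.

Lemma cdiffM phi psi x : cdiff phi x -> cdiff psi x -> cdiff (fun y => phi y * psi y) x.
Proof.
move=> [a b] [a' b']; split.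
  under eq_fun do rewrite cReM.
  by apply: differentiableB; exact: differentiableM.
under eq_fun do rewrite cImM.
by apply: differentiableD; exact: differentiableM.
Qed.

Lemma partialM j phi psi x : cdiff phi x -> cdiff psi x ->
  partial j (fun y => phi y * psi y) x =
  partial j phi x * psi x + phi x * partial j psi x.
Proof.
move=> /(cdiff_der (basis_vec j)) [a b] /(cdiff_der (basis_vec j)) [a' b'].
rewrite [RHS]complexE [LHS]/partial; congr (_ +i* _).
  under [in LHS]eq_fun do rewrite cReM.
  rewrite derB; [|exact: derivM|exact: derivM].
  rewrite !derM// cReD !cReM /partial /=; ring.
under [in LHS]eq_fun do rewrite cImM.
rewrite derD; [|exact: derivM|exact: derivM].
rewrite !derM// cImD !cImM /partial /=; ring.
Qed.

Lemma cdiff_cst c x : cdiff (fun=> c) x.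
Proof. by split; exact: differentiable_cst. Qed.

Lemma partial_cst j c x : partial j (fun=> c) x = 0.
Proof. by rewrite /partial !derive_cst. Qed.

Lemma cdiffZ c phi x : cdiff phi x -> cdiff (fun y => c * phi y) x.
Proof. by move=> dphi; apply: cdiffM => //; exact: cdiff_cst. Qed.

Lemma partialZ j c phi x : cdiff phi x ->
  partial j (fun y => c * phi y) x = c * partial j phi x.
Proof.
by move=> dphi; rewrite partialM ?partial_cst ?mul0r ?add0r//; exact: cdiff_cst.
Qed.

Lemma differentiable_lin2 a b x : differentiable (lin2 a b) x.
Proof. exact/linear_differentiable/continuous_lin2. Qed.

Lemma derive_lin2 a b x v : 'D_v (lin2 a b) x = lin2 a b v.
Proof.
by rewrite deriveE ?diff_lin//; [exact: continuous_lin2|exact: differentiable_lin2].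
Qed.

Lemma coord2E k x : coord2 k x = lin2 (~~ k)%:R k%:R x.
Proof.
by rewrite /coord2 /lin2; case: k => /=; rewrite mul1r mul0r ?add0r ?addr0.
Qed.

Lemma differentiable_coord2 k x : differentiable (coord2 k : R * R -> R) x.
Proof.
rewrite (_ : coord2 k = lin2 (~~ k)%:R k%:R); first exact: differentiable_lin2.
by apply/funext => y; exact: coord2E.
Qed.

Lemma derive_coord2 k j x : 'D_(basis_vec j) (coord2 k : R * R -> R) x = (j == k)%:R.
Proof.
rewrite (_ : coord2 k = lin2 (~~ k)%:R k%:R).
  by rewrite derive_lin2 /lin2 /basis_vec; case: j; case: k => /=; rewrite !(mulr0, mulr1, addr0, add0r).
by apply/funext => y; exact: coord2E.
Qed.

Lemma cdiff_real f x : differentiable f x -> cdiff (fun y => (f y)%:C) x.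
Proof. by move=> df; split => //=; exact: differentiable_cst. Qed.

Lemma partial_real j f x : partial j (fun y => (f y)%:C) x = ('D_(basis_vec j) f x)%:C.
Proof. by rewrite /partial /= derive_cst. Qed.

Lemma cdiff_coord k x : cdiff (fun y => (coord2 k y)%:C) x.
Proof. by apply: cdiff_real; exact: differentiable_coord2. Qed.

Lemma partial_coord j k x : partial j (fun y => (coord2 k y)%:C) x = ((j == k)%:R)%:C.
Proof. by rewrite partial_real derive_coord2. Qed.

Lemma differentiable_expR f x : differentiable f x ->
  differentiable (fun y => expR (f y)) x.
Proof.
move=> df; apply: (differentiable_comp (g := expR)) => //.
by apply/derivable1_diffP; exact: derivable_expR.
Qed.

Lemma derive_expR_comp f x v : differentiable f x ->
  'D_v (fun y => expR (f y)) x = expR (f x) * 'D_v f x.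
Proof.
move=> df; rewrite deriveE; last exact: differentiable_expR.
have de : differentiable (@expR R) (f x).
  by apply/derivable1_diffP; exact: derivable_expR.
have E : 'd (expR \o f) x = 'd (@expR R) (f x) \o 'd f x :> (_ -> _) by exact: diff_comp.
rewrite -[fun y => expR (f y)]/(expR \o f) E /= -(deriveE v df) diff1E//.
have -> : expR^`()%classic (f x) = expR (f x) by rewrite derive1E; exact: derive_val.
by rewrite /GRing.scale /= mulrC.
Qed.

Lemma derivable_line f x v (t : R) : derivable f (x + t *: v) v ->
  is_derive (t : R) (1 : R) (fun s : R => f (x + s *: v)) ('D_v f (x + t *: v)).
Proof.
move=> df.
have E : (fun h : R => h^-1 *: (((fun s : R => f (x + s *: v)) \o shift t) (h *: (1 : R))
    - f (x + t *: v))) =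
  (fun h => h^-1 *: ((f \o shift (x + t *: v)) (h *: v) - f (x + t *: v))).
  apply/funext => h /=; congr (_ *: (f _ - _)).
  by rewrite (_ : h *: (1 : R) = h) ?scalerDl 1?addrCA// /GRing.scale /= mulr1.
by split; rewrite ?/derivable ?/derive E.
Qed.

Lemma real_MVT f x v (t B : R) : (forall y, differentiable f y) -> 0 <= t ->
  (forall s, 0 <= s <= t -> `|'D_v f (x + s *: v)| <= B) ->
  `|f (x + t *: v) - f x| <= B * t.
Proof.
move=> df t0 fB.
pose g (s : R) := f (x + s *: v).
have dg (s : R) : is_derive s (1 : R) g ('D_v f (x + s *: v)).
  by apply: derivable_line; exact: diff_derivable.
have cg : continuous g.
  by move=> s; apply: differentiable_continuous; apply/derivable1_diffP; have [] := dg s.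
have [c] := @MVT_segment R g (fun s => 'D_v f (x + s *: v)) 0 t t0
  (fun s _ => dg s) (continuous_subspaceT cg).
rewrite in_itv /= => c0 e.
have -> : f (x + t *: v) - f x = g t - g 0 by rewrite /g scale0r addr0.
by rewrite e subr0 normrM (ger0_norm t0) ler_wpM2r// fB.
Qed.

(** The mean value theorem is applied to the real and imaginary parts separately, whence the factor
    2. *)
Lemma cMVT phi x j (t B : R) : (forall y, cdiff phi y) -> 0 <= t ->
  (forall s, 0 <= s <= t -> normc (partial j phi (x + s *: basis_vec j)) <= B) ->
  normc (phi (x + t *: basis_vec j) - phi x) <= 2 * B * t.
Proof.
move=> dphi t0 phiB; rewrite (le_trans (normc_le_abs _))//.
rewrite -mulrA mulr_natl mulr2n cReD cImD cReN cImN lerD//.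
  apply: (@real_MVT (fun y => cRe (phi y))) => //; first by move=> y; have [] := dphi y.
  by move=> s s0; rewrite (le_trans _ (phiB s s0))// (le_trans _ (abs_Re_le _)).
apply: (@real_MVT (fun y => cIm (phi y))) => //; first by move=> y; have [] := dphi y.
by move=> s s0; rewrite (le_trans _ (phiB s s0))// (le_trans _ (abs_Im_le _)).
Qed.

(** The partial derivative as a limit along the steps 1 / (n + 1), the sequential form that
    dominated convergence asks for. *)
Lemma cdiff_quotient phi j x : cdiff phi x ->
  (fun n => normc ((n.+1%:R)%:C * (phi (x + n.+1%:R^-1 *: basis_vec j) - phi x)
     - partial j phi x)) @ \oo --> (0 : R).
Proof.
move=> dphi; have [/cvg_ex [/= l1 h1] /cvg_ex [/= l2 h2]] := cdiff_der (basis_vec j) dphi.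
have cvg0 : (fun n => n.+1%:R^-1 : R) @ \oo --> 0^'.
  move=> A [e /= e0 eA]; have [N _ NA] := @cvg_harmonic R _ (nbhsx_ballx 0 e e0).
  exists N => // n /= Nn; apply: eA; last by rewrite /= invr_eq0 pnatr_eq0.
  exact: NA.
have e1 : partial j phi x = l1 +i* l2.
  by rewrite /partial /derive (cvg_lim _ h1) ?(cvg_lim _ h2)//; exact: Rhausdorff.
rewrite e1.
have k1 := cvg_comp _ _ cvg0 h1; have k2 := cvg_comp _ _ cvg0 h2.
have k1' : (fun n => `|n.+1%:R * (cRe (phi (x + n.+1%:R^-1 *: basis_vec j)) - cRe (phi x)) - l1|) @ \oo --> (0 : R).
  rewrite -[0](normr0 R) -(subrr l1); apply: cvg_norm; apply: cvgB; last exact: cvg_cst.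
  apply: cvg_trans k1; apply: near_eq_cvg; near=> n => /=.
  by rewrite invrK [_ + x]addrC.
have k2' : (fun n => `|n.+1%:R * (cIm (phi (x + n.+1%:R^-1 *: basis_vec j)) - cIm (phi x)) - l2|) @ \oo --> (0 : R).
  rewrite -[0](normr0 R) -(subrr l2); apply: cvg_norm; apply: cvgB; last exact: cvg_cst.
  apply: cvg_trans k2; apply: near_eq_cvg; near=> n => /=.
  by rewrite invrK [_ + x]addrC.
have h : (fun n => `|n.+1%:R * (cRe (phi (x + n.+1%:R^-1 *: basis_vec j)) - cRe (phi x)) - l1| +
  `|n.+1%:R * (cIm (phi (x + n.+1%:R^-1 *: basis_vec j)) - cIm (phi x)) - l2|) @ \oo --> (0 : R).
  by rewrite -[0]addr0; exact: cvgD.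
apply: squeeze0 h => n; rewrite normc_ge0 /= (le_trans (normc_le_abs _))//.
by rewrite !(cReD, cImD, cReN, cImN, cReM, cImM) /= !mul0r subr0 addr0.
Unshelve. all: by end_near. Qed.

Lemma sin_le_abs (b : R) : `|sin b| <= `|b|.
Proof.
wlog b0 : b / 0 <= b => [h|].
  have [/h//|/ltW b0] := leP 0 b.
  by rewrite -normrN -sinN -[leRHS]normrN h// oppr_ge0.
have [c _] := @MVT_segment R sin cos 0 b b0 (fun s _ => is_derive_sin s)
  (continuous_subspaceT (@continuous_sin R)).
rewrite sin0 !subr0 => ->; rewrite normrM ler_piMl// ler_norml.
by rewrite cos_geN1 cos_le1.
Qed.

Lemma cosB1_le (b : R) : `|cos b - 1| <= b ^+ 2.
Proof.
have -> : cos b - 1 = - (sin (b / 2) ^+ 2 *+ 2).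
  rewrite -[in LHS](divfK (_ : 2%:R != 0 :> R) b) ?pnatr_eq0//.
  rewrite mulr_natr mulr2n cosD -!expr2 cos2sin2 mulr2n; ring.
rewrite normrN ger0_norm ?mulrn_wge0 ?sqr_ge0//.
rewrite -real_normK ?num_real//.
have : `|sin (b / 2)| ^+ 2 <= `|b / 2| ^+ 2.
  by rewrite ler_sqr ?nnegrE//; exact: sin_le_abs.
rewrite (real_normK (num_real (b / 2))) expr_div_n => h.
by have := sqr_ge0 b; lra.
Qed.

Lemma sinB_le (b : R) : `|sin b - b| <= b ^+ 2.
Proof.
wlog b0 : b / 0 <= b => [h|].
  have [/h//|/ltW b0] := leP 0 b.
  have := h (- b); rewrite oppr_ge0 => /(_ b0).
  by rewrite sinN -opprD normrN sqrrN.
have dg (s : R) : is_derive s (1 : R) (fun s : R => sin s - s) (cos s - 1).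
  exact: is_deriveB.
have cg : continuous (fun s : R => sin s - s).
  by move=> s; apply: differentiable_continuous; apply/derivable1_diffP; have [] := dg s.
have [c] := @MVT_segment R (fun s => sin s - s) (fun s => cos s - 1) 0 b b0
  (fun s _ => dg s) (continuous_subspaceT cg).
rewrite in_itv /= => /andP[c0 cb]; rewrite sin0 !subr0 => ->.
rewrite normrM (ger0_norm b0) expr2 ler_wpM2r//.
(* It remains to bound |cos c - 1| by b. If b >= 2, it is at most 2; otherwise it is at most c^2 / 2
   <= b^2 / 2 <= b. *)
have [/(le_trans _) c1|c1] := leP 2 b.
  apply: c1; rewrite (le_trans (ler_normB _ _))// normr1.
  rewrite (_ : 2 = 1 + 1)// lerD2r ler_norml.
  by rewrite cos_geN1 cos_le1.
have -> : cos c - 1 = - (sin (c / 2) ^+ 2 *+ 2).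
  rewrite -[in LHS](divfK (_ : 2%:R != 0 :> R) c) ?pnatr_eq0//.
  rewrite mulr_natr mulr2n cosD -!expr2 cos2sin2 mulr2n; ring.
rewrite normrN ger0_norm ?mulrn_wge0 ?sqr_ge0//.
rewrite -real_normK ?num_real//.
have h : `|sin (c / 2)| ^+ 2 <= `|c / 2| ^+ 2.
  by rewrite ler_sqr ?nnegrE//; exact: sin_le_abs.
rewrite (real_normK (num_real (c / 2))) expr_div_n in h.
by nra.
Qed.

(** The remainder factors as e^{ia} ((cos b - 1) + i (sin b - b)). Only its quadratic order matters,
    so the constant is crude. *)
Lemma cexpi_taylor (a b : R) :
  normc (cexpi (a + b) - cexpi a - ('i * b%:C) * cexpi a : R[i]) <= 2 * b ^+ 2.
Proof.
have -> : cexpi (a + b) - cexpi a - ('i * b%:C) * cexpi a =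
  cexpi a * ((cos b - 1) +i* (sin b - b)) :> R[i].
  rewrite cexpiD; apply/eqP; rewrite eq_complex /cexpi /=.
  apply/andP; split; apply/eqP; ring.
rewrite normcM normc_cexpi mul1r (le_trans (normc_le_abs _))//=.
by rewrite mulr_natl mulr2n lerD// ?cosB1_le ?sinB_le.
Qed.

End Calculus.

(** * Schwartz functions and their Fourier transforms *)

Section Schwartz.
Context (R : realType).
Implicit Types (phi psi chi : R * R -> R[i]) (x xi : R * R) (j : bool).

(** A coinduction principle which replaces Leibniz formulas for iterated derivatives: closure of a
    class under one partial derivative propagates along the word of directions, so each use only has
    to name a suitable class. *)
Lemma schwartz_coind (C : (R * R -> R[i]) -> Prop) :
  (forall psi, C psi -> forall x, cdiff psi x) ->
  (forall psi, C psi -> forall a b, exists M, forall x,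
     `|x.1| ^+ a * `|x.2| ^+ b * normc (psi x) <= M) ->
  (forall psi j, C psi -> C (partial j psi)) ->
  forall psi, C psi -> schwartz psi.
Proof.
move=> Cd Cb Cp psi Cpsi.
have Cw w : C (partials w psi) by elim: w => // j w ih; exact: Cp.
split; first by move=> w x; exact: Cd.
by move=> [[a b] w]; have [M hM] := Cb _ (Cw w) a b; exists M.
Qed.

Lemma schwartz_cdiff phi x : schwartz phi -> cdiff phi x.
Proof. by move=> [h _]; exact: (h [::] x). Qed.

Lemma schwartz_bound phi a b : schwartz phi -> exists M, forall x,
  `|x.1| ^+ a * `|x.2| ^+ b * normc (phi x) <= M.
Proof. by move=> [_ /(_ ((a, b), [::]))] []M; exists M. Qed.

Lemma schwartz_partial phi j : schwartz phi -> schwartz (partial j phi).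
Proof.
have E w : partials w (partial j phi) = partials (rcons w j) phi.
  by rewrite /partials foldr_rcons.
move=> [h1 h2]; split; first by move=> w x; rewrite E; exact: h1.
move=> [[a b] w]; have [M hM] := h2 ((a, b), rcons w j); exists M => x.
by rewrite /weighted_partial /= E; exact: hM.
Qed.

Lemma partialDE j phi psi : (forall x, cdiff phi x) -> (forall x, cdiff psi x) ->
  partial j (fun x => phi x + psi x) = (fun x => partial j phi x + partial j psi x).
Proof. by move=> dphi dpsi; apply/funext => x; rewrite partialD. Qed.

Lemma partialZE j c phi : (forall x, cdiff phi x) ->
  partial j (fun x => c * phi x) = (fun x => c * partial j phi x).
Proof. by move=> dphi; apply/funext => x; rewrite partialZ. Qed.

Lemma schwartzD phi psi : schwartz phi -> schwartz psi ->
  schwartz (fun x => phi x + psi x).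
Proof.
move=> sphi spsi; apply: (@schwartz_coind (fun chi => exists phi psi,
  [/\ schwartz phi, schwartz psi & chi = fun x => phi x + psi x])); last by exists phi, psi.
- move=> _ [u [v [su sv ->]]] x.
  by apply: cdiffD; exact: schwartz_cdiff.
- move=> _ [u [v [su sv ->]]] a b.
  have [M hM] := schwartz_bound a b su; have [N hN] := schwartz_bound a b sv.
  exists (M + N) => x; rewrite (le_trans _ (lerD (hM x) (hN x)))//.
  by rewrite -mulrDr ler_wpM2l ?normcD// mulr_ge0// exprn_ge0.
- move=> _ j [u [v [su sv ->]]]; exists (partial j u), (partial j v).
  by split; [exact: schwartz_partial|exact: schwartz_partial|
    rewrite partialDE// => x; exact: schwartz_cdiff].
Qed.

Lemma schwartzZ c phi : schwartz phi -> schwartz (fun x => c * phi x).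
Proof.
move=> sphi; apply: (@schwartz_coind (fun chi => exists2 phi,
  schwartz phi & chi = fun x => c * phi x)); last by exists phi.
- move=> _ [u su ->] x.
  by apply: cdiffZ; exact: schwartz_cdiff.
- move=> _ [u su ->] a b.
  have [M hM] := schwartz_bound a b su.
  exists (normc c * M) => x; rewrite normcM mulrCA.
  by rewrite ler_wpM2l ?normc_ge0.
- move=> _ j [u su ->]; exists (partial j u); first exact: schwartz_partial.
  by rewrite partialZE// => x; exact: schwartz_cdiff.
Qed.

Lemma schwartz_coordM k phi : schwartz phi ->
  schwartz (fun x => (coord2 k x)%:C * phi x).
Proof.
(* The functions x_k phi alone do not form a stable class, as differentiation in the direction k
   also produces phi; hence the additional summand psi. *)
move=> sphi; apply: (@schwartz_coind (fun chi => exists phi psi,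
  [/\ schwartz phi, schwartz psi & chi = fun x => (coord2 k x)%:C * phi x + psi x])).
- move=> _ [u [v [su sv ->]]] x.
  apply: cdiffD; last exact: schwartz_cdiff.
  by apply: cdiffM; [exact: cdiff_coord|exact: schwartz_cdiff].
- move=> _ [u [v [su sv ->]]] a b.
  have [N hN] := schwartz_bound a b sv.
  have [M hM] : exists M, forall x,
      `|x.1| ^+ a * `|x.2| ^+ b * (`|coord2 k x| * normc (u x)) <= M.
    case: (k).
      have [M hM] := schwartz_bound a b.+1 su.
      by exists M => x; rewrite /coord2 (le_trans _ (hM x))// exprSr !mulrA.
    have [M hM] := schwartz_bound a.+1 b su.
    exists M => x; rewrite /coord2 (le_trans _ (hM x))// exprS.
    by rewrite le_eqVlt; apply/orP; left; apply/eqP; ring.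
  exists (M + N) => x; rewrite (le_trans _ (lerD (hM x) (hN x)))//.
  rewrite -mulrDr; apply: ler_wpM2l; first by rewrite mulr_ge0// exprn_ge0.
  by rewrite (le_trans (normcD _ _))// normcM normc_real.
- move=> _ j [u [v [su sv ->]]].
  exists (partial j u), (fun x => ((j == k)%:R)%:C * u x + partial j v x).
  split; first exact: schwartz_partial.
    by apply: schwartzD; [exact: schwartzZ|exact: schwartz_partial].
  apply/funext => x; rewrite partialD.
  + rewrite partialM ?partial_coord; [ring|exact: cdiff_coord|exact: schwartz_cdiff].
  + by apply: cdiffM; [exact: cdiff_coord|exact: schwartz_cdiff].
  + exact: schwartz_cdiff.
exists phi, (fun x => 0 * phi x); split => //; first exact: schwartzZ.
by apply/funext => x; rewrite mul0r addr0.
Qed.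

Lemma cdiff_measurable phi : (forall x, cdiff phi x) -> cmeas phi.
Proof.
move=> dphi; split; apply: continuous_measurable2 => x;
  by apply: differentiable_continuous; case: (dphi x).
Qed.

Lemma schwartz_meas phi : schwartz phi -> cmeas phi.
Proof. by move=> sphi; apply: cdiff_measurable => x; exact: schwartz_cdiff. Qed.

(** Expanding (1 + x1^2)(1 + x2^2) leaves four weighted bounds, those with exponents 0 or 2 in each
    variable. *)
Lemma schwartz_decay phi : schwartz phi ->
  exists2 M, 0 <= M & forall x, normc (phi x) <= M * wgt x.
Proof.
move=> sphi.
have [M0 h0] := schwartz_bound 0 0 sphi; have [M1 h1] := schwartz_bound 2 0 sphi.
have [M2 h2] := schwartz_bound 0 2 sphi; have [M3 h3] := schwartz_bound 2 2 sphi.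
have key x : (1 + x.1 ^+ 2) * (1 + x.2 ^+ 2) * normc (phi x) <= M0 + M1 + M2 + M3.
  have := lerD (lerD (lerD (h0 x) (h1 x)) (h2 x)) (h3 x).
  rewrite !expr0 !mul1r !mulr1 !real_normK ?num_real//; apply: le_trans.
  by rewrite le_eqVlt; apply/orP; left; apply/eqP; ring.
exists (M0 + M1 + M2 + M3).
  by apply: le_trans (key 0); rewrite mulr_ge0 ?normc_ge0// mulr_ge0// addr_ge0// sqr_ge0.
move=> x; have p1 : 0 < 1 + x.1 ^+ 2 by rewrite ltr_pwDl// sqr_ge0.
have p2 : 0 < 1 + x.2 ^+ 2 by rewrite ltr_pwDl// sqr_ge0.
rewrite wgtE -invfM ler_pdivlMr ?mulr_gt0//.
by rewrite mulrC; exact: key.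
Qed.

Lemma cintegrable_wgt (f : R * R -> R[i]) (c : R) : cmeas f ->
  (forall x, normc (f x) <= c * wgt x) -> cintegrable lebR2 setT f.
Proof.
move=> mf fc; apply: (@cintegrable_le _ _ R lebR2 f (fun x => c * wgt x)) => //.
  by have mw := @measurable_wgt R; mfun.
have c0 : 0 <= c.
  have : 0 <= c * wgt (0 : R * R) by rewrite (le_trans _ (fc 0))// normc_ge0.
  by rewrite pmulr_lge0// wgt_gt0.
under eq_integral do rewrite EFinM.
rewrite ge0_integralZl_EFin ?int_wgt//.
- by rewrite -EFinM ltry.
- by move=> x _; rewrite lee_fin wgt_ge0.
- by apply: mf_EFin; exact: measurable_wgt.
Qed.

Lemma cabs_wgt (f : R * R -> R[i]) (c : R) : cmeas f ->
  (forall x, normc (f x) <= c * wgt x) -> (cabs lebR2 f <= (c * pi ^+ 2)%:E)%E.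
Proof.
move=> mf fc.
have c0 : 0 <= c.
  have : 0 <= c * wgt (0 : R * R) by rewrite (le_trans _ (fc 0))// normc_ge0.
  by rewrite pmulr_lge0// wgt_gt0.
rewrite EFinM -int_wgt -ge0_integralZl_EFin//.
- apply: le_int.
  + by move=> x; rewrite lee_fin normc_ge0.
  + exact: cmeas_enormc.
  + by have mw := @measurable_wgt R; mfun.
  + by move=> x; rewrite -EFinM lee_fin.
- by move=> x _; rewrite lee_fin wgt_ge0.
- by apply: mf_EFin; exact: measurable_wgt.
Qed.

Lemma normc_cint_wgt (f : R * R -> R[i]) (c : R) : cmeas f ->
  (forall x, normc (f x) <= c * wgt x) -> normc (cint lebR2 f) <= c * pi ^+ 2.
Proof.
move=> mf fc; rewrite -lee_fin; apply: le_trans (cabs_wgt mf fc).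
exact: normc_cint.
Qed.

Lemma schwartz_int phi : schwartz phi -> cintegrable lebR2 setT phi.
Proof.
move=> sphi; have [M _ hM] := schwartz_decay sphi.
by apply: (@cintegrable_wgt _ M) => //; exact: schwartz_meas.
Qed.

(** The factor (|x1| + |x2|)^2 is the one produced by the quadratic remainder of the phase when a
    Fourier integral is differentiated. *)
Lemma schwartz_decay2 phi : schwartz phi -> exists2 M, 0 <= M &
  forall x, (`|x.1| + `|x.2|) ^+ 2 * normc (phi x) <= M * wgt x.
Proof.
move=> sphi.
have [M1 p1 h1] := schwartz_decay (schwartz_coordM false (schwartz_coordM false sphi)).
have [M2 p2 h2] := schwartz_decay (schwartz_coordM true (schwartz_coordM true sphi)).
exists ((M1 + M2) *+ 2); first by rewrite mulrn_wge0// addr_ge0.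
move=> x; have := h1 x; have := h2 x; rewrite !normcM !normc_real /coord2.
rewrite !mulrA -!expr2 => k2 k1.
have n0 := normc_ge0 (phi x); have w0 := wgt_ge0 x.
have s0 : (`|x.1| + `|x.2|) ^+ 2 <= (`|x.1| ^+ 2 + `|x.2| ^+ 2) *+ 2.
  by rewrite -subr_ge0 (_ : _ - _ = (`|x.1| - `|x.2|) ^+ 2) ?sqr_ge0//; ring.
rewrite (le_trans (ler_wpM2r n0 s0))//.
by rewrite mulrnAl mulrDl [in leRHS]mulrnAl [in leRHS]mulrDl lerMn2r lerD// orbT.
Qed.

(** The sign e = -1 gives [fourier] and e = 1 gives [inv_fourier] up to (2 pi)^-2, so that each
    property is proved once for both. *)
Definition FT (e : R) phi x : R[i] :=
  cint lebR2 (fun xi => cexpi (e * dotp x xi) * phi xi).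

Lemma FT_meas (e : R) phi x : cmeas phi ->
  cmeas (fun xi => cexpi (e * dotp x xi) * phi xi).
Proof. by move=> mphi; mfun. Qed.

Lemma FT_bound (e : R) phi : schwartz phi -> exists M, forall x, normc (FT e phi x) <= M.
Proof.
move=> sphi; have [M p hM] := schwartz_decay sphi.
exists (M * pi ^+ 2) => x; apply: normc_cint_wgt => [|xi].
  by apply: FT_meas; exact: schwartz_meas.
by rewrite normcM normc_cexpi mul1r.
Qed.

Lemma FT_int (e : R) phi x : schwartz phi ->
  cintegrable lebR2 setT (fun xi => cexpi (e * dotp x xi) * phi xi).
Proof.
move=> sphi; have [M p hM] := schwartz_decay sphi.
apply: (@cintegrable_wgt _ M) => [|xi].
  by apply: FT_meas; exact: schwartz_meas.
by rewrite normcM normc_cexpi mul1r.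
Qed.

Lemma FTZ e c phi x : schwartz phi -> FT e (fun xi => c * phi xi) x = c * FT e phi x.
Proof.
move=> sphi; rewrite /FT -cintZ; last exact: FT_int.
by apply: eq_cint => xi; rewrite mulrCA.
Qed.

(** Differentiation under the integral sign: the first-order remainder D of the phase is at most 2
    (e h.xi)^2 pointwise, and the decay of phi makes this integrable, with a bound quadratic in
    h. *)
Lemma FT_diff (e : R) phi x : schwartz phi -> cdiff (FT e phi) x /\
  forall j, partial j (FT e phi) x =
    FT e (fun xi => ('i * e%:C) * ((coord2 j xi)%:C * phi xi)) x.
Proof.
move=> sphi; have [M p hM] := schwartz_decay2 sphi.
apply: (@cdiff_quad _ _ _ _ (2 * e ^+ 2 * M * pi ^+ 2)) => h.
pose D (xi : R * R) : R[i] := cexpi (e * dotp (h + x) xi) - cexpi (e * dotp x xi)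
  - ('i * (e * dotp h xi)%:C) * cexpi (e * dotp x xi).
have sc j : schwartz (fun xi => ('i * e%:C) * ((coord2 j xi)%:C * phi xi)).
  by apply: schwartzZ; exact: schwartz_coordM.
have -> : FT e phi (h + x) - FT e phi x -
    (h.1%:C * FT e (fun xi => ('i * e%:C) * ((coord2 false xi)%:C * phi xi)) x +
     h.2%:C * FT e (fun xi => ('i * e%:C) * ((coord2 true xi)%:C * phi xi)) x) =
    cint lebR2 (fun xi => D xi * phi xi).
  rewrite /FT -!cintZ; [|exact: FT_int..].
  rewrite -cintD; [|apply: cintegrableZ; exact: FT_int..].
  rewrite -cintB; [|exact: FT_int..].
  rewrite -cintB; last 2 first.
  - by apply: cintegrableB; exact: FT_int.
  - by apply: cintegrableD; apply: cintegrableZ; exact: FT_int.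
  apply: eq_cint => xi; rewrite /D /coord2 /dotp /=.
  rewrite !(rmorphM, rmorphD) /=; ring.
have mphi := schwartz_meas sphi.
rewrite [leRHS](_ : _ = 2 * e ^+ 2 * M * `|h| ^+ 2 * pi ^+ 2); last by ring.
apply: normc_cint_wgt => [|xi]; first by rewrite /D; mfun.
have hD : normc (D xi) <= 2 * (e * dotp h xi) ^+ 2.
  rewrite /D (_ : e * dotp (h + x) xi = e * dotp x xi + e * dotp h xi).
    exact: cexpi_taylor.
  by rewrite /dotp /=; ring.
have hd : (dotp h xi) ^+ 2 <= `|h| ^+ 2 * (`|xi.1| + `|xi.2|) ^+ 2.
  rewrite -exprMn -[leLHS]real_normK ?num_real// ler_sqr ?nnegrE ?mulr_ge0 ?addr_ge0//.
  rewrite /dotp mulrDr (le_trans (ler_normD _ _))// !normrM lerD// ler_wpM2r//.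
    exact: norm1_le.
  exact: norm2_le.
rewrite normcM (le_trans (ler_wpM2r (normc_ge0 _) hD))//.
rewrite [leLHS](_ : _ = 2 * e ^+ 2 * (dotp h xi ^+ 2 * normc (phi xi))); last by ring.
rewrite [leRHS](_ : _ = 2 * e ^+ 2 * (`|h| ^+ 2 * (M * wgt xi))); last by ring.
apply: ler_wpM2l; first by rewrite mulr_ge0// sqr_ge0.
rewrite (le_trans (ler_wpM2r (normc_ge0 _) hd))// -mulrA.
by apply: ler_wpM2l; [exact: sqr_ge0|exact: hM].
Qed.

(** Convergence in R[i] is expressed throughout by a modulus tending to 0; identities between
    integrals are then proved by computing the limit of one sequence in two ways. *)
Lemma normc_lim_unique (A : nat -> R[i]) (l1 l2 : R[i]) :
  (fun n => normc (A n - l1)) @ \oo --> (0 : R) ->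
  (fun n => normc (A n - l2)) @ \oo --> (0 : R) -> l1 = l2.
Proof.
move=> h1 h2; apply/eqP; rewrite -subr_eq0; apply/eqP/normc_eq0.
have h : (fun n => normc (A n - l1) + normc (A n - l2)) @ \oo --> (0 : R).
  by rewrite -[0]addr0; exact: cvgD.
have : (fun=> normc (l1 - l2)) @ \oo --> (0 : R).
  apply: squeeze0 h => n; rewrite normc_ge0 /= (normc_distC (A n) l1).
  by rewrite (le_trans _ (normcD _ _))// addrA subrK.
by move/(cvg_unique (@Rhausdorff R) (cvg_cst _)).
Qed.

Lemma dotp_shift x xi j (h : R) :
  dotp x (xi + h *: basis_vec j) = dotp x xi + h * coord2 j x.
Proof.
by rewrite /dotp /basis_vec /coord2; case: j; rewrite /= /GRing.scale /=; ring.
Qed.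

Lemma cintegrable_shift (f : R * R -> R[i]) (b : R * R) :
  cintegrable lebR2 setT f -> cintegrable lebR2 setT (fun x => f (x + b)).
Proof.
move=> /cintegrableP[mf fi].
have mf' : cmeas (fun x : R * R => f (x.1 + b.1, x.2 + b.2)) by mfun.
apply/cintegrableP; split; first exact: mf'.
apply: le_lt_trans fi; rewrite le_eqVlt; apply/orP; left; apply/eqP.
apply: (ge0_int2_shift (f := fun x => (normc (f x))%:E)).
  exact: cmeas_enormc.
by move=> x; rewrite lee_fin normc_ge0.
Qed.

(** Instead of an integration by parts: the transform A of the difference quotient with step h tends
    to the left-hand side by dominated convergence, while a translation of the variable rewrites it
    as (e^{-i e h x_j} - 1) / h times the transform of phi, which tends to the right-hand side. *)
Lemma FT_partial (e : R) phi j x : schwartz phi ->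
  FT e (partial j phi) x = - ('i * (e * coord2 j x)%:C) * FT e phi x.
Proof.
move=> sphi; have spart := schwartz_partial j sphi.
have mphi := schwartz_meas sphi; have mpart := schwartz_meas spart.
pose A (n : nat) : R[i] := cint lebR2 (fun xi => cexpi (e * dotp x xi) *
  ((n.+1%:R)%:C * (phi (xi + n.+1%:R^-1 *: basis_vec j) - phi xi))).
have mshift b : cmeas (fun xi => phi (xi + b)).
  by apply: (cintegrable_meas (mu := lebR2)); apply: cintegrable_shift; exact: schwartz_int.
have [M M0 hM] := schwartz_decay spart.
have hn (n : nat) : 0 < (n.+1%:R^-1 : R) <= 1.
  by rewrite invr_gt0 ltr0n /= invf_le1// ler1n.
(* The 2 comes from [cMVT] and the 3 from [wgt_shift], which moves the weight back from an
   intermediate point to xi. *)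
have Ab n xi : normc (cexpi (e * dotp x xi) *
    ((n.+1%:R)%:C * (phi (xi + n.+1%:R^-1 *: basis_vec j) - phi xi))) <=
    (2 * (M * 3)) * wgt xi.
  rewrite normcM normc_cexpi mul1r normcM normc_real ger0_norm//.
  have /andP[n0 n1] := hn n.
  rewrite mulrC -ler_pdivlMr ?ltr0n// -[leRHS]mulrA.
  rewrite [leRHS](_ : _ = 2 * (M * 3 * wgt xi) * n.+1%:R^-1); last by rewrite !mulrA.
  apply: cMVT; [by move=> y; exact: schwartz_cdiff|exact: ltW|].
  move=> s /andP[s0 sn]; rewrite (le_trans (hM _))// -mulrA ler_wpM2l//.
  by apply: wgt_shift; rewrite s0 (le_trans sn).
have Am n : cmeas (fun xi => cexpi (e * dotp x xi) *
    ((n.+1%:R)%:C * (phi (xi + n.+1%:R^-1 *: basis_vec j) - phi xi))).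
  have ms := mshift (n.+1%:R^-1 *: basis_vec j).
  apply: cmeasM; first by mfun.
  by apply: cmeasM; [exact: cmeas_cst|exact: cmeasB].
apply: (@normc_lim_unique A).
  have [] := @cint_dct _ _ R lebR2 (fun n xi => cexpi (e * dotp x xi) *
    ((n.+1%:R)%:C * (phi (xi + n.+1%:R^-1 *: basis_vec j) - phi xi)))
    (fun xi => cexpi (e * dotp x xi) * partial j phi xi)
    (fun xi => (2 * (M * 3) * wgt xi)%:E).
  - exact: Am.
  - exact: FT_meas.
  - by have mw := @measurable_wgt R; mfun.
  - apply: aeW => xi; have := cdiff_quotient j (schwartz_cdiff xi sphi).
    apply: squeeze0 => n; rewrite normc_ge0 /=.
    by rewrite -mulrBr normcM normc_cexpi mul1r.
  - by apply: aeW => xi n; rewrite lee_fin; exact: Ab.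
  - under eq_integral do rewrite EFinM.
    rewrite ge0_integralZl_EFin ?int_wgt ?mulr_ge0//.
    + by rewrite -EFinM ltry.
    + by move=> xi _; rewrite lee_fin wgt_ge0.
    + by apply: mf_EFin; exact: measurable_wgt.
  - by move=> xi; rewrite lee_fin !mulr_ge0// wgt_ge0.
  move=> fi cv; apply: (cvg_cint _ fi cv) => n.
  by apply: (cintegrable_wgt (Am n)) => xi; exact: Ab.
have AE n : A n = (n.+1%:R)%:C * (cexpi (- (e * (n.+1%:R^-1 * coord2 j x))) - 1) * FT e phi x.
  rewrite /A -mulrA mulrBl mul1r /FT.
  have i1 := FT_int e x sphi.
  have e1 : cint lebR2 (fun xi => cexpi (e * dotp x xi) *
      phi (xi + n.+1%:R^-1 *: basis_vec j)) =
     cexpi (- (e * (n.+1%:R^-1 * coord2 j x))) *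
     cint lebR2 (fun xi => cexpi (e * dotp x xi) * phi xi).
    rewrite -cintZ//.
    transitivity (cint lebR2 (fun xi => cexpi (- (e * (n.+1%:R^-1 * coord2 j x))) *
      (cexpi (e * dotp x (xi + n.+1%:R^-1 *: basis_vec j)) *
       phi (xi + n.+1%:R^-1 *: basis_vec j)))).
      apply: eq_cint => xi; rewrite mulrA -cexpiD dotp_shift; congr (cexpi _ * _); ring.
    apply: (cint2_shift (f := fun xi => cexpi (- (e * (n.+1%:R^-1 * coord2 j x))) *
      (cexpi (e * dotp x xi) * phi xi)) (n.+1%:R^-1 *: basis_vec j)).
    mfun.
  have i2 : cintegrable lebR2 setT (fun xi => cexpi (e * dotp x xi) *
      phi (xi + n.+1%:R^-1 *: basis_vec j)).
    have [N N0 hN] := schwartz_decay sphi.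
    have ms := mshift (n.+1%:R^-1 *: basis_vec j).
    apply: (@cintegrable_wgt _ (N * 3)) => [|xi].
      by apply: cmeasM => //; mfun.
    have /andP[n0 n1] := hn n.
    rewrite normcM normc_cexpi mul1r (le_trans (hN _))// -mulrA ler_wpM2l//.
    by apply: wgt_shift; rewrite (ltW n0).
  rewrite -e1 -cintB// -cintZ; last exact: cintegrableB.
  by apply: eq_cint => xi; rewrite mulrBr mulrBr mulrCA (mulrCA (cexpi _)) -mulrBr.
have hz : (fun n : nat => 2 * (e * coord2 j x) ^+ 2 * normc (FT e phi x) * n.+1%:R^-1)
   @ \oo --> (0 : R).
  rewrite -[0](mulr0 (2 * (e * coord2 j x) ^+ 2 * normc (FT e phi x))).
  by apply: cvgM; [exact: cvg_cst|exact: cvg_harmonic].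
apply: squeeze0 hz => n; rewrite normc_ge0 /= AE -mulrBl normcM.
rewrite mulrAC ler_wpM2r ?normc_ge0//.
have := @cexpi_taylor R 0 (- (e * (n.+1%:R^-1 * coord2 j x))).
rewrite add0r cexpi0 mulr1 => h.
have nn0 : (n.+1%:R : R) != 0 by rewrite pnatr_eq0.
rewrite (_ : _ - _ = (n.+1%:R)%:C *
  (cexpi (- (e * (n.+1%:R^-1 * coord2 j x))) - 1 -
   'i * (- (e * (n.+1%:R^-1 * coord2 j x)))%:C)); last first.
  rewrite [RHS]mulrBr; congr (_ - _); rewrite mulrCA -rmorphM /=.
  by rewrite -mulrN -rmorphN; congr (_ * _%:C); rewrite mulrN; field.
rewrite normcM normc_real ger0_norm// (le_trans (ler_wpM2l _ h))//.
rewrite sqrrN !exprMn exprVn expr2.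
rewrite le_eqVlt; apply/orP; left; apply/eqP; by field.
Qed.

(** Each power of a coordinate is traded for a derivative of phi, without loss in the modulus
    because |e| = 1. *)
Lemma FT_poly_bound (e : R) phi a b : e ^+ 2 = 1 -> schwartz phi -> exists M, forall x,
  `|x.1| ^+ a * `|x.2| ^+ b * normc (FT e phi x) <= M.
Proof.
move=> e1; have ne : `|e| = 1.
  by apply/eqP; rewrite -(eqrXn2 (n:=2))// expr1n real_normK ?num_real// e1.
have step phi' j x : schwartz phi' ->
    normc (FT e (partial j phi') x) = `|coord2 j x| * normc (FT e phi' x).
  move=> s; rewrite FT_partial// normcM normcNE normcM normc_real normrM ne mul1r.
  by rewrite /normc /= expr0n expr1n /= add0r sqrtr1 mul1r.
elim: a phi => [|a ih] phi sphi.
  elim: b phi sphi => [|b ih] phi sphi.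
    by have [M hM] := FT_bound e sphi; exists M => x; rewrite !expr0 !mul1r.
  have [M hM] := ih _ (schwartz_partial true sphi); exists M => x.
  rewrite (le_trans _ (hM x))// step// /coord2 exprSr.
  by rewrite le_eqVlt; apply/orP; left; apply/eqP; ring.
have [M hM] := ih _ (schwartz_partial false sphi); exists M => x.
rewrite (le_trans _ (hM x))// step// /coord2 exprSr.
by rewrite le_eqVlt; apply/orP; left; apply/eqP; ring.
Qed.

Lemma FT_schwartz (e : R) phi : e ^+ 2 = 1 -> schwartz phi -> schwartz (FT e phi).
Proof.
move=> e1 sphi; apply: (@schwartz_coind (fun chi => exists2 phi,
  schwartz phi & chi = FT e phi)); last by exists phi.
- by move=> _ [u su ->] x; have [] := FT_diff e x su.
- by move=> _ [u su ->] a b; exact: FT_poly_bound.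
- move=> _ j [u su ->].
  exists (fun xi => ('i * e%:C) * ((coord2 j xi)%:C * u xi)).
    by apply: schwartzZ; exact: schwartz_coordM.
  by apply/funext => x; have [_ ->] := FT_diff e x su.
Qed.

Lemma dotpC x xi : dotp x xi = dotp xi x :> R.
Proof. by rewrite /dotp; ring. Qed.

Lemma fourierE phi : fourier phi = FT (-1) phi.
Proof.
apply/funext => x; apply: eq_cint => xi.
by rewrite mulN1r dotpC.
Qed.

Lemma inv_fourierE phi : inv_fourier phi = fun x => ((2 * pi) ^- 2)%:C * FT 1 phi x.
Proof.
apply/funext => x; congr (_ * _); apply: eq_cint => xi.
by rewrite mul1r.
Qed.

End Schwartz.

(** * Polynomials times decaying exponentials; the Gaussian and its transform *)

Section PolyExp.
Context (R : realType).
Implicit Types (p q : R * R -> R) (x xi : R * R) (j : bool).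

(** Polynomial functions given by their closure properties: stability under derivatives and
    polynomial growth follow by structural induction, without coefficients. *)
Inductive polyf : (R * R -> R) -> Prop :=
| polyf_cst c : polyf (fun=> c)
| polyf_coord k : polyf (fun x => coord2 k x)
| polyfD p q : polyf p -> polyf q -> polyf (fun x => p x + q x)
| polyfM p q : polyf p -> polyf q -> polyf (fun x => p x * q x).

Lemma polyfX p n : polyf p -> polyf (fun x => p x ^+ n).
Proof.
move=> pp; elim: n => [|n ih]; first exact: polyf_cst.
by under eq_fun do rewrite exprS; exact: polyfM.
Qed.

Lemma polyf_diff p x : polyf p -> differentiable p x.
Proof.
elim=> {p}[c|k|p q _ dp _ dq|p q _ dp _ dq].
- exact: differentiable_cst.
- exact: differentiable_coord2.
- exact: differentiableD.
- exact: differentiableM.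
Qed.

Lemma polyf_derive p j : polyf p ->
  exists2 q, polyf q & forall x, 'D_(basis_vec j) p x = q x.
Proof.
elim=> {p}[c|k|p q pp [p' pp' hp] pq [q' pq' hq]|p q pp [p' pp' hp] pq [q' pq' hq]].
- exists (fun=> 0); first exact: polyf_cst.
  by move=> x; rewrite derive_cst.
- exists (fun=> (j == k)%:R); first exact: polyf_cst.
  by move=> x; exact: derive_coord2.
- exists (fun x => p' x + q' x); first exact: polyfD.
  move=> x; rewrite (@derD _ p q) ?hp ?hq//; apply: diff_derivable; exact: polyf_diff.
- exists (fun x => p x * q' x + q x * p' x).
    by apply: polyfD; exact: polyfM.
  move=> x; rewrite (@derM _ p q) ?hp ?hq//; apply: diff_derivable; exact: polyf_diff.
Qed.

Lemma polyf_bound p : polyf p -> exists m, exists2 K, 0 <= K &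
  forall x, `|p x| <= K * (1 + (x.1 ^+ 2 + x.2 ^+ 2)) ^+ m.
Proof.
have u1 x : 1 <= 1 + (x.1 ^+ 2 + x.2 ^+ 2).
  by rewrite lerDl addr_ge0// sqr_ge0.
elim=> {p}[c|k|p q _ [m [K K0 hK]] _ [n [L L0 hL]]|p q _ [m [K K0 hK]] _ [n [L L0 hL]]].
- by exists 0%N, `|c| => // x; rewrite expr0 mulr1.
- exists 1%N, 1 => // x; rewrite expr1 mul1r.
  have h (t : R) : `|t| <= 1 + t ^+ 2.
    by rewrite -(real_normK (num_real t)); have := sqr_ge0 (`|t| - 1); nra.
  rewrite /coord2; case: k; rewrite (le_trans (h _))// lerD2l ?lerDl ?lerDr sqr_ge0//.
- exists (m + n)%N, (K + L); first exact: addr_ge0.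
  move=> x; rewrite (le_trans (ler_normD _ _))// mulrDl lerD//.
    by rewrite (le_trans (hK x))// ler_wpM2l// ler_weXn2l// leq_addr.
  by rewrite (le_trans (hL x))// ler_wpM2l// ler_weXn2l// leq_addl.
- exists (m + n)%N, (K * L); first exact: mulr_ge0.
  move=> x; rewrite normrM exprD mulrACA ler_pM//.
Qed.

(** One has 1 + u <= A e^{c u / N} with N = m + 1; the m-th power of this is at most A^m e^{c u}
    because m <= N. Taking m + 1 rather than m avoids a division by 0. *)
Lemma expr_expR_bound (c : R) m : 0 < c ->
  exists2 M, 0 <= M & forall u, 0 <= u -> (1 + u) ^+ m * expR (- (c * u)) <= M.
Proof.
move=> c0; pose N : R := m.+1%:R; pose A := 1 + N / c.
have N0 : 0 < N by rewrite ltr0n.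
have A0 : 0 <= A by rewrite addr_ge0// divr_ge0// ltW.
exists (A ^+ m) => [|u u0]; first exact: exprn_ge0.
have v0 : 0 <= c * u / N by rewrite divr_ge0 ?mulr_ge0 ?(ltW c0) ?(ltW N0).
have h : 1 + u <= A * expR (c * u / N).
  rewrite /A mulrDl mul1r lerD//; first by rewrite -expR0 ler_expR.
  rewrite (@le_trans _ _ (N / c * (c * u / N)))//.
    by rewrite le_eqVlt; apply/orP; left; apply/eqP; field; rewrite !gt_eqF.
  rewrite ler_wpM2l ?divr_ge0 ?ltW// (lt_le_trans _ (expR_ge1Dx _))//.
  by rewrite ltrDr.
rewrite expRN ler_pdivrMr ?expR_gt0//.
rewrite (le_trans (lerXn2r m _ _ h)) ?nnegrE ?addr_ge0 ?mulr_ge0 ?expR_ge0//.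
rewrite exprMn ler_wpM2l ?exprn_ge0// -expRM_natl ler_expR.
rewrite mulrA ler_pdivrMr//.
rewrite (mulrC _ N) ler_wpM2r ?mulr_ge0 ?(ltW c0)//.
by rewrite ler_nat.
Qed.

(** For fixed q, the functions p e^{-q} form a class stable under derivatives, p becoming p' - p q';
    the quadratic lower bound on q makes the exponential beat every power. *)
Lemma schwartz_polyexp q (c b : R) : polyf q -> 0 < c ->
  (forall x, c * (x.1 ^+ 2 + x.2 ^+ 2) - b <= q x) ->
  forall p, polyf p -> schwartz (fun x => (p x * expR (- q x))%:C).
Proof.
move=> pq c0 qc p pp.
have dq x : differentiable (fun x => expR (- q x)) x.
  by apply: differentiable_expR; apply: differentiableN; exact: polyf_diff.
apply: (@schwartz_coind _ (fun psi => exists2 p, polyf p &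
   psi = fun x => (p x * expR (- q x))%:C)); last by exists p.
- move=> _ [r pr ->] x; apply: cdiff_real; apply: differentiableM => //.
  exact: polyf_diff.
- move=> _ [r pr ->] a n.
  have [m [K K0 hK]] := polyf_bound pr.
  have [M M0 hM] := expr_expR_bound (a + n + m) c0.
  exists (K * M * expR b) => x; set u := x.1 ^+ 2 + x.2 ^+ 2.
  have u0 : 0 <= u by rewrite addr_ge0// sqr_ge0.
  have h (t : R) : `|t| <= 1 + t ^+ 2.
    by rewrite -(real_normK (num_real t)); have := sqr_ge0 (`|t| - 1); nra.
  have h1 : `|x.1| <= 1 + u by rewrite (le_trans (h _))// lerD2l lerDl sqr_ge0.
  have h2 : `|x.2| <= 1 + u by rewrite (le_trans (h _))// lerD2l lerDr sqr_ge0.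
  have u10 : 0 <= 1 + u by rewrite addr_ge0.
  rewrite normc_real normrM (ger0_norm (expR_ge0 _)).
  have e1 : expR (- q x) <= expR b * expR (- (c * u)).
    rewrite -expRD ler_expR lerNl opprD opprK addrC; exact: qc.
  apply: (@le_trans _ _ ((1 + u) ^+ a * (1 + u) ^+ n *
      (K * (1 + u) ^+ m * (expR b * expR (- (c * u)))))).
    apply: ler_pM.
    + by rewrite mulr_ge0// exprn_ge0.
    + by rewrite mulr_ge0// expR_ge0.
    + by apply: ler_pM; rewrite ?exprn_ge0// lerXn2r// nnegrE.
    + by apply: ler_pM => //; rewrite expR_ge0.
  rewrite [leLHS](_ : _ = K * expR b * ((1 + u) ^+ (a + n + m) * expR (- (c * u)))).
    rewrite [leRHS](_ : _ = K * expR b * M); last by ring.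
    by apply: ler_wpM2l; [rewrite mulr_ge0// expR_ge0|exact: hM].
  rewrite !exprD; ring.
- move=> _ j [r pr ->].
  have [r' pr' hr] := polyf_derive j pr; have [q' pq' hq] := polyf_derive j pq.
  exists (fun x => r' x + (-1) * (r x * q' x)).
    by apply: polyfD => //; apply: polyfM; [exact: polyf_cst|exact: polyfM].
  apply/funext => x; rewrite partial_real; congr (_%:C).
  have dr : derivable r x (basis_vec j) by apply: diff_derivable; exact: polyf_diff.
  rewrite (@derM _ r (fun x => expR (- q x)))//; last exact: diff_derivable.
  rewrite hr (@derive_expR_comp _ (fun x => - q x)); last first.
    by apply: differentiableN; exact: polyf_diff.
  rewrite (_ : 'D_(basis_vec j) (fun x => - q x) x = - q' x); first by ring.
  by rewrite -hq -deriveN//; apply: diff_derivable; exact: polyf_diff.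
Qed.

Definition gauss2 x : R := expR (- ((x.1 ^+ 2 + x.2 ^+ 2) / 2)).

Lemma polyf_sqr : polyf (fun x => (x.1 ^+ 2 + x.2 ^+ 2) / 2).
Proof.
apply: polyfM; last exact: polyf_cst.
by apply: polyfD; apply: polyfX; [exact: (polyf_coord false)|exact: (polyf_coord true)].
Qed.

Lemma schwartz_gauss2 : schwartz (fun x => (gauss2 x)%:C).
Proof.
have := @schwartz_polyexp _ 2^-1 0 polyf_sqr; rewrite invr_gt0 ltr0n => /(_ isT) h.
rewrite (_ : (fun x => _) = (fun x => (1 * expR (- ((x.1 ^+ 2 + x.2 ^+ 2) / 2)))%:C)).
  by apply: h; [by move=> x; rewrite subr0 mulrC|exact: polyf_cst].
by apply/funext => x; rewrite mul1r.
Qed.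

Lemma gauss2_le1 x : gauss2 x <= 1.
Proof.
by rewrite -expR0 ler_expR oppr_le0 divr_ge0// addr_ge0// sqr_ge0.
Qed.

Lemma gauss2_ge0 x : 0 <= gauss2 x. Proof. exact: expR_ge0. Qed.

Lemma measurable_gauss2 : measurable_fun setT gauss2.
Proof. by rewrite /gauss2; mfun. Qed.

Lemma int_gauss2 : (\int[lebR2]_x (gauss2 (x : R * R))%:E = (2 * pi)%:E)%E.
Proof.
(* Dilation by a, with a^2 = 1/2, turns e^{-|x|^2}, whose integral is the square of the
   one-dimensional one, into the Gaussian with exponent |x|^2 / 2. *)
pose a : R := Num.sqrt 2^-1.
have a0 : 0 < a by rewrite sqrtr_gt0 invr_gt0.
have a2 : a ^+ 2 = 2^-1 by rewrite sqr_sqrtr// invr_ge0.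
pose g (x : R * R) : \bar R := (expR (- x.1 ^+ 2) * expR (- x.2 ^+ 2))%:E.
have mg : measurable_fun setT g by rewrite /g; mfun.
have g0 x : (0 <= g x)%E by rewrite lee_fin mulr_ge0// expR_ge0.
have := ge0_int2_scale a0 mg g0.
rewrite (_ : (\int[lebR2]_x g x = pi%:E)%E); last first.
  rewrite tonelli1//.
  transitivity (\int[lebR]_x ((Num.sqrt pi)%:E * (gauss_fun (x : R))%:E))%E.
    apply: eq_integral => x _; rewrite -integralT_gauss muleC -ge0_integralZl_EFin//.
    + by move=> y _; rewrite lee_fin expR_ge0.
    + by rewrite /gauss_fun; mfun.
    + exact: expR_ge0.
  rewrite ge0_integralZl_EFin ?sqrtr_ge0//.
  + by rewrite integralT_gauss -EFinM -expr2 sqr_sqrtr// pi_ge0.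
  + by move=> x _; rewrite lee_fin expR_ge0.
  + by rewrite /gauss_fun; mfun.
have -> : (\int[lebR2]_x g (a * x.1, a * x.2)%R = \int[lebR2]_x (gauss2 (x : R * R))%:E)%E.
  apply: eq_integral => x _; rewrite /g /gauss2 /= -expRD -opprD; congr (expR (- _))%:E.
  by rewrite !exprMn a2 -mulrDr mulrC.
have i0 : (0 <= \int[lebR2]_x (gauss2 (x : R * R))%:E)%E.
  by apply: integral_ge0 => x _; rewrite lee_fin gauss2_ge0.
have : (\int[lebR2]_x (gauss2 (x : R * R))%:E < +oo)%E.
  have /schwartz_int/cintegrableP[_] := schwartz_gauss2; rewrite /cabs.
  under eq_integral do rewrite normc_real (ger0_norm (gauss2_ge0 _)).
  by [].
rewrite a2; case: (\int[lebR2]_x _)%E i0 => // r _ _ /eqP.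
rewrite -EFinM eqe => /eqP <-; congr (_%:E).
by rewrite mulrA divff ?mul1r// pnatr_eq0.
Qed.

Lemma cint_gauss2 : cint lebR2 (fun x => (gauss2 x)%:C) = (2 * pi)%:C.
Proof.
rewrite /cint /cintegral /= /Rintegral int_gauss2 integral0_eq//.
Qed.

(** The transform F of the Gaussian solves the same system as the Gaussian, namely that the j-th
    derivative of F is - x_j F; here e^2 = 1 enters. Hence F e^{|x|^2 / 2} has zero gradient and
    equals its value at 0, which is the integral 2 pi. *)
Lemma FT_gauss2 (e : R) x : e ^+ 2 = 1 ->
  FT e (fun y => (gauss2 y)%:C) x = (2 * pi)%:C * (gauss2 x)%:C.
Proof.
move=> e1; set G := fun y => (gauss2 y)%:C.
have sG : schwartz G := schwartz_gauss2.
have cG y : cdiff G y by exact: schwartz_cdiff.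
pose E y : R := expR ((y.1 ^+ 2 + y.2 ^+ 2) / 2).
have dsq (y : R * R) : differentiable (fun y : R * R => (y.1 ^+ 2 + y.2 ^+ 2) / 2) y.
  exact: (polyf_diff _ polyf_sqr).
have dE y : differentiable E y by exact: differentiable_expR.
have Dsq j y : 'D_(basis_vec j) (fun y : R * R => (y.1 ^+ 2 + y.2 ^+ 2) / 2) y = coord2 j y.
  have dc k : derivable (coord2 k : R * R -> R) y (basis_vec j).
    by apply: diff_derivable; exact: differentiable_coord2.
  rewrite (_ : (fun _ => _) = fun y : R * R =>
    2^-1 * (coord2 false y * coord2 false y + coord2 true y * coord2 true y)); last first.
    by apply/funext => z; rewrite mulrC !expr2.
  rewrite (@derM _ (fun=> 2^-1) (fun y => coord2 false y * coord2 false y + coord2 true y * coord2 true y)); last 2 first.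
  - exact: derivable_cst.
  - by apply: derivableD; exact: derivM.
  rewrite derive_cst mulr0 addr0.
  rewrite (@derD _ (fun y => coord2 false y * coord2 false y) (fun y => coord2 true y * coord2 true y)); [|exact: derivM|exact: derivM].
  rewrite !derM// !derive_coord2; case: j {dc}; by rewrite /= !(mulr0, mulr1, addr0, add0r); field.
have pG j y : partial j G y = - ((coord2 j y)%:C * G y).
  rewrite /G partial_real -rmorphM -rmorphN; congr (_%:C).
  rewrite (@derive_expR_comp _ (fun y : R * R => - ((y.1 ^+ 2 + y.2 ^+ 2) / 2))); last first.
    exact: differentiableN.
  rewrite (_ : 'D_(basis_vec j) (fun y : R * R => - ((y.1 ^+ 2 + y.2 ^+ 2) / 2)) y = - coord2 j y).
    by rewrite mulrN mulrC.
  by rewrite -Dsq -deriveN//; apply: diff_derivable.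
have pFG j y : partial j (FT e G) y = - (coord2 j y)%:C * FT e G y.
  have [_ ->] := FT_diff e y sG.
  have -> : (fun xi => 'i * e%:C * ((coord2 j xi)%:C * G xi)) =
      (fun xi => - ('i * e%:C) * partial j G xi).
    by apply/funext => xi; rewrite pG mulrN mulNr opprK.
  rewrite FTZ; last exact: schwartz_partial.
  rewrite FT_partial// mulrA mulrNN; congr (_ * _).
  have ee : e%:C * e%:C = 1 :> R[i] by rewrite -rmorphM -expr2 e1.
  have ii : 'i * 'i = -1 :> R[i] by rewrite -expr2 sqr_i.
  rewrite rmorphM /=; set z := (coord2 j y)%:C.
  rewrite (_ : 'i * e%:C * ('i * (e%:C * z)) = ('i * 'i) * (e%:C * e%:C) * z); last by ring.
  by rewrite ii ee; ring.
pose H y := FT e G y * (E y)%:C.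
have dF y : cdiff (FT e G) y by have [] := FT_diff e y sG.
have dH y : cdiff H y by apply: cdiffM => //; exact: cdiff_real.
have pH j y : partial j H y = 0.
  rewrite /H partialM//; last exact: cdiff_real.
  rewrite pFG partial_real (@derive_expR_comp _ (fun y : R * R => (y.1 ^+ 2 + y.2 ^+ 2) / 2))//.
  by rewrite Dsq rmorphM /=; ring.
have Hstep y j t : 0 <= t -> H (y + t *: basis_vec j) = H y.
  move=> t0; apply/eqP; rewrite -subr_eq0; apply/eqP/normc_eq0/eqP.
  rewrite eq_le normc_ge0 andbT.
  have := @cMVT _ H y j t 0 dH t0; rewrite mulr0 mul0r; apply => s _.
  by rewrite pH normc0.
have Hstep' y j t : H (y + t *: basis_vec j) = H y.
  have [/Hstep//|/ltW t0] := leP 0 t.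
  rewrite -(Hstep (y + t *: basis_vec j) j (- t)) ?oppr_ge0//.
  by rewrite scaleNr addrK.
have HE y : H y = H 0.
  have -> : y = 0 + y.1 *: basis_vec false + y.2 *: basis_vec true.
    rewrite add0r /basis_vec [LHS]surjective_pairing [RHS]surjective_pairing.
    by rewrite /= /GRing.scale /= !mulr0 !mulr1 addr0 add0r.
  by rewrite !Hstep'.
have := HE x; rewrite {2}/H /E /= !expr0n /= addr0 mul0r expR0 mulr1.
have -> : FT e G 0 = (2 * pi)%:C.
  rewrite -cint_gauss2; apply: eq_cint => y.
  by rewrite /dotp /= !mul0r addr0 mulr0 cexpi0 mul1r.
move=> <-; rewrite /H /E -mulrA -rmorphM /= /gauss2 -expRD subrr expR0.
by rewrite mulr1.
Qed.

End PolyExp.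

(** * Fourier inversion *)

Section Inversion.
Context (R : realType).
Local Notation cRe := (@complex.Re R).
Local Notation cIm := (@complex.Im R).
Implicit Types (phi psi : R * R -> R[i]) (x xi : R * R) (j : bool).

Lemma cvg0Ml (f : nat -> R) (c : R) : f @ \oo --> (0 : R) ->
  (fun n => f n * c) @ \oo --> (0 : R).
Proof. by move=> f0; rewrite -[0](mul0r c); apply: cvgM => //; exact: cvg_cst. Qed.

Lemma gauss2_0 : gauss2 (0 : R * R) = 1.
Proof. by rewrite /gauss2 /= expr0n /= addr0 mul0r oppr0 expR0. Qed.

Lemma cdiff_cvg phi x (u : nat -> R * R) : cdiff phi x -> u @ \oo --> x ->
  (fun n => normc (phi (u n) - phi x)) @ \oo --> (0 : R).
Proof.
move=> [d1 d2] ux.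
have k1 : (fun n => `|cRe (phi (u n)) - cRe (phi x)|) @ \oo --> (0 : R).
  rewrite -[0](normr0 R) -(subrr (cRe (phi x))); apply: cvg_norm; apply: cvgB; last exact: cvg_cst.
  exact: (cvg_comp _ _ ux (differentiable_continuous d1)).
have k2 : (fun n => `|cIm (phi (u n)) - cIm (phi x)|) @ \oo --> (0 : R).
  rewrite -[0](normr0 R) -(subrr (cIm (phi x))); apply: cvg_norm; apply: cvgB; last exact: cvg_cst.
  exact: (cvg_comp _ _ ux (differentiable_continuous d2)).
have h : (fun n => `|cRe (phi (u n)) - cRe (phi x)| +
    `|cIm (phi (u n)) - cIm (phi x)|) @ \oo --> (0 : R).
  by rewrite -[0]addr0; exact: cvgD.
apply: squeeze0 h => n; rewrite normc_ge0 /= (le_trans (normc_le_abs _))//.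
by rewrite !(cReD, cImD, cReN, cImN).
Qed.

Lemma cvg_scaled x w : (fun n : nat => x + (n.+1%:R^-1 : R) *: w) @ \oo --> x.
Proof.
rewrite -[X in _ --> X]addr0 -(scale0r w); apply: cvgD; first exact: cvg_cst.
by apply: cvgZl; exact: cvg_harmonic.
Qed.

Lemma measurable_cst_wgt (c : R) : measurable_fun setT (fun x : R * R => (c * wgt x)%:E).
Proof. by have mw := @measurable_wgt R; mfun. Qed.

Lemma int_cst_wgt (c : R) : 0 <= c -> (\int[lebR2]_x (c * wgt (x : R * R))%:E < +oo)%E.
Proof.
move=> c0; under eq_integral do rewrite EFinM.
rewrite ge0_integralZl_EFin ?int_wgt//.
- by rewrite -EFinM ltry.
- by move=> xi _; rewrite lee_fin wgt_ge0.
- by apply: mf_EFin; exact: measurable_wgt.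
Qed.

(** The factor e^{-|a xi|^2 / 2}, with a = 1 / (n + 1), makes the double integral absolutely
    convergent. Fubini and the transform of the Gaussian turn the regularized integral L into the
    average K of phi (x + a w) against 2 pi times the Gaussian; the limits of L and K as a tends to
    0 are the two sides. *)
Lemma FT_inversion (e : R) phi x : e ^+ 2 = 1 -> schwartz phi ->
  FT (- e) (FT e phi) x = ((2 * pi) ^+ 2)%:C * phi x.
Proof.
move=> e1 sphi; pose a (n : nat) : R := n.+1%:R^-1.
have a0 n : 0 < a n by rewrite invr_gt0 ltr0n.
have scK n (w : R * R) : (a n)^-1 *: ((a n * w.1, a n * w.2) : R * R) = w.
  case: w => w1 w2; rewrite [LHS]surjective_pairing /= /GRing.scale /=.
  by rewrite !mulKf// gt_eqF.
have sF := FT_schwartz e1 sphi.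
have mphi := schwartz_meas sphi; have mF := schwartz_meas sF.
have mG := @measurable_gauss2 R.
have sG := @schwartz_gauss2 R.
pose L n : R[i] := cint lebR2 (fun xi => cexpi (- e * dotp x xi) *
  ((gauss2 (a n *: xi))%:C * FT e phi xi)).
have [MF MF0 hMF] := schwartz_decay sF; have [M M0 hM] := schwartz_decay sphi.
have [MG MG0 hMG] := schwartz_decay sG.
have Lm n : cmeas (fun xi => cexpi (- e * dotp x xi) *
    ((gauss2 (a n *: xi))%:C * FT e phi xi)).
  have mGa : measurable_fun setT (fun xi : R * R => gauss2 (a n *: xi)).
    apply: (@mf_comp _ _ _ _ _ _ (@gauss2 R) (fun xi : R * R => a n *: xi)) => //.
    by rewrite (_ : (fun _ => _) = fun xi : R * R => (a n * xi.1, a n * xi.2))//; mfun.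
  by mfun.
have Lb n xi : normc (cexpi (- e * dotp x xi) *
    ((gauss2 (a n *: xi))%:C * FT e phi xi)) <= MF * wgt xi.
  rewrite normcM normc_cexpi mul1r normcM normc_real ger0_norm ?gauss2_ge0//.
  by rewrite (le_trans _ (hMF xi))// ler_piMl ?normc_ge0// gauss2_le1.
apply: (@normc_lim_unique _ L).
  have [] := @cint_dct _ _ R lebR2 (fun n xi => cexpi (- e * dotp x xi) *
    ((gauss2 (a n *: xi))%:C * FT e phi xi))
    (fun xi => cexpi (- e * dotp x xi) * FT e phi xi)
    (fun xi => (MF * wgt (xi : R * R))%:E).
  - exact: Lm.
  - exact: FT_meas.
  - exact: measurable_cst_wgt.
  - apply: aeW => xi.
    have h : (fun n => normc ((gauss2 (0 + a n *: xi))%:C - (gauss2 0)%:C) * normc (FT e phi xi)) @ \oo --> (0 : R).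
      apply: cvg0Ml.
      apply: (@cdiff_cvg (fun y => (gauss2 y)%:C) 0); last exact: cvg_scaled.
      exact: schwartz_cdiff.
    apply: squeeze0 h => n; rewrite normc_ge0 /= add0r -mulrBr normcM normc_cexpi mul1r.
    by rewrite -normcM mulrBl gauss2_0 mul1r.
  - by apply: aeW => xi n; rewrite lee_fin; exact: Lb.
  - exact: int_cst_wgt.
  - by move=> xi; rewrite lee_fin mulr_ge0// wgt_ge0.
  move=> fi cv; apply: (cvg_cint _ fi cv) => n.
  by apply: (cintegrable_wgt (Lm n)) => xi; exact: Lb.
pose K n : R[i] := cint lebR2 (fun w : R * R => phi (x + a n *: w) * ((2 * pi) * gauss2 w)%:C).
have mshift b : cmeas (fun xi => phi (b + xi)).
  under eq_fun do rewrite addrC.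
  by apply: (cintegrable_meas (mu := lebR2)); apply: cintegrable_shift; exact: schwartz_int.
have mscale n : cmeas (fun w : R * R => phi (x + a n *: w)).
  have m := mshift x.
  apply: (@cmeas_comp _ _ _ _ _ (fun y => phi (x + y)) (fun w : R * R => a n *: w)) => //.
  by rewrite (_ : (fun _ => _) = fun xi : R * R => (a n * xi.1, a n * xi.2))//; mfun.
have LK n : L n = K n.
  pose Phi (p : (R * R) * (R * R)) : R[i] := cexpi (- e * dotp x p.1) *
    (gauss2 (a n *: p.1))%:C * (cexpi (e * dotp p.1 p.2) * phi p.2).
  have mGa : measurable_fun setT (fun xi : R * R => gauss2 (a n *: xi)).
    apply: (@mf_comp _ _ _ _ _ _ (@gauss2 R) (fun xi : R * R => a n *: xi)) => //.
    by rewrite (_ : (fun _ => _) = fun xi : R * R => (a n * xi.1, a n * xi.2))//; mfun.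
  have mPhi : cmeas Phi.
    rewrite /Phi; apply: cmeasM; last by mfun.
    apply: cmeasM; first by mfun.
    apply: cmeas_real.
    by apply: (@mf_comp _ _ _ _ _ _ (fun xi : R * R => gauss2 (a n *: xi)) fst) => //; mfun.
  have Gai : (\int[lebR2]_xi (gauss2 (a n *: (xi : R * R)))%:E < +oo)%E.
    have mg' : measurable_fun setT (fun xi : R * R => (gauss2 xi)%:E) by mfun.
    have := ge0_int2_scale (a0 n) mg' (fun xi => gauss2_ge0 xi).
    rewrite int_gauss2 => /eqP.
    have : (0 <= \int[lebR2]_xi (gauss2 (a n *: (xi : R * R)))%:E)%E.
      by apply: integral_ge0 => xi _; rewrite lee_fin gauss2_ge0.
    rewrite /GRing.scale /=.
    case: (\int[lebR2]_xi _)%E => // [r _ _|_]; first by rewrite ltry.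
    by rewrite gt0_muley// lte_fin exprn_gt0.
  have iPhi : cintegrable (pmeas lebR2 lebR2) setT Phi.
    apply/cintegrableP; split => //; rewrite cabs_pmeas1//.
    have /cintegrableP[_ phii] := schwartz_int sphi.
    have E (xi : R * R) : (cabs lebR2 (fun y => Phi (xi, y)) = (gauss2 (a n *: xi))%:E * cabs lebR2 phi)%E.
      rewrite /cabs -ge0_integralZl_EFin.
      - apply: eq_integral => y _; rewrite /Phi !normcM !normc_cexpi normc_real !mul1r.
        by rewrite ger0_norm ?gauss2_ge0// EFinM.
      - exact: measurableT.
      - by move=> y _; rewrite lee_fin normc_ge0.
      - exact: cmeas_enormc.
      - exact: gauss2_ge0.
    have fin : cabs lebR2 phi \is a fin_num by rewrite ge0_fin_numE ?cabs_ge0.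
    rewrite (_ : (fun _ => _) = (fun xi : R * R => (gauss2 (a n *: xi))%:E * (fine (cabs lebR2 phi))%:E)%E); last first.
      by apply/funext => xi; rewrite E fineK.
    rewrite ge0_integralZr.
    - by rewrite muleC lte_mul_pinfty// lee_fin fine_ge0// cabs_ge0.
    - exact: measurableT.
    - by mfun.
    - by move=> xi _; rewrite lee_fin gauss2_ge0.
    - by rewrite lee_fin fine_ge0// cabs_ge0.
  have -> : L n = cint lebR2 (fun xi => cint lebR2 (fun y => Phi (xi, y))).
    rewrite /L; apply: eq_cint => xi; rewrite mulrA /FT -cintZ; last exact: FT_int.
    by apply: eq_cint => y.
  rewrite (cint_swap iPhi).
  (* The integral over xi is the transform of a dilated Gaussian, hence an approximate identity
     centred at x. *)
  have inner (y : R * R) : cint lebR2 (fun xi => Phi (xi, y)) =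
      ((a n ^- 2) * (2 * pi) * gauss2 ((a n)^-1 *: (y - x)))%:C * phi y.
    transitivity (phi y * cint lebR2 (fun xi => cexpi (e * dotp (y - x) xi) * (gauss2 (a n *: xi))%:C)).
      rewrite -cintZ.
        apply: eq_cint => xi; rewrite /Phi /=.
        rewrite (_ : e * dotp (y - x) xi = - e * dotp x xi + e * dotp xi y).
          by rewrite cexpiD; ring.
        by rewrite /dotp /=; ring.
      apply/cintegrableP; split; first by mfun.
      rewrite /cabs; under eq_integral do
        rewrite normcM normc_cexpi mul1r normc_real ger0_norm ?gauss2_ge0//.
      exact: Gai.
    rewrite mulrC; congr (_ * _).
    pose f (zeta : R * R) : R[i] := cexpi (e * dotp ((a n)^-1 *: (y - x)) zeta) * (gauss2 zeta)%:C.
    have mf : cmeas f by rewrite /f; mfun.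
    have := cint2_scale (a0 n) mf.
    have -> : cint lebR2 f = FT e (fun y => (gauss2 y)%:C) ((a n)^-1 *: (y - x)) by [].
    rewrite FT_gauss2//.
    have -> : (fun xi : R * R => f (a n * xi.1, a n * xi.2)) =
        (fun xi => cexpi (e * dotp (y - x) xi) * (gauss2 (a n *: xi))%:C).
      apply/funext => xi; rewrite /f; congr (cexpi (e * _) * _).
      rewrite /dotp /= /GRing.scale /=; field.
      by rewrite /a invr_eq0 pnatr_eq0.
    move=> h; rewrite -mulrA rmorphM /= rmorphM /= -h mulrA -rmorphM /= mulVf ?mul1r//.
    by rewrite expf_neq0// gt_eqF.
  transitivity (cint lebR2 (fun y => ((a n ^- 2) * (2 * pi) * gauss2 ((a n)^-1 *: (y - x)))%:C * phi y)).
    by apply: eq_cint.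
  pose F (z : R * R) : R[i] := ((a n ^- 2) * (2 * pi) * gauss2 ((a n)^-1 *: z))%:C * phi (x + z).
  have mGb : measurable_fun setT (fun xi : R * R => gauss2 ((a n)^-1 *: xi)).
    apply: (@mf_comp _ _ _ _ _ _ (@gauss2 R) (fun xi : R * R => (a n)^-1 *: xi)) => //.
    by rewrite (_ : (fun _ => _) = fun xi : R * R => ((a n)^-1 * xi.1, (a n)^-1 * xi.2))//; mfun.
  have mF' : cmeas F.
    have m := mshift x; rewrite /F; apply: cmeasM => //; mfun.
  have -> : cint lebR2 (fun y => ((a n ^- 2) * (2 * pi) * gauss2 ((a n)^-1 *: (y - x)))%:C * phi y) = cint lebR2 F.
    rewrite -(cint2_shift (- x) mF'); apply: eq_cint => y.
    by rewrite /F; congr (_ * phi _); rewrite addrC subrK.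
  rewrite -(cint2_scale (a0 n) mF') /K -cintZ.
    apply: eq_cint => w; rewrite /F mulrA mulrC; congr (_ * _).
    rewrite -rmorphM /=; congr (_%:C).
    rewrite scK.
    by field; rewrite gt_eqF.
  apply: (@cintegrable_wgt _ _ ((a n ^- 2) * (2 * pi) * (M * MG) * 1)).
    by apply: (@cmeas_comp _ _ _ _ _ F (fun w : R * R => (a n * w.1, a n * w.2))) => //; mfun.
  move=> w; rewrite /F scK.
  have wgt1 (y : R * R) : wgt y <= 1.
    rewrite wgtE mulr_ile1// ?invr_ge0 ?addr_ge0 ?sqr_ge0// invf_le1 ?lerDl ?sqr_ge0//;
      by rewrite ltr_pwDl// sqr_ge0.
  have hp : normc (phi (x + (a n * w.1, a n * w.2))) <= M.
    by rewrite (le_trans (hM _))// ler_piMr.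
  have hg : gauss2 w <= MG * wgt w.
    by have := hMG w; rewrite normc_real ger0_norm ?gauss2_ge0.
  have c0 : 0 <= a n ^- 2 * (2 * pi) by rewrite mulr_ge0// ?mulr_ge0 ?pi_ge0// invr_ge0 exprn_ge0 ?ltW.
  rewrite normcM normc_real ger0_norm; last by rewrite mulr_ge0 ?gauss2_ge0.
  rewrite mulr1 -!mulrA [leRHS](_ : _ = (a n ^- 2 * (2 * pi)) * ((MG * wgt w) * M)); last by ring.
  rewrite [leLHS](_ : _ = (a n ^- 2 * (2 * pi)) * (gauss2 w * normc (phi (x + (a n * w.1, a n * w.2))))); last by ring.
  by apply: ler_wpM2l => //; apply: ler_pM; rewrite ?gauss2_ge0 ?normc_ge0.
have -> : ((2 * pi) ^+ 2)%:C * phi x = cint lebR2 (fun w : R * R => phi x * ((2 * pi) * gauss2 w)%:C).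
  transitivity (phi x * (2 * pi)%:C * cint lebR2 (fun w => (gauss2 w)%:C)).
    by rewrite cint_gauss2 expr2 rmorphM /=; ring.
  rewrite -cintZ; last exact: schwartz_int.
  by apply: eq_cint => w; rewrite -[LHS]mulrA -rmorphM.
have Km n : cmeas (fun w : R * R => phi (x + a n *: w) * ((2 * pi) * gauss2 w)%:C).
  by have m := mscale n; apply: cmeasM => //; mfun.
have wgt1 (y : R * R) : wgt y <= 1.
  rewrite wgtE mulr_ile1// ?invr_ge0 ?addr_ge0 ?sqr_ge0// invf_le1 ?lerDl ?sqr_ge0//;
    by rewrite ltr_pwDl// sqr_ge0.
have Kb n w : normc (phi (x + a n *: w) * ((2 * pi) * gauss2 w)%:C) <=
    (M * (2 * pi) * MG) * wgt w.
  have hp : normc (phi (x + a n *: w)) <= M by rewrite (le_trans (hM _))// ler_piMr.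
  have hg : gauss2 w <= MG * wgt w.
    by have := hMG w; rewrite normc_real ger0_norm ?gauss2_ge0.
  have p0 : 0 <= 2 * pi :> R by rewrite mulr_ge0// pi_ge0.
  have p1 : 0 <= 2 * pi * gauss2 w by apply: mulr_ge0 => //; exact: gauss2_ge0.
  rewrite normcM normc_real ger0_norm//.
  rewrite [leRHS](_ : _ = M * (2 * pi * (MG * wgt w))); last by ring.
  apply: ler_pM => //; first exact: normc_ge0.
  by rewrite ler_wpM2l.
have [] := @cint_dct _ _ R lebR2 (fun n w => phi (x + a n *: w) * ((2 * pi) * gauss2 w)%:C)
    (fun w : R * R => phi x * ((2 * pi) * gauss2 w)%:C)
    (fun w => (M * (2 * pi) * MG * wgt (w : R * R))%:E).
- exact: Km.
- by mfun.
- exact: measurable_cst_wgt.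
- apply: aeW => w.
  have h : (fun n => normc (phi (x + a n *: w) - phi x) * normc ((2 * pi * gauss2 w)%:C)) @ \oo --> (0 : R).
    apply: cvg0Ml.
    apply: cdiff_cvg; last exact: cvg_scaled.
    exact: schwartz_cdiff.
  by apply: squeeze0 h => n; rewrite normc_ge0 /= -mulrBl normcM.
- by apply: aeW => w n; rewrite lee_fin; exact: Kb.
- by apply: int_cst_wgt; rewrite !mulr_ge0// pi_ge0.
- by move=> w; rewrite lee_fin !mulr_ge0 ?wgt_ge0 ?pi_ge0.
move=> fi cv; rewrite (funext LK); apply: (cvg_cint _ fi cv) => n.
by apply: (cintegrable_wgt (Km n)) => w; exact: Kb.
Qed.

Lemma schwartz_fourier phi : schwartz phi -> schwartz (fourier phi).
Proof. by move=> sphi; rewrite fourierE; apply: FT_schwartz => //; rewrite sqrrN expr1n. Qed.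

Lemma schwartz_inv_fourier phi : schwartz phi -> schwartz (inv_fourier phi).
Proof.
by move=> sphi; rewrite inv_fourierE; apply: schwartzZ; apply: FT_schwartz => //; rewrite expr1n.
Qed.

Lemma fourierK phi : schwartz phi -> inv_fourier (fourier phi) = phi.
Proof.
move=> sphi; apply/funext => x; rewrite inv_fourierE fourierE.
have := @FT_inversion (-1) phi x; rewrite opprK sqrrN expr1n => -> //.
rewrite mulrA -rmorphM mulVf ?mul1r// expf_neq0// mulf_neq0 ?pnatr_eq0//.
by rewrite gt_eqF// pi_gt0.
Qed.

Lemma inv_fourierK phi : schwartz phi -> fourier (inv_fourier phi) = phi.
Proof.
move=> sphi; apply/funext => x; rewrite inv_fourierE fourierE.
rewrite FTZ; last by apply: FT_schwartz => //; rewrite expr1n.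
rewrite FT_inversion ?expr1n//.
rewrite mulrA -rmorphM mulVf ?mul1r// expf_neq0// mulf_neq0 ?pnatr_eq0//.
by rewrite gt_eqF// pi_gt0.
Qed.

End Inversion.

(** * Functions orthogonal to all Schwartz functions *)

Lemma ae_imply1 d (T : measurableType d) (R : realType) (mu : {measure set T -> \bar R})
    (P S : T -> Prop) : (forall x, P x -> S x) ->
  {ae mu, forall x, P x} -> {ae mu, forall x, S x}.
Proof. by move=> h; apply: filterS. Qed.

Lemma ae_imply2 d (T : measurableType d) (R : realType) (mu : {measure set T -> \bar R})
    (P Q S : T -> Prop) : (forall x, P x -> Q x -> S x) ->
  {ae mu, forall x, P x} -> {ae mu, forall x, Q x} -> {ae mu, forall x, S x}.
Proof. by move=> h; apply: filterS2. Qed.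

Section DuBoisReymond.
Context (R : realType).
Local Notation cRe := (@complex.Re R).
Local Notation cIm := (@complex.Im R).
Local Notation mR := (measurableTypeR R).
Implicit Types (phi psi : R * R -> R[i]) (x xi : R * R) (j : bool).

Definition orect (a b c d : R) : set (R * R) := `]a, b[ `*` `]c, d[.

Lemma measurable_orect a b c d : measurable (orect a b c d).
Proof. by apply: measurableX; exact: measurable_itv. Qed.

Lemma oo_itvI (a b c d : R) : `]a, b[%classic `&` `]c, d[ = `]Num.max a c, Num.min b d[%classic.
Proof.
apply/seteqP; split => x /=; rewrite !in_itv /= gt_max lt_min.
  by move=> [/andP[-> ->] /andP[-> ->]].
by move=> /andP[/andP[-> ->] /andP[-> ->]].
Qed.

(* The affine map inside the power sends ]a, b[ onto ]-1, 1[, so that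
   e^{- cutoff} tends to the indicator of ]a, b[. *)
Definition cutoff (n : nat) (a b t : R) : R :=
  n.+1%:R * (((t - (a + b) / 2) / ((b - a) / 2)) ^+ 2) ^+ n.+1.

(** With s the squared affine variable, the left-hand side is nonpositive for s <= 1, and s <= (n +
    1) s^(n + 1) for s >= 1. The bound does not depend on n; it gives both the Gaussian decay of the
    test functions and their uniform domination. *)
Lemma cutoff_ge n a b (t : R) :
  ((t - (a + b) / 2) / ((b - a) / 2)) ^+ 2 - 1 <= cutoff n a b t.
Proof.
rewrite /cutoff; set s := (_ ^+ 2); have s0 : 0 <= s by exact: sqr_ge0.
have [s1|s1] := leP s 1.
  by rewrite (@le_trans _ _ 0)// ?subr_le0// mulr_ge0// exprn_ge0.
rewrite (@le_trans _ _ s)//; first by rewrite gerDl oppr_le0.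
rewrite -[leLHS]mul1r ler_pM ?ler1n//.
by rewrite -[leLHS]expr1 ler_weXn2l// ltW.
Qed.

(** The factor n + 1 in [cutoff] makes it diverge at the end points as well, where the power stays
    equal to 1; so the limit is the indicator of the open interval at every point. *)
Lemma cvg_cutoff a b (t : R) : a < b ->
  (fun n => expR (- cutoff n a b t)) @ \oo --> (\1_(`]a, b[%classic : set R) t : R).
Proof.
move=> ab; pose y := (t - (a + b) / 2) / ((b - a) / 2).
have ba0 : 0 < (b - a) / 2 by rewrite divr_gt0 ?subr_gt0.
have yE : (t \in `]a, b[) = (`|y| < 1).
  rewrite in_itv /= ltr_norml ltr_pdivlMr// ltr_pdivrMr//.
  by apply/idP/idP => /andP[h1 h2]; apply/andP; split; lra.
rewrite indicE; have -> : (t \in (`]a, b[%classic : set R)) = (`|y| < 1).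
  by rewrite -yE; apply/idP/idP => [/set_mem//|h]; exact/mem_set.
have [y1|y1] := ltP `|y| 1; last first.
  have yy : 1 <= y ^+ 2 by rewrite -real_normK ?num_real// exprn_ege1.
  have h : (fun n => n.+1%:R^-1 : R) @ \oo --> (0 : R) by exact: cvg_harmonic.
  apply: squeeze0 h => n; rewrite expR_ge0 /= expRN lef_pV2 ?posrE ?expR_gt0 ?ltr0n//.
  apply: (@le_trans _ _ (cutoff n a b t)); last first.
    by apply: le_trans (expR_ge1Dx _); rewrite lerDr.
  rewrite /cutoff -/y.
  have : 1 <= (y ^+ 2) ^+ n.+1 by rewrite exprn_ege1.
  have n0 : 0 < n.+1%:R :> R by rewrite ltr0n.
  by move=> h1; rewrite ler_peMr// ltW.
have yy : 0 <= y ^+ 2 < 1.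
  rewrite sqr_ge0 /= -real_normK ?num_real// expr_lt1//.
rewrite -[X in _ --> X]expR0; apply: (@cvg_comp _ _ _ (fun n => - cutoff n a b t) expR _ (nbhs (0 : R))); last exact: continuous_expR.
rewrite -[0]oppr0; apply: cvgN; rewrite /cutoff -/y.
case/andP: yy; set s := y ^+ 2; rewrite le_eqVlt => /predU1P[<- _|s0 s1].
  by under eq_fun do rewrite expr0n /= mulr0; exact: cvg_cst.
(* (n + 1) s^(n + 1) is the product of (n + 1) q^(n + 1), which Bernoulli's inequality for 1 / q
   keeps bounded, and of q^(n + 1), which tends to 0. *)
pose q := Num.sqrt s; have q0 : 0 < q by rewrite sqrtr_gt0.
have qs : q ^+ 2 = s by rewrite sqr_sqrtr// ltW.
have q1 : q < 1 by rewrite -(@ltr_pXn2r _ 2)// ?nnegrE ?ltW// qs expr1n.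
have d0 : 0 < q^-1 - 1 by rewrite subr_gt0 invf_gt1.
have h : (fun n => (q^-1 - 1)^-1 * q ^+ n.+1) @ \oo --> (0 : R).
  rewrite -[0](mulr0 (q^-1 - 1)^-1); apply: cvgM; first exact: cvg_cst.
  have := @cvg_expr R q; rewrite ger0_norm ?ltW// => /(_ q1) h.
  by apply/cvgrPdist_lt => e e0; have /cvgrPdist_lt/(_ _ e0)[N _ hN] := h;
    exists N => // n /= Nn; apply: hN; rewrite /= (leq_trans Nn).
apply: squeeze0 h => n; rewrite mulr_ge0 ?ler0n ?(exprn_ge0 _ (ltW s0))//=.
rewrite -qs -exprM mulnC exprM expr2 mulrA ler_wpM2r ?exprn_ge0 ?(ltW q0)//.
have B (m : nat) : m%:R * (q^-1 - 1) <= (q^-1) ^+ m.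
  elim: m => [|m ih]; first by rewrite mul0r.
  rewrite exprS -[X in _ <= X * _](subrK 1) mulrDl mul1r -natr1 mulrDl mul1r addrC.
  rewrite lerD// ler_peMr ?(ltW d0)// exprn_ege1// -subr_ge0 ltW//.
have := B n.+1; rewrite exprVn -ler_pdivlMr// => hB.
by rewrite -ler_pdivlMr ?exprn_gt0// mulrC.
Qed.

Definition bump (n : nat) (a b c d : R) x : R :=
  expR (- (cutoff n a b x.1 + cutoff n c d x.2)).

Lemma schwartz_bump n a b c d : a < b -> c < d ->
  schwartz (fun x => (bump n a b c d x)%:C).
Proof.
move=> ab cd.
have pc k u v : polyf (fun x : R * R => cutoff n u v (coord2 k x)).
  rewrite /cutoff; apply: polyfM; first exact: polyf_cst.
  apply: polyfX; apply: polyfX; apply: polyfM; last exact: polyf_cst.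
  by apply: polyfD; [exact: polyf_coord|exact: polyf_cst].
have pq : polyf (fun x : R * R => cutoff n a b x.1 + cutoff n c d x.2).
  by apply: polyfD; [exact: (pc false)|exact: (pc true)].
pose r1 := (b - a) / 2; pose r2 := (d - c) / 2.
have r10 : 0 < r1 by rewrite divr_gt0 ?subr_gt0.
have r20 : 0 < r2 by rewrite divr_gt0 ?subr_gt0.
(* For either half-length r one has k r^2 <= 1/2, and t^2 / 2 <= (t - m)^2 + m^2 for either midpoint
   m. *)
pose k := (2 * (r1 ^+ 2 + r2 ^+ 2))^-1.
have rr : 0 < r1 ^+ 2 + r2 ^+ 2 by rewrite addr_gt0// exprn_gt0.
have k0 : 0 < k by rewrite invr_gt0 mulr_gt0.
have key (r m t : R) : 0 < r -> r ^+ 2 <= r1 ^+ 2 + r2 ^+ 2 ->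
    k * t ^+ 2 - m ^+ 2 / r ^+ 2 <= ((t - m) / r) ^+ 2.
  move=> r0 rle; have r2' : 0 < r ^+ 2 by rewrite exprn_gt0.
  rewrite expr_div_n lerBlDr -mulrDl ler_pdivlMr//.
  rewrite (@le_trans _ _ (t ^+ 2 / 2))//.
    rewrite mulrAC [leRHS]mulrC ler_wpM2r ?sqr_ge0//.
    rewrite /k invfM -mulrA ler_piMr ?invr_ge0// mulrC ler_pdivrMr//.
    by rewrite mul1r.
  by have := sqr_ge0 (t - 2 * m); nra.
pose m1 := (a + b) / 2; pose m2 := (c + d) / 2.
have := @schwartz_polyexp _ _ k (m1 ^+ 2 / r1 ^+ 2 + m2 ^+ 2 / r2 ^+ 2 + 2) pq k0.
move=> /(_ _ (fun=> 1) (polyf_cst 1)) h.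
rewrite (_ : (fun x => _) = (fun x => (1 * expR (- (cutoff n a b x.1 + cutoff n c d x.2)))%:C)).
  apply: h => x.
  have h1 := le_trans (lerB (key r1 m1 x.1 r10 _) (lexx 1)) (cutoff_ge n a b x.1).
  have h2 := le_trans (lerB (key r2 m2 x.2 r20 _) (lexx 1)) (cutoff_ge n c d x.2).
  have := lerD (h1 _) (h2 _); rewrite ?lerDl ?lerDr ?sqr_ge0// => /(_ isT isT).
  by apply: le_trans; rewrite le_eqVlt; apply/orP; left; apply/eqP; ring.
by apply/funext => x; rewrite mul1r.
Qed.

Lemma cvg_bump a b c d x : a < b -> c < d ->
  (fun n => bump n a b c d x) @ \oo --> (\1_(orect a b c d) x : R).
Proof.
move=> ab cd; rewrite /bump.
under eq_fun do rewrite opprD expRD.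
have -> : \1_(orect a b c d) x = \1_(`]a, b[%classic : set R) x.1 * \1_(`]c, d[%classic : set R) x.2 :> R.
  by rewrite !indicE /orect in_setX -natrM mulnb.
by apply: cvgM; exact: cvg_cutoff.
Qed.

(** [cutoff_ge] costs 1 in each variable, whence e^2. The dominating function is itself a multiple
    of a Schwartz function. *)
Lemma bump_le n a b c d x : bump n a b c d x <= expR 2 * bump 0 a b c d x.
Proof.
rewrite /bump -expRD ler_expR.
have e (u v t : R) : cutoff 0 u v t = ((t - (u + v) / 2) / ((v - u) / 2)) ^+ 2.
  by rewrite /cutoff mul1r expr1.
rewrite !e; have := cutoff_ge n a b x.1; have := cutoff_ge n c d x.2; lra.
Qed.

Lemma measurable_bump n a b c d : measurable_fun setT (bump n a b c d).
Proof. by rewrite /bump /cutoff; mfun. Qed.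

(** Dominated convergence along [bump n]. The dominating function is e^2 |f| [bump 0], which is
    integrable by the hypothesis on f, as [bump 0] is a Schwartz function. *)
Lemma orect_vanish (f : R * R -> R[i]) : cmeas f ->
  (forall phi, schwartz phi -> cintegrable lebR2 setT (fun x => f x * phi x) /\
     cint lebR2 (fun x => f x * phi x) = 0) ->
  forall a b c d, cintegrable lebR2 setT (fun x => f x * (\1_(orect a b c d) x)%:C) /\
    cint lebR2 (fun x => f x * (\1_(orect a b c d) x)%:C) = 0.
Proof.
move=> mf f0 a b c d.
have triv : orect a b c d = set0 ->
    cintegrable lebR2 setT (fun x => f x * (\1_(orect a b c d) x)%:C) /\
    cint lebR2 (fun x => f x * (\1_(orect a b c d) x)%:C) = 0.
  move=> ->; have -> : (fun x => f x * (\1_set0 x)%:C) = fun=> 0.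
    by apply/funext => x; rewrite indicE in_set0 mulr0.
  by rewrite cint0; split => //; exact: cintegrable0.
have [ab|ab] := ltP a b; last first.
  by apply: triv; rewrite /orect set_itv_ge ?set0X// bnd_simp -leNgt.
have [cd|cd] := ltP c d; last first.
  by apply: triv; rewrite /orect [X in _ `*` X]set_itv_ge ?setX0// bnd_simp -leNgt.
have mb n := @measurable_bump n a b c d.
have [i0 _] := f0 _ (schwartz_bump 0 ab cd).
have /cintegrableP[_ fin0] := i0.
have [] := @cint_dct _ _ R lebR2 (fun n x => f x * (bump n a b c d x)%:C)
   (fun x => f x * (\1_(orect a b c d) x)%:C)
   (fun x => (expR 2 * normc (f x * (bump 0 a b c d x)%:C))%:E).
- by move=> n; have m := mb n; mfun.
- have m : measurable_fun setT (\1_(orect a b c d) : R * R -> R).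
    exact: (measurable_indic (@measurable_orect a b c d)).
  by apply: cmeasM => //; apply: cmeas_real.
- by have m := mb 0%N; mfun.
- apply: aeW => x.
  have h : (fun n => `|bump n a b c d x - \1_(orect a b c d) x| * normc (f x)) @ \oo --> (0 : R).
    apply: cvg0Ml; rewrite -[0](normr0 R) -(subrr (\1_(orect a b c d) x)).
    by apply: cvg_norm; apply: cvgB; [exact: cvg_bump|exact: cvg_cst].
  apply: squeeze0 h => n; rewrite normc_ge0 /= -mulrBr normcM mulrC.
  by rewrite -rmorphB normc_real.
- apply: aeW => x n; rewrite lee_fin !normcM !normc_real !ger0_norm ?expR_ge0//.
  by rewrite mulrCA ler_wpM2l ?normc_ge0// bump_le.
- under eq_integral do rewrite EFinM.
  rewrite ge0_integralZl_EFin ?expR_ge0//.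
  + have fin : cabs lebR2 (fun x => f x * (bump 0 a b c d x)%:C) \is a fin_num.
      by rewrite ge0_fin_numE ?cabs_ge0.
    by rewrite -/(cabs _ _) -(fineK fin) -EFinM ltry.
  + by move=> x _; rewrite lee_fin normc_ge0.
  + by have m := mb 0%N; mfun.
- by move=> x; rewrite lee_fin mulr_ge0 ?expR_ge0 ?normc_ge0.
move=> fi cv; split => //.
have h := cvg_cint (fun n => (f0 _ (schwartz_bump n ab cd)).1) fi cv.
apply/esym; apply: (@normc_lim_unique _ (fun=> 0)).
  by under eq_fun do rewrite subrr normc0; exact: cvg_cst.
by apply: squeeze0 h => n; rewrite normc_ge0 /= (f0 _ (schwartz_bump n ab cd)).2.
Qed.

(** The pi-lambda theorem for the sets A whose image under Phi carries a zero integral. The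
    transport Phi lets one statement serve for each factor of a rectangle in turn, and then, with
    Phi the identity, for the plane. *)
Lemma dynkin_vanish d (T : measurableType d) (mu : {measure set (mR * mR) -> \bar R})
    (u : R * R -> R) (Phi : set T -> set (R * R)) (G : set (set T)) :
  mu.-integrable setT (EFin \o u) ->
  @measurable _ T = <<s G >> -> setI_closed G ->
  (forall A, measurable A -> measurable (Phi A)) ->
  (forall A, Phi (~` A) = Phi setT `\` Phi A) ->
  (forall A, Phi A `<=` Phi setT) ->
  (forall F : (set T)^nat, Phi (\bigcup_k F k) = \bigcup_k Phi (F k)) ->
  (forall A B, A `&` B = set0 -> Phi A `&` Phi B = set0) ->
  (\int[mu]_(x in Phi setT) (u x)%:E = 0)%E ->
  (forall A, G A -> (\int[mu]_(x in Phi A) (u x)%:E = 0)%E) ->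
  forall A, measurable A -> (\int[mu]_(x in Phi A) (u x)%:E = 0)%E.
Proof.
move=> iu GE GI mPhi PhiC PhiS PhiU PhiI PT PG A mA.
have iu' (B : set (R * R)) : measurable B -> mu.-integrable B (EFin \o u).
  by move=> mB; apply: integrableS iu.
apply: (@dynkin_induction _ T G (fun A => \int[mu]_(x in Phi A) (u x)%:E = 0)%E) => //.
- move=> S mS PS; rewrite PhiC.
  have : (\int[mu]_(x in Phi setT) (u x)%:E = \int[mu]_(x in Phi S `|` (Phi setT `\` Phi S)) (u x)%:E)%E.
    by congr (integral _ _ _); apply/seteqP; split => x; [by have [|] := pselect (Phi S x); [left|right]|move=> [/PhiS|[]]].
  have mD : measurable (Phi setT `\` Phi S) by apply: measurableD; exact: mPhi.
  rewrite PT integral_setU_EFin//.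
  + by rewrite PS add0e => <-.
  + exact: mPhi.
  + apply/measurable_EFinP; apply: (measurable_int mu); apply: iu'.
    by apply: measurableU => //; exact: mPhi.
  + by apply/disj_setPS => x []//= h1 [_ h2].
- move=> F mF tF PF; rewrite PhiU integral_bigcup//.
  + by rewrite eseries0.
  + apply/trivIsetP => i j _ _ ij; apply: PhiI.
    by move/trivIsetP: tF; exact.
  + by move=> i; exact: mPhi.
  + by apply: iu'; apply: bigcupT_measurable => i; exact: mPhi.
- by rewrite -GE.
Qed.

(** Bounded open intervals are replaced by measurable sets one factor at a time, then measurable
    rectangles by measurable sets of the plane. Strips and the whole plane are separate hypotheses
    because the complement step needs the integral over the largest set, which is not a bounded
    rectangle. *)
Lemma rect_vanish (u : R * R -> R) : lebR2.-integrable setT (EFin \o u) ->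
  (forall a b c d, (\int[lebR2]_(x in orect a b c d) (u x)%:E = 0)%E) ->
  (\int[lebR2]_x (u x)%:E = 0)%E ->
  (forall a b, (\int[lebR2]_(x in `]a, b[ `*` setT) (u x)%:E = 0)%E) ->
  (forall a b, (\int[lebR2]_(x in setT `*` `]a, b[) (u x)%:E = 0)%E) ->
  {ae lebR2, forall x, u x = 0}.
Proof.
move=> iu u0 uT u1 u2.
have GE : @measurable _ mR = <<s @RGenOpens.G R >> by exact: RGenOpens.measurableE.
have GI : setI_closed (@RGenOpens.G R).
  move=> _ _ [a [b ->]] [c [e ->]]; exists (Num.max a c), (Num.min b e).
  by rewrite oo_itvI.
have s1 c e A : measurable A -> (\int[lebR2]_(x in A `*` `]c, e[) (u x)%:E = 0)%E.
  apply: (@dynkin_vanish _ mR lebR2 u (fun A => A `*` `]c, e[%classic) (@RGenOpens.G R)) => //.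
  - by move=> B mB; apply: measurableX.
  - move=> B; apply/seteqP; split => -[x y] /=; first by move=> [? ?]; split => // -[].
    by move=> [[_ ?] h]; split => // ?; apply: h.
  - by move=> B [x y] [].
  - by move=> F; apply/seteqP; split => -[x y] /=; [move=> [[k _ ?] ?]; exists k|move=> [k _ [? ?]]; split => //; exists k].
  - move=> B C BC; rewrite -setXI BC; by rewrite set0X.
  - by move=> B [a [b ->]]; exact: u0.
have s2 A : measurable A -> (\int[lebR2]_(x in A `*` setT) (u x)%:E = 0)%E.
  apply: (@dynkin_vanish _ mR lebR2 u (fun A => A `*` setT) (@RGenOpens.G R)) => //.
  - by move=> B mB; apply: measurableX.
  - move=> B; apply/seteqP; split => -[x y] /=; first by move=> [? ?]; split => // -[].
    by move=> [[_ ?] h]; split => // ?; apply: h.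
  - by move=> F; apply/seteqP; split => -[x y] /=; [move=> [[k _ ?] ?]; exists k|move=> [k _ [? ?]]; split => //; exists k].
  - move=> B C BC; rewrite -setXI BC; by rewrite set0X.
  - by rewrite setXTT.
  - by move=> B [a [b ->]]; exact: u1.
have s3 A B : measurable A -> measurable B -> (\int[lebR2]_(x in A `*` B) (u x)%:E = 0)%E.
  move=> mA; apply: (@dynkin_vanish _ mR lebR2 u (fun B => A `*` B) (@RGenOpens.G R)) => //.
  - by move=> C mC; apply: measurableX.
  - move=> C; apply/seteqP; split => -[x y] /=; first by move=> [? ?]; split => // -[].
    by move=> [[? _] h]; split => // ?; apply: h.
  - by move=> C [x y] [].
  - by move=> F; apply/seteqP; split => -[x y] /=; [move=> [? [k _ ?]]; exists k|move=> [k _ [? ?]]; split => //; exists k].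
  - move=> C D CD; rewrite -setXI CD; by rewrite setX0.
  - exact: s2.
  - by move=> C [a [b ->]]; exact: s1.
have s4 A : measurable A -> (\int[lebR2]_(x in A) (u x)%:E = 0)%E.
  apply: (@dynkin_vanish _ (mR * mR)%type lebR2 u id [set A `*` B | A in measurable & B in measurable]) => //.
  - exact: measurable_prod_measurableType.
  - move=> _ _ [A1 mA1 [B1 mB1 <-]] [A2 mA2 [B2 mB2 <-]]; rewrite -setXI.
    by exists (A1 `&` A2); [exact: measurableI|exists (B1 `&` B2) => //; exact: measurableI].
  - by move=> B; rewrite setTD.
  - by move=> _ [A1 mA1 [B1 mB1 <-]]; exact: s3.
have : ae_eq lebR2 setT (EFin \o u) (cst 0%E).
  apply: (integral_ae_eq measurableT iu) => // E _ mE.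
  by rewrite s4// integral0_eq.
by apply: filterS => x /(_ Logic.I) /= [].
Qed.

(** f itself need not be integrable, so it is cut to the squares [B n], where it is. Cutting
    preserves the vanishing of integrals because a rectangle meets a square in a rectangle. *)
Lemma du_bois_reymond (f : R * R -> R[i]) : cmeas f ->
  (forall phi, schwartz phi -> cintegrable lebR2 setT (fun x => f x * phi x) /\
     cint lebR2 (fun x => f x * phi x) = 0) ->
  {ae lebR2, forall x, f x = 0}.
Proof.
move=> mf f0; have fr := orect_vanish mf f0.
have main (u : R * R -> R) : measurable_fun setT u ->
    (forall a b c d, lebR2.-integrable setT (fun x => (u x * \1_(orect a b c d) x)%:E) /\
       (\int[lebR2]_x (u x * \1_(orect a b c d) x)%:E = 0)%E) ->
    {ae lebR2, forall x, u x = 0}.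
  move=> mu ur.
  pose B (n : nat) := orect (- n%:R) n%:R (- n%:R) n%:R.
  have mB n : measurable (B n) by exact: measurable_orect.
  have BI n a b c d : orect a b c d `&` B n =
      orect (Num.max a (- n%:R)) (Num.min b n%:R) (Num.max c (- n%:R)) (Num.min d n%:R).
    by rewrite /B /orect -setXI !oo_itvI.
  have uE n (A : set (R * R)) : measurable A ->
     (\int[lebR2]_(x in A) (u x * \1_(B n) x)%:E = \int[lebR2]_x (u x * \1_(A `&` B n) x)%:E)%E.
    move=> mA; rewrite integral_mkcond; apply: eq_integral => x _.
    rewrite /restrict !indicE in_setI; case: (x \in A) => //=.
    by rewrite mulr0.
  have key n : {ae lebR2, forall x, u x * \1_(B n) x = 0}.
    apply: rect_vanish.
    - by have [] := ur (- n%:R) n%:R (- n%:R) n%:R.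
    - by move=> a b c d; rewrite uE; [rewrite BI; exact: (ur _ _ _ _).2|exact: measurable_orect].
    - by have [] := ur (- n%:R) n%:R (- n%:R) n%:R.
    - move=> a b; rewrite uE; last by apply: measurableX.
      rewrite (_ : _ `&` _ = orect (Num.max a (- n%:R)) (Num.min b n%:R) (- n%:R) n%:R); first exact: (ur _ _ _ _).2.
      by rewrite /B /orect -setXI oo_itvI setTI.
    - move=> a b; rewrite uE; last by apply: measurableX.
      rewrite (_ : _ `&` _ = orect (- n%:R) n%:R (Num.max a (- n%:R)) (Num.min b n%:R)); first exact: (ur _ _ _ _).2.
      by rewrite /B /orect -setXI oo_itvI setTI.
  have := ae_foralln key; apply: filterS => x ux.
  pose n := Num.truncn (`|x.1| + `|x.2|).
  have xn : `|x.1| + `|x.2| < n.+1%:R by exact: truncnS_gt.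
  have := ux n.+1; rewrite indicE mem_set ?mulr1//.
  rewrite /B /orect; split; rewrite /= in_itv /= -ltr_norml (le_lt_trans _ xn)//.
    by rewrite lerDl.
  by rewrite lerDr.
have [mf1 mf2] := mf.
have r1 : {ae lebR2, forall x, cRe (f x) = 0}.
  apply: main => // a b c d; have [[i1 i2] e] := fr a b c d.
  have E : (fun x => (cRe (f x) * \1_(orect a b c d) x)%:E) =
     (fun x => (cRe (f x * (\1_(orect a b c d) x)%:C))%:E).
    by apply/funext => x; rewrite cReM /= mulr0 subr0.
  rewrite E; split => //.
  rewrite -[LHS]fineK; last exact: integrable_fin_num.
  by have /= := congr1 (@complex.Re R) e; rewrite /Rintegral => ->.
have r2 : {ae lebR2, forall x, cIm (f x) = 0}.
  apply: main => // a b c d; have [[i1 i2] e] := fr a b c d.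
  have E : (fun x => (cIm (f x) * \1_(orect a b c d) x)%:E) =
     (fun x => (cIm (f x * (\1_(orect a b c d) x)%:C))%:E).
    by apply/funext => x; rewrite cImM /= mulr0 add0r.
  rewrite E; split => //.
  rewrite -[LHS]fineK; last exact: integrable_fin_num.
  by have /= := congr1 (@complex.Im R) e; rewrite /Rintegral => ->.
by apply: (ae_imply2 _ r1 r2) => x; case: (f x) => a b /= -> ->.
Qed.

End DuBoisReymond.

(** * Convolutions *)

Section IntegralTools.
Context d (T : measurableType d) (R : realType) (mu : {measure set T -> \bar R}).
Implicit Types f g : T -> R[i].

Lemma cabsZ c f : cmeas f -> cabs mu (fun x => c * f x) = ((normc c)%:E * cabs mu f)%E.
Proof.
move=> mf; rewrite /cabs; under eq_integral do rewrite normcM EFinM.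
rewrite ge0_integralZl_EFin ?normc_ge0//; first by move=> x _; rewrite lee_fin normc_ge0.
exact: cmeas_enormc.
Qed.

Lemma cabs_le_scale f g (M : R) : cmeas f -> cmeas g -> 0 <= M ->
  (forall x, normc (f x) <= M * normc (g x)) -> (cabs mu f <= M%:E * cabs mu g)%E.
Proof.
move=> mf mg M0 h.
have -> : (M%:E * cabs mu g)%E = cabs mu (fun x => M%:C * g x).
  by rewrite cabsZ// normc_real ger0_norm.
apply: cabs_le => //; first by mfun.
by move=> x; rewrite normcM normc_real ger0_norm.
Qed.

Lemma cintegrable_lty f : cintegrable mu setT f -> (cabs mu f < +oo)%E.
Proof. by case/cintegrableP. Qed.

Lemma cabs_fin_num f : cintegrable mu setT f -> cabs mu f \is a fin_num.
Proof. by move=> fi; rewrite ge0_fin_numE ?cabs_ge0// cintegrable_lty. Qed.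

Lemma cintegrable_dom f g (M : R) : cintegrable mu setT g -> cmeas f -> 0 <= M ->
  (forall x, normc (f x) <= M * normc (g x)) -> cintegrable mu setT f.
Proof.
move=> gi mf M0 h; apply/cintegrableP; split => //.
apply: (le_lt_trans (cabs_le_scale mf (cintegrable_meas gi) M0 h)).
by rewrite -(fineK (cabs_fin_num gi)) -EFinM ltry.
Qed.

Lemma cintegrableMr f g (M : R) : cintegrable mu setT f -> cmeas g -> 0 <= M ->
  (forall x, normc (g x) <= M) -> cintegrable mu setT (fun x => f x * g x).
Proof.
move=> fi mg M0 h; have mf := cintegrable_meas fi.
apply: (cintegrable_dom fi _ M0); first by mfun.
by move=> x; rewrite normcM mulrC ler_wpM2r ?normc_ge0.
Qed.

Lemma cintegrableMl f g (M : R) : cintegrable mu setT f -> cmeas g -> 0 <= M ->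
  (forall x, normc (g x) <= M) -> cintegrable mu setT (fun x => g x * f x).
Proof.
move=> fi mg M0 h; have := cintegrableMr fi mg M0 h.
by under eq_fun do rewrite mulrC.
Qed.

(** A boolean test in the integrand replaces the domain of integration; a time interval [0, t] thus
    becomes part of an integrand on the whole line, to which Fubini applies. *)
Lemma cint_restrict (D : set T) (b : T -> bool) f : measurable D ->
  (forall x, b x = (x \in D)) ->
  cintegral mu D f = cint mu (fun x => if b x then f x else 0).
Proof.
move=> mD bD; rewrite /cint /cintegral /Rintegral.
congr (_ +i* _); congr fine; rewrite [LHS]integral_mkcond; apply: eq_integral => x _;
  by rewrite /restrict bD; case: ifP.
Qed.

Lemma cintegrable_restrict (D : set T) (b : T -> bool) f : measurable D ->
  (forall x, b x = (x \in D)) ->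
  cintegrable mu setT (fun x => if b x then f x else 0) -> cintegrable mu D f.
Proof.
move=> mD bD [i1 i2]; split; apply/(integrable_mkcond _ mD).
  apply: eq_integrable i1 => // x _.
  by rewrite /restrict bD; case: ifP.
apply: eq_integrable i2 => // x _.
by rewrite /restrict bD; case: ifP.
Qed.

End IntegralTools.

Section Tensor.
Context d1 d2 (T1 : measurableType d1) (T2 : measurableType d2) (R : realType).
Variables (m1 : {sigma_finite_measure set T1 -> \bar R})
  (m2 : {sigma_finite_measure set T2 -> \bar R}).

Lemma ge0_integralM_l (f : T1 -> \bar R) (k : \bar R) : measurable_fun setT f ->
  (forall x, 0 <= f x)%E -> (0 <= k)%E ->
  (\int[m1]_x (f x * k) = \int[m1]_x f x * k)%E.
Proof. by move=> mf f0 k0; rewrite ge0_integralZr. Qed.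

Lemma ge0_integralM_r (f : T1 -> \bar R) (k : \bar R) : measurable_fun setT f ->
  (forall x, 0 <= f x)%E -> (0 <= k)%E ->
  (\int[m1]_x (k * f x) = k * \int[m1]_x f x)%E.
Proof. by move=> mf f0 k0; rewrite ge0_integralZl. Qed.

End Tensor.

Section Convolution.
Context (R : realType).
Implicit Types (F G H : R * R -> \bar R) (f g h : R * R -> R[i]) (x b xi : R * R).

(** Extended-valued, hence defined at every xi; finiteness is recovered almost everywhere from
    [int_econv]. *)
Definition econv F G xi : \bar R := (\int[lebR2]_b (F (sub2 xi b) * G b))%E.

Lemma int_sub2 F b : measurable_fun setT F -> (forall x, 0 <= F x)%E ->
  (\int[lebR2]_x F (sub2 x b) = \int[lebR2]_x F x)%E.
Proof. by move=> mF F0; exact: (ge0_int2_shift (- b.1, - b.2) mF F0). Qed.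

Lemma measurable_econv_integrand F G : measurable_fun setT F -> measurable_fun setT G ->
  measurable_fun setT (fun z : (R * R) * (R * R) => F (sub2 z.1 z.2) * G z.2)%E.
Proof. by move=> mF mG; mfun. Qed.

Lemma econv_ge0 F G xi : (forall x, 0 <= F x)%E -> (forall x, 0 <= G x)%E ->
  (0 <= econv F G xi)%E.
Proof. by move=> F0 G0; apply: integral_ge0 => x _; exact: mule_ge0. Qed.

Lemma measurable_econv F G : measurable_fun setT F -> measurable_fun setT G ->
  (forall x, 0 <= F x)%E -> (forall x, 0 <= G x)%E -> measurable_fun setT (econv F G).
Proof.
move=> mF mG F0 G0.
apply: (measurable_tonelli1 lebR2 (measurable_econv_integrand mF mG)).
by move=> z; exact: mule_ge0.
Qed.

Lemma int_econv F G : measurable_fun setT F -> measurable_fun setT G ->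
  (forall x, 0 <= F x)%E -> (forall x, 0 <= G x)%E ->
  (\int[lebR2]_x econv F G x = \int[lebR2]_x F x * \int[lebR2]_x G x)%E.
Proof.
move=> mF mG F0 G0; have m := measurable_econv_integrand mF mG.
have p (z : (R * R) * (R * R)) : (0 <= F (sub2 z.1 z.2) * G z.2)%E by exact: mule_ge0.
rewrite -[LHS](tonelli1 lebR2 lebR2 m p) (tonelli2 lebR2 lebR2 m p) /=.
under eq_integral.
  move=> b _; rewrite ge0_integralZr//; first by rewrite int_sub2//; over.
  by mfun.
by rewrite ge0_integralZl// integral_ge0.
Qed.

Lemma econvDl F G H xi : measurable_fun setT F -> measurable_fun setT G -> measurable_fun setT H ->
  (forall x, 0 <= F x)%E -> (forall x, 0 <= G x)%E -> (forall x, 0 <= H x)%E ->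
  econv (fun x => F x + G x)%E H xi = (econv F H xi + econv G H xi)%E.
Proof.
move=> mF mG mH F0 G0 H0; rewrite /econv -ge0_integralD//.
- by apply: eq_integral => b _; rewrite ge0_muleDl.
- by move=> b _; exact: mule_ge0.
- by mfun.
- by move=> b _; exact: mule_ge0.
- by mfun.
Qed.

Lemma econvDr F G H xi : measurable_fun setT F -> measurable_fun setT G -> measurable_fun setT H ->
  (forall x, 0 <= F x)%E -> (forall x, 0 <= G x)%E -> (forall x, 0 <= H x)%E ->
  econv F (fun x => G x + H x)%E xi = (econv F G xi + econv F H xi)%E.
Proof.
move=> mF mG mH F0 G0 H0; rewrite /econv -ge0_integralD//.
- by apply: eq_integral => b _; rewrite ge0_muleDr.
- by move=> b _; exact: mule_ge0.
- by mfun.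
- by move=> b _; exact: mule_ge0.
- by mfun.
Qed.

Lemma le_econv F F' G G' xi : measurable_fun setT F -> measurable_fun setT G ->
  measurable_fun setT F' -> measurable_fun setT G' ->
  (forall x, 0 <= F x)%E -> (forall x, 0 <= G x)%E ->
  (forall x, F x <= F' x)%E -> (forall x, G x <= G' x)%E ->
  (econv F G xi <= econv F' G' xi)%E.
Proof.
move=> mF mG mF' mG' F0 G0 FF GG; apply: le_int.
- by move=> b; exact: mule_ge0.
- by mfun.
- by mfun.
- by move=> b; exact: lee_pmul.
Qed.

(* For [f] and [g] the Fourier transforms of two functions F and G, that of
   u_G . grad F is [Bker f g], the bilinear convolution with this kernel. *)
Definition ker xi b : R := cross xi b / enorm b / (2 * pi) ^+ 2.

Lemma two_pi_gt0 : 0 < (2 * pi) ^+ 2 :> R.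
Proof. by rewrite exprn_gt0// mulr_gt0// pi_gt0. Qed.

Lemma ker_le xi b : `|ker xi b| <= enorm xi / (2 * pi) ^+ 2.
Proof.
have p0 := two_pi_gt0.
rewrite /ker normrM [X in _ * X]ger0_norm ?invr_ge0 ?(ltW p0)// ler_wpM2r ?invr_ge0 ?(ltW p0)//.
rewrite normrM [X in _ * X]ger0_norm ?invr_ge0 ?enorm_ge0//.
(* At b = 0 the kernel is 0, since the inverse of 0 is 0. *)
have := enorm_ge0 b; rewrite le_eqVlt => /predU1P[<-|b0].
  by rewrite invr0 mulr0 enorm_ge0.
by rewrite ler_pdivrMr// cross_le.
Qed.

(** The cross product of b with itself vanishes, so xi may be replaced by xi - b in the kernel: the
    derivative can be put on the transported factor because the velocity is divergence free. *)
Lemma ker_le_sub xi b : `|ker xi b| <= enorm (sub2 xi b) / (2 * pi) ^+ 2.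
Proof.
have -> : ker xi b = ker (sub2 xi b) b; last exact: ker_le.
by rewrite /ker; congr (_ / _ / _); rewrite /cross /sub2 /=; ring.
Qed.

Definition Bker f g xi : R[i] :=
  cint lebR2 (fun b => (ker xi b)%:C * (f (sub2 xi b) * g b)).

Lemma cmeas_Bker_integrand f g : cmeas f -> cmeas g ->
  cmeas (fun z : (R * R) * (R * R) => (ker z.1 z.2)%:C * (f (sub2 z.1 z.2) * g z.2)).
Proof. by move=> mf mg; rewrite /ker; mfun. Qed.

Lemma cmeas_Bker f g : cmeas f -> cmeas g -> cmeas (Bker f g).
Proof. by move=> mf mg; exact: (cmeas_pint lebR2 (cmeas_Bker_integrand mf mg)). Qed.

Definition cconv f g xi : R[i] := cint lebR2 (fun b => f (sub2 xi b) * g b).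

Lemma cmeas_cconv_integrand f g : cmeas f -> cmeas g ->
  cmeas (fun z : (R * R) * (R * R) => f (sub2 z.1 z.2) * g z.2).
Proof. by move=> mf mg; mfun. Qed.

Lemma cabs_cconv f g xi :
  cabs lebR2 (fun b => f (sub2 xi b) * g b) =
  econv (fun x => (normc (f x))%:E) (fun x => (normc (g x))%:E) xi.
Proof. by apply: eq_integral => b _; rewrite normcM EFinM. Qed.

Lemma cintegrable_cconv_integrand f g : cintegrable lebR2 setT f -> cintegrable lebR2 setT g ->
  cintegrable (pmeas lebR2 lebR2) setT
    (fun z : (R * R) * (R * R) => f (sub2 z.1 z.2) * g z.2).
Proof.
move=> fi gi; have mf := cintegrable_meas fi; have mg := cintegrable_meas gi.
have m := cmeas_cconv_integrand mf mg.
apply/cintegrableP; split => //; rewrite (cabs_pmeas1 lebR2 lebR2 m) /=.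
under eq_integral do rewrite cabs_cconv.
rewrite int_econv.
- have := cabs_fin_num fi; have := cabs_fin_num gi; rewrite /cabs => h1 h2.
  by rewrite -(fineK h1) -(fineK h2) -EFinM ltry.
- exact: cmeas_enormc.
- exact: cmeas_enormc.
- by move=> x; rewrite lee_fin normc_ge0.
- by move=> x; rewrite lee_fin normc_ge0.
Qed.

Lemma cmeas_cconv f g : cmeas f -> cmeas g -> cmeas (cconv f g).
Proof. by move=> mf mg; exact: (cmeas_pint lebR2 (cmeas_cconv_integrand mf mg)). Qed.

Lemma cintegrable_cconv f g : cintegrable lebR2 setT f -> cintegrable lebR2 setT g ->
  cintegrable lebR2 setT (cconv f g).
Proof.
move=> fi gi.
exact: (cintegrable_pint (m1 := lebR2) (m2 := lebR2) (cintegrable_cconv_integrand fi gi)).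
Qed.

Lemma ae_cconv f g : cintegrable lebR2 setT f -> cintegrable lebR2 setT g ->
  {ae lebR2, forall xi, cintegrable lebR2 setT (fun b => f (sub2 xi b) * g b)}.
Proof.
move=> fi gi.
exact: (ae_cintegrable1 (m1 := lebR2) (m2 := lebR2) (cintegrable_cconv_integrand fi gi)).
Qed.

Lemma Bker_le f g xi : cmeas f -> cmeas g ->
  ((normc (Bker f g xi))%:E <= (enorm xi / (2 * pi) ^+ 2)%:E *
     econv (fun x => (normc (f x))%:E) (fun x => (normc (g x))%:E) xi)%E.
Proof.
move=> mf mg; have m1 : cmeas (fun b => (ker xi b)%:C * (f (sub2 xi b) * g b)).
  exact: (cmeas_comp (cmeas_Bker_integrand mf mg) (measurable_pair1 xi)).
have m2 : cmeas (fun b => f (sub2 xi b) * g b).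
  exact: (cmeas_comp (cmeas_cconv_integrand mf mg) (measurable_pair1 xi)).
rewrite -cabs_cconv; apply: (le_trans (normc_cint lebR2 m1)).
apply: (cabs_le_scale lebR2 m1 m2).
  by rewrite mulr_ge0 ?enorm_ge0// invr_ge0 ltW// two_pi_gt0.
move=> b; rewrite normcM normc_real; apply: ler_wpM2r; first exact: normc_ge0.
exact: ker_le.
Qed.

End Convolution.

(** * Distributions whose Fourier transform is integrable *)

Section Representation.
Context (R : realType).
Implicit Types (f g h phi psi : R * R -> R[i]) (T U : functional R) (x xi : R * R) (j : bool).
Local Notation L1 := (cintegrable lebR2 setT).

Lemma compact_bounded2 (K : set (R * R)) : compact K ->
  exists n : nat, K `<=` orect (- n%:R) n%:R (- n%:R) n%:R.
Proof.
move=> /compact_bounded; rewrite /bounded_set /bounded_near.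
move=> /pinfty_ex_gt0 [M M0 hM]; exists (Num.truncn M).+1 => x /hM /= xM.
have lt : `|x| < (Num.truncn M).+1%:R by apply: (le_lt_trans xM); exact: truncnS_gt.
by split; rewrite /= in_itv /= -ltr_norml (le_lt_trans _ lt) ?norm1_le ?norm2_le.
Qed.

Lemma lebR2_orect (a b c e : R) : (lebR2 (orect a b c e) < +oo)%E.
Proof.
rewrite /lebR2 /= /pmeas /orect product_measure1E//.
rewrite /lebR /= !lebesgue_measure_itv /=; case: ifP => _; case: ifP => _;
  by rewrite ?mule0 ?mul0e -?EFinB -?EFinM ?ltry.
Qed.

Lemma locally_integrable2_bounded h : cmeas h ->
  (forall n : nat, exists M, forall x, orect (- n%:R) n%:R (- n%:R) n%:R x -> normc (h x) <= M) ->
  locally_integrable2 h.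
Proof.
move=> mh bh; split; [exact: mh.1|exact: mh.2|move=> K cK].
have [n Kn] := compact_bounded2 cK; have [M hM] := bh n.
have mK := compact_measurable2 cK.
have mB := @measurable_orect R (- n%:R) n%:R (- n%:R) n%:R.
apply: (@le_lt_trans _ _ (\int[lebR2]_(x in orect (- n%:R) n%:R (- n%:R) n%:R) (normc (h x))%:E)%E).
  apply: ge0_subset_integral => //.
    by apply: (measurable_funS measurableT) => //; exact: cmeas_enormc.
  by move=> x _; rewrite lee_fin normc_ge0.
apply: (@le_lt_trans _ _ (\int[lebR2]_(x in orect (- n%:R) n%:R (- n%:R) n%:R) (cst M%:E x))%E).
  apply: ge0_le_integral => //; first by move=> x _; rewrite lee_fin normc_ge0.
    by apply: (measurable_funS measurableT) => //; exact: cmeas_enormc.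
rewrite integral_cst//; have := lebR2_orect (- n%:R) n%:R (- n%:R) n%:R.
have := @measure_ge0 _ _ R lebR2 (orect (- n%:R) n%:R (- n%:R) n%:R).
move=> m0 mlt; have mfin := ge0_fin_numE m0; rewrite mlt in mfin.
by rewrite -(fineK mfin) -EFinM ltry.
Qed.

(** The weight w, bounded on squares, is meant for the symbol of the advection term, which is
    controlled by |xi| times an integrable function. *)
Lemma locally_integrable2_L1M (w : R * R -> R) f : L1 f -> measurable_fun setT w ->
  (forall n : nat, exists M, forall x, orect (- n%:R) n%:R (- n%:R) n%:R x -> `|w x| <= M) ->
  forall h, cmeas h ->
  {ae lebR2, forall x, normc (h x) <= `|w x| * normc (f x)} -> locally_integrable2 h.
Proof.
move=> fi mw bw h mh hwf; split; [exact: mh.1|exact: mh.2|move=> K cK].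
have [n Kn] := compact_bounded2 cK; have [M hM] := bw n.
have mK := compact_measurable2 cK.
have mf := cintegrable_meas fi.
apply: (@le_lt_trans _ _ (\int[lebR2]_(x in K) (`|M| * normc (f x))%:E)%E).
  apply: ae_ge0_le_integral => //.
  - by move=> x _; rewrite lee_fin normc_ge0.
  - by apply: (measurable_funS measurableT) => //; exact: cmeas_enormc.
  - by move=> x _; rewrite lee_fin mulr_ge0 ?normc_ge0.
  - by apply: (measurable_funS measurableT) => //; mfun.
  - apply: ae_imply1 hwf => x hx Kx; rewrite lee_fin (le_trans hx)// ler_wpM2r ?normc_ge0//.
    by rewrite (le_trans (hM _ (Kn _ Kx)))// ler_norm.
apply: (@le_lt_trans _ _ (\int[lebR2]_x (`|M| * normc (f x))%:E)%E).
  apply: ge0_subset_integral => //.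
    by mfun.
  by move=> x _; rewrite lee_fin mulr_ge0 ?normc_ge0.
under eq_integral do rewrite EFinM.
rewrite ge0_integralZl_EFin//.
- by rewrite -/(cabs lebR2 f) -(fineK (cabs_fin_num fi)) -EFinM ltry.
- by move=> x _; rewrite lee_fin normc_ge0.
- exact: cmeas_enormc.
Qed.

Lemma locally_integrable2_L1 f : L1 f -> locally_integrable2 f.
Proof.
move=> fi; apply: (@locally_integrable2_L1M (fun=> 1) f fi).
- exact: measurable_cst.
- by move=> n; exists 1 => x _; rewrite normr1.
- exact: cintegrable_meas fi.
- by apply: aeW => x; rewrite normr1 mul1r.
Qed.

(** Makes the choice in [density] immaterial up to null sets. *)
Lemma is_density_ae T f g : is_density T f -> is_density T g ->
  {ae lebR2, forall x, f x = g x}.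
Proof.
move=> [[mf1 mf2 _] hf] [[mg1 mg2 _] hg].
have mf : cmeas f by split.
have mg : cmeas g by split.
have : {ae lebR2, forall x, f x - g x = 0}.
  apply: du_bois_reymond; first by mfun.
  move=> phi sphi; have [fi ef] := hf _ sphi; have [gi eg] := hg _ sphi.
  have -> : (fun x => (f x - g x) * phi x) = (fun x => f x * phi x - g x * phi x).
    by apply/funext => x; rewrite mulrBl.
  split; first exact: (@cintegrableB _ _ R lebR2 _ _ fi gi).
  rewrite (@cintB _ _ R lebR2 _ _ fi gi).
  by have := ef; rewrite eg /cint => ->; rewrite subrr.
by apply: ae_imply1 => x /eqP; rewrite subr_eq0 => /eqP.
Qed.

Lemma densityP T f : is_density T f -> is_density T (density T).
Proof. by move=> hf; apply: (@xgetI _ (fun=> 0) [set f | is_density T f] f). Qed.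

Lemma is_density_meas T f : is_density T f -> cmeas f.
Proof. by move=> [[? ? _] _]; split. Qed.

Lemma density_ae T f : is_density T f -> {ae lebR2, forall x, density T x = f x}.
Proof. by move=> hf; apply: is_density_ae (densityP hf) hf. Qed.

Lemma fhat_meas T g : is_density (distr_fourier T) g -> cmeas (fhat T).
Proof. by move=> /densityP/is_density_meas. Qed.

Lemma schwartz_bounded phi : schwartz phi ->
  exists2 M, 0 <= M & forall x, normc (phi x) <= M.
Proof.
move=> sp; have [M hM] := schwartz_bound 0 0 sp; exists M => [|x].
  by apply: (le_trans _ (hM (0, 0))); rewrite !expr0 !mul1r normc_ge0.
by have := hM x; rewrite !expr0 !mul1r.
Qed.

Lemma L1_schwartz f phi : L1 f -> schwartz phi -> L1 (fun x => f x * phi x).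
Proof.
move=> fi sp; have [M M0 hM] := schwartz_bounded sp.
exact: (cintegrableMr fi (schwartz_meas sp) M0 hM).
Qed.

(* The tempered distribution with Fourier transform [g] *)
Definition Fof g : functional R := fun phi =>
  cint lebR2 (fun xi => g xi * inv_fourier phi xi).

(** The interface between the two sides: elements of X^0 are handled through an integrable symbol,
    and equality of distributions is only tested on Schwartz functions. *)
Definition rep T g : Prop := L1 g /\ eq_distr T (Fof g).

Lemma rep_Fof g : L1 g -> rep (Fof g) g.
Proof. by move=> gi; split. Qed.

Lemma rep_density_fourier T g : rep T g -> is_density (distr_fourier T) g.
Proof.
move=> [gi e]; split; first exact: locally_integrable2_L1.
move=> phi sp; split; first exact: L1_schwartz.
by rewrite /distr_fourier e; [rewrite /Fof fourierK|exact: schwartz_fourier].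
Qed.

Lemma fhat_ae T g : is_density (distr_fourier T) g ->
  {ae lebR2, forall xi, fhat T xi = g xi}.
Proof. exact: density_ae. Qed.

Lemma rep_fhat T g : rep T g -> {ae lebR2, forall xi, fhat T xi = g xi}.
Proof. by move=> /rep_density_fourier/fhat_ae. Qed.

Lemma repN T g : rep T g -> rep (fun phi => - T phi) (fun xi => - g xi).
Proof.
move=> [gi e]; split; first exact: (@cintegrableN _ _ R lebR2).
move=> phi sp; rewrite e// /Fof.
rewrite -(@cintN _ _ R lebR2); first by apply: eq_cint => x; rewrite mulNr.
exact: (L1_schwartz gi (schwartz_inv_fourier sp)).
Qed.

Lemma repB T U f g : rep T f -> rep U g -> rep (T \- U) (fun xi => f xi - g xi).
Proof.
move=> [fi e] [gi e']; split; first exact: (@cintegrableB _ _ R lebR2).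
move=> phi sp; rewrite /= e// e'// /Fof.
have si := schwartz_inv_fourier sp.
rewrite -(@cintB _ _ R lebR2); first by apply: eq_cint => x; rewrite mulrBl.
  exact: (L1_schwartz fi si).
exact: (L1_schwartz gi si).
Qed.

Lemma Xnorm_rep (s : R) T g : is_density (distr_fourier T) g ->
  Xnorm s T = (\int[lebR2]_xi (enorm (xi : R * R) `^ s * normc (g xi))%:E)%E.
Proof.
move=> dg; have m := fhat_meas dg; have mg := is_density_meas dg.
have mp : measurable_fun setT (fun xi : R * R => enorm xi `^ s).
  exact: (measurableT_comp (measurable_powR s) (@measurable_enorm R)).
apply: ge0_ae_eq_integral => //.
- by mfun.
- by mfun.
- by move=> x _; rewrite lee_fin mulr_ge0 ?normc_ge0 ?powR_ge0.
- by move=> x _; rewrite lee_fin mulr_ge0 ?normc_ge0 ?powR_ge0.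
by apply: ae_imply1 (fhat_ae dg) => x ->.
Qed.

Lemma Xnorm0_rep T g : is_density (distr_fourier T) g -> Xnorm 0 T = cabs lebR2 g.
Proof.
move=> /(Xnorm_rep 0) ->; apply: eq_integral => x _.
by rewrite powRr0 mul1r.
Qed.

Lemma Xnorm1_rep T g : is_density (distr_fourier T) g ->
  Xnorm 1 T = (\int[lebR2]_xi (enorm (xi : R * R) * normc (g xi))%:E)%E.
Proof.
move=> /(Xnorm_rep 1) ->; apply: eq_integral => x _.
by rewrite powRr1// enorm_ge0.
Qed.

Lemma Xspace0_rep T : Xspace 0 T -> rep T (fhat T).
Proof.
move=> [_ [f df] n]; have m := fhat_meas df.
have fi : L1 (fhat T).
  apply/cintegrableP; split => //.
  by rewrite -(Xnorm0_rep (densityP df)).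
split => // phi sp; have si := schwartz_inv_fourier sp.
have [_ e] := (densityP df).2 _ si; rewrite -[phi in LHS]inv_fourierK//.
Qed.

Lemma schwartz_weighted_bounded phi p : schwartz phi -> has_ubound (range (weighted_partial p phi)).
Proof. by move=> [_ /(_ p)[M hM]]; exists M => _ [x _ <-]. Qed.

Lemma schwartz_seminorm_ge phi p x : schwartz phi ->
  weighted_partial p phi x <= schwartz_seminorm p phi.
Proof.
by move=> sp; apply: (ub_le_sup (schwartz_weighted_bounded p sp)); exists x.
Qed.

(** The pairing is bounded by the norm of g times the supremum of the inverse transform of phi,
    which the integral of |phi| controls. *)
Lemma tempered_Fof g : L1 g -> tempered (Fof g).
Proof.
move=> gi; have mg := cintegrable_meas gi; split.
  move=> a phi psi sp sq; rewrite /Fof.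
  have s1 := schwartz_inv_fourier sp; have s2 := schwartz_inv_fourier sq.
  have i1 := L1_schwartz gi s1; have i2 := L1_schwartz gi s2.
  rewrite -(cintZ _ i1) -(@cintD _ _ R lebR2)//; last exact: cintegrableZ.
  apply: eq_cint => xi; rewrite !inv_fourierE /FT.
  rewrite [X in _ = X + _]mulrCA -mulrDr; congr (_ * _); rewrite [X in _ = X + _]mulrCA -mulrDr; congr (_ * _).
  have j1 := FT_int 1 xi sp; have j2 := FT_int 1 xi sq.
  rewrite -(cintZ _ j1) -(@cintD _ _ R lebR2)//; last exact: cintegrableZ.
  by apply: eq_cint => x; rewrite mulrDr mulrCA.
(* These seminorms come from expanding (1 + x1^2)(1 + x2^2), the inverse of the weight. *)
pose ps : seq ((nat * nat) * seq bool) :=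
  [:: (0, 0, [::]); (2, 0, [::]); (0, 2, [::]); (2, 2, [::])]%N.
exists ps, (fine (cabs lebR2 g) * ((2 * pi) ^- 2 * pi ^+ 2)) => phi sp.
pose S := \sum_(p <- ps) schwartz_seminorm p phi.
have dec x : normc (phi x) <= S * wgt x.
  have w0 : 0 < (1 + x.1 ^+ 2) * (1 + x.2 ^+ 2) :> R.
    by rewrite mulr_gt0// ltr_pwDl// sqr_ge0.
  rewrite wgtE -invfM ler_pdivlMr// /S !big_cons big_nil.
  have h a b := schwartz_seminorm_ge (a, b, [::]) x sp.
  have := h 0%N 0%N; have := h 2%N 0%N; have := h 0%N 2%N; have := h 2%N 2%N.
  rewrite /weighted_partial /= !expr0 !real_normK ?num_real// !mul1r mulr1.
  set n := normc _; nra.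
have ib xi : normc (inv_fourier phi xi) <= (2 * pi) ^- 2 * (S * pi ^+ 2).
  rewrite inv_fourierE normcM normc_real ger0_norm; last first.
    by rewrite invr_ge0 ltW// two_pi_gt0.
  apply: ler_wpM2l; first by rewrite invr_ge0 ltW// two_pi_gt0.
  apply: normc_cint_wgt; first exact: FT_meas (schwartz_meas sp).
  by move=> x; rewrite normcM normc_cexpi mul1r.
have S0 : 0 <= (2 * pi) ^- 2 * (S * pi ^+ 2) by apply: le_trans (ib (0, 0)); exact: normc_ge0.
have si := schwartz_inv_fourier sp; have msi := schwartz_meas si.
have := L1_schwartz gi si => gsi.
rewrite -lee_fin /Fof (le_trans (normc_cint lebR2 (cintegrable_meas gsi)))//.
have := cabs_le_scale lebR2 (cintegrable_meas gsi) mg S0.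
move=> h; apply: (le_trans (h _)).
  by move=> x; rewrite normcM mulrC ler_wpM2r ?normc_ge0.
rewrite -{1}(fineK (cabs_fin_num gi)) -EFinM lee_fin.
by rewrite le_eqVlt; apply/orP; left; apply/eqP; rewrite -/S; ring.
Qed.

Lemma Xspace0_Fof g : L1 g -> Xspace 0 (Fof g).
Proof.
move=> gi; have dg := rep_density_fourier (rep_Fof gi).
split; [exact: tempered_Fof|by exists g|].
by rewrite (Xnorm0_rep dg) cintegrable_lty.
Qed.

Lemma FT_cmeas (e : R) f : cmeas f -> cmeas (FT e f).
Proof.
move=> mf; apply: (cmeas_pint lebR2 (F := fun z : (R * R) * (R * R) =>
  cexpi (e * dotp z.1 z.2) * f z.2)).
by mfun.
Qed.

Lemma FT_L1 (e : R) f x : L1 f -> L1 (fun xi => cexpi (e * dotp x xi) * f xi).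
Proof.
move=> fi; apply: (cintegrableMl fi (M := 1)) => //.
  by mfun.
by move=> y; rewrite normc_cexpi.
Qed.

Lemma FT_L1_bound (e : R) f x : L1 f -> normc (FT e f x) <= fine (cabs lebR2 f).
Proof.
move=> fi; rewrite -lee_fin fineK ?cabs_fin_num//.
apply: (le_trans (normc_cint lebR2 (FT_meas e x (cintegrable_meas fi)))).
apply: cabs_le; [exact: (FT_meas e x (cintegrable_meas fi))|exact: (cintegrable_meas fi)|].
by move=> y; rewrite normcM normc_cexpi mul1r.
Qed.

Lemma FT_L1_mul (e : R) f h : L1 f -> L1 h -> L1 (fun x => FT e f x * h x).
Proof.
move=> fi hi; apply: (cintegrableMl hi (M := fine (cabs lebR2 f))).
- exact: (FT_cmeas e (cintegrable_meas fi)).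
- by rewrite fine_ge0// cabs_ge0.
- by move=> x; exact: FT_L1_bound.
Qed.

Lemma FT_duality (e : R) f h : L1 f -> L1 h ->
  cint lebR2 (fun x => FT e f x * h x) = cint lebR2 (fun xi => f xi * FT e h xi).
Proof.
move=> fi hi; have mf := cintegrable_meas fi; have mh := cintegrable_meas hi.
pose F (z : (R * R) * (R * R)) := cexpi (e * dotp z.1 z.2) * f z.2 * h z.1.
have mF : cmeas F by rewrite /F; mfun.
have Fi : cintegrable (pmeas lebR2 lebR2) setT F.
  apply/cintegrableP; split => //; rewrite (cabs_pmeas1 lebR2 lebR2 mF) /F /=.
  have E x : cabs lebR2 (fun y => cexpi (e * dotp x y) * f y * h x) =
      (cabs lebR2 f * (normc (h x))%:E)%E.
    rewrite muleC -cabsZ//; apply: eq_integral => y _.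
    by rewrite !normcM normc_cexpi mul1r mulrC.
  under eq_integral do rewrite E.
  rewrite (@ge0_integralM_r _ _ R lebR2).
  - have := cabs_fin_num fi; have := cabs_fin_num hi; rewrite /cabs => h1 h2.
    by rewrite -(fineK h1) -(fineK h2) -EFinM ltry.
  - exact: cmeas_enormc.
  - by move=> x; rewrite lee_fin normc_ge0.
  - exact: cabs_ge0.
have := cint_swap Fi; rewrite /F /= => E.
rewrite (_ : cint lebR2 (fun x => FT e f x * h x) =
  cint lebR2 (fun x => cint lebR2 (fun y => cexpi (e * dotp x y) * f y * h x))).
  rewrite E; apply: eq_cint => y; rewrite /FT -(cintZ (f y)).
    by apply: eq_cint => x; rewrite dotpC; ring.
  exact: FT_L1.
apply: eq_cint => x; rewrite mulrC /FT -(cintZ (h x)).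
  by apply: eq_cint => y; rewrite mulrC.
exact: FT_L1.
Qed.

Definition phys g x : R[i] := ((2 * pi) ^- 2)%:C * FT 1 g x.

Lemma phys_cmeas g : cmeas g -> cmeas (phys g).
Proof. by move=> mg; apply: cmeasM; [exact: cmeas_cst|exact: FT_cmeas]. Qed.

Lemma phys_bound g x : L1 g -> normc (phys g x) <= (2 * pi) ^- 2 * fine (cabs lebR2 g).
Proof.
move=> gi; rewrite normcM normc_real ger0_norm; last by rewrite invr_ge0 ltW// two_pi_gt0.
by rewrite ler_wpM2l ?FT_L1_bound// invr_ge0 ltW// two_pi_gt0.
Qed.

Lemma phys_ge0 g : L1 g -> 0 <= (2 * pi) ^- 2 * fine (cabs lebR2 g).
Proof. by move=> gi; apply: le_trans (phys_bound (0, 0) gi); exact: normc_ge0. Qed.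

Lemma phys_duality g h : L1 g -> L1 h ->
  cint lebR2 (fun x => phys g x * h x) = cint lebR2 (fun xi => g xi * phys h xi).
Proof.
move=> gi hi; rewrite /phys.
rewrite (@eq_cint _ _ R lebR2 _ (fun x => ((2 * pi) ^- 2)%:C * (FT 1 g x * h x))); last first.
  by move=> x; rewrite mulrA.
rewrite (cintZ _ (FT_L1_mul 1 gi hi)) (FT_duality 1 gi hi) -cintZ.
  by apply: eq_cint => x; ring.
have := FT_L1_mul 1 hi gi.
by under eq_fun do rewrite mulrC.
Qed.

(** By duality. The distribution is therefore a bounded function, which gives a meaning to the
    pointwise product in [distr_mul]. *)
Lemma rep_density T g : rep T g -> is_density T (phys g).
Proof.
move=> [gi e]; have mg := cintegrable_meas gi; have mp := phys_cmeas mg; split.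
  apply: locally_integrable2_bounded => // n.
  by exists ((2 * pi) ^- 2 * fine (cabs lebR2 g)) => x _; exact: phys_bound.
move=> phi sp; have ip := schwartz_int sp; split.
  apply: (cintegrableMl ip mp (phys_ge0 gi)).
  by move=> x; exact: phys_bound.
rewrite e// /Fof; have := phys_duality gi ip; rewrite /cint => ->.
by rewrite inv_fourierE.
Qed.

(* Fourier symbols of theta |-> - R_2 theta and theta |-> R_1 theta *)
Definition vsym j xi : R[i] :=
  if j then 0 -i* (xi.1 / enorm xi) else 0 +i* (xi.2 / enorm xi).

Lemma vsym_le1 j xi : normc (vsym j xi) <= 1.
Proof.
have h (a : R) : `|a| <= enorm xi -> `|a / enorm xi| <= 1.
  move=> ha; rewrite normrM [X in _ * X]ger0_norm ?invr_ge0 ?enorm_ge0//.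
  have := enorm_ge0 xi; rewrite le_eqVlt => /predU1P[<-|e0].
    by rewrite invr0 mulr0.
  by rewrite ler_pdivrMr// mul1r.
apply: (le_trans (normc_le_abs _)).
by case: j => /=; rewrite normr0 add0r ?normrN h ?abs1_le_enorm ?abs2_le_enorm.
Qed.

Lemma rep_mult (m : R * R -> R[i]) T g : rep T g -> cmeas m ->
  (forall xi, normc (m xi) <= 1) -> rep (mult m T) (fun xi => m xi * g xi).
Proof.
move=> r mm m1; have mg := cintegrable_meas r.1.
have mf := fhat_meas (rep_density_fourier r).
split; first exact: (cintegrableMl r.1 mm ler01).
move=> phi sp; have ms := schwartz_meas (schwartz_inv_fourier sp).
apply: ae_cint; [by mfun|by mfun|].
by apply: ae_imply1 (rep_fhat r) => x ->.
Qed.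

Lemma rep_velocity j T g : rep T g -> rep (velocity j T) (fun xi => vsym j xi * g xi).
Proof.
move=> r; have le1 k xi : normc (0 -i* (coord2 k xi / enorm xi) : R[i]) <= 1.
  have := vsym_le1 (~~ k) xi.
  case: k => /=; rewrite /vsym /coord2 //=.
  by move=> h; rewrite -normcNE (_ : - _ = 0 +i* (xi.2 / enorm xi))//; congr (_ +i* _); rewrite ?oppr0 ?opprK.
have me := @measurable_enorm R; have mm k : cmeas (fun xi : R * R => 0 -i* (coord2 k xi / enorm xi) : R[i]) by mfun.
case: j => /=; first exact: (rep_mult r (mm false) (le1 false)).
have := repN (rep_mult r (mm true) (le1 true)).
rewrite (_ : (fun xi => - _) = (fun xi => vsym false xi * g xi))//.
apply/funext => xi; rewrite -mulNr; congr (_ * _); rewrite /vsym /coord2.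
by congr (_ +i* _); rewrite ?oppr0 ?opprK.
Qed.

(** The convolution theorem, tested on psi. Duality is applied for f and then for g; the phases
    combine, and inversion, which is used on psi only, leaves the double integral of f(a) g(b) psi(a
    + b). A translation by b turns it into the pairing of the convolution with psi. *)
Lemma phys_mul_FT f g psi : L1 f -> L1 g -> schwartz psi ->
  cint lebR2 (fun x => phys f x * phys g x * FT (-1) psi x) =
  ((2 * pi) ^- 2)%:C * cint lebR2 (fun xi => cconv f g xi * psi xi).
Proof.
move=> fi gi sp.
have mf := cintegrable_meas fi; have mg := cintegrable_meas gi.
have e1 : (-1 : R) ^+ 2 = 1 by rewrite sqrrN expr1n.
have sF := FT_schwartz e1 sp; have Fi := schwartz_int sF.
have hi : L1 (fun x => phys g x * FT (-1) psi x).
  apply: (cintegrableMl Fi (phys_cmeas mg) (phys_ge0 gi)).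
  by move=> x; exact: phys_bound.
rewrite (@eq_cint _ _ R lebR2 _ (fun x => phys f x * (phys g x * FT (-1) psi x))); last first.
  by move=> x; rewrite mulrA.
rewrite (phys_duality fi hi).
have inner a : phys (fun x => phys g x * FT (-1) psi x) a =
   ((2 * pi) ^- 2)%:C * cint lebR2 (fun b => g b * psi (a.1 + b.1, a.2 + b.2)).
  rewrite /phys; congr (_ * _); rewrite /FT.
  rewrite (@eq_cint _ _ R lebR2 _ (fun x => phys g x * (cexpi (1 * dotp a x) * FT (-1) psi x))); last first.
    by move=> x; rewrite /phys /FT; ring.
  rewrite (phys_duality gi (FT_L1 1 a Fi)); apply: eq_cint => b; congr (_ * _).
  rewrite /phys {1}/FT.
  rewrite (@eq_cint _ _ R lebR2 _ (fun x => cexpi (- -1 * dotp (a.1 + b.1, a.2 + b.2) x) * FT (-1) psi x)); last first.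
    move=> x; rewrite mulrA -cexpiD; congr (cexpi _ * _).
    by rewrite /dotp /=; ring.
  rewrite -/(FT _ _ _) FT_inversion// mulrA -rmorphM mulVf ?mul1r//.
  by rewrite gt_eqF// two_pi_gt0.
under eq_fun do rewrite inner.
have [M M0 hM] := schwartz_bounded sp; have mpsi := schwartz_meas sp.
have G1i : cintegrable (pmeas lebR2 lebR2) setT
    (fun z : (R * R) * (R * R) => f (sub2 z.1 z.2) * g z.2 * psi z.1).
  apply: (cintegrableMr (cintegrable_cconv_integrand fi gi) _ M0); first by mfun.
  by move=> z.
pose G (z : (R * R) * (R * R)) := f z.1 * g z.2 * psi (z.1.1 + z.2.1, z.1.2 + z.2.2).
have mG : cmeas G by rewrite /G; mfun.
have fgi : cintegrable (pmeas lebR2 lebR2) setT (fun z : (R * R) * (R * R) => f z.1 * g z.2).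
  have m : cmeas (fun z : (R * R) * (R * R) => f z.1 * g z.2) by mfun.
  apply/cintegrableP; split => //; rewrite (cabs_pmeas1 lebR2 lebR2 m) /=.
  under eq_integral do rewrite cabsZ//.
  rewrite (@ge0_integralM_l _ _ R lebR2).
  - have := cabs_fin_num fi; have := cabs_fin_num gi; rewrite /cabs => h1 h2.
    by rewrite -(fineK h1) -(fineK h2) -EFinM ltry.
  - exact: cmeas_enormc.
  - by move=> x; rewrite lee_fin normc_ge0.
  - exact: cabs_ge0.
have Gi : cintegrable (pmeas lebR2 lebR2) setT G.
  apply: (cintegrableMr fgi _ M0); first by mfun.
  by move=> z.
rewrite (@eq_cint _ _ R lebR2 _ (fun a => ((2 * pi) ^- 2)%:C * cint lebR2 (fun b => G (a, b)))); last first.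
  move=> a; rewrite mulrCA; congr (_ * _).
  have [fa0|fa0] := eqVneq (f a) 0.
    rewrite fa0 mul0r -[LHS](@cint0 _ _ R lebR2); apply: eq_cint => b.
    by rewrite /G /= fa0 !mul0r.
  rewrite -cintZ; first by apply: eq_cint => b; rewrite /G /= mulrA.
  apply: (cintegrableMr gi _ M0); last by move=> b.
  by apply: (cmeas_comp mpsi); mfun.
rewrite cintZ; last exact: (cintegrable_pint Gi).
congr (_ * _); rewrite (cint_swap Gi).
rewrite [RHS](_ : _ = cint lebR2 (fun xi => cint lebR2 (fun b => f (sub2 xi b) * g b * psi xi))); last first.
  apply: ae_cint.
  - by apply: cmeasM => //; apply: cmeas_cconv.
  - exact: (cmeas_pint lebR2 (F := fun z : (R * R) * (R * R) => f (sub2 z.1 z.2) * g z.2 * psi z.1)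
      (cintegrable_meas G1i)).
  - apply: ae_imply1 (ae_cconv fi gi) => xi fgi'.
    rewrite mulrC /cconv -cintZ//; apply: eq_cint => b; exact: mulrC.
rewrite (cint_swap G1i); apply: eq_cint => b /=.
rewrite -(@cint2_shift R (fun xi => f (sub2 xi b) * g b * psi xi) b); last by mfun.
apply: eq_cint => a; rewrite /G /sub2 /=.
by rewrite !addrK; case: a.
Qed.

(** Collects the origin of each factor of the kernel: the minus sign of the transposed derivative,
    (2 pi)^-2 of the product, - i xi_j of the derivative of a Fourier transform, and the symbols of
    the velocity at b. *)
Lemma ker_vsym xi b : (ker xi b)%:C =
  - ((2 * pi) ^- 2)%:C * ('i * (-1)%:C) *
    ((coord2 false xi)%:C * vsym false b + (coord2 true xi)%:C * vsym true b).
Proof.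
rewrite /ker /vsym /cross /coord2; apply/eqP; rewrite eq_complex /=.
by apply/andP; split; apply/eqP; ring.
Qed.

Lemma locally_integrable2_Bker g : L1 g -> locally_integrable2 (Bker g g).
Proof.
move=> gi; have mg := cintegrable_meas gi.
pose G x := (normc (g x))%:E.
have mG : measurable_fun setT G by exact: cmeas_enormc.
have G0 x : (0 <= G x)%E by rewrite lee_fin normc_ge0.
have mE := measurable_econv mG mG G0 G0.
have E0 x := econv_ge0 x G0 G0.
have iE : (\int[lebR2]_x econv G G x < +oo)%E.
  rewrite int_econv// -/(cabs lebR2 g).
  by rewrite -(fineK (cabs_fin_num gi)) -EFinM ltry.
have mf : measurable_fun setT (fun x => fine (econv G G x)).
  by apply: measurableT_comp mE.
have fi : L1 (fun x => (fine (econv G G x))%:C).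
  apply/cintegrableP; split; first by mfun.
  apply: le_lt_trans iE; apply: le_int => //.
  - by move=> x; rewrite lee_fin normc_ge0.
  - by mfun.
  - move=> x; rewrite normc_real ger0_norm ?fine_ge0//.
    by have := E0 x; case: (econv _ _ _) => // _; rewrite leey.
pose w (x : R * R) := enorm x / (2 * pi) ^+ 2.
have p0 := @two_pi_gt0 R.
have w0 x : 0 <= w x by rewrite /w mulr_ge0 ?enorm_ge0// invr_ge0 ltW.
apply: (@locally_integrable2_L1M w _ fi).
- by have me := @measurable_enorm R; rewrite /w; mfun.
- move=> n; exists ((n%:R + n%:R) / (2 * pi) ^+ 2) => x [].
  rewrite /= !in_itv /= -!ltr_norml => h1 h2.
  rewrite ger0_norm// /w ler_wpM2r ?invr_ge0 ?(ltW p0)//.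
  rewrite (le_trans (enorm_le_abs _))//.
  by rewrite lerD// ltW.
- exact: cmeas_Bker.
- have := @ae_lty R _ _ lebR2 _ mE E0 iE; apply: ae_imply1 => x xlt.
  rewrite ger0_norm// normc_real ger0_norm ?fine_ge0// -lee_fin EFinM fineK.
    exact: Bker_le.
  by rewrite ge0_fin_numE.
Qed.

(** The derivatives fall on the transform of the test function, where they become multiplications
    inside the integral; the convolution theorem treats each component and [ker_vsym] adds them up.
    The conclusion is a density and not [rep], as the symbol is only controlled by |xi| times an
    integrable function. *)
Lemma rep_advection T g : rep T g ->
  is_density (distr_fourier (advection T T)) (Bker g g).
Proof.
move=> r; have gi := r.1; have mg := cintegrable_meas gi.
have mB := cmeas_Bker mg mg; split; first exact: locally_integrable2_Bker.
move=> phi sp.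
pose v j xi := vsym j xi * g xi.
have vi j : L1 (v j) := (rep_velocity j r).1.
pose chi j xi := 'i * (-1)%:C * ((coord2 j xi)%:C * phi xi).
have sc j : schwartz (chi j) by apply: schwartzZ; exact: schwartz_coordM.
have dT := rep_density r; have dv j := rep_density (rep_velocity j r).
have ci j := cintegrable_cconv gi (vi j).
have cci j : L1 (fun xi => cconv g (v j) xi * chi j xi) by exact: L1_schwartz (ci j) (sc j).
have DM j : distr_mul T (velocity j T) (partial j (fourier phi)) =
    ((2 * pi) ^- 2)%:C * cint lebR2 (fun xi => cconv g (v j) xi * chi j xi).
  rewrite -(phys_mul_FT gi (vi j) (sc j)).
  have -> : partial j (fourier phi) = FT (-1) (chi j).
    by apply/funext => x; rewrite fourierE; have [_ ->] := FT_diff (-1) x sp.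
  have mF : cmeas (FT (-1) (chi j)) by apply: FT_cmeas; exact: schwartz_meas.
  have m1 := is_density_meas dT; have m2 := is_density_meas (dv j).
  have m3 := is_density_meas (densityP dT); have m4 := is_density_meas (densityP (dv j)).
  apply: ae_cint; [by mfun|by mfun|].
  by apply: ae_imply2 (density_ae dT) (density_ae (dv j)) => x -> ->.
pose c : R[i] := - ((2 * pi) ^- 2)%:C.
have sumi : L1 (fun xi => c * (cconv g (v false) xi * chi false xi + cconv g (v true) xi * chi true xi)).
  apply: cintegrableZ; exact: (@cintegrableD _ _ R lebR2 _ _ (cci false) (cci true)).
have E : {ae lebR2, forall xi, c * (cconv g (v false) xi * chi false xi + cconv g (v true) xi * chi true xi)
   = Bker g g xi * phi xi}.
  apply: ae_imply2 (ae_cconv gi (vi false)) (ae_cconv gi (vi true)) => xi i1 i2.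
  rewrite /chi.
  transitivity ((c * ('i * (-1)%:C) * (coord2 false xi)%:C * cconv g (v false) xi +
     c * ('i * (-1)%:C) * (coord2 true xi)%:C * cconv g (v true) xi) * phi xi); first by ring.
  congr (_ * _); rewrite /cconv -!cintZ// -(@cintD _ _ R lebR2); last 2 first.
    exact: cintegrableZ.
    exact: cintegrableZ.
  by apply: eq_cint => b; rewrite ker_vsym /v -/c; ring.
have mBp : cmeas (fun xi => Bker g g xi * phi xi) by have := schwartz_meas sp => ?; mfun.
split; first exact: (ae_cintegrable sumi mBp E).
transitivity (cint lebR2 (fun xi => c * (cconv g (v false) xi * chi false xi + cconv g (v true) xi * chi true xi))).
  rewrite cintZ; last exact: (@cintegrableD _ _ R lebR2 _ _ (cci false) (cci true)).
  rewrite (@cintD _ _ R lebR2 _ _ (cci false) (cci true)).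
  rewrite /distr_fourier /advection /distr_partial (DM false) (DM true) /c.
  by move: (cint _ _) (cint _ _) => A B; ring.
exact: (ae_cint (cintegrable_meas sumi) mBp E).
Qed.

End Representation.

(** * The bilinear Duhamel operator and its majorants *)

Section Duhamel.
Context (R : realType).
Local Notation mR := (measurableTypeR R).
Implicit Types (f h : R -> R * R -> R[i]) (F H : R * R -> \bar R) (xi : R * R) (t : R)
  (z : R * (R * R)).

Definition lebR3 : {sigma_finite_measure set (mR * (mR * mR))%type -> \bar R} :=
  pmeas (@lebR R) (@lebR2 R).

Definition invc : R := ((2 * pi) ^+ 2)^-1.

Lemma invc_gt0 : 0 < invc. Proof. by rewrite invr_gt0 two_pi_gt0. Qed.

Lemma invc_ge0 : 0 <= invc. Proof. exact: ltW invc_gt0. Qed.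

(** From pi >= 2; this is the numerical fact behind both the invariant bound of the iteration and
    the absorption in the uniqueness proof. *)
Lemma invc_lt : invc < 4^-1.
Proof.
rewrite /invc ltf_pV2 ?posrE ?two_pi_gt0//.
by have := @pi_ge2 R; rewrite exprMn => h; nra.
Qed.

(** For a > 0 this is the total mass of an exponential law translated by s; for a = 0 the integrand
    vanishes, whence an inequality. It is the gain of one derivative by e^{-t|D|}. *)
Lemma exp_time_int (a s : R) : 0 <= a ->
  (\int[lebR]_t (if s <= t then a * expR (- ((t - s) * a)) else 0)%:E <= 1)%E.
Proof.
rewrite le_eqVlt => /predU1P[<-|a0].
  rewrite integral0_eq// => t _.
  by case: ifP => // _; rewrite mul0r.
have := @ge0_int_shift R (fun t => (exponential_pdf a t)%:E) (- s).
rewrite [X in (_ -> _ -> _ = X) -> _]integral_exponential_pdf//.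
have -> : (fun t => (exponential_pdf a (t + - s))%:E) =
   (fun t => (if s <= t then a * expR (- ((t - s) * a)) else 0)%:E).
  apply/funext => t; congr (_%:E); case: (leP s t) => st.
    by rewrite exponential_pdfE ?subr_ge0//=; congr (_ * expR _); ring.
  by rewrite lt0_exponential_pdf// subr_lt0.
move=> -> //.
- by apply/measurable_EFinP; exact: measurable_exponential_pdf.
- by move=> x; rewrite lee_fin exponential_pdf_ge0// ltW.
Qed.

(** Joint measurability in time and frequency, which Fubini in time needs and which measurability at
    each time does not give. *)
Definition jmeas f : Prop := cmeas (fun z : R * (R * R) => f z.1 z.2).

Lemma jmeas_slice f t : jmeas f -> cmeas (f t).
Proof. by move=> mf; exact: (cmeas_comp mf (measurable_pair1 t)). Qed.

(** The restriction to 0 <= s <= t is a test in the integrand, so that the domain of integration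
    does not move with t. *)
Definition dui f h t xi z : R[i] :=
  if (0 <= z.1) && (z.1 <= t) then
    (expR (- ((t - z.1) * enorm xi)) * ker xi z.2)%:C * (f z.1 (sub2 xi z.2) * h z.1 z.2)
  else 0.

(* int_0^t e^{-(t - s)|D|} (u_h . grad f)(s) ds on the Fourier side, as a single
   integral over (s, eta) *)
Definition Bop f h t xi : R[i] := cint lebR3 (dui f h t xi).

Lemma jmeas_dui f h : jmeas f -> jmeas h ->
  cmeas (fun y : (R * (R * R)) * (R * (R * R)) => dui f h y.1.1 y.1.2 y.2).
Proof.
move=> mf mh; rewrite /dui.
have m1 : cmeas (fun y : (R * (R * R)) * (R * (R * R)) => f y.2.1 (sub2 y.1.2 y.2.2)).
  by apply: (cmeas_comp mf (g := fun y : (R * (R * R)) * (R * (R * R)) => (y.2.1, sub2 y.1.2 y.2.2))); mfun.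
have m2 : cmeas (fun y : (R * (R * R)) * (R * (R * R)) => h y.2.1 y.2.2).
  by apply: (cmeas_comp mh (g := fun y : (R * (R * R)) * (R * (R * R)) => (y.2.1, y.2.2))); mfun.
apply: cmeas_if; [by mfun| |exact: cmeas_cst].
apply: cmeasM; last exact: cmeasM.
by rewrite /ker; mfun.
Qed.

Lemma dui_cmeas f h t xi : jmeas f -> jmeas h -> cmeas (dui f h t xi).
Proof.
move=> mf mh; exact: (cmeas_comp (jmeas_dui mf mh) (measurable_pair1 (t, xi))).
Qed.

Lemma jmeas_Bop f h : jmeas f -> jmeas h -> jmeas (Bop f h).
Proof. by move=> mf mh; exact: (cmeas_pint lebR3 (jmeas_dui mf mh)). Qed.

Definition timeint f (x : R * R) : \bar R :=
  (\int[lebR]_t (if 0 <= t then enorm x * normc (f t x) else 0)%:E)%E.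

Lemma measurable_timeint_integrand f : jmeas f ->
  measurable_fun setT (fun z : R * (R * R) =>
    (if 0 <= z.1 then enorm z.2 * normc (f z.1 z.2) else 0)%:E).
Proof.
move=> mf; have m := cmeas_normc mf; have me := @measurable_enorm R.
by apply: mf_EFin; apply: measurable_fun_ifT; mfun.
Qed.

Lemma timeint_integrand_ge0 f z : (0 <= (if 0 <= z.1 then enorm z.2 * normc (f z.1 z.2) else 0)%:E)%E.
Proof. by rewrite lee_fin; case: ifP => // _; rewrite mulr_ge0 ?enorm_ge0 ?normc_ge0. Qed.

Lemma measurable_timeint f : jmeas f -> measurable_fun setT (timeint f).
Proof.
move=> mf; apply: (measurable_tonelli2 lebR (measurable_timeint_integrand mf)).
exact: timeint_integrand_ge0.
Qed.

(** The majorant is extended-valued and the bounds hold at every frequency; null sets enter only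
    when its integral is known to be finite. *)
Definition maj f F : Prop :=
  [/\ jmeas f, measurable_fun setT F, forall x, (0 <= F x)%E,
      forall t x, 0 <= t -> ((normc (f t x))%:E <= F x)%E &
      forall x, (timeint f x <= F x)%E].

(** A majorant of |[dui]| that is free of t: the kernel is bounded through |xi - b|, which stands
    next to f, and h is replaced by its majorant. Its integral in time is [timeint f] at xi - b
    times the remaining factor. *)
Definition wdui f H xi z : \bar R :=
  ((if 0 <= z.1 then enorm (sub2 xi z.2) * normc (f z.1 (sub2 xi z.2)) else 0)%:E *
   (invc%:E * H z.2))%E.

Lemma wdui_ge0 f H xi z : (forall x, 0 <= H x)%E -> (0 <= wdui f H xi z)%E.
Proof.
move=> H0; rewrite mule_ge0// ?mule_ge0 ?lee_fin ?invc_ge0//.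
by case: ifP => // _; rewrite mulr_ge0 ?enorm_ge0 ?normc_ge0.
Qed.

Lemma measurable_wdui f H xi : jmeas f -> measurable_fun setT H ->
  measurable_fun setT (wdui f H xi).
Proof.
move=> mf mH; have m := measurable_timeint_integrand mf.
apply: emeasurable_funM.
  apply: (measurableT_comp m (g := fun z : R * (R * R) => (z.1, sub2 xi z.2))).
  by mfun.
by mfun.
Qed.

Lemma int_wdui f F H xi : maj f F -> measurable_fun setT H -> (forall x, 0 <= H x)%E ->
  (\int[lebR3]_z wdui f H xi z <= invc%:E * econv F H xi)%E.
Proof.
move=> [mf mF F0 _ tf] mH H0.
rewrite (tonelli2 lebR lebR2 (measurable_wdui xi mf mH))//; last first.
  by move=> z; exact: wdui_ge0.
have mt := measurable_timeint mf.
rewrite /econv -ge0_integralZl_EFin ?invc_ge0//; last 2 first.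
  by move=> x _; rewrite mule_ge0.
  by mfun.
apply: le_int.
- by move=> y; apply: integral_ge0 => x _; exact: wdui_ge0.
- apply: (measurable_tonelli2 lebR (measurable_wdui xi mf mH)).
  by move=> z; exact: wdui_ge0.
- by mfun.
- move=> y; rewrite /wdui /=.
  rewrite (@ge0_integralM_l _ _ R lebR); last 3 first.
  + have m := measurable_timeint_integrand mf.
    apply: (measurableT_comp m (g := fun t : R => (t, sub2 xi y))).
    by mfun.
  + by move=> t; exact: (timeint_integrand_ge0 f (t, sub2 xi y)).
  + by rewrite mule_ge0// lee_fin invc_ge0.
  rewrite muleCA; apply: lee_wpmul2l; first by rewrite lee_fin invc_ge0.
  by apply: lee_wpmul2r => //; exact: tf.
Qed.

(** The heat factor is kept here because its integral over t yields the bound on [timeint]; for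
    bounds at a fixed time it is estimated by 1. *)
Lemma dui_le f h H t xi z : (forall t x, 0 <= t -> ((normc (h t x))%:E <= H x)%E) ->
  (forall x, 0 <= H x)%E ->
  ((normc (dui f h t xi z))%:E <=
   (if z.1 <= t then expR (- ((t - z.1) * enorm xi)) else 0)%:E * wdui f H xi z)%E.
Proof.
move=> hH H0; rewrite /dui; case: ifP => [/andP[z0 zt]|_]; last first.
  rewrite normc0 mule_ge0 ?wdui_ge0// lee_fin; case: ifP => // _; exact: expR_ge0.
rewrite zt /wdui z0 !normcM normc_real normrM [`|expR _|]ger0_norm ?expR_ge0//.
rewrite -!mulrA EFinM; apply: lee_wpmul2l; first by rewrite lee_fin expR_ge0.
rewrite muleA -EFinM mulrA [in leLHS]EFinM; apply: lee_pmul; last exact: hH.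
- by rewrite lee_fin mulr_ge0 ?normc_ge0.
- by rewrite lee_fin normc_ge0.
- rewrite lee_fin mulrAC ler_wpM2r ?normc_ge0//; exact: ker_le_sub.
Qed.

Lemma dui_le_wdui f h H t xi z : (forall t x, 0 <= t -> ((normc (h t x))%:E <= H x)%E) ->
  (forall x, 0 <= H x)%E -> ((normc (dui f h t xi z))%:E <= wdui f H xi z)%E.
Proof.
move=> hH H0; apply: (le_trans (dui_le f t xi z hH H0)).
rewrite -[leRHS]mul1e; apply: lee_wpmul2r; first exact: wdui_ge0.
rewrite lee_fin; case: ifP => // zt.
by rewrite -expR0 ler_expR oppr_le0 mulr_ge0 ?enorm_ge0// subr_ge0.
Qed.

Lemma cabs_dui f h F H t xi : maj f F -> maj h H ->
  (cabs lebR3 (dui f h t xi) <= invc%:E * econv F H xi)%E.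
Proof.
move=> mf [mh mH H0 hH _]; have [jf _ _ _ _] := mf.
apply: le_trans (int_wdui xi mf mH H0); apply: le_int.
- by move=> z; rewrite lee_fin normc_ge0.
- by apply: cmeas_enormc; exact: dui_cmeas.
- exact: measurable_wdui.
- by move=> z; exact: dui_le_wdui.
Qed.

Lemma cintegrable_dui f h F H t xi : maj f F -> maj h H -> (econv F H xi < +oo)%E ->
  cintegrable lebR3 setT (dui f h t xi).
Proof.
move=> mf mh fin; have [jf _ F0 _ _] := mf; have [jh _ H0 _ _] := mh.
apply/cintegrableP; split; first exact: dui_cmeas.
apply: (le_lt_trans (cabs_dui t xi mf mh)).
have := econv_ge0 xi F0 H0; case: (econv F H xi) fin => // r _ _.
by rewrite -EFinM ltry.
Qed.

(** By Tonelli the integral over t is taken innermost. It only involves |xi| e^{-(t - s)|xi|} on t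
    >= s, of mass at most 1, and what is left is the bound already used at a fixed time. *)
Lemma timeint_Bop f h F H xi : maj f F -> maj h H ->
  (timeint (Bop f h) xi <= invc%:E * econv F H xi)%E.
Proof.
move=> mf mh; have [jf mF F0 _ _] := mf; have [jh mH H0 hH _] := mh.
pose k (t s : R) : R := if s <= t then enorm xi * expR (- ((t - s) * enorm xi)) else 0.
have k0 t s : 0 <= k t s.
  by rewrite /k; case: ifP => // _; rewrite mulr_ge0 ?enorm_ge0 ?expR_ge0.
pose K (y : R * (R * (R * R))) : \bar R := ((k y.1 y.2.1)%:E * wdui f H xi y.2)%E.
have mk : measurable_fun setT (fun y : R * (R * (R * R)) => (k y.1 y.2.1)%:E).
  by rewrite /k; apply: mf_EFin; apply: measurable_fun_ifT; mfun.
have mw := measurable_wdui xi jf mH.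
have mK : measurable_fun setT K.
  apply: emeasurable_funM; first exact: mk.
  by apply: (measurableT_comp mw).
have K0 y : (0 <= K y)%E by rewrite /K mule_ge0 ?wdui_ge0// lee_fin.
apply: (@le_trans _ _ (\int[lebR]_t \int[lebR3]_z K (t, z))%E).
  apply: le_int.
  - by move=> t; exact: (timeint_integrand_ge0 (Bop f h) (t, xi)).
  - have m := measurable_timeint_integrand (jmeas_Bop jf jh).
    by apply: (measurableT_comp m (g := fun t : R => (t, xi))); mfun.
  - exact: (measurable_tonelli1 lebR3 mK).
  - move=> t; case: ifP => t0; last by apply: integral_ge0 => z _; exact: K0.
    have me : cmeas (fun z => (enorm xi)%:C * dui f h t xi z).
      by apply: cmeasM; [exact: cmeas_cst|exact: dui_cmeas].
    apply: (@le_trans _ _ (cabs lebR3 (fun z => (enorm xi)%:C * dui f h t xi z))).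
      rewrite cabsZ; last exact: dui_cmeas.
      rewrite normc_real ger0_norm ?enorm_ge0// EFinM.
      apply: lee_wpmul2l; first by rewrite lee_fin enorm_ge0.
      by apply: normc_cint; exact: dui_cmeas.
    apply: le_int.
    + by move=> z; rewrite lee_fin normc_ge0.
    + exact: cmeas_enormc.
    + by apply: (measurableT_comp mK (g := fun z : R * (R * R) => (t, z))); mfun.
    + move=> z; rewrite normcM normc_real ger0_norm ?enorm_ge0// EFinM /K /=.
      apply: (@le_trans _ _ ((enorm xi)%:E * ((if z.1 <= t then expR (- ((t - z.1) * enorm xi)) else 0)%:E * wdui f H xi z))%E).
        apply: lee_wpmul2l; first by rewrite lee_fin enorm_ge0.
        exact: dui_le.
      rewrite muleA -EFinM /k; case: ifP => // _.
      by rewrite mulr0.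
rewrite -(tonelli1 lebR lebR3 mK K0) (tonelli2 lebR lebR3 mK K0).
apply: le_trans (int_wdui xi mf mH H0); apply: le_int.
- by move=> z; apply: integral_ge0 => t _; exact: K0.
- exact: (measurable_tonelli2 lebR mK).
- exact: mw.
- move=> z; rewrite /K /= (@ge0_integralM_l _ _ R lebR).
  + rewrite -[leRHS]mul1e; apply: lee_wpmul2r; first exact: wdui_ge0.
    by apply: exp_time_int; exact: enorm_ge0.
  + by apply: (measurableT_comp mk (g := fun t : R => (t, z))); mfun.
  + by move=> t; rewrite lee_fin.
  + exact: wdui_ge0.
Qed.

Lemma maj_Bop f h F H : maj f F -> maj h H ->
  maj (Bop f h) (fun xi => invc%:E * econv F H xi)%E.
Proof.
move=> mf mh; have [jf mF F0 _ _] := mf; have [jh mH H0 _ _] := mh; split.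
- exact: jmeas_Bop.
- by have m := measurable_econv mF mH F0 H0; mfun.
- by move=> x; rewrite mule_ge0 ?econv_ge0// lee_fin invc_ge0.
- move=> t xi t0; apply: le_trans (cabs_dui t xi mf mh).
  by apply: normc_cint; exact: dui_cmeas.
- by move=> xi; exact: timeint_Bop.
Qed.

Lemma majD f h F H : maj f F -> maj h H ->
  maj (fun t x => f t x + h t x) (fun x => F x + H x)%E.
Proof.
move=> [jf mF F0 fF tf] [jh mH H0 hH th]; split.
- exact: (cmeasD jf jh).
- by mfun.
- by move=> x; rewrite adde_ge0.
- move=> t x t0; apply: le_trans (leeD (fF _ x t0) (hH _ x t0)).
  by rewrite -EFinD lee_fin normcD.
- move=> x; apply: le_trans (leeD (tf x) (th x)).
  have sl (u : R -> R * R -> R[i]) : jmeas u ->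
     measurable_fun setT (fun t : R => (if 0 <= t then enorm x * normc (u t x) else 0)%:E).
    move=> mu; have m := measurable_timeint_integrand mu.
    by apply: (measurableT_comp m (g := fun t : R => (t, x))); mfun.
  have m1 := sl _ jf; have m2 := sl _ jh.
  rewrite /timeint -ge0_integralD//; last 2 first.
    by move=> t _; exact: (timeint_integrand_ge0 f (t, x)).
    by move=> t _; exact: (timeint_integrand_ge0 h (t, x)).
  apply: le_int.
  + by move=> t; exact: (timeint_integrand_ge0 (fun t x => f t x + h t x) (t, x)).
  + exact: (sl (fun t x => f t x + h t x) (cmeasD jf jh)).
  + exact: (emeasurable_funD m1 m2).
  + move=> t; rewrite -EFinD lee_fin; case: ifP => _; last by rewrite addr0.
    by rewrite -mulrDr ler_wpM2l ?enorm_ge0// normcD.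
Qed.

Lemma majN f F : maj f F -> maj (fun t x => - f t x) F.
Proof.
move=> [jf mF F0 fF tf]; split => //.
- exact: (cmeasN jf).
- by move=> t x t0; rewrite normcNE fF.
- move=> x; apply: le_trans (tf x); rewrite le_eqVlt; apply/orP; left; apply/eqP.
  by apply: eq_integral => t _; rewrite normcNE.
Qed.

Definition heat (g : R * R -> R[i]) t xi : R[i] := (expR (- (t * enorm xi)))%:C * g xi.

Lemma jmeas_heat g : cmeas g -> jmeas (heat g).
Proof. by move=> mg; have me := @measurable_enorm R; rewrite /jmeas /heat; mfun. Qed.

Lemma heat_le g t xi : 0 <= t -> normc (heat g t xi) <= normc (g xi).
Proof.
move=> t0; rewrite normcM normc_real ger0_norm ?expR_ge0//.
rewrite -[leRHS]mul1r ler_wpM2r ?normc_ge0//.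
by rewrite -expR0 ler_expR oppr_le0 mulr_ge0// enorm_ge0.
Qed.

Lemma maj_heat g : cmeas g -> maj (heat g) (fun xi => (normc (g xi))%:E).
Proof.
move=> mg; split.
- exact: jmeas_heat.
- exact: cmeas_enormc.
- by move=> x; rewrite lee_fin normc_ge0.
- by move=> t x t0; rewrite lee_fin heat_le.
- move=> x; rewrite /timeint.
  have E t : ((if 0 <= t then enorm x * normc (heat g t x) else 0)%:E =
     (if 0 <= t then enorm x * expR (- ((t - 0) * enorm x)) else 0)%:E * (normc (g x))%:E)%E.
    rewrite -EFinM; congr (_%:E); case: ifP => _; last by rewrite mul0r.
    by rewrite normcM normc_real ger0_norm ?expR_ge0// subr0 mulrA.
  under eq_integral do rewrite E.
  have m : measurable_fun setT (fun t : R => (if 0 <= t then enorm x * expR (- ((t - 0) * enorm x)) else 0)%:E).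
    apply: mf_EFin; apply: measurable_fun_ifT; [|by mfun|by mfun].
    by apply: measurable_fun_ler; mfun.
  rewrite (@ge0_integralM_l _ _ R lebR).
  + rewrite -[leRHS]mul1e; apply: lee_wpmul2r; first by rewrite lee_fin normc_ge0.
    by apply: exp_time_int; exact: enorm_ge0.
  + exact: m.
  + by move=> t; rewrite lee_fin; case: ifP => // _; rewrite mulr_ge0 ?enorm_ge0 ?expR_ge0.
  + by rewrite lee_fin normc_ge0.
Qed.

Lemma dui0 h t xi z : dui (fun _ _ => 0) h t xi z = 0.
Proof. by rewrite /dui; case: ifP => // _; rewrite mul0r mulr0. Qed.

Lemma duiDl f f' h t xi z : dui (fun t x => f t x + f' t x) h t xi z =
  dui f h t xi z + dui f' h t xi z.
Proof. by rewrite /dui; case: ifP => _; [rewrite -mulrDr -mulrDl|rewrite addr0]. Qed.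

Lemma duiDr f h h' t xi z : dui f (fun t x => h t x + h' t x) t xi z =
  dui f h t xi z + dui f h' t xi z.
Proof. by rewrite /dui; case: ifP => _; [rewrite -mulrDr -mulrDr|rewrite addr0]. Qed.

End Duhamel.

(** * The Picard iteration *)

Section AeProduct.
Context d1 d2 (T1 : measurableType d1) (T2 : measurableType d2) (R : realType).
Variables (m1 : {sigma_finite_measure set T1 -> \bar R})
  (m2 : {sigma_finite_measure set T2 -> \bar R}).

Lemma ae_fst (P : T1 -> Prop) : {ae m1, forall x, P x} ->
  {ae pmeas m1 m2, forall z, P z.1}.
Proof.
move=> [N [mN N0 PN]]; exists (N `*` setT); split.
- exact: measurableX.
- have e : (m1 N * m2 setT = 0)%E by rewrite (N0 : m1 N = 0%E) mul0e.
  by rewrite -e; exact: product_measure1E.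
- by move=> z /= Pz; split => //; exact: PN.
Qed.

Lemma ae_snd (P : T2 -> Prop) : {ae m2, forall x, P x} ->
  {ae pmeas m1 m2, forall z, P z.2}.
Proof.
move=> [N [mN N0 PN]]; exists (setT `*` N); split.
- exact: measurableX.
- have e : (m1 setT * m2 N = 0)%E by rewrite (N0 : m2 N = 0%E) mule0.
  by rewrite -e; exact: product_measure1E.
- by move=> z /= Pz; split => //; exact: PN.
Qed.

End AeProduct.

Lemma cvg_normc (R : realType) (u : nat -> R[i]) (l : R[i]) :
  (fun n => normc (u n - l)) @ \oo --> (0 : R) ->
  (fun n => normc (u n)) @ \oo --> normc l.
Proof.
move=> h; apply/cvgrPdist_le => e e0; have /cvgrPdist_le/(_ _ e0)[N _ hN] := h.
exists N => // n /hN; rewrite /= sub0r normrN ger0_norm ?normc_ge0//; apply: le_trans.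
have h1 : normc (u n) <= normc (u n - l) + normc l.
  by rewrite -[u n in leLHS](subrK l); exact: normcD.
have h2 : normc l <= normc (u n - l) + normc (u n).
  by rewrite normc_distC -[l in leLHS](subrK (u n)); exact: normcD.
by rewrite ler_norml; apply/andP; split; lra.
Qed.

(** * Continuity in time of the Duhamel and heat terms at a fixed frequency *)

Section TimeContinuity.
Context (R : realType).
Local Notation lebR3 := (lebR3 R).
Implicit Types (f h : R -> R * R -> R[i]) (F H : R * R -> \bar R) (xi x : R * R) (t : R)
  (z : R * (R * R)).

Lemma ae_lebR_neq t : {ae (@lebR R), forall s, s != t}.
Proof.
exists [set t]; split.
- exact: measurable_set1.
- exact: lebesgue_measure_set1.
- by move=> s /= /negP; rewrite negbK => /eqP.
Qed.

Lemma int_box (k t : R) : 0 <= t ->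
  (\int[lebR]_s (if (0 <= s) && (s <= t) then k else 0)%:E = (k * t)%:E)%E.
Proof.
move=> t0; transitivity (\int[lebR]_(s in `[0%R, t]) (cst k%:E s))%E.
  rewrite [RHS]integral_mkcond; apply: eq_integral => s _.
  by rewrite /restrict mem_setE in_itv /=; case: ifP.
rewrite integral_cst//.
rewrite /lebR /= lebesgue_measure_itv /= lte_fin.
move: t0; rewrite le_eqVlt => /predU1P[<-|t0]; first by rewrite ltxx mule0 mulr0.
by rewrite t0 -EFinB subr0 -EFinM.
Qed.

(** The other kernel bound, with |xi| in place of |xi - b|: it costs a factor growing with t and xi,
    harmless when both are fixed, and asks nothing of the time integral of f. *)
Definition box_weight t xi (s : R) : R :=
  if (0 <= s) && (s <= t) then enorm xi * invc R else 0.

Lemma box_weight_ge0 t xi s : 0 <= box_weight t xi s.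
Proof. by rewrite /box_weight; case: ifP => // _; rewrite mulr_ge0 ?enorm_ge0 ?invc_ge0. Qed.

Lemma measurable_box_weight t xi : measurable_fun setT (box_weight t xi).
Proof.
rewrite /box_weight; apply: measurable_fun_ifT; [|exact: measurable_cst|exact: measurable_cst].
by apply: measurable_and; apply: measurable_fun_ler; mfun.
Qed.

Lemma dui_box f h t xi z : normc (dui f h t xi z) <=
  box_weight t xi z.1 * (normc (f z.1 (sub2 xi z.2)) * normc (h z.1 z.2)).
Proof.
rewrite /dui /box_weight; case: ifP => [/andP[z0 zt]|_]; last by rewrite normc0 mul0r.
rewrite !normcM normc_real normrM ger0_norm ?expR_ge0//.
apply: ler_wpM2r; first by rewrite mulr_ge0 ?normc_ge0.
rewrite -[leRHS]mul1r; apply: ler_pM; rewrite ?expR_ge0 ?normr_ge0//; last exact: ker_le.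
by rewrite -expR0 ler_expR oppr_le0 mulr_ge0 ?enorm_ge0// subr_ge0.
Qed.

Lemma int_box_econv F H t xi : 0 <= t -> measurable_fun setT F -> measurable_fun setT H ->
  (forall x, 0 <= F x)%E -> (forall x, 0 <= H x)%E ->
  (\int[lebR3]_z ((box_weight t xi z.1)%:E * (F (sub2 xi z.2) * H z.2)) =
   (enorm xi * invc R * t)%:E * econv F H xi)%E.
Proof.
move=> t0 mF mH F0 H0; have mb := @measurable_box_weight t xi.
rewrite (tonelli2 lebR lebR2); last 2 first.
- apply: emeasurable_funM; last by mfun.
  by apply: mf_EFin; apply: (measurableT_comp mb).
- by move=> z; rewrite mule_ge0// ?lee_fin ?box_weight_ge0// mule_ge0.
rewrite /econv -ge0_integralZl_EFin//; last 3 first.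
- by move=> x _; rewrite mule_ge0.
- by mfun.
- by rewrite !mulr_ge0 ?enorm_ge0 ?invc_ge0.
apply: eq_integral => y _ /=.
rewrite (@ge0_integralM_l _ _ R lebR); first by rewrite int_box.
- exact: mf_EFin.
- by move=> s; rewrite lee_fin box_weight_ge0.
- by rewrite mule_ge0.
Qed.

Definition decay t xi (s : R) : R :=
  if (0 <= s) && (s <= t) then expR (- ((t - s) * enorm xi)) else 0.

Lemma dui_factor f h t xi z : dui f h t xi z =
  (decay t xi z.1)%:C * ((ker xi z.2)%:C * (f z.1 (sub2 xi z.2) * h z.1 z.2)).
Proof.
rewrite /dui /decay; case: ifP => _; last by rewrite mul0r.
by rewrite rmorphM -mulrA.
Qed.

(** As a function of its time, the factor jumps from 0 to 1 at s when s >= 0; the excluded value s =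
    t is a null set for the integral in s. *)
Lemma cvg_decay xi (s t : R) (u : nat -> R) : s != t -> u @ \oo --> t ->
  (fun n => `|decay (u n) xi s - decay t xi s|) @ \oo --> (0 : R).
Proof.
move=> st ut; have [s0|s0] := leP 0 s; last first.
  have ns : (0 <= s) = false by rewrite leNgt s0.
  rewrite /decay ns /=.
  by under eq_fun do rewrite subrr normr0; exact: cvg_cst.
have E : (fun n => expR (- ((u n - s) * enorm xi))) @ \oo --> expR (- ((t - s) * enorm xi)).
  apply: (@cvg_comp _ _ _ (fun n => - ((u n - s) * enorm xi)) expR _ (nbhs (- ((t - s) * enorm xi)))); last exact: continuous_expR.
  by apply: cvgN; apply: cvgM; [apply: cvgB => //; exact: cvg_cst|exact: cvg_cst].
rewrite /decay s0 /=; case: (ltgtP s t) st => // st _.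
- have : (fun n => `|expR (- ((u n - s) * enorm xi)) - expR (- ((t - s) * enorm xi))|) @ \oo --> (0 : R).
    rewrite -[0](normr0 R) -(subrr (expR (- ((t - s) * enorm xi)))).
    by apply: cvg_norm; apply: cvgB => //; exact: cvg_cst.
  apply: cvg_trans; apply: near_eq_cvg.
  have : \forall n \near \oo, s < u n by exact: (cvgr_gt _ ut).
  by apply: filterS => n /ltW ->.
- have : \forall n \near \oo, u n < s by exact: (cvgr_lt _ ut).
  move=> h; apply/cvgrPdist_lt => e e0; apply: filterS h => n.
  by rewrite ltNge => /negbTE ->; rewrite subrr normr0 subr0 normr0.
Qed.

Lemma Bop_cvg f h F H xi t (u : nat -> R) : maj f F -> maj h H ->
  (econv F H xi < +oo)%E -> u @ \oo --> t ->
  (fun n => normc (Bop f h (u n) xi - Bop f h t xi)) @ \oo --> (0 : R).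
Proof.
move=> mf mh fin ut; have [jf mF F0 _ _] := mf; have [jh mH H0 hH _] := mh.
have di s := cintegrable_dui s mf mh fin.
have [] := @cint_dct _ _ R lebR3 (fun n => dui f h (u n) xi) (dui f h t xi) (wdui f H xi).
- by move=> n; exact: dui_cmeas.
- exact: dui_cmeas.
- exact: measurable_wdui.
- have := ae_fst lebR2 (ae_lebR_neq t); apply: ae_imply1 => z zt.
  have := cvg0Ml (normc ((ker xi z.2)%:C * (f z.1 (sub2 xi z.2) * h z.1 z.2))) (cvg_decay xi zt ut).
  apply: squeeze0 => n; rewrite normc_ge0 /= !dui_factor -mulrBl normcM.
  by rewrite -rmorphB normc_real.
- by apply: aeW => z n; exact: dui_le_wdui.
- apply: le_lt_trans (int_wdui xi mf mH H0) _.
  have := econv_ge0 xi F0 H0; case: (econv F H xi) fin => // r _ _.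
  by rewrite -EFinM ltry.
- by move=> z; exact: wdui_ge0.
by move=> fi cv; exact: (cvg_cint _ fi cv).
Qed.

Lemma heat_cvg (g : R * R -> R[i]) xi t (u : nat -> R) : u @ \oo --> t ->
  (fun n => normc (heat g (u n) xi - heat g t xi)) @ \oo --> (0 : R).
Proof.
move=> ut; have E : (fun n => expR (- (u n * enorm xi))) @ \oo --> expR (- (t * enorm xi)).
  apply: (@cvg_comp _ _ _ (fun n => - (u n * enorm xi)) expR _ (nbhs (- (t * enorm xi)))); last exact: continuous_expR.
  by apply: cvgN; apply: cvgM => //; exact: cvg_cst.
have : (fun n => `|expR (- (u n * enorm xi)) - expR (- (t * enorm xi))|) @ \oo --> (0 : R).
  rewrite -[0](normr0 R) -(subrr (expR (- (t * enorm xi)))).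
  by apply: cvg_norm; apply: cvgB => //; exact: cvg_cst.
move/(cvg0Ml (normc (g xi))); apply: squeeze0 => n; rewrite normc_ge0 /= /heat -mulrBl normcM.
by rewrite -rmorphB normc_real.
Qed.

End TimeContinuity.

(** * Iterates, majorants and their limit *)

Section Iteration.
Context (R : realType).
Local Notation lebR3 := (lebR3 R).
Local Notation c := (invc R).
Variable g0 : R * R -> R[i].
Hypothesis g0i : cintegrable lebR2 setT g0.
Hypothesis g0_small : (cabs lebR2 g0 <= 1)%E.
Implicit Types (x xi : R * R) (t : R) (n : nat).

(* The pair (g_{n+1} - g_n, g_n) for the iteration
   g_{n+1}(t) = e^{-t|xi|} g0 - B(g_n, g_n)(t) with g_0 = 0 *)
Fixpoint picard n : (R -> R * R -> R[i]) * (R -> R * R -> R[i]) :=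
  if n is n'.+1 then
    let: (d, g) := picard n' in
    let g' := fun t x => g t x + d t x in
    (fun t x => - (Bop g' d t x + Bop d g t x), g')
  else (heat g0, fun _ _ => 0).

(** The same recursion with all signs positive. Carrying the increments makes the second component
    the partial sums of the first, so that its boundedness gives absolute convergence of the
    iterates at each frequency. *)
Fixpoint majorant n : (R * R -> \bar R) * (R * R -> \bar R) :=
  if n is n'.+1 then
    let: (D, P) := majorant n' in
    let P' := fun x => (P x + D x)%E in
    (fun x => c%:E * econv P' D x + c%:E * econv D P x, P')%E
  else (fun x => (normc (g0 x))%:E, fun=> 0%E).

Local Notation dn n := (picard n).1.
Local Notation gn n := (picard n).2.
Local Notation Dn n := (majorant n).1.
Local Notation Pn n := (majorant n).2.

Lemma picardS n : picard n.+1 =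
  (fun t x => - (Bop (gn n.+1) (dn n) t x + Bop (dn n) (gn n) t x),
   fun t x => gn n t x + dn n t x).
Proof. by rewrite /=; case: (picard n). Qed.

Lemma majorantS n : majorant n.+1 =
  (fun x => c%:E * econv (Pn n.+1) (Dn n) x + c%:E * econv (Dn n) (Pn n) x,
   fun x => Pn n x + Dn n x)%E.
Proof. by rewrite /=; case: (majorant n). Qed.

Lemma maj0 : maj (fun (_ : R) (_ : R * R) => 0 : R[i]) (fun=> 0%E).
Proof.
split => //.
- by move=> t x _; rewrite normc0.
- move=> x; rewrite /timeint integral0_eq// => t _.
  by rewrite normc0 mulr0; case: ifP.
Qed.

Lemma maj_picard n : maj (dn n) (Dn n) /\ maj (gn n) (Pn n).
Proof.
elim: n => [|n [md mg]].
  by split; [exact: (maj_heat (cintegrable_meas g0i))|exact: maj0].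
have mg' : maj (gn n.+1) (Pn n.+1) by rewrite picardS majorantS; exact: majD.
split => //; rewrite (picardS n) (majorantS n) /=.
by apply: majN; apply: majD; apply: maj_Bop.
Qed.

Lemma Dn_ge0 n x : (0 <= Dn n x)%E.
Proof. by have [[_ _ h _ _] _] := maj_picard n; exact: h. Qed.

Lemma Pn_ge0 n x : (0 <= Pn n x)%E.
Proof. by have [_ [_ _ h _ _]] := maj_picard n; exact: h. Qed.

Lemma measurable_Dn n : measurable_fun setT (Dn n).
Proof. by have [[_ h _ _ _] _] := maj_picard n. Qed.

Lemma measurable_Pn n : measurable_fun setT (Pn n).
Proof. by have [_ [_ h _ _ _]] := maj_picard n. Qed.

Lemma PnS n x : Pn n.+1 x = (Pn n x + Dn n x)%E.
Proof. by rewrite majorantS. Qed.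

Lemma DnS n x : Dn n.+1 x =
  (c%:E * econv (Pn n.+1) (Dn n) x + c%:E * econv (Dn n) (Pn n) x)%E.
Proof. by rewrite [in LHS]majorantS. Qed.

(** Bilinearity telescopes the increments into a closed quadratic recursion. Only sums occur, as the
    values may be infinite. *)
Lemma Pn_rec n x : Pn n.+1 x = ((normc (g0 x))%:E + c%:E * econv (Pn n) (Pn n) x)%E.
Proof.
have mP := measurable_Pn; have mD := measurable_Dn; have p0 := Pn_ge0; have d0 := Dn_ge0.
have c0 : (0 <= c%:E)%E by rewrite lee_fin invc_ge0.
elim: n => [|n ih].
  rewrite PnS /= /econv integral0_eq ?mule0 ?adde0 ?add0e//.
rewrite [LHS]PnS ih DnS.
have E : econv (Pn n.+1) (Pn n.+1) x =
    (econv (Pn n) (Pn n) x + (econv (Pn n.+1) (Dn n) x + econv (Dn n) (Pn n) x))%E.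
  transitivity (econv (Pn n.+1) (fun y => Pn n y + Dn n y)%E x).
    by congr (econv _ _ _); apply/funext => y; exact: PnS.
  rewrite econvDr//.
  rewrite (_ : econv (Pn n.+1) (Pn n) x = econv (Pn n) (Pn n) x + econv (Dn n) (Pn n) x)%E.
    by rewrite -addeA; congr (_ + _)%E; rewrite addeC.
  rewrite -econvDl//; congr (econv _ _ _); apply/funext => y; exact: PnS.
rewrite E -addeA; congr (_ + _)%E.
have e1 := econv_ge0 x (p0 n) (p0 n); have e2 := econv_ge0 x (p0 n.+1) (d0 n).
have e3 := econv_ge0 x (d0 n) (p0 n).
by rewrite -[X in (_ + X)%E]ge0_muleDr// -ge0_muleDr// adde_ge0.
Qed.

(** The integral of a convolution being a product, the recursion becomes p -> a + k p^2 with a <= 1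
    and k < 1/4, and p <= 2 a gives a + 4 k a^2 <= 2 a. *)
Lemma int_Pn n : (\int[lebR2]_x Pn n x <= 2%:E * cabs lebR2 g0)%E.
Proof.
have mP := measurable_Pn; have p0 := Pn_ge0.
elim: n => [|n ih].
  by rewrite integral0_eq// mule_ge0 ?cabs_ge0// lee_fin.
under eq_integral do rewrite Pn_rec.
have mE := measurable_econv (mP n) (mP n) (p0 n) (p0 n).
have E0 x := econv_ge0 x (p0 n) (p0 n).
rewrite ge0_integralD//; last 4 first.
- by move=> x _; rewrite lee_fin normc_ge0.
- exact: cmeas_enormc (cintegrable_meas g0i).
- by move=> x _; rewrite mule_ge0// lee_fin invc_ge0.
- by mfun.
rewrite ge0_integralZl_EFin ?invc_ge0//.
rewrite int_econv// -/(cabs lebR2 g0).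
have fa := cabs_fin_num g0i; move: ih g0_small (cabs_ge0 lebR2 g0).
have : (0 <= \int[lebR2]_x Pn n x)%E by apply: integral_ge0.
rewrite -(fineK fa); set a := fine _.
case: (\int[lebR2]_x Pn n x)%E => [p| |]//.
rewrite -!EFinM -EFinD !lee_fin => p0' pa a1 a0.
have := @invc_lt R; have := @invc_ge0 R; have : p * p <= (2 * a) * (2 * a) by exact: ler_pM.
set k := invc R => pp k0 k4.
have : k * (p * p) <= 4^-1 * ((2 * a) * (2 * a)) by apply: ler_pM => //; [exact: mulr_ge0|exact: ltW].
nra.
Qed.

Lemma Pn_nondecreasing x : nondecreasing_seq (fun n => Pn n x).
Proof. by apply/nondecreasing_seqP => n; rewrite PnS leeDl// Dn_ge0. Qed.

Definition Plim x : \bar R := limn (fun n => Pn n x).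

Lemma cvg_Pn x : (fun n => Pn n x) @ \oo --> Plim x.
Proof. exact: (ereal_nondecreasing_is_cvgn (Pn_nondecreasing x)). Qed.

Lemma Pn_le_Plim n x : (Pn n x <= Plim x)%E.
Proof.
apply: lime_ge; first exact: (ereal_nondecreasing_is_cvgn (Pn_nondecreasing x)).
by exists n => // m /= nm; exact: Pn_nondecreasing.
Qed.

Lemma Dn_le_Plim n x : (Dn n x <= Plim x)%E.
Proof. by apply: le_trans (Pn_le_Plim n.+1 x); rewrite PnS leeDr// Pn_ge0. Qed.

Lemma Plim_ge0 x : (0 <= Plim x)%E.
Proof. exact: le_trans (Pn_ge0 0 x) (Pn_le_Plim 0 x). Qed.

Lemma measurable_Plim : measurable_fun setT Plim.
Proof.
apply: (emeasurable_fun_cvg (fun n => Pn n)); first exact: measurable_Pn.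
by move=> x _; exact: cvg_Pn.
Qed.

Lemma int_Plim : (\int[lebR2]_x Plim x <= 2%:E * cabs lebR2 g0)%E.
Proof.
rewrite (@monotone_convergence _ _ R lebR2 setT _ (fun n => Pn n))//.
- apply: lime_le; last by apply: nearW => n; exact: int_Pn.
  apply: ereal_nondecreasing_is_cvgn => m n mn; apply: le_int.
  + exact: Pn_ge0.
  + exact: measurable_Pn.
  + exact: measurable_Pn.
  + by move=> x; exact: Pn_nondecreasing.
- exact: measurable_Pn.
- by move=> n x _; exact: Pn_ge0.
- by move=> x _; exact: Pn_nondecreasing.
Qed.

Lemma int_Plim_lty : (\int[lebR2]_x Plim x < +oo)%E.
Proof.
apply: (le_lt_trans int_Plim); rewrite -(fineK (cabs_fin_num g0i)) -EFinM ltry.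
by [].
Qed.

(** The sums of the absolute increments are bounded by [Pn n x], hence by the finite limit. *)
Lemma cvg_increments (u : nat -> R) x : (Plim x < +oo)%E ->
  (forall n, (`|u n.+1 - u n|%:E <= Dn n x)%E) -> cvgn u.
Proof.
move=> fin hu; pose v n := u n.+1 - u n.
have sv n : series v n = u n - u 0%N.
  rewrite /series /=; elim: n => [|n ih]; first by rewrite big_geq// subrr.
  by rewrite big_nat_recr//= ih /v addrC subrKA.
have sP n : ((series (fun k => `|v k|) n)%:E <= Pn n x)%E.
  rewrite /series /=; elim: n => [|n ih]; first by rewrite big_geq.
  by rewrite big_nat_recr//= EFinD PnS; apply: leeD => //; exact: hu.
have cv : cvgn (series v).
  apply: normed_cvg; apply: nondecreasing_is_cvgn.
    apply/nondecreasing_seqP => n.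
    by change (series (fun k => `|v k|) n <= series (fun k => `|v k|) n.+1);
      rewrite /series /= big_nat_recr//= lerDl.
  exists (fine (Plim x)) => _ [n _ <-]; rewrite -lee_fin fineK.
    exact: le_trans (sP n) (Pn_le_Plim n x).
  by rewrite ge0_fin_numE ?Plim_ge0.
have -> : u = (fun n => series v n + u 0%N) by apply/funext => n; rewrite sv subrK.
by apply: is_cvgD => //; exact: is_cvg_cst.
Qed.

Lemma cvg_gn t x : 0 <= t -> (Plim x < +oo)%E ->
  cvgn (fun n => complex.Re (gn n t x)) /\ cvgn (fun n => complex.Im (gn n t x)).
Proof.
move=> t0 fin; have h n : ((normc (gn n.+1 t x - gn n t x))%:E <= Dn n x)%E.
  rewrite picardS /= addrC addKr.
  by have [[_ _ _ hD _] _] := maj_picard n; exact: hD.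
split; apply: (cvg_increments fin) => n; apply: le_trans (h n); rewrite lee_fin.
  by rewrite -cReN -cReD abs_Re_le.
by rewrite -cImN -cImD abs_Im_le.
Qed.

(** The value 0 at negative times and where the majorant is infinite keeps the bound by [Plim] valid
    everywhere and the limit jointly measurable. *)
Definition glim t x : R[i] :=
  if (0 <= t) && (Plim x < +oo)%E then
    limn (fun n => complex.Re (gn n t x)) +i* limn (fun n => complex.Im (gn n t x))
  else 0.

Lemma cvg_glim t x : 0 <= t -> (Plim x < +oo)%E ->
  (fun n => normc (gn n t x - glim t x)) @ \oo --> (0 : R).
Proof.
move=> t0 fin; have [c1 c2] := cvg_gn t0 fin.
have aux (u : nat -> R) : cvgn u -> (fun n => `|u n - limn u|) @ \oo --> (0 : R).
  move=> cu; rewrite -[0](normr0 R) -(subrr (limn u)).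
  by apply: cvg_norm; apply: cvgB => //; exact: cvg_cst.
have h : (fun n => `|complex.Re (gn n t x) - limn (fun n => complex.Re (gn n t x))| +
     `|complex.Im (gn n t x) - limn (fun n => complex.Im (gn n t x))|) @ \oo --> (0 : R).
  by rewrite -[0](addr0 (0 : R)); apply: cvgD; exact: aux.
apply: squeeze0 h => n; rewrite normc_ge0 /=; apply: (le_trans (normc_le_abs _)).
by rewrite /glim t0 fin /= cReD cImD cReN cImN.
Qed.

Lemma jmeas_glim : jmeas glim.
Proof.
pose b z := (0 <= z.1) && (Plim (z : R * (R * R)).2 < +oo)%E.
have mb : measurable_fun setT b.
  apply: measurable_and; first by apply: measurable_fun_ler; mfun.
  apply: measurable_fun_lte; last exact: measurable_cst.
  by apply: (measurableT_comp measurable_Plim).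
have mg n : cmeas (fun z : R * (R * R) => gn n z.1 z.2) by have [_ []] := maj_picard n.
split.
  apply: (@measurable_fun_cvg _ _ R setT (fun n (z : R * (R * R)) => if b z then complex.Re (gn n z.1 z.2) else 0)).
    by move=> n; have [m _] := mg n; apply: measurable_fun_ifT.
  move=> z _; rewrite /glim -/(b z); case: ifP => [/andP[t0 fin]|_]; last exact: cvg_cst.
  by have [] := cvg_gn t0 fin.
apply: (@measurable_fun_cvg _ _ R setT (fun n (z : R * (R * R)) => if b z then complex.Im (gn n z.1 z.2) else 0)).
  by move=> n; have [_ m] := mg n; apply: measurable_fun_ifT.
move=> z _; rewrite /glim -/(b z); case: ifP => [/andP[t0 fin]|_]; last exact: cvg_cst.
by have [] := cvg_gn t0 fin.
Qed.

Lemma glim_le t x : ((normc (glim t x))%:E <= Plim x)%E.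
Proof.
rewrite {1}/glim; case: ifP => [/andP[t0 fin]|_]; last by rewrite normc0 Plim_ge0.
have -> : limn (fun n => complex.Re (gn n t x)) +i* limn (fun n => complex.Im (gn n t x)) = glim t x.
  by rewrite /glim t0 fin.
have fP : Plim x \is a fin_num by rewrite ge0_fin_numE ?Plim_ge0.
rewrite -(fineK fP) lee_fin; apply/ler_addgt0Pr => e e0.
have /cvgrPdist_lt/(_ _ e0)[N _ hN] := cvg_glim t0 fin.
have := hN N (leqnn N); rewrite /= sub0r normrN ger0_norm ?normc_ge0// => h.
rewrite -[glim t x](subKr (gn N t x)) (le_trans (normcB _ _))// lerD//; last exact: ltW.
rewrite -lee_fin fineK//; apply: le_trans (Pn_le_Plim N x).
by have [_ [_ _ _ hP _]] := maj_picard N; exact: hP.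
Qed.

(** The pointwise bound passes to the limit directly, the bound on the time integral by Fatou's
    lemma; where [Plim] is infinite there is nothing to prove. *)
Lemma maj_glim : maj glim Plim.
Proof.
split; [exact: jmeas_glim|exact: measurable_Plim|exact: Plim_ge0| |].
  by move=> t x _; exact: glim_le.
move=> x; have [fin|] := boolP (Plim x < +oo)%E; last first.
  by rewrite -leNgt => h; apply: le_trans h; rewrite leey.
pose u n t : \bar R := (if 0 <= t then enorm x * normc (gn n t x) else 0)%:E.
have mu n : measurable_fun setT (u n).
  have [_ [jg _ _ _ _]] := maj_picard n; have m := measurable_timeint_integrand jg.
  by apply: (measurableT_comp m (g := fun t : R => (t, x))); mfun.
have u0 n t : (0 <= u n t)%E by exact: (timeint_integrand_ge0 (gn n) (t, x)).
have := @fatou _ _ R lebR setT measurableT u mu (fun n t _ => u0 n t).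
have -> : (\int[lebR]_t limn_einf (u ^~ t) = timeint glim x)%E.
  apply: eq_integral => t _; suff cu : u ^~ t @ \oo --> (if 0 <= t then enorm x * normc (glim t x) else 0)%:E.
    by rewrite (cvg_limn_einf_sup cu).1.
  rewrite /u; case: ifP => t0; last exact: cvg_cst.
  apply: cvg_EFin; first by exact: nearW.
  apply: cvgM; first exact: cvg_cst.
  exact: cvg_normc (cvg_glim t0 fin).
move=> h; apply: (le_trans h).
rewrite limn_einf_lim; apply: lime_le; first exact: is_cvg_einfs.
apply: nearW => n; apply: ereal_inf_le; exists (\int[lebR]_t u n t)%E; first by exists n => /=.
apply: le_trans (Pn_le_Plim n x); have [_ [_ _ _ _ tP]] := maj_picard n; exact: tP.
Qed.

Lemma econv_Plim_lty n m xi : (econv Plim Plim xi < +oo)%E ->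
  [/\ (econv (Pn n) (Pn m) xi < +oo)%E, (econv (Pn n) (Dn m) xi < +oo)%E &
      (econv (Dn n) (Pn m) xi < +oo)%E].
Proof.
move=> fin; split; apply: le_lt_trans fin; apply: le_econv;
  by [exact: measurable_Plim|exact: measurable_Pn|exact: measurable_Dn|
      exact: Pn_ge0|exact: Dn_ge0|exact: Pn_le_Plim|exact: Dn_le_Plim].
Qed.

Lemma gnS n t x : gn n.+1 t x = gn n t x + dn n t x.
Proof. by rewrite picardS. Qed.

(** With g' = g + d, the increments satisfy B(g', d) + B(d, g) = B(g', g') - B(g, g). Splitting the
    integrals requires integrability, which the finiteness of the limiting convolution provides for
    all n at once. *)
Lemma picard_eq n t xi : (econv Plim Plim xi < +oo)%E ->
  gn n.+1 t xi = heat g0 t xi - Bop (gn n) (gn n) t xi.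
Proof.
move=> fin; elim: n => [|n ih].
  rewrite gnS /= add0r /Bop (@eq_cint _ _ R lebR3 _ (fun=> 0)) ?cint0 ?subr0//.
  by move=> z; exact: dui0.
have dS : dn n.+1 t xi = - (Bop (gn n.+1) (dn n) t xi + Bop (dn n) (gn n) t xi).
  by rewrite [in LHS]picardS.
rewrite gnS ih dS -addrA -opprD; congr (_ - _).
have [mdn mgn] := maj_picard n; have [_ mgn1] := maj_picard n.+1.
have [f1 _ f3] := econv_Plim_lty n n fin; have [_ f2 _] := econv_Plim_lty n.+1 n fin.
have i1 := cintegrable_dui t mgn mgn f1.
have i2 := cintegrable_dui t mgn1 mdn f2.
have i3 := cintegrable_dui t mdn mgn f3.
rewrite /Bop -(@cintD _ _ R lebR3 _ _ i2 i3) -(@cintD _ _ R lebR3 _ _ i1); last first.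
  exact: (@cintegrableD _ _ R lebR3 _ _ i2 i3).
have E : (fun t x => gn n t x + dn n t x) = gn n.+1 by rewrite picardS.
by apply: eq_cint => z; rewrite addrCA -duiDl E addrC -duiDr E.
Qed.

Lemma int_sub2r F xi : measurable_fun setT F -> (forall x, 0 <= F x)%E ->
  (\int[lebR2]_b F (sub2 xi b) = \int[lebR2]_x F x)%E.
Proof.
move=> mF F0; have m : measurable_fun setT (fun x : R * R => F (x.1 + xi.1, x.2 + xi.2)) by mfun.
rewrite -(ge0_int2_shift xi mF F0) -(ge0_int2_opp m)//.
by apply: eq_integral => b _; rewrite /sub2 /= ![- _ + _]addrC.
Qed.

Lemma ae_Plim_pair xi : {ae lebR3, forall z, (Plim (sub2 xi z.2) < +oo)%E /\ (Plim z.2 < +oo)%E}.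
Proof.
have mP := measurable_Plim; have P0 := Plim_ge0; have Pi := int_Plim_lty.
have h1 : {ae lebR2, forall b, (Plim b < +oo)%E} by exact: (@ae_lty R _ _ lebR2).
have h2 : {ae lebR2, forall b, (Plim (sub2 xi b) < +oo)%E}.
  apply: (@ae_lty R _ _ lebR2 (fun b => Plim (sub2 xi b))) => //; first by mfun.
  by rewrite int_sub2r.
have h3 : {ae lebR2, forall b, (Plim (sub2 xi b) < +oo)%E /\ (Plim b < +oo)%E}.
  by apply: ae_imply2 h2 h1 => b.
exact: (ae_snd lebR h3).
Qed.

Lemma Bop_picard_cvg t xi : 0 <= t -> (econv Plim Plim xi < +oo)%E ->
  (fun n => normc (Bop (gn n) (gn n) t xi - Bop glim glim t xi)) @ \oo --> (0 : R).
Proof.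
move=> t0 fin; have mP := measurable_Plim; have P0 := Plim_ge0.
have mg n : maj (gn n) (Pn n) by have [] := maj_picard n.
have di n : cintegrable lebR3 setT (dui (gn n) (gn n) t xi).
  by apply: (cintegrable_dui t (mg n) (mg n)); have [] := econv_Plim_lty n n fin.
(* The majorant [wdui] of the n-th integrand depends on n; the one obtained from [dui_box], with
   [Plim] in both factors, does not. *)
have [] := @cint_dct _ _ R lebR3 (fun n => dui (gn n) (gn n) t xi) (dui glim glim t xi)
  (fun z => (box_weight t xi z.1)%:E * (Plim (sub2 xi z.2) * Plim z.2))%E.
- by move=> n; exact: cintegrable_meas (di n).
- by apply: dui_cmeas; exact: jmeas_glim.
- have mb := @measurable_box_weight R t xi.
  apply: emeasurable_funM; last by mfun.
  by apply: mf_EFin; apply: (measurableT_comp mb).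
- apply: ae_imply1 (ae_Plim_pair xi) => z [z1 z2].
  have [b|b] := boolP ((0 <= z.1) && (z.1 <= t)); last first.
    rewrite /dui (negbTE b); under eq_fun do rewrite subrr normc0.
    exact: cvg_cst.
  have [s0 st] := andP b.
  rewrite /dui b; set k := (_ * _)%:C.
  set A := fun n => gn n z.1 (sub2 xi z.2); set B := fun n => gn n z.1 z.2.
  have cA := cvg_glim s0 z1; have cB := cvg_glim s0 z2.
  have cA' := cvg_normc cA.
  have h : (fun n => normc (A n) * normc (B n - glim z.1 z.2) +
      normc (A n - glim z.1 (sub2 xi z.2)) * normc (glim z.1 z.2)) @ \oo --> (0 : R).
    rewrite -[0](addr0 (0 : R)); apply: cvgD; last exact: cvg0Ml.
    rewrite -[0](mulr0 (normc (glim z.1 (sub2 xi z.2)))); exact: cvgM.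
  have := cvg0Ml (normc k) h; apply: squeeze0 => n; rewrite normc_ge0 /= -mulrBr normcM mulrC.
  apply: ler_wpM2r; first exact: normc_ge0.
  rewrite -!normcM; apply: le_trans (normcD _ _); rewrite le_eqVlt; apply/orP; left; apply/eqP.
  by congr normc; rewrite mulrBr mulrBl addrA subrK.
- apply: aeW => z n; apply: (le_trans (y := (box_weight t xi z.1 *
    (normc (gn n z.1 (sub2 xi z.2)) * normc (gn n z.1 z.2)))%:E)).
    by rewrite lee_fin dui_box.
  rewrite EFinM /box_weight; case: ifP => [/andP[s0 st]|_]; last by rewrite !mul0e.
  apply: lee_wpmul2l; first by rewrite lee_fin mulr_ge0 ?enorm_ge0 ?invc_ge0.
  have [_ _ _ hP _] := mg n.
  rewrite EFinM; apply: lee_pmul; rewrite ?lee_fin ?normc_ge0//.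
    exact: le_trans (hP _ _ s0) (Pn_le_Plim n _).
  exact: le_trans (hP _ _ s0) (Pn_le_Plim n _).
- rewrite int_box_econv//; have := econv_ge0 xi P0 P0.
  by case: (econv _ _ _) fin => // r _ _; rewrite -EFinM ltry.
- by move=> z; rewrite mule_ge0// ?lee_fin ?box_weight_ge0// mule_ge0.
by move=> fi cv; exact: (cvg_cint di fi cv).
Qed.

(** One set of frequencies of full measure for all times; this independence of t is what makes the
    uncountable supremum in time and continuity in time tractable. *)
Definition good xi : Prop := (Plim xi < +oo)%E /\ (econv Plim Plim xi < +oo)%E.

Lemma ae_good : {ae lebR2, forall xi, good xi}.
Proof.
have mP := measurable_Plim; have P0 := Plim_ge0; have Pi := int_Plim_lty.
have h1 : {ae lebR2, forall b, (Plim b < +oo)%E} by exact: (@ae_lty R _ _ lebR2).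
have h2 : {ae lebR2, forall b, (econv Plim Plim b < +oo)%E}.
  apply: (@ae_lty R _ _ lebR2 (econv Plim Plim)).
  - exact: measurable_econv.
  - by move=> x; exact: econv_ge0.
  - rewrite int_econv//; have : (0 <= \int[lebR2]_x Plim x)%E by apply: integral_ge0.
    by case: (\int[lebR2]_x Plim x)%E Pi => // r _ _; rewrite -EFinM ltry.
by apply: ae_imply2 h1 h2 => xi.
Qed.

Lemma glim_eq t xi : 0 <= t -> good xi ->
  glim t xi = heat g0 t xi - Bop glim glim t xi.
Proof.
move=> t0 [fin efin]; apply: (@normc_lim_unique _ (fun n => gn n.+1 t xi)).
  have h := cvg_glim t0 fin; apply/cvgrPdist_lt => e e0.
  have /cvgrPdist_lt/(_ _ e0)[N _ hN] := h.
  by exists N => // n Nn; apply: (hN n.+1); exact: (leq_trans Nn).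
apply: squeeze0 (Bop_picard_cvg t0 efin) => n; rewrite normc_ge0 /= picard_eq//.
by rewrite normc_distC opprB addrC addrA subrK normc_distC normc_distC.
Qed.

(** Continuity in time is read off the equation, both terms of which are continuous in t at a good
    frequency. *)
Lemma glim_cvg t xi (u : nat -> R) : 0 <= t -> (forall n, 0 <= u n) -> good xi ->
  u @ \oo --> t -> (fun n => normc (glim (u n) xi - glim t xi)) @ \oo --> (0 : R).
Proof.
move=> t0 u0 gx ut; have h1 := heat_cvg g0 xi ut.
have h2 := Bop_cvg maj_glim maj_glim gx.2 ut.
have h : (fun n => normc (heat g0 (u n) xi - heat g0 t xi) +
   normc (Bop glim glim (u n) xi - Bop glim glim t xi)) @ \oo --> (0 : R).
  by rewrite -[0](addr0 (0 : R)); exact: cvgD.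
apply: squeeze0 h => n; rewrite normc_ge0 /= !glim_eq//.
apply: le_trans (normcB _ _); rewrite le_eqVlt; apply/orP; left; apply/eqP.
have alg (a b p q : R[i]) : a - p - (b - q) = (a - b) - (p - q) by ring.
by rewrite alg.
Qed.

End Iteration.

(** * The mild formulation on the Fourier side *)

Section MildForm.
Context (R : realType).
Local Notation lebR3 := (lebR3 R).
Implicit Types (f h : R -> R * R -> R[i]) (phi : R * R -> R[i]) (xi x : R * R) (t : R)
  (z : R * (R * R)).
Local Notation L1 := (cintegrable lebR2 setT).

Definition box_cst (k t s : R) : R := if (0 <= s) && (s <= t) then k else 0.

Lemma measurable_box_cst k t : measurable_fun setT (box_cst k t).
Proof.
rewrite /box_cst; apply: measurable_fun_ifT; [|exact: measurable_cst|exact: measurable_cst].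
by apply: measurable_and; apply: measurable_fun_ler; mfun.
Qed.

Lemma box_cst_ge0 k t s : 0 <= k -> 0 <= box_cst k t s.
Proof. by rewrite /box_cst; case: ifP. Qed.

(** Intended for integration over xi as well, hence without the factor |xi| of the kernel bound:
    that factor is absorbed by the test function in [fub_le] and by the heat factor in
    [dui_time_le], or is a constant at a fixed frequency. *)
Definition pair_box f h (k t : R) xi z : \bar R :=
  (box_cst k t z.1 * (normc (f z.1 (sub2 xi z.2)) * normc (h z.1 z.2)))%:E.

Lemma pair_box_ge0 f h (k t : R) xi z : 0 <= k -> (0 <= pair_box f h k t xi z)%E.
Proof. by move=> k0; rewrite lee_fin mulr_ge0 ?box_cst_ge0// mulr_ge0 ?normc_ge0. Qed.

Lemma measurable_pair_box f h (k t : R) : jmeas f -> jmeas h ->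
  measurable_fun setT (fun y : (R * R) * (R * (R * R)) => pair_box f h k t y.1 y.2).
Proof.
move=> jf jh; have mb := @measurable_box_cst k t.
have m1 : cmeas (fun y : (R * R) * (R * (R * R)) => f y.2.1 (sub2 y.1 y.2.2)).
  by apply: (cmeas_comp jf (g := fun y : (R * R) * (R * (R * R)) => (y.2.1, sub2 y.1 y.2.2))); mfun.
have m2 : cmeas (fun y : (R * R) * (R * (R * R)) => h y.2.1 y.2.2).
  by apply: (cmeas_comp jh (g := fun y : (R * R) * (R * (R * R)) => (y.2.1, y.2.2))); mfun.
apply: mf_EFin; apply: measurable_funM; first by apply: (measurableT_comp mb); mfun.
by apply: measurable_funM; exact: cmeas_normc.
Qed.

Lemma int_pair_box f h (k t : R) : jmeas f -> jmeas h -> 0 <= k ->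
  (\int[lebR2]_xi \int[lebR3]_z pair_box f h k t xi z =
   \int[lebR]_s ((box_cst k t s)%:E * (cabs lebR2 (f s) * cabs lebR2 (h s))))%E.
Proof.
move=> jf jh k0; have m := measurable_pair_box k t jf jh.
have p0 (y : (R * R) * (R * (R * R))) : (0 <= pair_box f h k t y.1 y.2)%E by exact: pair_box_ge0.
rewrite -(tonelli1 lebR2 lebR3 m p0) (tonelli2 lebR2 lebR3 m p0) /=.
have m' := measurable_tonelli2 lebR2 m p0.
rewrite (tonelli1 lebR lebR2 m'); last by move=> z; apply: integral_ge0 => y _; exact: p0.
apply: eq_integral => s _ /=.
have mf := jmeas_slice s jf; have mh := jmeas_slice s jh.
have b0 : (0 <= (box_cst k t s)%:E)%E by rewrite lee_fin box_cst_ge0.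
have mnf := cmeas_enormc mf; have mnh := cmeas_enormc mh.
transitivity (\int[lebR2]_y ((box_cst k t s)%:E * (cabs lebR2 (f s) * (normc (h s y))%:E)))%E.
  apply: eq_integral => y _; rewrite /pair_box /=.
  under eq_integral do rewrite EFinM EFinM.
  rewrite (@ge0_integralM_r _ _ R lebR2)//; last 2 first.
  - by apply: emeasurable_funM; mfun.
  - by move=> x; rewrite mule_ge0 ?lee_fin ?normc_ge0.
  congr (_ * _)%E; rewrite (@ge0_integralM_l _ _ R lebR2).
  - by rewrite (@int_sub2 R (fun x => (normc (f s x))%:E))// => x; rewrite lee_fin normc_ge0.
  - by mfun.
  - by move=> x; rewrite lee_fin normc_ge0.
  - by rewrite lee_fin normc_ge0.
rewrite (@ge0_integralM_r _ _ R lebR2)//; last 2 first.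
- by apply: emeasurable_funM => //; exact: measurable_cst.
- by move=> x; rewrite mule_ge0 ?cabs_ge0// lee_fin normc_ge0.
congr (_ * _)%E; rewrite (@ge0_integralM_r _ _ R lebR2)//; last exact: cabs_ge0.
by move=> x; rewrite lee_fin normc_ge0.
Qed.

Lemma schwartz_enorm_bound phi : schwartz phi ->
  exists2 C, 0 <= C & forall x, enorm x * normc (phi x) <= C.
Proof.
move=> sp; have [M1 h1] := schwartz_bound 1 0 sp; have [M2 h2] := schwartz_bound 0 1 sp.
have h x : enorm x * normc (phi x) <= M1 + M2.
  have := h1 x; have := h2 x; rewrite !expr0 !expr1 mulr1 mul1r => a b.
  apply: (@le_trans _ _ ((`|x.1| + `|x.2|) * normc (phi x))).
    by rewrite ler_wpM2r ?normc_ge0 ?enorm_le_abs.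
  by rewrite mulrDl lerD.
exists (M1 + M2) => //; apply: le_trans (h (0, 0)).
by rewrite mulr_ge0 ?enorm_ge0 ?normc_ge0.
Qed.

Section Fubini.
Variables (f : R -> R * R -> R[i]) (t M : R) (psi : R * R -> R[i]).
Hypotheses (jf : jmeas f) (t0 : 0 <= t)
  (fi : forall s, 0 <= s -> s <= t -> L1 (f s))
  (fM : forall s, 0 <= s -> s <= t -> (cabs lebR2 (f s) <= M%:E)%E)
  (sp : schwartz psi).

(** The Duhamel integrand paired with a test function. The hypotheses on f are uniform L^1 bounds on
    [0, t] and no majorant, so that the exchange of integrals holds for arbitrary solutions as well
    as for the constructed one. *)
Definition fub (y : (R * R) * (R * (R * R))) : R[i] := dui f f t y.1 y.2 * psi y.1.

Lemma cmeas_fub : cmeas fub.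
Proof.
have m := jmeas_dui jf jf; have mp := schwartz_meas sp.
have m1 : cmeas (fun y : (R * R) * (R * (R * R)) => dui f f t y.1 y.2).
  by apply: (cmeas_comp m (g := fun y : (R * R) * (R * (R * R)) => ((t, y.1), y.2))); mfun.
by apply: cmeasM => //; apply: (cmeas_comp mp); mfun.
Qed.

Lemma fub_le C : (forall x, enorm x * normc (psi x) <= C) -> forall xi z,
  ((normc (fub (xi, z)))%:E <= pair_box f f (C * invc R) t xi z)%E.
Proof.
move=> hC xi z; rewrite /fub /pair_box normcM lee_fin /=.
apply: (@le_trans _ _ (box_weight t xi z.1 * (normc (f z.1 (sub2 xi z.2)) * normc (f z.1 z.2)) * normc (psi xi))).
  by rewrite ler_wpM2r ?normc_ge0// dui_box.
rewrite mulrAC; apply: ler_wpM2r; first by rewrite mulr_ge0 ?normc_ge0.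
rewrite /box_weight /box_cst; case: ifP => _; last by rewrite mul0r.
by rewrite mulrAC ler_wpM2r ?invc_ge0.
Qed.

Lemma cintegrable_fub : cintegrable (pmeas lebR2 lebR3) setT fub.
Proof.
have [C C0 hC] := schwartz_enorm_bound sp.
have k0 : 0 <= C * invc R by rewrite mulr_ge0 ?invc_ge0.
apply/cintegrableP; split; first exact: cmeas_fub.
have M0 : (0 <= M%:E)%E by apply: le_trans (fM (lexx 0) t0); exact: cabs_ge0.
have m := measurable_pair_box (C * invc R) t jf jf.
have p0 (y : (R * R) * (R * (R * R))) : (0 <= pair_box f f (C * invc R) t y.1 y.2)%E.
  exact: pair_box_ge0.
apply: (@le_lt_trans _ _ (\int[pmeas lebR2 lebR3]_y pair_box f f (C * invc R) t y.1 y.2)%E).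
  apply: le_int => //.
  - by move=> y; rewrite lee_fin normc_ge0.
  - by apply: cmeas_enormc; exact: cmeas_fub.
  - by case=> xi z; exact: fub_le.
rewrite (tonelli1 lebR2 lebR3 m p0) /= int_pair_box//.
apply: (@le_lt_trans _ _ (\int[lebR]_s (box_cst (C * invc R * (M * M)) t s)%:E)%E).
  have mb k := @measurable_box_cst k t.
  have mc : measurable_fun setT (fun s => cabs lebR2 (f s)) by exact: (measurable_pabs lebR2 jf).
  apply: le_int.
  - by move=> s; rewrite mule_ge0 ?mule_ge0 ?cabs_ge0// lee_fin box_cst_ge0.
  - exact: (emeasurable_funM (mf_EFin (mb _)) (emeasurable_funM mc mc)).
  - exact: (mf_EFin (mb _)).
  - move=> s; rewrite /box_cst; case: ifP => [/andP[s0 st]|_]; last by rewrite mul0e.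
    rewrite [in leRHS]EFinM; apply: lee_wpmul2l; first by rewrite lee_fin.
    by rewrite [in leRHS]EFinM; apply: lee_pmul; rewrite ?cabs_ge0 ?fM.
by rewrite int_box// ltry.
Qed.

(** Valid for every s, so that the two orders of integration agree as functions of time and not
    merely almost everywhere. *)
Lemma cintegrable_fub_slice s : cintegrable (pmeas lebR2 lebR2) setT
  (fun y : (R * R) * (R * R) => fub (y.1, (s, y.2))).
Proof.
have [C C0 hC] := schwartz_enorm_bound sp; have mp := schwartz_meas sp.
have me := @measurable_enorm R.
have [b|b] := boolP ((0 <= s) && (s <= t)); last first.
  rewrite (_ : (fun y => _) = fun=> 0); first exact: cintegrable0.
  by apply/funext => y; rewrite /fub /dui /= (negbTE b) mul0r.
have [s0 st] := andP b.
have fs := fi s0 st; have ci := cintegrable_cconv_integrand fs fs.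
pose w (y : (R * R) * (R * R)) : R[i] :=
  (expR (- ((t - s) * enorm y.1)) * ker y.1 y.2)%:C * psi y.1.
have mw : cmeas w by rewrite /w /ker; mfun.
have := cintegrableMl ci mw (mulr_ge0 C0 (@invc_ge0 R)).
rewrite (_ : (fun x : (R * R) * (R * R) => w x * _) = (fun y : (R * R) * (R * R) => fub (y.1, (s, y.2)))); last first.
  by apply/funext => y; rewrite /w /fub /dui /= b mulrAC.
apply => y; rewrite /w normcM normc_real normrM ger0_norm ?expR_ge0//.
apply: (@le_trans _ _ (enorm y.1 * invc R * normc (psi y.1))).
  apply: ler_wpM2r; first exact: normc_ge0.
  rewrite -[leRHS]mul1r; apply: ler_pM; rewrite ?expR_ge0 ?normr_ge0//; last exact: ker_le.
  by rewrite -expR0 ler_expR oppr_le0 mulr_ge0 ?enorm_ge0// subr_ge0.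
by rewrite mulrAC ler_wpM2r ?invc_ge0.
Qed.

Definition fub_time s : R[i] :=
  cint lebR2 (fun xi => cint lebR2 (fun y => fub (xi, (s, y)))).

Lemma fub_time_swap s :
  fub_time s = cint lebR2 (fun y => cint lebR2 (fun xi => fub (xi, (s, y)))).
Proof. exact: (cint_swap (cintegrable_fub_slice s)). Qed.

Lemma cintegrable_fub_swap : cintegrable lebR3 setT (fun z => cint lebR2 (fun xi => fub (xi, z))).
Proof.
have m : cmeas (fun y : (R * (R * R)) * (R * R) => fub (y.2, y.1)).
  by apply: (cmeas_comp cmeas_fub (g := fun y : (R * (R * R)) * (R * R) => (y.2, y.1))); mfun.
apply: (cintegrable_pint (m1 := lebR3) (m2 := lebR2) (F := fun y => fub (y.2, y.1))).
apply/cintegrableP; split => //; rewrite (cabs_pmeas1 lebR3 lebR2 m) /=.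
have /cintegrableP[_] := cintegrable_fub.
by rewrite (cabs_pmeas2 lebR2 lebR3 cmeas_fub).
Qed.

Lemma fub_time_int :
  [/\ cintegrable lebR setT fub_time, L1 (fun xi => Bop f f t xi * psi xi) &
      cint lebR fub_time = cint lebR2 (fun xi => Bop f f t xi * psi xi)].
Proof.
have Fi := cintegrable_fub; have Si := cintegrable_fub_swap.
have E1 : fub_time = (fun s => cint lebR2 (fun y => cint lebR2 (fun xi => fub (xi, (s, y))))).
  by apply/funext => s; exact: fub_time_swap.
have mB : cmeas (fun xi => Bop f f t xi * psi xi).
  apply: cmeasM; last exact: schwartz_meas.
  exact: (jmeas_slice t (jmeas_Bop jf jf)).
have mI : cmeas (fun xi => cint lebR3 (fun z => fub (xi, z))).
  exact: (cmeas_pint lebR3 cmeas_fub).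
have E2 : {ae lebR2, forall xi, cint lebR3 (fun z => fub (xi, z)) = Bop f f t xi * psi xi}.
  apply: ae_imply1 (ae_cintegrable1 Fi) => xi ixi.
  (* Integrability of [dui] is recovered from that of [fub] by dividing by psi; where psi vanishes,
     both sides are 0. *)
  have [p0|p0] := eqVneq (psi xi) 0.
    rewrite p0 mulr0 -[RHS](@cint0 _ _ R lebR3); apply: eq_cint => z.
    by rewrite /fub /= p0 mulr0.
  have di : cintegrable lebR3 setT (dui f f t xi).
    have := cintegrableZ (psi xi)^-1 ixi.
    by under eq_fun do rewrite /fub /= mulrC mulfK//.
  by rewrite mulrC /Bop -cintZ//; apply: eq_cint => z; rewrite /fub /= mulrC.
split.
- by rewrite E1; exact: (cintegrable_pint (m1 := lebR) (m2 := lebR2) Si).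
- exact: (ae_cintegrable (cintegrable_pint Fi) mB E2).
- rewrite E1 -(cint_pmeas1 (m1 := lebR) (m2 := lebR2) Si) -(cint_swap Fi).
  exact: ae_cint.
Qed.

End Fubini.

(** The passage between the two formulations: the time integral of the paired Duhamel term is the
    pairing of the symbol [Bop f f t]. At each s in [0, t], the inner integral of [fub] is the
    advection symbol for almost every xi. *)
Lemma duhamel_Bop (theta : R -> functional R) f t M phi : jmeas f -> 0 <= t ->
  (forall s, 0 <= s -> s <= t -> rep (theta s) (f s)) ->
  (forall s, 0 <= s -> s <= t -> (cabs lebR2 (f s) <= M%:E)%E) ->
  schwartz phi ->
  [/\ cintegrable lebR `[0, t] (duhamel theta t phi),
      L1 (fun xi => Bop f f t xi * inv_fourier phi xi) &
      cintegral lebR `[0, t] (duhamel theta t phi) =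
        cint lebR2 (fun xi => Bop f f t xi * inv_fourier phi xi)].
Proof.
move=> jf t0 rf fM sphi; have sp := schwartz_inv_fourier sphi.
have me := @measurable_enorm R.
have fi s (s0 : 0 <= s) (st : s <= t) : L1 (f s) := (rf s s0 st).1.
have [i1 i2 e] := fub_time_int jf t0 fi fM sp.
have E : (fun s => if (0 <= s) && (s <= t) then duhamel theta t phi s else 0) =
    fub_time f t (inv_fourier phi).
  apply/funext => s; case: ifP => [/andP[s0 st]|b]; last first.
    rewrite /fub_time -[LHS](@cint0 _ _ R lebR2); apply: eq_cint => xi.
    rewrite -[LHS](@cint0 _ _ R lebR2); apply: eq_cint => y.
    by rewrite /fub /dui /= b mul0r.
  have da := rep_advection (rf s s0 st); have fs := fi s s0 st.
  have ma := fhat_meas da; have mp := schwartz_meas sp.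
  have mB := is_density_meas da.
  have mI : cmeas (fun xi => cint lebR2 (fun y => fub f t (inv_fourier phi) (xi, (s, y)))).
    apply: (cmeas_pint lebR2 (F := fun y : (R * R) * (R * R) => fub f t (inv_fourier phi) (y.1, (s, y.2)))).
    by apply: (cmeas_comp (cmeas_fub t jf sp) (g := fun y : (R * R) * (R * R) => (y.1, (s, y.2)))); mfun.
  apply: ae_cint => //; first by mfun.
  apply: ae_imply2 (fhat_ae da) (ae_cconv fs fs) => xi -> ci.
  have mk : cmeas (fun b => (ker xi b)%:C : R[i]) by rewrite /ker; mfun.
  have ki : L1 (fun b => (ker xi b)%:C * (f s (sub2 xi b) * f s b)).
    apply: (cintegrableMl ci mk (M := enorm xi / (2 * pi) ^+ 2)).
      by rewrite mulr_ge0 ?enorm_ge0// invr_ge0 ltW// two_pi_gt0.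
    by move=> b; rewrite normc_real ker_le.
  set ex := (expR _)%:C; set p := inv_fourier phi xi.
  transitivity ((ex * p) * Bker (f s) (f s) xi); first by rewrite mulrAC.
  rewrite -(cintZ (ex * p) ki); apply: eq_cint => b.
  rewrite /fub /dui /= s0 st /= -/p.
  rewrite (_ : (expR _ * ker xi b)%:C = ex * (ker xi b)%:C); last exact: rmorphM.
  have alg (a1 a2 a3 a4 : R[i]) : a1 * a2 * (a3 * a4) = a1 * a3 * a4 * a2 by ring.
  exact: alg.
have mD : measurable (`[0, t]%classic : set R) by exact: measurable_itv.
have bD s : ((0 <= s) && (s <= t)) = (s \in (`[0, t]%classic : set R)).
  by rewrite mem_setE in_itv.
split.
- by apply: (@cintegrable_restrict _ _ R lebR _ _ (duhamel theta t phi) mD bD); rewrite E.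
- exact: i2.
- by rewrite (@cint_restrict _ _ R lebR _ _ (duhamel theta t phi) mD bD) E.
Qed.

End MildForm.

(** * Functions of time that are continuous into L^1 *)

Section StepApproximation.
Context (R : realType).
Implicit Types (f : R -> R * R -> R[i]) (x : R * R) (t s e : R).

Definition distL1 (f g : R * R -> R[i]) : \bar R := cabs lebR2 (fun x => f x - g x).

Lemma distL1C (f g : R * R -> R[i]) : distL1 f g = distL1 g f.
Proof. by rewrite /distL1 -cabsN; apply: eq_integral => x _; rewrite opprB. Qed.

Lemma distL1_triangle (f g h : R * R -> R[i]) : cmeas f -> cmeas g -> cmeas h ->
  (distL1 f h <= distL1 f g + distL1 g h)%E.
Proof.
move=> mf mg mh; have := @cabsD _ _ R lebR2 (fun x => f x - g x) (fun x => g x - h x).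
move=> H; apply: le_trans (H _ _); [|by mfun|by mfun].
rewrite le_eqVlt; apply/orP; left; apply/eqP.
by apply: eq_integral => x _; rewrite subrKA.
Qed.

Definition contL1 f : Prop := forall t, 0 <= t -> forall e, 0 < e ->
  exists2 d, 0 < d & forall s, 0 <= s -> `|s - t| < d -> (distL1 (f s) (f t) < e%:E)%E.

(** The Heine-Cantor theorem, through the near-covering form of compactness. Only t is confined to
    [0, T]; both times are compared with the centre x of a covering ball, at the cost of halving e
    and d. *)
Lemma contL1_unif f (T : R) e : (forall t, 0 <= t -> cmeas (f t)) -> contL1 f -> 0 < e ->
  exists m : nat, forall s t, 0 <= s -> 0 <= t -> t <= T -> `|s - t| <= m.+1%:R^-1 ->
    (distL1 (f s) (f t) < e%:E)%E.
Proof.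
move=> mf cf e0.
have /compact_near_coveringP := @segment_compact R 0 T.
move=> /(_ nat \oo (fun m t => 0 <= t -> forall s, 0 <= s -> `|s - t| <= m.+1%:R^-1 -> (distL1 (f s) (f t) < e%:E)%E)).
move=> /(_ _) []; last first.
  move=> N _ hN; exists N => s t s0 t0 tT; apply: (hN N _ t) => //=.
  by rewrite in_itv /= t0.
move=> x; rewrite /= in_itv /= => /andP[x0 xT].
have e20 : 0 < e / 2 by rewrite divr_gt0.
have [d d0 hd] := cf x x0 _ e20.
have d20 : 0 < d / 2 by rewrite divr_gt0.
have [N _ hN] := near_infty_natSinv_lt (PosNum d20).
exists (ball x (d / 2), [set m | (N <= m)%N]); first by split; [exact: nbhsx_ballx|exists N].
move=> [y m] [/= By Nm] y0 s s0 sy.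
have {}By : `|y - x| < d / 2 by rewrite distrC.
have dy : (distL1 (f y) (f x) < (e / 2)%:E)%E.
  by apply: hd => //; rewrite (lt_trans By)// ltr_pdivrMr// ltr_pMr// ltr1n.
have ds : (distL1 (f s) (f x) < (e / 2)%:E)%E.
  apply: hd => //; rewrite -(subrKA y) (le_lt_trans (ler_normD _ _))//.
  by rewrite [ltRHS](splitr d) ltrD// (le_lt_trans sy)// hN.
apply: (le_lt_trans (distL1_triangle (mf s s0) (mf x x0) (mf y y0))).
by rewrite [X in (_ + X)%E]distL1C (splitr e) EFinD lteD.
Qed.

Definition cell (m k : nat) : set R := `[k%:R / m.+1%:R, k.+1%:R / m.+1%:R[%classic.

Lemma measurable_cell m k : measurable (cell m k).
Proof. exact: measurable_itv. Qed.

Lemma cell_sum (m K : nat) (G : nat -> R[i]) t : 0 <= t -> t < K%:R / m.+1%:R ->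
  \sum_(k < K) (\1_(cell m k) t)%:C * G k = G (Num.truncn (t * m.+1%:R)).
Proof.
move=> t0 tK; have m0 : 0 < m.+1%:R :> R by rewrite ltr0n.
have tm0 : 0 <= t * m.+1%:R by rewrite mulr_ge0// ltW.
set k0 := Num.truncn _.
have cE k : (t \in cell m k) = (k == k0).
  rewrite /cell mem_setE in_itv /= ler_pdivrMr// ltr_pdivlMr//.
  have /andP[h1 h2] := truncn_itv tm0; rewrite -/k0 in h1 h2.
  apply/idP/eqP => [/andP[a b]|-> //]; last by rewrite h1 h2.
  have l1 : (k < k0.+1)%N by rewrite -(ltr_nat R) (le_lt_trans a).
  have l2 : (k0 < k.+1)%N by rewrite -(ltr_nat R) (le_lt_trans h1).
  by apply/eqP; rewrite eqn_leq -ltnS l1 -ltnS l2.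
have k0K : (k0 < K)%N.
  have /andP[h1 _] := truncn_itv tm0.
  by rewrite -(ltr_nat R) (le_lt_trans h1)// -ltr_pdivlMr.
rewrite (bigD1 (Ordinal k0K))//= indicE cE eqxx mul1r big1 ?addr0// => k kk.
rewrite indicE cE; case: eqP => [E|_]; last by rewrite mul0r.
by move: kk; rewrite -val_eqE /= E eqxx.
Qed.

Definition node (m : nat) t : R := (Num.truncn (t * m.+1%:R))%:R / m.+1%:R.

Lemma node_ge0 (m : nat) t : 0 <= node m t.
Proof. by rewrite divr_ge0. Qed.

Lemma node_near (m : nat) t : 0 <= t -> `|node m t - t| <= m.+1%:R^-1.
Proof.
rewrite /node => t0; have m0 : 0 < m.+1%:R :> R by rewrite ltr0n.
have /andP[h1 h2] := truncn_itv (mulr_ge0 t0 (ltW m0)).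
rewrite distrC ger0_norm ?subr_ge0 ?ler_pdivrMr//.
rewrite lerBlDr -[X in X + _]mul1r -mulrDl ler_pdivlMr// ltW//.
by rewrite addrC natr1.
Qed.

Lemma contL1_step f (n : nat) e : (forall t, 0 <= t -> cmeas (f t)) -> contL1 f -> 0 < e ->
  exists m K : nat, forall t, 0 <= t -> t <= n%:R -> t < K%:R / m.+1%:R /\
    (distL1 (f (node m t)) (f t) < e%:E)%E.
Proof.
move=> mf cf e0; have [m hm] := contL1_unif n%:R mf cf e0.
have m0 : 0 < m.+1%:R :> R by rewrite ltr0n.
(* One cell beyond n (m + 1): cells are half-open and t = n has to be covered. *)
exists m, ((n * m.+1).+1)%N => t t0 tn; split; last first.
  by apply: hm => //; [exact: node_ge0|exact: node_near].
rewrite ltr_pdivlMr// (@le_lt_trans _ _ (n * m.+1)%:R) ?ltr_nat//.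
by rewrite natrM ler_wpM2r// ltW.
Qed.

Lemma nneseries_cvg0 (a : nat -> R) : (forall n, 0 <= a n) ->
  (\sum_(0 <= k <oo) (a k)%:E < +oo)%E -> a @ \oo --> (0 : R).
Proof.
move=> a0 fin; apply: cvg_series_cvg_0; apply: nondecreasing_is_cvgn.
  by apply/nondecreasing_seqP => n; rewrite /series /= big_nat_recr//= lerDl.
have fn : (\sum_(0 <= k <oo) (a k)%:E)%E \is a fin_num.
  by rewrite ge0_fin_numE// nneseries_ge0// => n _ _; rewrite lee_fin.
exists (fine (\sum_(0 <= k <oo) (a k)%:E)%E) => _ [n _ <-]; rewrite -lee_fin fineK//.
rewrite /series /= -sumEFin; apply: nneseries_lim_ge => k _ _.
by rewrite lee_fin.
Qed.

(** Summable L^1 distances make the sum of the pointwise distances finite almost everywhere, so the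
    whole sequence converges there, without extraction of a subsequence. *)
Lemma distL1_fast_ae (F : nat -> R * R -> R[i]) (g : R * R -> R[i]) :
  (forall n, cmeas (F n)) -> cmeas g ->
  (forall n, (distL1 (F n) g <= (1 / (2 ^ n.+1)%:R)%:E)%E) ->
  {ae lebR2, forall x, (fun n => normc (F n x - g x)) @ \oo --> (0 : R)}.
Proof.
move=> mF mg hF.
have m n : measurable_fun setT (fun x => (normc (F n x - g x))%:E).
  by have := mF n => ?; mfun.
pose S x := (\sum_(0 <= k <oo) (normc (F k x - g x))%:E)%E.
have p n x : (0 <= (normc (F n x - g x))%:E)%E by rewrite lee_fin normc_ge0.
have S0 x : (0 <= S x)%E by rewrite nneseries_ge0.
have mS : measurable_fun setT S.
  by apply: ge0_emeasurable_sum => // k x _ _; exact: p.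
have iS : (\int[lebR2]_x S x < +oo)%E.
  rewrite integral_nneseries//.
  apply: (@le_lt_trans _ _ (\sum_(0 <= k <oo) (1 / (2 ^ k.+1)%:R)%:E)%E).
    apply: lee_nneseries; first by move=> n _ _; exact: integral_ge0.
    by move=> n _; exact: hF.
  by apply: (le_lt_trans (epsilon_trick0 xpredT ler01)); exact: ltry.
have := @ae_lty R _ _ lebR2 S mS S0 iS; apply: ae_imply1 => x /nneseries_cvg0; apply => n.
exact: normc_ge0.
Qed.

(** Step functions in time on finer and finer meshes are jointly measurable and, at each t in
    [0, n], converge fast in L^1, hence almost everywhere. Their upper limit, taken on real and
    imaginary parts, exists at every point and is jointly measurable; it agrees with f t wherever
    they converge to it. *)
Lemma jmeas_version f (n : nat) : (forall t, 0 <= t -> cmeas (f t)) -> contL1 f ->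
  exists2 F : R -> R * R -> R[i], jmeas F &
    forall t, 0 <= t -> t <= n%:R -> {ae lebR2, forall x, F t x = f t x}.
Proof.
move=> mf cf.
have e0 k : 0 < 1 / (2 ^ k.+1)%:R :> R by rewrite divr_gt0// ltr0n expn_gt0.
have /choice[mk hmk] : forall k : nat, exists mK : nat * nat, forall t, 0 <= t -> t <= n%:R ->
    t < mK.2%:R / mK.1.+1%:R /\
    (distL1 (f (node mK.1 t)) (f t) < (1 / (2 ^ k.+1)%:R)%:E)%E.
  by move=> k; have [m [K h]] := contL1_step n mf cf (e0 k); exists (m, K).
pose G k t x := \sum_(i < (mk k).2) (\1_(cell (mk k).1 i) t)%:C * f (i%:R / (mk k).1.+1%:R) x.
have jG k : jmeas (G k).
  apply: cmeas_sum => i; have mfi : cmeas (f (i%:R / (mk k).1.+1%:R)).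
    by apply: mf; rewrite divr_ge0.
  have mi : measurable_fun setT (\1_(cell (mk k).1 i) : R -> R).
    exact: (measurable_indic (measurable_cell _ _)).
  apply: cmeasM; last by apply: (cmeas_comp mfi); mfun.
  by apply: cmeas_real; apply: (measurableT_comp mi).
pose lsup (u : nat -> R) : R := fine (limn_esup (fun k => (u k)%:E)).
have mlsup (u : nat -> R * (R * R) -> R) : (forall k, measurable_fun setT (u k)) ->
    measurable_fun setT (fun z => lsup (fun k => u k z)).
  move=> mu; apply: (measurableT_comp (f := fine)) => //.
  by apply: measurable_fun_limn_esup => k; exact: mf_EFin.
exists (fun t x => lsup (fun k => complex.Re (G k t x)) +i* lsup (fun k => complex.Im (G k t x))).
  apply: cmeas_complex; first by apply: (mlsup (fun k z => complex.Re (G k z.1 z.2))) => k; exact: (jG k).1.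
  by apply: (mlsup (fun k z => complex.Im (G k z.1 z.2))) => k; exact: (jG k).2.
move=> t t0 tn.
have GE k x : G k t x = f (node (mk k).1 t) x.
  have [tK _] := hmk k t t0 tn.
  exact: (cell_sum (fun i => f (i%:R / (mk k).1.+1%:R) x) t0 tK).
have := @distL1_fast_ae (fun k => G k t) (f t).
move=> /(_ (fun k => jmeas_slice t (jG k)) (mf t t0)) H.
apply: ae_imply1 (H _) => [x cx|k]; last first.
  rewrite (_ : G k t = f (node (mk k).1 t)).
    by rewrite ltW//; have [] := hmk k t t0 tn.
  by apply/funext => x; exact: GE.
have aux (u : nat -> R) l : (fun k => `|u k - l|) @ \oo --> (0 : R) -> lsup u = l.
  move=> h; have ul : u @ \oo --> l.
    apply/cvgrPdist_lt => e ep; have /cvgrPdist_lt/(_ _ ep)[N _ hN] := h.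
    by exists N => // k /hN; rewrite /= sub0r normrN normr_id distrC.
  have ule : (fun k => (u k)%:E) @ \oo --> l%:E by apply: cvg_EFin => //; exact: nearW.
  by rewrite /lsup (cvg_limn_einf_sup ule).2.
rewrite [RHS]complexE; congr (_ +i* _); apply: aux; apply: squeeze0 cx => k.
  by rewrite normr_ge0 /= -cReN -cReD abs_Re_le.
by rewrite normr_ge0 /= -cImN -cImD abs_Im_le.
Qed.

End StepApproximation.

(** * Existence *)

Section Existence.
Context (R : realType).
Local Notation L1 := (cintegrable lebR2 setT).
Variable g0 : R * R -> R[i].
Hypothesis g0i : L1 g0.
Hypothesis g0_small : (cabs lebR2 g0 <= 1)%E.
Implicit Types (x xi : R * R) (t s e : R).
Local Notation g := (glim g0).
Local Notation P := (Plim g0).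

Let P0 : forall x, (0 <= P x)%E := Plim_ge0 g0i.
Let mP : measurable_fun setT P := measurable_Plim g0i.
Let Pi : (\int[lebR2]_x P x < +oo)%E := int_Plim_lty g0i g0_small.

Lemma glim_cmeas t : cmeas (g t).
Proof. exact: jmeas_slice (jmeas_glim g0i). Qed.

Lemma cabs_glim t : (cabs lebR2 (g t) <= \int[lebR2]_x P x)%E.
Proof.
apply: le_int => //.
- by move=> x; rewrite lee_fin normc_ge0.
- by apply: cmeas_enormc; exact: glim_cmeas.
- by move=> x; exact: glim_le.
Qed.

Lemma glim_L1 t : L1 (g t).
Proof.
by apply/cintegrableP; split; [exact: glim_cmeas|exact: le_lt_trans (cabs_glim t) Pi].
Qed.

(** Otherwise some sequence of times tending to t stays at distance at least e, against dominated
    convergence with the time-independent majorant [Plim]. *)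
Lemma glim_contL1 : contL1 g.
Proof.
move=> t t0 e e0; apply: contrapT => h.
have /choice[u hu] : forall n : nat, exists s,
    [/\ 0 <= s, `|s - t| < n.+1%:R^-1 & ~ (distL1 (g s) (g t) < e%:E)%E].
  move=> n; apply: contrapT => hn; apply: h.
  exists n.+1%:R^-1; first by rewrite invr_gt0.
  by move=> s s0 st; apply: contrapT => ns; apply: hn; exists s.
have ut : u @ \oo --> t.
  apply/cvgrPdist_lt => d d0.
  have [N _ hN] := near_infty_natSinv_lt (PosNum d0).
  exists N => // n /hN /= nd; have [_ un _] := hu n.
  by rewrite distrC (lt_trans un).
have [] := @cint_dct _ _ R lebR2 (fun n => g (u n)) (g t) P.
- by move=> n; exact: glim_cmeas.
- exact: glim_cmeas.
- exact: mP.
- apply: ae_imply1 (ae_good g0i g0_small) => x gx.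
  by apply: (glim_cvg g0i g0_small) => // n; have [] := hu n.
- by apply: aeW => x n; exact: glim_le.
- exact: Pi.
- exact: P0.
move=> _ /fine_cvgP[[N1 _ hN1] /cvgrPdist_lt/(_ _ e0)[N2 _ hN2]].
pose n := maxn N1 N2; have [_ _] := hu n; apply.
have f1 := hN1 n (leq_maxl _ _); have := hN2 n (leq_maxr _ _).
rewrite /= sub0r normrN ger0_norm ?fine_ge0 ?cabs_ge0// => lt1.
by rewrite /distL1 -(fineK f1) lte_fin.
Qed.

Definition mild_solution t : functional R := Fof (g t).

Lemma rep_theta t : rep (mild_solution t) (g t).
Proof. exact: rep_Fof (glim_L1 t). Qed.

Let dtheta t : is_density (distr_fourier (mild_solution t)) (g t) := rep_density_fourier (rep_theta t).

Lemma Xnorm0_theta t : (Xnorm 0 (mild_solution t) <= \int[lebR2]_x P x)%E.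
Proof. by rewrite (Xnorm0_rep (dtheta t)) cabs_glim. Qed.

(** An enumeration of the nonnegative rationals that reaches every mesh node; an integer that codes
    no pair is sent to time 0. *)
Definition qtime (n : nat) : R :=
  let p := odflt (0, 0)%N (unpickle n) in p.1%:R / p.2.+1%:R.

Lemma qtime_ge0 n : 0 <= qtime n.
Proof. by rewrite divr_ge0. Qed.

Lemma qtime_node (m : nat) t : exists n, qtime n = node m t.
Proof. by exists (pickle (Num.truncn (t * m.+1%:R), m)); rewrite /qtime pickleK. Qed.

Lemma cvg_node t : 0 <= t -> (fun m => node m t) @ \oo --> t.
Proof.
move=> t0; apply/cvgrPdist_lt => e e0.
have [N _ hN] := near_infty_natSinv_lt (PosNum e0).
exists N => // n /hN /= ne; rewrite distrC.
exact: le_lt_trans (node_near n t0) ne.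
Qed.

(** A countable supremum, hence measurable; by continuity in time it bounds the values at all times
    at a good frequency. *)
Definition qsup x : \bar R := esups (fun n => (normc (g (qtime n) x))%:E) 0.

Lemma qsup_ge n x : ((normc (g (qtime n) x))%:E <= qsup x)%E.
Proof. by apply: ereal_sup_ubound; exists n. Qed.

Lemma glim_le_qsup t x : 0 <= t -> good g0 x -> ((normc (g t x))%:E <= qsup x)%E.
Proof.
move=> t0 gx; have h := glim_cvg g0i g0_small t0 (fun m => node_ge0 m t) gx (cvg_node t0).
have q0 : (0 <= qsup x)%E by apply: le_trans (qsup_ge 0 x); rewrite lee_fin normc_ge0.
have hq m : ((normc (g (node m t) x))%:E <= qsup x)%E.
  by have [n <-] := qtime_node m t; exact: qsup_ge.
case: (qsup x) q0 hq => [r| |]//; last by move=> _ _; rewrite leey.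
move=> _ hq; rewrite lee_fin; apply/ler_addgt0Pr => e e0.
have /cvgrPdist_lt/(_ _ e0)[N _ hN] := h.
have := hN N (leqnn N); rewrite /= sub0r normrN ger0_norm ?normc_ge0// => lt1.
rewrite -[g t x](subKr (g (node N t) x)) (le_trans (normcB _ _))// lerD//; last exact: ltW.
by rewrite -lee_fin.
Qed.

(** For minimality, a competitor dominates at each rational time off a null set, and countably many
    null sets have a null union. *)
Lemma is_time_sup_qsup : is_time_sup mild_solution qsup.
Proof.
split; first split.
- apply: (measurable_fun_esups (f := fun n x => (normc (g (qtime n) x))%:E)) => n.
  by apply: cmeas_enormc; exact: glim_cmeas.
- move=> t t0; apply: ae_imply2 (rep_fhat (rep_theta t)) (ae_good g0i g0_small) => x -> gx.
  exact: glim_le_qsup.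
- move=> S' [mS' hS'].
  have : {ae lebR2, forall x, forall n, ((normc (g (qtime n) x))%:E <= S' x)%E}.
    apply: ae_foralln => n; have := hS' _ (qtime_ge0 n).
    by move/(ae_imply2 _ (rep_fhat (rep_theta (qtime n)))); apply => x ->.
  by apply: ae_imply1 => x h; apply: ge_ereal_sup => _ [n _ <-]; exact: h.
Qed.

Lemma time_sup_theta : is_time_sup mild_solution (time_sup mild_solution).
Proof. exact: (@xgetI _ (fun=> +oo%E) [set S | is_time_sup mild_solution S] _ is_time_sup_qsup). Qed.

Lemma frakX0_norm_theta : (frakX0_norm mild_solution <= \int[lebR2]_x P x)%E.
Proof.
have [[mS hS] minS] := time_sup_theta.
have le1 : {ae lebR2, forall x, (time_sup mild_solution x <= P x)%E}.
  apply: minS; split => // t t0; apply: ae_imply1 (rep_fhat (rep_theta t)) => x ->.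
  exact: glim_le.
have ge0 : {ae lebR2, forall x, (0 <= time_sup mild_solution x)%E}.
  apply: ae_imply1 (hS 0 (lexx 0)) => x; apply: le_trans.
  by rewrite lee_fin normc_ge0.
(* The chosen supremum is nonnegative only almost everywhere; its positive part is nonnegative
   everywhere and has the same integral. *)
have mm : measurable_fun setT (fun x => maxe 0%E (time_sup mild_solution x)).
  by apply: measurable_maxe => //; exact: measurable_cst.
have E : (frakX0_norm mild_solution = \int[lebR2]_x maxe 0 (time_sup mild_solution x))%E.
  apply: ae_eq_integral => //.
  by apply: ae_imply1 ge0 => x h _; rewrite max_r.
rewrite E; apply: ae_ge0_le_integral => //.
- by move=> x _; rewrite le_max lexx.
- by apply: ae_imply1 le1 => x h _; rewrite ge_max P0.
Qed.

Lemma frakX0_mild : frakX0 mild_solution.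
Proof.
have fP : (\int[lebR2]_x P x)%E \is a fin_num by rewrite ge0_fin_numE// integral_ge0.
split.
- by move=> t _; exact: Xspace0_Fof (glim_L1 t).
- by exists (fine (\int[lebR2]_x P x)%E) => t _; rewrite fineK// Xnorm0_theta.
- move=> t t0.
  have E s : Xnorm 0 (mild_solution s \- mild_solution t) = distL1 (g s) (g t).
    exact: (Xnorm0_rep (rep_density_fourier (repB (rep_theta s) (rep_theta t)))).
  under eq_fun do rewrite E.
  have fin s : distL1 (g s) (g t) \is a fin_num.
    exact: (cabs_fin_num (@cintegrableB _ _ R lebR2 _ _ (glim_L1 s) (glim_L1 t))).
  apply/fine_cvgP; split; first by apply: nearW.
  apply/cvgrPdist_lt => e e0; have [d d0 hd] := glim_contL1 t0 e0.
  have : \forall s \near nbhs t, `|s - t| < d.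
    by apply/nbhs_ballP; exists d => // s /=; rewrite /ball /= distrC.
  apply: filterS => s std; rewrite /times /= in_itv /= andbT => s0.
  rewrite sub0r normrN ger0_norm ?fine_ge0 ?cabs_ge0//.
  by rewrite -lte_fin fineK// hd.
- exact: le_lt_trans frakX0_norm_theta Pi.
Qed.

Let w1 (z : R * (R * R)) : \bar R :=
  (if 0 <= z.1 then enorm z.2 * normc (g z.1 z.2) else 0)%:E.
Let mw1 : measurable_fun setT w1 := measurable_timeint_integrand (jmeas_glim g0i).
Let w10 z : (0 <= w1 z)%E := timeint_integrand_ge0 g z.

Lemma Xnorm1_theta t : 0 <= t -> Xnorm 1 (mild_solution t) = (\int[lebR2]_x w1 (t, x))%E.
Proof.
move=> t0; rewrite (Xnorm1_rep (dtheta t)); apply: eq_integral => x _.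
by rewrite /w1 /= t0.
Qed.

Lemma int_w1 : (\int[lebR]_t \int[lebR2]_x w1 (t, x) <= \int[lebR2]_x P x)%E.
Proof.
rewrite -(tonelli1 lebR lebR2 mw1 w10) (tonelli2 lebR lebR2 mw1 w10).
apply: le_int => //.
- by move=> x; apply: integral_ge0.
- exact: (measurable_tonelli2 lebR mw1 w10).
- by move=> x; have [_ _ _ _ h] := maj_glim g0i; exact: h.
Qed.

Lemma frakX1_norm_theta : (frakX1_norm mild_solution <= \int[lebR2]_x P x)%E.
Proof.
apply: le_trans int_w1; rewrite le_eqVlt; apply/orP; left; apply/eqP.
rewrite /frakX1_norm integral_mkcond; apply: eq_integral => t _.
rewrite /restrict /times mem_setE in_itv /= andbT; case: ifPn => [t0|t0].
  exact: Xnorm1_theta.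
by rewrite integral0_eq// => x _; rewrite /w1 /= (negbTE t0).
Qed.

Lemma ae_w1 : {ae lebR, forall t, (\int[lebR2]_x w1 (t, x) < +oo)%E}.
Proof.
apply: (@ae_lty R _ _ lebR (fun t => \int[lebR2]_x w1 (t, x))%E).
- exact: (measurable_tonelli1 lebR2 mw1 w10).
- by move=> t; apply: integral_ge0.
- exact: le_lt_trans int_w1 Pi.
Qed.

(** The X^1 norm of the solution is known to be finite at almost every time only, which may leave
    out the mesh nodes. Truncation puts the values at the nodes in X^1 and bounds X^1 distances on
    low frequencies by n times L^1 distances. *)
Definition trunc_sym (n : nat) (h : R * R -> R[i]) x : R[i] := if enorm x <= n%:R then h x else 0.

Lemma trunc_sym_cmeas n h : cmeas h -> cmeas (trunc_sym n h).
Proof.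
move=> mh; rewrite /trunc_sym; apply: cmeas_if => //.
by apply: measurable_fun_ler; [exact: measurable_enorm|exact: measurable_cst].
Qed.

Lemma trunc_sym_L1 n h : L1 h -> L1 (trunc_sym n h).
Proof.
move=> hi; apply: (cintegrable_dom hi (trunc_sym_cmeas n (cintegrable_meas hi)) ler01) => x.
by rewrite mul1r /trunc_sym; case: ifP => // _; rewrite normc0 normc_ge0.
Qed.

Lemma Xspace1_trunc n h : L1 h -> Xspace 1 (Fof (trunc_sym n h)).
Proof.
move=> hi; have ti := trunc_sym_L1 n hi.
have dt := rep_density_fourier (rep_Fof ti).
split; [exact: tempered_Fof|by exists (trunc_sym n h)|].
rewrite (Xnorm1_rep dt).
apply: (@le_lt_trans _ _ (n%:R%:E * cabs lebR2 h)%E); last first.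
  by rewrite -(fineK (cabs_fin_num hi)) -EFinM ltry.
have mt := cintegrable_meas ti; have me := @measurable_enorm R; have mh := cintegrable_meas hi.
rewrite /cabs -ge0_integralZl_EFin//; last 2 first.
- by move=> x _; rewrite lee_fin normc_ge0.
- exact: cmeas_enormc.
apply: le_int.
- by move=> x; rewrite lee_fin mulr_ge0 ?enorm_ge0 ?normc_ge0.
- by mfun.
- by mfun.
- move=> x; rewrite -EFinM lee_fin /trunc_sym; case: ifP => xn.
    by rewrite ler_wpM2r ?normc_ge0.
  by rewrite normc0 mulr0 mulr_ge0 ?normc_ge0.
Qed.

Definition tailf (n : nat) t x : R[i] := if enorm x <= n%:R then 0 else (enorm x)%:C * g t x.

Lemma tail_cvg t : 0 <= t -> (\int[lebR2]_x w1 (t, x) < +oo)%E ->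
  (fun n : nat => cabs lebR2 (tailf n t)) @ \oo --> 0%E.
Proof.
move=> t0 fin; have mg := glim_cmeas t; have me := @measurable_enorm R.
have [] := @cint_dct _ _ R lebR2
  (fun n => tailf n t) (fun=> 0)
  (fun x => w1 (t, x)).
- move=> n; rewrite /tailf; apply: cmeas_if; [|exact: cmeas_cst|by mfun].
  by apply: measurable_fun_ler => //; exact: measurable_cst.
- exact: cmeas_cst.
- by apply: (measurableT_comp mw1 (g := fun x : R * R => (t, x))); mfun.
- apply: aeW => x; apply/cvgrPdist_lt => e e0.
  exists (Num.truncn (enorm x)).+1 => // n /= Nn.
  rewrite /tailf; have -> : enorm x <= n%:R.
    by rewrite ltW// (lt_le_trans (truncnS_gt _))// ler_nat.
  by rewrite subrr normc0 subrr normr0.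
- apply: aeW => x n; rewrite /w1 /tailf /= t0 lee_fin; case: ifP => _.
    by rewrite normc0 mulr_ge0 ?enorm_ge0 ?normc_ge0.
  by rewrite normcM normc_real ger0_norm ?enorm_ge0.
- exact: fin.
- by move=> x; exact: w10.
move=> _; apply: cvg_trans; apply: near_eq_cvg; apply: nearW => n.
by apply: eq_integral => x _; rewrite subr0.
Qed.

(** The n-th simple function freezes time at the nodes of a mesh of [0, n] and truncates frequencies
    at n. Its X^1 error is at most n times an L^1 error plus the tail of the symbol beyond n, which
    tends to 0 when the X^1 norm at time t is finite. *)
Lemma strongly_measurable_theta : strongly_measurable_X 1 mild_solution.
Proof.
(* The tolerance (n + 1)^-2 still leaves 1 / (n + 1) after multiplication by the truncation level
   n. *)
have e0 n : 0 < (n.+1%:R ^+ 2)^-1 :> R by rewrite invr_gt0 exprn_gt0.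
have /choice[mk hmk] : forall n : nat, exists mK : nat * nat, forall t, 0 <= t -> t <= n%:R ->
    t < mK.2%:R / mK.1.+1%:R /\ (distL1 (g (node mK.1 t)) (g t) < ((n.+1%:R ^+ 2)^-1)%:E)%E.
  by move=> n; have [m [K h]] := contL1_step n (fun t _ => glim_cmeas t) glim_contL1 (e0 n); exists (m, K).
pose Tk n k : functional R := Fof (trunc_sym n (g (k%:R / (mk n).1.+1%:R))).
exists (fun n t phi => \sum_(k < (mk n).2) (\1_(cell (mk n).1 k) t)%:C * Tk n k phi); split.
  move=> n; exists (mk n).2, (fun k => cell (mk n).1 k), (fun k => Tk n k); split => // k; split.
    exact: measurable_cell.
  exact: Xspace1_trunc (glim_L1 _).
apply: ae_imply1 ae_w1 => t fin t0.
have sE n : t <= n%:R -> (fun phi => \sum_(k < (mk n).2) (\1_(cell (mk n).1 k) t)%:C * Tk n k phi) =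
    Fof (trunc_sym n (g (node (mk n).1 t))).
  move=> tn; apply/funext => phi; have [tK _] := hmk n t t0 tn.
  exact: (cell_sum (fun k => Tk n k phi) t0 tK).
have h2 : (fun n : nat => ((n.+1%:R^-1)%:E + cabs lebR2 (tailf n t))%E) @ \oo --> 0%E.
  rewrite -[0%E](adde0 (0%R%:E : \bar R)); apply: cvgeD => //; last exact: tail_cvg.
  by apply: cvg_EFin; [exact: nearW|exact: cvg_harmonic].
apply: (squeeze_cvge _ (cvg_cst 0%E) h2).
exists (Num.truncn t).+1 => // n /= Nn.
have tn : t <= n%:R by rewrite ltW// (lt_le_trans (truncnS_gt _))// ler_nat.
have [_ dn] := hmk n t t0 tn.
set q := node (mk n).1 t in dn *.
have ti := trunc_sym_L1 n (glim_L1 q).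
have -> : Xnorm 1 ((fun phi => \sum_(k < (mk n).2) (\1_(cell (mk n).1 k) t)%:C * Tk n k phi) \- mild_solution t) =
   (\int[lebR2]_x (enorm (x : R * R) * normc (trunc_sym n (g q) x - g t x))%:E)%E.
  rewrite sE//; exact: (Xnorm1_rep (rep_density_fourier (repB (rep_Fof ti) (rep_theta t)))).
apply/andP; split.
  by apply: integral_ge0 => x _; rewrite lee_fin mulr_ge0 ?enorm_ge0 ?normc_ge0.
have mt := cintegrable_meas ti; have me := @measurable_enorm R.
have m1 := glim_cmeas t; have m2 := glim_cmeas q.
have mtail : cmeas (tailf n t).
  rewrite /tailf; apply: cmeas_if; [|exact: cmeas_cst|by mfun].
  by apply: measurable_fun_ler => //; exact: measurable_cst.
apply: (@le_trans _ _ (\int[lebR2]_x ((n%:R * normc (g q x - g t x))%:E +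
    (normc (tailf n t x))%:E))%E).
  apply: le_int.
  - by move=> x; rewrite lee_fin mulr_ge0 ?enorm_ge0 ?normc_ge0.
  - by mfun.
  - apply: emeasurable_funD; first by mfun.
    exact: cmeas_enormc.
  - move=> x; rewrite -EFinD lee_fin /trunc_sym /tailf; case: ifP => xn.
      by rewrite normc0 addr0 ler_wpM2r ?normc_ge0.
    rewrite sub0r normcNE normcM normc_real ger0_norm ?enorm_ge0// lerDr.
    by rewrite mulr_ge0 ?normc_ge0.
rewrite ge0_integralD//; last 4 first.
- by move=> x _; rewrite lee_fin mulr_ge0 ?normc_ge0.
- by mfun.
- by move=> x _; rewrite lee_fin normc_ge0.
- exact: cmeas_enormc.
apply: leeD => //; under eq_integral do rewrite EFinM.
rewrite ge0_integralZl_EFin//; last 2 first.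
- by move=> x _; rewrite lee_fin normc_ge0.
- by mfun.
apply: (@le_trans _ _ (n%:R%:E * ((n.+1%:R ^+ 2)^-1)%:E)%E).
  by apply: lee_wpmul2l; [rewrite lee_fin|exact: ltW].
rewrite -EFinM lee_fin expr2 invfM mulrA ler_piMl ?invr_ge0//.
by rewrite ler_pdivrMr// mul1r ler_nat.
Qed.

Lemma frakX1_mild : frakX1 mild_solution.
Proof.
split; last exact: le_lt_trans frakX1_norm_theta Pi.
  apply: ae_imply1 ae_w1 => t fin t0; split.
  - exact: tempered_Fof (glim_L1 t).
  - by exists (g t).
  - by rewrite Xnorm1_theta.
exact: strongly_measurable_theta.
Qed.

Lemma is_solution_mild (theta0 : functional R) : g0 = fhat theta0 -> is_solution theta0 mild_solution.
Proof.
move=> g0E t t0 phi sphi.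
have fP : (\int[lebR2]_x P x)%E \is a fin_num by rewrite ge0_fin_numE// integral_ge0.
have [i1 i2 e] := @duhamel_Bop R mild_solution g t (fine (\int[lebR2]_x P x)%E) phi
  (jmeas_glim g0i) t0 (fun s _ _ => rep_theta s)
  (fun s _ _ => ltac:(rewrite fineK//; exact: cabs_glim)) sphi.
split; first exact: i1.
have sp := schwartz_inv_fourier sphi; have ms := schwartz_meas sp.
have hi : L1 (fun xi => heat g0 t xi * inv_fourier phi xi).
  apply: L1_schwartz => //; apply: (cintegrable_dom g0i _ ler01).
    exact: (jmeas_slice t (jmeas_heat (cintegrable_meas g0i))).
  by move=> x; rewrite mul1r heat_le.
have -> : semigroup t theta0 phi = cint lebR2 (fun xi => heat g0 t xi * inv_fourier phi xi).
  by rewrite /heat g0E.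
transitivity (cint lebR2 (fun xi => heat g0 t xi * inv_fourier phi xi - Bop g g t xi * inv_fourier phi xi)).
  have mg := glim_cmeas t; have mi := cintegrable_meas (@cintegrableB _ _ R lebR2 _ _ hi i2).
  apply: ae_cint => //; first by mfun.
  by apply: ae_imply1 (ae_good g0i g0_small) => xi gx; rewrite glim_eq// mulrBl.
by rewrite (@cintB _ _ R lebR2 _ _ hi i2) -e.
Qed.

(** Each norm is at most the integral of the common majorant, which is at most twice the norm of the
    data. *)
Lemma norm_mild : (frakX0_norm mild_solution + frakX1_norm mild_solution <= 4%:E * cabs lebR2 g0)%E.
Proof.
have h := int_Plim g0i g0_small.
apply: (le_trans (leeD (le_trans frakX0_norm_theta h) (le_trans frakX1_norm_theta h))).
rewrite -(fineK (cabs_fin_num g0i)) -!EFinM -EFinD lee_fin.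
by rewrite -mulrDl -natrD.
Qed.

End Existence.

(** * Uniqueness *)

Section TimeSpaceBound.
Context (R : realType).
Local Notation lebR3 := (lebR3 R).
Local Notation c := (invc R).
Implicit Types (f h : R -> R * R -> R[i]) (xi x : R * R) (t s T : R) (z : R * (R * R)).

(** Here the derivative is left on the output: |xi| is paired with the heat factor, to be integrated
    in t, and f and h enter through their moduli only, so that no X^1 norm appears. *)
Lemma dui_time_le f h T t xi z :
  ((box_cst 1 T t)%:E * (normc (dui f h t xi z))%:E <=
   (if z.1 <= t then enorm xi * expR (- ((t - z.1) * enorm xi)) else 0)%:E *
     pair_box f h c T xi z)%E.
Proof.
have p0 := pair_box_ge0 f h T xi z (@invc_ge0 R).
have r0 : (0 <= (if z.1 <= t then enorm xi * expR (- ((t - z.1) * enorm xi)) else 0)%:E *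
    pair_box f h c T xi z)%E.
  rewrite mule_ge0// lee_fin; case: ifP => // _; by rewrite mulr_ge0 ?enorm_ge0 ?expR_ge0.
rewrite {1}/box_cst; case: ifP => [/andP[t0 tT]|_]; last by rewrite mul0e.
rewrite mul1e dui_factor /decay; case: ifP => [/andP[z0 zt]|_]; last by rewrite mul0r normc0.
rewrite zt /pair_box /box_cst z0 (le_trans zt tT) /= -EFinM lee_fin.
rewrite !normcM !normc_real ger0_norm ?expR_ge0//.
rewrite !mulrA; apply: ler_wpM2r; first exact: normc_ge0.
apply: ler_wpM2r; first exact: normc_ge0.
by rewrite mulrAC [leRHS]mulrC; apply: ler_wpM2l; [exact: expR_ge0|exact: ker_le].
Qed.

(** Tonelli with t innermost removes |xi| and the heat factor; the integrals over frequencies then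
    factor into the two L^1 norms at time s. *)
Lemma int_time_dui f h T : jmeas f -> jmeas h ->
  (\int[lebR]_t ((box_cst 1 T t)%:E * \int[lebR2]_xi cabs lebR3 (dui f h t xi)) <=
   \int[lebR]_s ((box_cst c T s)%:E * (cabs lebR2 (f s) * cabs lebR2 (h s))))%E.
Proof.
move=> jf jh.
pose V (y : R * ((R * R) * (R * (R * R)))) : \bar R :=
  ((box_cst 1 T y.1)%:E * (normc (dui f h y.1 y.2.1 y.2.2))%:E)%E.
have mb := @measurable_box_cst R 1 T.
have md : cmeas (fun y : R * ((R * R) * (R * (R * R))) => dui f h y.1 y.2.1 y.2.2).
  by apply: (cmeas_comp (jmeas_dui jf jh)
    (g := fun y : R * ((R * R) * (R * (R * R))) => ((y.1, y.2.1), y.2.2))); mfun.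
have mV : measurable_fun setT V.
  apply: emeasurable_funM; last exact: cmeas_enormc.
  by apply: mf_EFin; apply: (measurableT_comp mb).
have V0 y : (0 <= V y)%E by rewrite mule_ge0// lee_fin ?normc_ge0// box_cst_ge0.
have E t : ((box_cst 1 T t)%:E * \int[lebR2]_xi cabs lebR3 (dui f h t xi) =
    \int[pmeas lebR2 lebR3]_y V (t, y))%E.
  have mdt : cmeas (fun y : (R * R) * (R * (R * R)) => dui f h t y.1 y.2).
    by apply: (cmeas_comp md (g := fun y : (R * R) * (R * (R * R)) => (t, y))); mfun.
  rewrite -(cabs_pmeas1 lebR2 lebR3 mdt) /V /=.
  rewrite (@ge0_integralM_r _ _ R (pmeas lebR2 lebR3))//.
  - exact: cmeas_enormc.
  - by move=> y; rewrite lee_fin normc_ge0.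
  - by rewrite lee_fin box_cst_ge0.
under eq_integral do rewrite E.
rewrite -(tonelli1 lebR (pmeas lebR2 lebR3) mV V0) (tonelli2 lebR (pmeas lebR2 lebR3) mV V0).
have mp := measurable_pair_box c T jf jh.
have p0 (y : (R * R) * (R * (R * R))) : (0 <= pair_box f h c T y.1 y.2)%E.
  exact: (pair_box_ge0 f h T y.1 y.2 (@invc_ge0 R)).
rewrite -(int_pair_box T jf jh (@invc_ge0 R)) -(tonelli1 lebR2 lebR3 mp p0).
apply: le_int.
- by move=> y; apply: integral_ge0 => t _; exact: V0.
- exact: (measurable_tonelli2 lebR mV V0).
- exact: mp.
- case=> xi z; rewrite /V /=.
  have mk : measurable_fun setT (fun t : R =>
      (if z.1 <= t then enorm xi * expR (- ((t - z.1) * enorm xi)) else 0)%:E).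
    apply: mf_EFin; apply: measurable_fun_ifT; [|by mfun|exact: measurable_cst].
    by apply: measurable_fun_ler; mfun.
  apply: (@le_trans _ _ (\int[lebR]_t ((if z.1 <= t then enorm xi * expR (- ((t - z.1) * enorm xi)) else 0)%:E *
     pair_box f h c T xi z))%E).
    apply: le_int.
    + by move=> t; exact: (V0 (t, (xi, z))).
    + by apply: (measurableT_comp mV (g := fun t : R => (t, (xi, z)))); mfun.
    + by apply: emeasurable_funM => //; exact: measurable_cst.
    + by move=> t; exact: dui_time_le.
  rewrite (@ge0_integralM_l _ _ R lebR)//.
  + rewrite -[leRHS]mul1e; apply: lee_wpmul2r; first exact: (p0 (xi, z)).
    by apply: exp_time_int; exact: enorm_ge0.
  + by move=> t; rewrite lee_fin; case: ifP => // _; rewrite mulr_ge0 ?enorm_ge0 ?expR_ge0.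
  + exact: (p0 (xi, z)).
Qed.

(** Replaces the finiteness of a majorant convolution for an arbitrary solution, for which no
    majorant is available: the integral over xi is finite without the weight |xi|, which is then a
    constant at each frequency. *)
Lemma ae_cintegrable_dui f h t (M : R) : jmeas f -> jmeas h -> 0 <= t -> 0 <= M ->
  (forall s, 0 <= s -> s <= t -> (cabs lebR2 (f s) * cabs lebR2 (h s) <= M%:E)%E) ->
  {ae lebR2, forall xi, cintegrable lebR3 setT (dui f h t xi)}.
Proof.
move=> jf jh t0 M0 hM; have mp := measurable_pair_box 1 t jf jh.
have p0 (y : (R * R) * (R * (R * R))) : (0 <= pair_box f h 1 t y.1 y.2)%E.
  exact: pair_box_ge0.
have fin : (\int[lebR2]_xi \int[lebR3]_z pair_box f h 1 t xi z < +oo)%E.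
  rewrite int_pair_box//; apply: (@le_lt_trans _ _ (\int[lebR]_s (box_cst M t s)%:E)%E); last first.
    by rewrite int_box// ltry.
  have mb k := @measurable_box_cst R k t.
  have mcf : measurable_fun setT (fun s => cabs lebR2 (f s)) by exact: (measurable_pabs lebR2 jf).
  have mch : measurable_fun setT (fun s => cabs lebR2 (h s)) by exact: (measurable_pabs lebR2 jh).
  apply: le_int.
  - by move=> s; rewrite mule_ge0 ?mule_ge0 ?cabs_ge0// lee_fin box_cst_ge0.
  - exact: (emeasurable_funM (mf_EFin (mb _)) (emeasurable_funM mcf mch)).
  - exact: (mf_EFin (mb _)).
  - move=> s; rewrite /box_cst; case: ifP => [/andP[s0 st]|_]; last by rewrite mul0e.
    by rewrite mul1e hM.
have := @ae_lty R _ _ lebR2 (fun xi => \int[lebR3]_z pair_box f h 1 t xi z)%E.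
move=> /(_ (measurable_tonelli1 lebR3 mp p0)) h1.
apply: ae_imply1 (h1 _ fin) => [xi hx|xi]; last by apply: integral_ge0 => z _; exact: (p0 (xi, z)).
apply/cintegrableP; split; first exact: dui_cmeas.
apply: (@le_lt_trans _ _ ((enorm xi * c)%:E * \int[lebR3]_z pair_box f h 1 t xi z)%E); last first.
  have : (0 <= \int[lebR3]_z pair_box f h 1 t xi z)%E.
    by apply: integral_ge0 => z _; exact: (p0 (xi, z)).
  by case: (\int[lebR3]_z _)%E hx => // r _ _; rewrite -EFinM ltry.
have mpx : measurable_fun setT (pair_box f h 1 t xi).
  by apply: (measurableT_comp mp (g := fun z : R * (R * R) => (xi, z))); mfun.
rewrite -(@ge0_integralM_r _ _ R lebR3)//; last 2 first.
- by move=> z; exact: (p0 (xi, z)).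
- by rewrite lee_fin mulr_ge0 ?enorm_ge0 ?invc_ge0.
apply: le_int.
- by move=> z; rewrite lee_fin normc_ge0.
- by apply: cmeas_enormc; exact: dui_cmeas.
- by apply: emeasurable_funM => //; exact: measurable_cst.
- move=> z; rewrite /pair_box -EFinM lee_fin; apply: (le_trans (dui_box _ _ _ _ _)).
  rewrite [leRHS]mulrA; apply: ler_wpM2r; first by rewrite mulr_ge0 ?normc_ge0.
  by rewrite /box_weight /box_cst; case: ifP => _; rewrite ?mulr1 ?mulr0.
Qed.

Lemma duiBl f f' h t xi z : dui (fun t x => f t x - f' t x) h t xi z =
  dui f h t xi z - dui f' h t xi z.
Proof.
by rewrite /dui; case: ifP => _; [rewrite -mulrBr -mulrBl|rewrite subrr].
Qed.

Lemma duiBr f h h' t xi z : dui f (fun t x => h t x - h' t x) t xi z =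
  dui f h t xi z - dui f h' t xi z.
Proof.
by rewrite /dui; case: ifP => _; [rewrite -mulrBr -mulrBr|rewrite subrr].
Qed.

(** The integration is confined to the null set s = 0. *)
Lemma Bop0 f h xi : jmeas f -> jmeas h -> Bop f h 0 xi = 0.
Proof.
move=> jf jh; rewrite -(@cint0 _ _ R lebR3); apply: ae_cint.
- exact: dui_cmeas.
- exact: cmeas_cst.
- have := ae_fst lebR2 (@ae_lebR_neq R 0); apply: ae_imply1 => z z0.
  by rewrite /dui -eq_le eq_sym (negbTE z0).
Qed.

(** The interval ]t - d, t + d[ clipped to [0, T] has positive length, so a null set cannot contain
    it. This upgrades almost everywhere to everywhere for continuous functions of time. *)
Lemma ae_lebR_dense (Q : R -> Prop) T t d : {ae (@lebR R), forall s, 0 <= s -> s <= T -> Q s} ->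
  0 < T -> 0 <= t -> t <= T -> 0 < d ->
  exists s, [/\ 0 <= s, s <= T, `|s - t| < d & Q s].
Proof.
move=> [N [mN N0 QN]] T0 t0 tT d0; apply: contrapT => h.
pose a := Num.max (t - d) 0; pose b := Num.min (t + d) T.
have ab : a < b.
  rewrite gt_max !lt_min T0.
  by apply/andP; split; apply/andP; split => //; lra.
have IN : (`]a, b[%classic : set R) `<=` N.
  move=> s /=; rewrite in_itv /= gt_max lt_min => /andP[/andP[s1 s2] /andP[s3 s4]].
  apply: QN => /= H; apply: h; exists s; split; [exact: ltW|exact: ltW| |].
    by rewrite ltr_norml ltrBrDr ltrBlDr [-d + t]addrC s1 addrC.
  by apply: H; exact: ltW.
have := @le_measure _ R _ (@lebR R) (`]a, b[%classic : set R) N.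
rewrite !inE => /(_ (measurable_itv _) mN IN).
move: (N0) => /eqP; rewrite eq_le => /andP[N0' _] H; move: (le_trans H N0').
rewrite /lebR /= lebesgue_measure_itv /= lte_fin ab -EFinB lee_fin.
by rewrite leNgt subr_gt0 ab.
Qed.

End TimeSpaceBound.

(** * The distance between two solutions and the continuity argument *)

Section Uniqueness.
Context (R : realType).
Local Notation lebR3 := (lebR3 R).
Local Notation c := (invc R).
Local Notation L1 := (cintegrable lebR2 setT).
Implicit Types (f h : R -> R * R -> R[i]) (xi x : R * R) (t s T e : R).

Lemma rep_ae (U : functional R) (u v : R * R -> R[i]) : rep U u -> cmeas v ->
  {ae lebR2, forall x, u x = v x} -> rep U v.
Proof.
move=> [ui e] mv uv; split; first exact: (ae_cintegrable ui mv uv).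
move=> phi sp; rewrite e//; have ms := schwartz_meas (schwartz_inv_fourier sp).
have mu := cintegrable_meas ui.
by apply: ae_cint; [by mfun|by mfun|apply: ae_imply1 uv => x ->].
Qed.

Lemma distL1_ae (u u' v v' : R * R -> R[i]) : cmeas u -> cmeas u' -> cmeas v -> cmeas v' ->
  {ae lebR2, forall x, u x = u' x} -> {ae lebR2, forall x, v x = v' x} ->
  distL1 u v = distL1 u' v'.
Proof.
move=> mu mu' mv mv' h1 h2; apply: ae_cabs; [by mfun|by mfun|].
by apply: ae_imply2 h1 h2 => x -> ->.
Qed.

(** The weak equation is tested with the Fourier transform of psi, so that the symbols are paired
    with psi itself, an arbitrary Schwartz function; functions orthogonal to all of these vanish
    almost everywhere. *)
Lemma mild_form (theta0 : functional R) (th : R -> functional R) f (t M : R) :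
  L1 (fhat theta0) -> is_solution theta0 th -> jmeas f -> 0 <= t ->
  (forall s, 0 <= s -> s <= t -> rep (th s) (f s)) ->
  (forall s, 0 <= s -> s <= t -> (cabs lebR2 (f s) <= M%:E)%E) ->
  {ae lebR2, forall xi, f t xi = heat (fhat theta0) t xi - Bop f f t xi}.
Proof.
move=> g0i sol jf t0 rf fM.
have ft := rf t t0 (lexx t); have mh := jmeas_slice t (jmeas_heat (cintegrable_meas g0i)).
have mft := jmeas_slice t jf; have mB := jmeas_slice t (jmeas_Bop jf jf).
pose u xi := f t xi - (heat (fhat theta0) t xi - Bop f f t xi).
have mu : cmeas u by rewrite /u; mfun.
suff : {ae lebR2, forall xi, u xi = 0}.
  by apply: ae_imply1 => xi /eqP; rewrite subr_eq0 => /eqP.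
apply: (du_bois_reymond mu) => psi spsi.
pose phi := fourier psi; have sphi : schwartz phi by exact: schwartz_fourier.
have psiE : inv_fourier phi = psi by exact: fourierK.
have [i1 i2 e] := duhamel_Bop jf t0 rf fM sphi.
have [_ solt] := sol t t0 phi sphi.
rewrite psiE in i2 e.
have hi : L1 (fun xi => heat (fhat theta0) t xi * psi xi).
  apply: L1_schwartz => //; apply: (cintegrable_dom g0i _ ler01) => // x.
  by rewrite mul1r heat_le.
have fi := L1_schwartz ft.1 spsi.
have hBi := @cintegrableB _ _ R lebR2 _ _ hi i2.
have uE : (fun xi => u xi * psi xi) =
   (fun xi => f t xi * psi xi - (heat (fhat theta0) t xi * psi xi - Bop f f t xi * psi xi)).
  by apply/funext => xi; rewrite /u !mulrBl.
rewrite uE; split; first exact: (@cintegrableB _ _ R lebR2 _ _ fi hBi).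
rewrite (@cintB _ _ R lebR2 _ _ fi hBi) (@cintB _ _ R lebR2 _ _ hi i2).
have h1 : th t phi = cint lebR2 (fun xi => f t xi * psi xi) by rewrite ft.2// /Fof psiE.
have h2 : semigroup t theta0 phi = cint lebR2 (fun xi => heat (fhat theta0) t xi * psi xi).
  by rewrite /semigroup /mult psiE.
have h3 := solt; rewrite h1 h2 in h3.
by rewrite h3 -e subrr.
Qed.

Variable (theta0 : functional R).
Hypothesis (X0 : Xspace 0 theta0) (small : (Xnorm 0 theta0 < (1 / 4)%:E)%E).
Local Notation g0 := (fhat theta0).

Let g0r : rep theta0 g0 := Xspace0_rep X0.
Let g0i : L1 g0 := g0r.1.
Let g0E : Xnorm 0 theta0 = cabs lebR2 g0 := Xnorm0_rep (rep_density_fourier g0r).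
Let g0_lt : (cabs lebR2 g0 < (1 / 4)%:E)%E. Proof. by rewrite -g0E. Qed.
Let g0_small : (cabs lebR2 g0 <= 1)%E.
Proof. by apply: le_trans (ltW g0_lt) _; rewrite lee_fin ler_pdivrMr// mul1r ler1n. Qed.
Local Notation g := (glim g0).
Local Notation theta := (mild_solution g0).

Variable (th : R -> functional R).
Hypotheses (thX0 : frakX0 th) (thsol : is_solution theta0 th).
Local Notation f := (fun t => fhat (th t)).

Let fr t : 0 <= t -> rep (th t) (f t).
Proof. by move=> t0; have [h _ _ _] := thX0; apply: Xspace0_rep; exact: h. Qed.

Let fm t : 0 <= t -> cmeas (f t).
Proof. by move=> t0; exact: cintegrable_meas (fr t0).1. Qed.

Lemma fhat_contL1 : contL1 f.
Proof.
move=> t t0 e e0; have [_ _ h _] := thX0.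
have /fine_cvgP[h1 h2] := h t t0.
have /cvgrPdist_lt/(_ _ e0) h3 := h2.
have : nbhs t [set s | times s -> (distL1 (f s) (f t) < e%:E)%E].
  have h1' : nbhs t (fun s => times s -> Xnorm 0 (th s \- th t) \is a fin_num) := h1.
  have h3' : nbhs t (fun s => times s -> `|0 - fine (Xnorm 0 (th s \- th t))| < e) := h3.
  move: h1' h3'; apply: filterS2 => s {}h1 {}h3 ts.
  have s0 : 0 <= s by move: ts; rewrite /times /= in_itv /= andbT.
  have E : Xnorm 0 (th s \- th t) = distL1 (f s) (f t).
    exact: (Xnorm0_rep (rep_density_fourier (repB (fr s0) (fr t0)))).
  have := h3 ts; have := h1 ts; rewrite E => fin.
  rewrite sub0r normrN ger0_norm ?fine_ge0 ?cabs_ge0// => lt1.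
  by rewrite -(fineK fin) lte_fin.
move=> /nbhs_ballP[d d0 hd]; exists d => // s s0 st.
apply: (hd s); first by rewrite /ball /= distrC.
by rewrite /times /= in_itv /= s0.
Qed.

Let N t := distL1 (f t) (g t).

Lemma N_ge0 t : (0 <= N t)%E. Proof. exact: cabs_ge0. Qed.

Lemma N_fin t : 0 <= t -> N t \is a fin_num.
Proof.
move=> t0; apply: cabs_fin_num.
exact: (@cintegrableB _ _ R lebR2 _ _ (fr t0).1 (glim_L1 g0i g0_small t)).
Qed.

Lemma N_le_add s t : 0 <= s -> 0 <= t ->
  (N s <= distL1 (f s) (f t) + N t + distL1 (g s) (g t))%E.
Proof.
move=> s0 t0; have mg r := glim_cmeas g0i r.
have h := distL1_triangle (fm t0) (mg t) (mg s).
rewrite [distL1 (g t) (g s)]distL1C in h.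
apply: (le_trans (distL1_triangle (fm s0) (fm t0) (mg s))).
have alg (a b d : \bar R) : (a + b + d = a + (b + d))%E by rewrite addeA.
by rewrite alg; exact: leeD.
Qed.

Lemma N_cont t e : 0 <= t -> 0 < e -> exists2 d, 0 < d &
  forall s, 0 <= s -> `|s - t| < d -> (N s < N t + e%:E)%E /\ (N t < N s + e%:E)%E.
Proof.
move=> t0 e0; have e20 : 0 < e / 2 by rewrite divr_gt0.
have [d1 d10 h1] := fhat_contL1 t0 e20.
have [d2 d20 h2] := glim_contL1 g0i g0_small t0 e20.
exists (Num.min d1 d2); first by rewrite lt_min d10.
move=> s s0; rewrite lt_min => /andP[st1 st2].
have ffin : distL1 (f s) (f t) \is a fin_num.
  exact: (cabs_fin_num (@cintegrableB _ _ R lebR2 _ _ (fr s0).1 (fr t0).1)).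
have gfin : distL1 (g s) (g t) \is a fin_num.
  by apply: cabs_fin_num; apply: (@cintegrableB _ _ R lebR2); exact: glim_L1.
have := h1 s s0 st1; have := h2 s s0 st2.
have := N_le_add s0 t0; have := N_le_add t0 s0.
rewrite [distL1 (f t) _]distL1C [distL1 (g t) _]distL1C.
rewrite -(fineK (N_fin t0)) -(fineK (N_fin s0)) -(fineK ffin) -(fineK gfin).
move: (fine (N t)) (fine (N s)) (fine (distL1 (f s) (f t))) (fine (distL1 (g s) (g t))).
move=> p q r u; rewrite -!EFinD !lee_fin !lte_fin => a1 a2 a3 a4; have := splitr e.
by split; lra.
Qed.

(** At each time the version differs from [fhat] on a null set only, so it represents the same
    distributions and inherits their bound and the equation; the point is its joint
    measurability. *)
Lemma measurable_version (n : nat) : exists F : R -> R * R -> R[i], exists M : R,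
  [/\ jmeas F, 0 <= M,
      forall t, 0 <= t -> t <= n%:R -> {ae lebR2, forall x, F t x = f t x},
      forall t, 0 <= t -> t <= n%:R -> rep (th t) (F t) /\ (cabs lebR2 (F t) <= M%:E)%E &
      forall t, 0 <= t -> t <= n%:R ->
        {ae lebR2, forall xi, F t xi = heat g0 t xi - Bop F F t xi}].
Proof.
have [F jF FE] := jmeas_version n fm fhat_contL1; have [_ [M hM] _ _] := thX0.
have rF t : 0 <= t -> t <= n%:R -> rep (th t) (F t).
  move=> t0 tn; apply: (rep_ae (fr t0) (jmeas_slice t jF)).
  by apply: ae_imply1 (FE t t0 tn) => x ->.
have FM t : 0 <= t -> t <= n%:R -> (cabs lebR2 (F t) <= M%:E)%E.
  by move=> t0 tn; rewrite -(Xnorm0_rep (rep_density_fourier (rF t t0 tn))); exact: hM.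
exists F, M; split => //.
- by rewrite -lee_fin; apply: le_trans (FM 0 (lexx 0) (ler0n _ _)); exact: cabs_ge0.
- by move=> t t0 tn; split; [exact: rF|exact: FM].
- move=> t t0 tn; apply: (mild_form g0i thsol jF t0).
    by move=> s s0 st; apply: rF => //; exact: le_trans tn.
  by move=> s s0 st; apply: FM => //; exact: le_trans tn.
Qed.

Lemma N_version F t : 0 <= t -> jmeas F -> {ae lebR2, forall x, F t x = f t x} ->
  N t = cabs lebR2 (fun x => F t x - g t x).
Proof.
move=> t0 jF FE; have mg := glim_cmeas g0i t; have mF := jmeas_slice t jF.
apply: (distL1_ae (fm t0) mF mg mg); last exact: aeW.
by apply: ae_imply1 FE => x ->.
Qed.

Lemma N_at0 : N 0 = 0%E.
Proof.
have [F [M [jF _ FE _ Fm]]] := measurable_version 0.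
have le00 : (0 : R) <= 0%:R by [].
rewrite (N_version (lexx 0) jF (FE 0 (lexx 0) le00)).
have mg := glim_cmeas g0i 0; have mF := jmeas_slice 0 jF.
apply: ae_cabs0; first by mfun.
apply: ae_imply2 (Fm 0 (lexx 0) le00) (ae_good g0i g0_small) => x -> gx.
have jg := jmeas_glim g0i.
by rewrite (glim_eq g0i g0_small (lexx 0) gx) !Bop0// subrr.
Qed.

(** Twice the bound 1/4 on the data. *)
Lemma cabs_glim_half t : (cabs lebR2 (g t) <= (1 / 2)%:E)%E.
Proof.
apply: (le_trans (cabs_glim g0i t)); apply: (le_trans (int_Plim g0i g0_small)).
have := g0_lt; rewrite -(fineK (cabs_fin_num g0i)) -EFinM lte_fin lee_fin.
lra.
Qed.

(** The heat terms cancel and B(F, F) - B(g, g) = B(F - g, F) + B(g, F - g). The integrability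
    behind this splitting comes from L^1 bounds for F and from the majorant for g. *)
Lemma diff_le F w n t : w = (fun t x => F t x - g t x) -> jmeas F -> 0 <= t -> t <= n%:R ->
  (exists2 M : R, 0 <= M & forall s, 0 <= s -> s <= n%:R -> (cabs lebR2 (F s) <= M%:E)%E) ->
  {ae lebR2, forall xi, F t xi = heat g0 t xi - Bop F F t xi} ->
  (cabs lebR2 (w t) <= \int[lebR2]_xi cabs lebR3 (dui w F t xi) +
     \int[lebR2]_xi cabs lebR3 (dui g w t xi))%E.
Proof.
move=> wE jF t0 tn [M M0 FM] Fm.
have jg := jmeas_glim g0i.
have jw : jmeas w by rewrite wE; exact: (cmeasB jF jg).
have mcd a b : jmeas a -> jmeas b -> measurable_fun setT (fun xi => cabs lebR3 (dui a b t xi)).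
  move=> ja jb; apply: (measurable_pabs lebR3 (F := fun y : (R * R) * (R * (R * R)) => dui a b t y.1 y.2)).
  by apply: (cmeas_comp (jmeas_dui ja jb) (g := fun y : (R * R) * (R * (R * R)) => ((t, y.1), y.2))); mfun.
have m1 := mcd _ _ jw jF; have m2 := mcd _ _ jg jw.
rewrite -ge0_integralD//; last 2 first.
- by move=> x _; exact: cabs_ge0.
- by move=> x _; exact: cabs_ge0.
have mw := jmeas_slice t jw.
apply: ae_ge0_le_integral => //.
- by move=> x _; rewrite lee_fin normc_ge0.
- exact: cmeas_enormc.
- by move=> x _; rewrite adde_ge0// cabs_ge0.
- exact: emeasurable_funD.
have iFF : {ae lebR2, forall xi, cintegrable lebR3 setT (dui F F t xi)}.
  apply: (ae_cintegrable_dui jF jF t0 (mulr_ge0 M0 M0)) => s s0 st.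
  by rewrite EFinM; apply: lee_pmul; rewrite ?cabs_ge0// FM// (le_trans st).
have h2 : {ae lebR2, forall xi, F t xi = heat g0 t xi - Bop F F t xi /\ cintegrable lebR3 setT (dui F F t xi)}.
  by apply: ae_imply2 Fm iFF.
apply: ae_imply2 h2 (ae_good g0i g0_small) => xi [Fxi ii] gx _.
have ig := cintegrable_dui t (maj_glim g0i) (maj_glim g0i) gx.2.
have wtE : w t xi = - cint lebR3 (fun z => dui w F t xi z + dui g w t xi z).
  rewrite wE Fxi (glim_eq g0i g0_small t0 gx).
  rewrite (@eq_cint _ _ R lebR3 _ (fun z => dui F F t xi z - dui g g t xi z)); last first.
    by move=> z; rewrite duiBl duiBr addrA subrK.
  rewrite (@cintB _ _ R lebR3 _ _ ii ig) /Bop.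
  have alg (a b d : R[i]) : a - b - (a - d) = - (b - d) by ring.
  exact: alg.
have d1 := dui_cmeas t xi jw jF; have d2 := dui_cmeas t xi jg jw.
rewrite wtE normcNE; apply: (le_trans (normc_cint lebR3 (cmeasD d1 d2))).
exact: cabsD.
Qed.

(** From N <= 1 the norm of F is at most 1 + 1/2, and that of g is at most 1/2, so the coefficient 2
    (2 pi)^-2 is at most 1/2 and the integral of N over [0, T] is at most half of itself. It is
    finite because N <= 1, hence zero; N then vanishes almost everywhere, and everywhere by
    continuity. *)
Lemma N_gap (n : nat) T : 0 < T -> T <= n%:R ->
  (forall s, 0 <= s -> s <= T -> (N s <= 1)%E) ->
  forall s, 0 <= s -> s <= T -> N s = 0%E.
Proof.
move=> T0 Tn N1; have [F [M [jF M0 FE FM Fm]]] := measurable_version n.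
have jg := jmeas_glim g0i.
pose w := fun t x => F t x - g t x.
have jw : jmeas w by exact: (cmeasB jF jg).
have tn t : t <= T -> t <= n%:R by move=> h; exact: le_trans Tn.
have NE t : 0 <= t -> t <= T -> N t = cabs lebR2 (w t).
  by move=> t0 tT; apply: N_version => //; apply: FE => //; exact: tn.
have mc (u : R -> R * R -> R[i]) : jmeas u -> measurable_fun setT (fun s => cabs lebR2 (u s)).
  by move=> ju; exact: (measurable_pabs lebR2 ju).
have mb k := mf_EFin (@measurable_box_cst R k T).
have b0 k s : 0 <= k -> (0 <= (box_cst k T s)%:E)%E by move=> k0; rewrite lee_fin box_cst_ge0.
pose J s := ((box_cst 1 T s)%:E * cabs lebR2 (w s))%E.
have J0 s : (0 <= J s)%E by rewrite mule_ge0 ?cabs_ge0 ?b0.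
have mJ : measurable_fun setT J by exact: (emeasurable_funM (mb 1) (mc _ jw)).
have mcd a b : jmeas a -> jmeas b ->
    measurable_fun setT (fun t => \int[lebR2]_xi cabs lebR3 (dui a b t xi))%E.
  move=> ja jb.
  have m3 : measurable_fun setT (fun y : R * (R * R) => cabs lebR3 (dui a b y.1 y.2)).
    exact: (measurable_pabs lebR3 (jmeas_dui ja jb)).
  by apply: (measurable_tonelli1 lebR2 m3) => y; exact: cabs_ge0.
have i0 a b t : (0 <= \int[lebR2]_xi cabs lebR3 (dui a b t xi))%E.
  by apply: integral_ge0 => x _; exact: cabs_ge0.
(* The norms are replaced by opaque functions, known through the inequalities stated next; the rest
   is arithmetic of extended reals. *)
have [W WE] : exists W : R -> \bar R, W = (fun s => cabs lebR2 (w s)) := ex_intro _ _ erefl.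
have [V VE] : exists V : R -> \bar R, V = (fun s => cabs lebR2 (F s)) := ex_intro _ _ erefl.
have [G GE] : exists G : R -> \bar R, G = (fun s => cabs lebR2 (g s)) := ex_intro _ _ erefl.
have mW : measurable_fun setT W by rewrite WE; exact: mc.
have mV : measurable_fun setT V by rewrite VE; exact: mc.
have mG : measurable_fun setT G by rewrite GE; exact: mc.
have W0 s : (0 <= W s)%E by rewrite WE cabs_ge0.
have V0 s : (0 <= V s)%E by rewrite VE cabs_ge0.
have G0 s : (0 <= G s)%E by rewrite GE cabs_ge0.
have G2 s : (G s <= (1 / 2)%:E)%E by rewrite GE; exact: cabs_glim_half.
have W1 s : 0 <= s -> s <= T -> (W s <= 1)%E by move=> s0 sT; rewrite WE -NE// N1.
have VW s : (V s <= W s + G s)%E.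
  rewrite VE WE GE.
  apply: le_trans (cabsD lebR2 (jmeas_slice s jw) (jmeas_slice s jg)); rewrite le_eqVlt; apply/orP; left; apply/eqP.
  by apply: eq_integral => x _; rewrite /w subrK.
have [A AE] : exists A : R -> \bar R, A = (fun t => \int[lebR2]_xi cabs lebR3 (dui w F t xi))%E := ex_intro _ _ erefl.
have [B BE] : exists B : R -> \bar R, B = (fun t => \int[lebR2]_xi cabs lebR3 (dui g w t xi))%E := ex_intro _ _ erefl.
have mA : measurable_fun setT A by rewrite AE; exact: mcd.
have mB : measurable_fun setT B by rewrite BE; exact: mcd.
have A0 t : (0 <= A t)%E by rewrite AE; exact: i0.
have B0 t : (0 <= B t)%E by rewrite BE; exact: i0.
have WAB t : 0 <= t -> t <= T -> (W t <= A t + B t)%E.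
  move=> t0 tT; rewrite WE AE BE.
  apply: (diff_le (erefl w) jF t0 (tn t tT)); last exact: Fm t0 (tn t tT).
  by exists M => // s s0 sn; have [] := FM s s0 sn.
have IA : (\int[lebR]_t ((box_cst 1 T t)%:E * A t) <= \int[lebR]_s ((box_cst c T s)%:E * (W s * V s)))%E.
  by rewrite AE WE VE; exact: int_time_dui.
have IB : (\int[lebR]_t ((box_cst 1 T t)%:E * B t) <= \int[lebR]_s ((box_cst c T s)%:E * (G s * W s)))%E.
  by rewrite BE WE GE; exact: int_time_dui.
have JE s : J s = ((box_cst 1 T s)%:E * W s)%E by rewrite WE.
have mbA := emeasurable_funM (mb 1) mA; have mbB := emeasurable_funM (mb 1) mB.
have mbW := emeasurable_funM (mb c) (emeasurable_funM mW mV).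
have mbG := emeasurable_funM (mb c) (emeasurable_funM mG mW).
clear AE BE WE VE GE.
have half : (\int[lebR]_s J s <= (1 / 2)%:E * \int[lebR]_s J s)%E.
  apply: (@le_trans _ _ (\int[lebR]_t ((box_cst 1 T t)%:E * A t) +
     \int[lebR]_t ((box_cst 1 T t)%:E * B t))%E).
    rewrite -ge0_integralD//; last 2 first.
    - by move=> t _; rewrite mule_ge0 ?b0.
    - by move=> t _; rewrite mule_ge0 ?b0.
    apply: le_int => //; first exact: emeasurable_funD.
    move=> t; rewrite JE /box_cst; case: ifP => [/andP[t0 tT]|_]; last by rewrite !mul0e adde0.
    by rewrite !mul1e; exact: WAB.
  apply: (le_trans (leeD IA IB)).
  rewrite -ge0_integralD//; last 2 first.
  - by move=> t _; rewrite mule_ge0 ?mule_ge0 ?b0 ?invc_ge0.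
  - by move=> t _; rewrite mule_ge0 ?mule_ge0 ?b0 ?invc_ge0.
  rewrite -ge0_integralZl_EFin ?divr_ge0//.
  apply: le_int => //.
  - by move=> t; rewrite adde_ge0// mule_ge0 ?mule_ge0 ?b0 ?invc_ge0.
  - exact: emeasurable_funD.
  - by apply: emeasurable_funM => //; exact: measurable_cst.
  move=> t; rewrite JE /box_cst; case: ifP => [/andP[t0 tT]|_]; last by rewrite !mul0e mule0 adde0.
  move: (G2 t) (W1 t t0 tT) (VW t) (V0 t) (G0 t) (W0 t).
  case: (G t) => [a| |]//; case: (W t) => [b| |]//.
  case: (V t) => [d| |]//.
  rewrite -!EFinM -!EFinD !lee_fin => a2 b1 dab d0 a0 b0'.
  have := @invc_ge0 R; have := @invc_lt R; move: c => k k4 k0.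
  rewrite !mul1r; apply: (@le_trans _ _ (k * (2 * b))).
    rewrite -mulrDr ler_wpM2l//.
    have : b * d <= b * (3 / 2) by rewrite ler_wpM2l//; lra.
    have : a * b <= (1 / 2) * b by rewrite ler_wpM2r//; lra.
    lra.
  have : k * b <= 4^-1 * b by rewrite ler_wpM2r// ltW.
  lra.
have Jfin : (\int[lebR]_s J s < +oo)%E.
  apply: (@le_lt_trans _ _ (\int[lebR]_s (box_cst 1 T s)%:E)%E); last by rewrite int_box ?ltW// ltry.
  apply: le_int; [exact: J0|exact: mJ|exact: mb|move=> s].
  rewrite /J /box_cst; case: ifP => [/andP[s0 sT]|_]; last by rewrite mul0e.
  by rewrite mul1e -NE// N1.
have Jz : (\int[lebR]_s J s = 0)%E.
  have : (0 <= \int[lebR]_s J s)%E by exact: integral_ge0.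
  case: (\int[lebR]_s J s)%E half Jfin => [r| |]//.
  rewrite -EFinM !lee_fin => h _ r0; congr (_%:E).
  by apply/eqP; rewrite eq_le r0 andbT; lra.
have Jae : {ae (@lebR R), forall s, J s = 0%E}.
  have : (\int[lebR]_s `|J s| = 0)%E by rewrite -[RHS]Jz; apply: eq_integral => s _; rewrite gee0_abs.
  move/(ae_eq_integral_abs lebR measurableT mJ).
  by apply: ae_imply1 => s /(_ Logic.I).
have Nae : {ae (@lebR R), forall s, 0 <= s -> s <= T -> N s = 0%E}.
  apply: ae_imply1 Jae => s; rewrite /J /box_cst => Js s0 sT.
  by rewrite NE//; move: Js; rewrite s0 sT mul1e.
move=> s s0 sT; apply/eqP; rewrite eq_le N_ge0 andbT; apply/lee_addgt0Pr => e e0.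
have [d d0 hd] := N_cont s0 e0.
have [r [r0 rT rs Nr]] := ae_lebR_dense Nae T0 s0 sT d0.
by have [_ /ltW] := hd r r0 rs; rewrite Nr.
Qed.

(** A continuity argument on the supremum S of the times up to which N vanishes: N vanishes at S, is
    at most 1 slightly beyond, and [N_gap] on the longer interval contradicts the choice of S. *)
Lemma N_eq0 t : 0 <= t -> N t = 0%E.
Proof.
move=> t0; apply: contrapT => Nt.
pose A := [set T | 0 <= T <= t /\ forall s, 0 <= s -> s <= T -> N s = 0%E].
have A0 : A 0.
  split; first by rewrite lexx.
  move=> s s0 s1; have -> : s = 0 by apply/eqP; rewrite eq_le s0 s1.
  exact: N_at0.
have Aub : ubound A t by move=> T [/andP[]].
have hsA : has_sup A by split; [exists 0|exists t].
pose S := sup A.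
have S0 : 0 <= S by exact: (ub_le_sup hsA.2 A0).
have St : S <= t by exact: (ge_sup hsA.1 Aub).
have lowS s : 0 <= s -> s < S -> N s = 0%E.
  move=> s0 sS; have d0 : 0 < S - s by rewrite subr_gt0.
  have [T [_ hT] sT] := sup_adherent d0 hsA.
  by apply: hT => //; rewrite -/S subKr in sT; exact: ltW.
have NS : N S = 0%E.
  move: S0; rewrite le_eqVlt => /predU1P[<-|S0]; first exact: N_at0.
  apply/eqP; rewrite eq_le N_ge0 andbT; apply/lee_addgt0Pr => e e0.
  have [d d0 hd] := N_cont (ltW S0) e0.
  (* The minimum keeps s nonnegative, while s < S and |s - S| < d. *)
  pose s := S - Num.min (d / 2) S.
  have m0 : 0 < Num.min (d / 2) S by rewrite lt_min S0 divr_gt0.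
  have mS : Num.min (d / 2) S <= S by rewrite ge_min lexx orbT.
  have md : Num.min (d / 2) S <= d / 2 by rewrite ge_min lexx.
  have s0 : 0 <= s by rewrite subr_ge0.
  have sS : s < S by rewrite ltrBlDr ltrDl.
  have sd : `|s - S| < d.
    rewrite /s addrAC subrr sub0r normrN gtr0_norm// (le_lt_trans md)//.
    by rewrite ltr_pdivrMr// ltr_pMr// ltr1n.
  by have [_ /ltW] := hd s s0 sd; rewrite (lowS s).
have SltT : S < t.
  by rewrite lt_neqAle St andbT; apply/eqP => E; apply: Nt; rewrite -E.
(* Continuity with tolerance 1: as N vanishes at S, this yields the bound N <= 1 that [N_gap] asks
   for. *)
have [d d0 hd] := N_cont S0 ltr01.
pose T := Num.min (S + d / 2) t.
have ST : S < T by rewrite lt_min SltT ltrDl divr_gt0.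
have Tt : T <= t by rewrite ge_min lexx orbT.
have Td : T <= S + d / 2 by rewrite ge_min lexx.
have T0 : 0 < T by exact: le_lt_trans ST.
have NT1 s : 0 <= s -> s <= T -> (N s <= 1)%E.
  move=> s0 sT; have [sS|Ss] := ltP s S; first by rewrite lowS// lee_fin.
  have sd : `|s - S| < d.
    rewrite ger0_norm ?subr_ge0// ltrBlDr addrC (le_lt_trans sT)// (le_lt_trans Td)//.
    by rewrite ltrD2l ltr_pdivrMr// ltr_pMr// ltr1n.
  by have [/ltW] := hd s s0 sd; rewrite NS add0e.
have Tn : T <= (Num.truncn T).+1%:R by rewrite ltW// truncnS_gt.
have AT : A T.
  split; first by rewrite (ltW T0).
  exact: (N_gap T0 Tn NT1).
have := ub_le_sup hsA.2 AT; rewrite -/S leNgt ST.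
by [].
Qed.

Lemma solution_unique t : 0 <= t -> eq_distr (th t) (theta t).
Proof.
move=> t0 phi sp; have r := fr t0; rewrite r.2//.
have mg := glim_cmeas g0i t; have mf := fm t0.
have ms := schwartz_meas (schwartz_inv_fourier sp).
apply: ae_cint; [by mfun|by mfun|].
have md : cmeas (fun x => f t x - g t x) by mfun.
have := @cabs_eq0 _ _ R lebR2 _ md (N_eq0 t0); apply: ae_imply1 => x /eqP.
by rewrite subr_eq0 => /eqP ->.
Qed.

End Uniqueness.

Theorem theorem1p3 (R : realType) (theta0 : functional R)
    (htheta0 : Xspace 0 theta0) (hsmall : (Xnorm 0 theta0 < (1 / 4)%:E)%E) :
  exists theta : R -> functional R,
    [/\ frakX0 theta, frakX1 theta, is_solution theta0 theta,
        (frakX0_norm theta + frakX1_norm theta <= 4%:E * Xnorm 0 theta0)%E &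
        forall theta' : R -> functional R,
          frakX0 theta' -> frakX1 theta' -> is_solution theta0 theta' ->
          forall t : R, 0 <= t -> eq_distr (theta' t) (theta t)].
Proof.
have r := Xspace0_rep htheta0.
have nE := Xnorm0_rep (rep_density_fourier r).
have g0i := r.1.
have g0_small : (cabs lebR2 (fhat theta0) <= 1)%E.
  by rewrite -nE (le_trans (ltW hsmall))// lee_fin ler_pdivrMr// mul1r ler1n.
exists (mild_solution (fhat theta0)); split.
- exact: frakX0_mild.
- exact: frakX1_mild.
- exact: is_solution_mild.
- by rewrite nE; exact: norm_mild.
- by move=> theta' h _ sol t t0; exact: (solution_unique htheta0 hsmall h sol).
Qed.
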